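(* Let $\mathcal V=vB^*A$ with $v:\mathbb R^n\to\mathbb C$ measurable and $A,B\in\mathbb C^{N\times N}$ satisfying $|A|=|B|=1$, $B^*A\ne0$, $A\alpha_kB^*=0$ for $k\in\{1,\dots,n\}$. Suppose that one of the following holds: (1) $n\in\mathbb N\setminus\{2,4\}$, $m=0$, $A\alpha_{n+1}B^*\ne0$ and $AB^*=0$; (2) $n\in\mathbb N\setminus\{1,2\}$, $m\ge0$, $A\alpha_{n+1}B^*=0$ and $AB^*=0$. Then $$\sigma(\mathscr D_{m,\mathcal V})=\sigma_c(\mathscr D_{m,\mathcal V})=\sigma(\mathscr D_m)=(-\infty,-m]\cup[m,\infty),$$ and in particular $\sigma_p(\mathscr D_{m,\mathcal V})=\varnothing$.
   Context: Let $n\ge1$ and $N=2^{\lceil n/2\rceil}$. The Dirac matrices $\alpha_1,\dots,\alpha_{n+1}\in\mathbb C^{N\times N}$ are Hermitian matrices with $\alpha_k\alpha_j+\alpha_j\alpha_k=2\delta_{kj}I_N$ for $j,k\in\{1,\dots,n+1\}$. For $m\ge0$ the free Dirac operator is $\mathscr D_m=-i\sum_{k=1}^n\alpha_k\partial_k+m\alpha_{n+1}$, self-adjoint in $\mathfrak H=L^2(\mathbb R^n;\mathbb C^N)$ with domain $H^1(\mathbb R^n;\mathbb C^N)$. For a matrix $M$, $|M|$ denotes the operator norm induced by the Euclidean norm. Perturbed operator. Given $\mathcal V=vB^*A$ with $v:\mathbb R^n\to\mathbb C$ measurable and constant $A,B\in\mathbb C^{N\times N}$, put $a=|v|^{1/2}$,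 $b=\overline{\operatorname{sgn}(v)}\,|v|^{1/2}$ (with $\operatorname{sgn}(w)=w/|w|$ for $w\ne0$, $\operatorname{sgn}(0)=0$), and let $\mathcal A=aA$, $\mathcal B=bB$ be the corresponding closed multiplication operators in $\mathfrak H$ with maximal domains, so that $\mathcal V=\mathcal B^*\mathcal A$. Standing assumption: $\operatorname{dom}(|\mathscr D_m|^{1/2})=H^{1/2}(\mathbb R^n;\mathbb C^N)\subseteq \operatorname{dom}(\mathcal A)\cap\operatorname{dom}(\mathcal B)$. With $G_0=|\mathscr D_m|+1$, the operators $\mathcal AG_0^{-1/2}$, $\mathcal BG_0^{-1/2}$ are then bounded, and $\mathscr D_{m,\mathcal V}$ is the extension of $\mathscr D_m+\mathcal V$ given by $$\mathscr D_{m,\mathcal V}=G_0^{1/2}\big(\mathscr D_mG_0^{-1}+[\mathcal BG_0^{-1/2}]^*\,\mathcal AG_0^{-1/2}\big)G_0^{1/2}$$ on its natural domain (those $\psi\in\operatorname{dom}(G_0^{1/2})$ for which the bracket applied to $G_0^{1/2}\psi$ lies in $\operatorname{dom}(G_0^{1/2})$). $\sigma_p$ denotes the set of all eigenvalues (including those embedded in $\sigma(\mathscr D_m)$), and $\sigma_c$ the continuous spectrum (those $z\in\sigma(T)$ with $T-z$ injective with dense, non-full range). *)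

(* Defs.v *)
From HB Require Import structures.
From mathcomp Require Import all_boot all_order all_algebra.
From mathcomp Require Import all_classical all_reals all_analysis.
From mathcomp Require Import complex.

Set Implicit Arguments.
Unset Strict Implicit.
Unset Printing Implicit Defensive.
Import Order.TTheory GRing.Theory Num.Theory.
Import numFieldNormedType.Exports.
Local Open Scope classical_set_scope.
Local Open Scope ring_scope.
Local Open Scope sesquilinear_scope.


(* n.-tuple carries the product sigma-algebra, i.e. the Borel sets of R^n. *)
Notation Rn R n := (n.-tuple (measurableTypeR R)).

Section Lebesgue.
Context {R : realType}.

Definition Rn_cons n (p : measurableTypeR R * Rn R n) : Rn R n.+1 :=
  [tuple of p.1 :: p.2].

Lemma measurable_Rn_cons n : measurable_fun [set: _] (@Rn_cons n).
Proof. exact: measurable_cons. Qed.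

Section step.
Context n (mu : {sigma_finite_measure set (Rn R n) -> \bar R}).

Definition lebesgue_step : set (Rn R n.+1) -> \bar R :=
  pushforward (lebesgue_measure \x mu)%E (@Rn_cons n).

Let step0 : lebesgue_step set0 = 0%E.
Proof. by rewrite /lebesgue_step /pushforward preimage_set0 measure0. Qed.

Let step_ge0 A : (0 <= lebesgue_step A)%E.
Proof. by rewrite /lebesgue_step /pushforward; exact: measure_ge0. Qed.

Let step_sigma_additive : semi_sigma_additive lebesgue_step.
Proof.
move=> F mF tF mUF; rewrite /lebesgue_step /pushforward preimage_bigcup.
apply: measure_semi_sigma_additive.
- by move=> k; rewrite -[X in measurable X]setTI; exact: measurable_Rn_cons.
- apply/trivIsetP => /= i j _ _ ij; rewrite -preimage_setI.
  by move/trivIsetP : tF => /(_ _ _ _ _ ij) ->//; rewrite preimage_set0.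
- by rewrite -preimage_bigcup -[X in measurable X]setTI; exact: measurable_Rn_cons.
Qed.

HB.instance Definition _ := isMeasure.Build _ _ _ lebesgue_step
  step0 step_ge0 step_sigma_additive.

Let step_sigma_finite : sigma_finite setT lebesgue_step.
Proof.
have /sigma_finiteP[F [TF ndF Foo]] := sigma_finiteT (@lebesgue_measure R).
have /sigma_finiteP[G [TG ndG Goo]] := sigma_finiteT mu.
pose uncons (x : Rn R n.+1) : measurableTypeR R * Rn R n :=
  (thead x, [tuple of behead x]).
have unconsK : cancel (@Rn_cons n) uncons.
  case=> x t; rewrite /uncons /Rn_cons /=; congr pair.
  exact/val_inj.
have muncons : measurable_fun [set: _] uncons.
  by apply: measurable_fun_pair; [exact: measurable_tnth|exact: measurable_behead].
exists (fun k => uncons @^-1` (F k `*` G k)).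
  apply/seteqP; split => // x _.
  have : [set: measurableTypeR R] (uncons x).1 by [].
  have : [set: Rn R n] (uncons x).2 by [].
  rewrite TF TG => -[k _ Gk] [l _ Fl]; exists (maxn k l) => //; split.
  - by move: Fl; exact/subsetPset/ndF/leq_maxr.
  - by move: Gk; exact/subsetPset/ndG/leq_maxl.
move=> k; have [mF Fk] := Foo k; have [mG Gk] := Goo k; split.
  by rewrite -[X in measurable X]setTI; apply: muncons => //; exact: measurableX.
rewrite /lebesgue_step /pushforward -comp_preimage.
rewrite (_ : uncons \o _ = id); last by apply/funext => x /=; exact: unconsK.
by rewrite preimage_id product_measure1E// lte_mul_pinfty// ge0_fin_numE.
Qed.

HB.instance Definition _ := Measure_isSigmaFinite.Build _ _ _ lebesgue_step
  step_sigma_finite.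
End step.

Fixpoint lebesgue_Rn n : {sigma_finite_measure set (Rn R n) -> \bar R} :=
  if n is n'.+1 then lebesgue_step (lebesgue_Rn n')
  else \d_([tuple] : Rn R 0).

End Lebesgue.

Notation normc := complex.ComplexField.Normc.normc.

Section Vectors.
Context {R : realType}.

Definition l2norm N (u : 'cV[R[i]]_N) : R :=
  Num.sqrt (\sum_(i < N) normc (u i 0) ^+ 2).

Definition opnorm N (M : 'M[R[i]]_N) : R :=
  sup [set l2norm (M *m u) | u in [set u | l2norm u <= 1]].

Definition dirac_matrices n N (alpha : 'I_n.+1 -> 'M[R[i]]_N) : Prop :=
  (forall k, (alpha k)^t* = alpha k) /\
  (forall k j, alpha k *m alpha j + alpha j *m alpha k
               = ((k == j)%:R *+ 2)%:M).

(* sgn 0 = 0 because 0^-1 = 0. *)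
Definition csgn (w : R[i]) : R[i] := w / `|w|.

End Vectors.

Section L2.
Context {R : realType} {n N : nat}.
Let mu := @lebesgue_Rn R n.
Definition vfun : Type := Rn R n -> 'cV[R[i]]_N.
Implicit Types f g h u w : vfun.

Definition cmeasurable (h : Rn R n -> R[i]) : Prop :=
  measurable_fun setT (fun x => complex.Re (h x)) /\
  measurable_fun setT (fun x => complex.Im (h x)).

(* The library's sigma-algebra on R^n is Borel; a function is Lebesgue
   measurable iff it agrees a.e. with a Borel one. *)
Definition lebesgue_measurable (h : Rn R n -> R[i]) : Prop :=
  exists2 h', cmeasurable h' & h = h' %[ae mu].

Definition cintegral (h : Rn R n -> R[i]) : R[i] :=
  Complex (\int[mu]_x complex.Re (h x)) (\int[mu]_x complex.Im (h x)).

(* Elements of the Hilbert space are represented by functions; all notions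
   below are invariant under a.e. equality of such representatives. *)
Definition L2 : set vfun := [set f : vfun |
  (forall i, cmeasurable (fun x => f x i 0)) /\
  (\int[mu]_x ((l2norm (f x) ^+ 2)%:E) < +oo)%E].

Definition aeeq f g : Prop := f = g %[ae mu].

Definition inner f g : R[i] := cintegral (fun x => ((f x)^t* *m g x) 0 0).

Definition L2norm f : R := Num.sqrt (\int[mu]_x (l2norm (f x) ^+ 2)).

End L2.
Arguments vfun R n N : clear implicits.

Section WeakDerivative.
Context {R : realType} {n N : nat}.
Implicit Types phi : 'rV[R]_n -> R.

Definition partial (k : 'I_n) phi : 'rV[R]_n -> R :=
  fun x => 'D_(delta_mx 0 k) phi x.

Fixpoint of_class_C (r : nat) phi : Prop :=
  continuous phi /\
  if r is r'.+1 then
    forall k, (forall x, derivable phi x (delta_mx 0 k)) /\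
              of_class_C r' (partial k phi)
  else True.

Definition test_function phi : Prop :=
  (forall r, of_class_C r phi) /\ compact (closure [set x | phi x != 0]).

Definition row_of (x : Rn R n) : 'rV[R]_n := \row_k tnth x k.

Definition weak_partial (k : 'I_n) (f g : vfun R n N) : Prop :=
  [/\ L2 f, L2 g & forall phi, test_function phi -> forall i,
    cintegral (fun x => (partial k phi (row_of x))%:C%C * f x i 0)
    = - cintegral (fun x => (phi (row_of x))%:C%C * g x i 0)].

End WeakDerivative.

Section Operators.
Context {R : realType} {n N : nat}.
Implicit Types f g h u w : vfun R n N.

(* Unbounded operators in the Hilbert space, as graphs. *)
Definition op : Type := vfun R n N -> vfun R n N -> Prop.
Implicit Types S T : op.

Definition dom T : set (vfun R n N) := [set f | exists g, T f g].

Definition op_scalar (z : R[i]) : op := fun f g =>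
  [/\ L2 f, L2 g & aeeq g (fun x => z *: f x)].

Definition op_add S T : op := fun f h =>
  exists g1 g2, [/\ S f g1, T f g2, L2 h & aeeq h (fun x => g1 x + g2 x)].

Definition op_comp S T : op := fun f h => exists2 g, T f g & S g h.

Definition op_inv T : op := fun f g => T g f.

Definition op_adj T : op := fun f g =>
  [/\ L2 f, L2 g & forall u w, T u w -> inner f w = inner g u].

Definition dense_set (D : set (vfun R n N)) : Prop :=
  forall f, L2 f -> forall e : R, 0 < e ->
    exists2 u, D u & L2norm (fun x => f x - u x) < e.

Definition self_adjoint T : Prop :=
  dense_set (dom T) /\ forall f g, T f g <-> op_adj T f g.

(* The order on R[i] makes this say that <f, T f> is real and nonnegative. *)
Definition nonnegative T : Prop := forall f g, T f g -> 0 <= inner f g.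

(* T^(1/2), for T nonnegative self-adjoint: the unique nonnegative
   self-adjoint operator whose square is T. *)
Definition op_sqrt T : op := fun f g => exists S,
  [/\ self_adjoint S, nonnegative S,
      forall u w, op_comp S S u w <-> T u w & S f g].

Definition op_abs T : op := op_sqrt (op_comp (op_adj T) T).

Definition shift T (z : R[i]) : op := op_add T (op_scalar (- z)).

Definition injective_op T : Prop :=
  forall f1 f2 g, T f1 g -> T f2 g -> aeeq f1 f2.

Definition range_op T : set (vfun R n N) := [set g | exists f, T f g].

Definition surjective_op T : Prop := forall g, L2 g -> range_op T g.

Definition bounded_op T : Prop :=
  exists c : R, forall f g, T f g -> L2norm g <= c * L2norm f.

Definition resolvent_set T : set R[i] := [set z |
  [/\ injective_op (shift T z), surjective_op (shift T z)
    & bounded_op (op_inv (shift T z))]].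

Definition spectrum T : set R[i] := ~` resolvent_set T.

Definition point_spectrum T : set R[i] := [set z |
  exists f g, [/\ T f g, aeeq g (fun x => z *: f x) & ~ aeeq f (fun=> 0)]].

Definition continuous_spectrum T : set R[i] := [set z |
  [/\ spectrum T z, injective_op (shift T z),
      dense_set (range_op (shift T z)) & ~ surjective_op (shift T z)]].

(* Multiplication by s(x) M with maximal domain. *)
Definition mult_op (s : Rn R n -> R[i]) (M : 'M[R[i]]_N) : op := fun f g =>
  [/\ L2 f, L2 g & aeeq g (fun x => s x *: (M *m f x))].

End Operators.
Arguments op R n N : clear implicits.

Section Dirac.
Context {R : realType} {n N : nat}.
Variables (alpha : 'I_n.+1 -> 'M[R[i]]_N) (m : R).

(* alpha_k is alpha (lift ord_max k) for k < n; alpha_{n+1} is alpha ord_max. *)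
Definition free_dirac : op R n N := fun f h =>
  [/\ L2 f, L2 h & exists2 g : 'I_n -> vfun R n N,
    forall k, weak_partial k f (g k)
  & aeeq h (fun x =>
      - 'i%C *: \sum_(k < n) (alpha (lift ord_max k) *m g k x)
      + m%:C%C *: (alpha ord_max *m f x))].

Variables (v : Rn R n -> R[i]) (A B : 'M[R[i]]_N).

Definition pert_A : op R n N :=
  mult_op (fun x => (Num.sqrt (normc (v x)))%:C%C) A.

Definition pert_B : op R n N :=
  mult_op (fun x => (csgn (v x))^*%C * (Num.sqrt (normc (v x)))%:C%C) B.

Definition G0 : op R n N := op_add (op_abs free_dirac) (op_scalar 1).

(* The natural domain is the one built into op_comp. *)
Definition perturbed_dirac : op R n N :=
  let G := op_sqrt G0 in
  op_comp G
    (op_comp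
      (op_add (op_comp free_dirac (op_inv G0))
              (op_comp (op_adj (op_comp pert_B (op_inv G)))
                       (op_comp pert_A (op_inv G))))
      G).

End Dirac.

(* Main.v *)
Require Import Defs.
From HB Require Import structures.
From mathcomp Require Import all_boot all_order all_algebra.
From mathcomp Require Import all_classical all_reals all_analysis.
From mathcomp Require Import complex measurable_realfun gauss_integral.
From mathcomp Require Import ring lra.

Set Implicit Arguments.
Unset Strict Implicit.
Unset Printing Implicit Defensive.
Import Order.TTheory GRing.Theory Num.Theory.
Import numFieldNormedType.Exports.
Local Open Scope classical_set_scope.
Local Open Scope ring_scope.
Local Open Scope sesquilinear_scope.

(* On the Fourier side D_m is multiplication by D(x) = sum_k x_k alpha_k + m alpha_(n+1), and D(x)^2 = e(x)^2 with
   e(x)^2 = |x|^2 + m^2.  The Fourier transform is the unitary operator sending each polynomial Gaussian to its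
   transform: both families are total and have the same Gram matrix.
   Every case gives A (D(x) + z) B^* = 0 for all x and z.  Since (D(x) - z)^-1 = (D(x) + z) / (e(x)^2 - z^2), the
   perturbation K satisfies K (D_m - z)^-1 K = 0, so that (D_m - z)^-1 - (D_m - z)^-1 K (D_m - z)^-1 is the resolvent off
   the spectrum of D_m.  On that spectrum (D_mV - z) psi = 0 implies A psi = 0 and then psi = 0, because the level sets
   of e are null; cutting the same formula off near e(x)^2 = z^2 gives the density of the range.  For a nonzero column
   Y of A^* one also has Y^* (D(x) + z) B^* = 0, so surjectivity of D_mV - z would bound |(D(x) + z) Y| by a multiple
   of |e(x)^2 - z^2|, which fails near e(x)^2 = z^2. *)

(** The potential multiplies in position space and D_m in momentum space. The matrices A and B,
    being constant, commute with the Fourier transform, and all that is used of the perturbation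
    besides boundedness is this: [KA] vanishes on functions with values in the kernel of A, and the
    values of [KBs] are annihilated by bounded multipliers M with M(x) B^* = 0. In A D(x) B^* the
    last matrix contributes nothing, in case (1) because m = 0, in case (2) because A alpha_(n+1)
    B^* = 0. Since v may be unbounded, K need not be an operator on L^2. The operators A G_0^(-1/2)
    and B G_0^(-1/2) are bounded by the domain inclusion and the uniform boundedness principle, so
    the equations are written for phi = G_0^(1/2) psi, with powers of w = (e + 1)^(-1/2) as weights.
    As [op_sqrt] admits every nonnegative self-adjoint square root, |D_m|, |D_m|^(1/2) and G_0^(1/2)
    become multipliers only through a uniqueness theorem for square roots. *)

(** * Hilbert space: uniform boundedness, Riesz representation, unitaries from Gram matrices *)

Section Hilbert.
Context {R : realType} {V : lmodType R[i]}.
Variable rip : V -> V -> R.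

Definition hnorm u := Num.sqrt (rip u u).

(* A complex space is used through the real part [rip] of its inner product;
   completeness is only asked of rapidly converging sequences. *)
Record is_hilbert : Prop := IsHilbert {
  ripC : forall u v, rip u v = rip v u;
  ripDl : forall u v w, rip (u + v) w = rip u w + rip v w;
  ripZl : forall (r : R) u w, rip (r%:C%C *: u) w = r * rip u w;
  rip_ge0 : forall u, 0 <= rip u u;
  rip_eq0 : forall u, rip u u = 0 -> u = 0;
  hcomplete : forall u : nat -> V,
    (forall i, hnorm (u i.+1 - u i) <= 2^-1 ^+ i) ->
    exists l, hnorm (u n - l) @[n --> \oo] --> (0 : R) }.

Hypothesis hH : is_hilbert.
Let C := ripC hH.

Lemma ripDr u v w : rip w (u + v) = rip w u + rip w v.
Proof. by rewrite C ripDl// !(C w). Qed.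
Lemma ripZr (r : R) u w : rip w (r%:C%C *: u) = r * rip w u.
Proof. by rewrite C ripZl// (C w). Qed.
Lemma ripNl u w : rip (- u) w = - rip u w.
Proof.
have := ripZl hH (-1) u w; rewrite mulN1r => <-.
by congr (rip _ _); rewrite rmorphN1 scaleN1r.
Qed.
Lemma ripNr u w : rip w (- u) = - rip w u.
Proof. by rewrite C ripNl C. Qed.
Lemma rip0l w : rip 0 w = 0.
Proof. by rewrite -(subrr w) ripDl// ripNl subrr. Qed.
Lemma rip0r w : rip w 0 = 0. Proof. by rewrite C rip0l. Qed.
Lemma ripBl u v w : rip (u - v) w = rip u w - rip v w.
Proof. by rewrite ripDl// ripNl. Qed.
Lemma ripBr u v w : rip w (u - v) = rip w u - rip w v.
Proof. by rewrite ripDr ripNr. Qed.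

Lemma hnorm_ge0 u : 0 <= hnorm u. Proof. exact: sqrtr_ge0. Qed.
Lemma hnorm_sqr u : hnorm u ^+ 2 = rip u u.
Proof. by rewrite sqr_sqrtr// rip_ge0. Qed.
Lemma hnorm0 : hnorm 0 = 0. Proof. by rewrite /hnorm rip0l sqrtr0. Qed.
Lemma hnorm_eq0 u : hnorm u = 0 -> u = 0.
Proof. by move=> h; apply: (rip_eq0 hH); rewrite -hnorm_sqr h expr0n. Qed.
Lemma hnormN u : hnorm (- u) = hnorm u.
Proof. by rewrite /hnorm ripNl ripNr opprK. Qed.
Lemma hnormB u v : hnorm (u - v) = hnorm (v - u).
Proof. by rewrite -hnormN opprB. Qed.
Lemma hnormZ (r : R) u : hnorm (r%:C%C *: u) = `|r| * hnorm u.
Proof.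
by rewrite /hnorm ripZl// ripZr mulrA -expr2 sqrtrM ?sqr_ge0// sqrtr_sqr.
Qed.

Lemma cauchy_schwarz u v : `|rip u v| <= hnorm u * hnorm v.
Proof.
rewrite -(@ler_pXn2r _ 2)// ?nnegrE ?mulr_ge0 ?hnorm_ge0//.
rewrite exprMn !hnorm_sqr real_normK ?num_real//.
have [v0|v0] := eqVneq (rip v v) 0.
  by rewrite (rip_eq0 hH v0) !rip0r expr0n mulr0.
have vp : 0 < rip v v by rewrite lt_def v0 rip_ge0.
have := rip_ge0 hH (u - (rip u v / rip v v)%:C%C *: v).
rewrite ripBl !ripBr ripZl// !ripZr ripZl// (C v u).
set a := rip u u; set b := rip u v; set c := rip v v.
rewrite -/c in vp.
have -> : a - b / c * b - (b / c * b - b / c * (b / c * c)) = (a * c - b ^+ 2) / c.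
  by field; rewrite gt_eqF.
by rewrite pmulr_lge0 ?invr_gt0// subr_ge0.
Qed.

Lemma hnormD u v : hnorm (u + v) <= hnorm u + hnorm v.
Proof.
rewrite -(@ler_pXn2r _ 2)// ?nnegrE ?addr_ge0 ?hnorm_ge0//.
rewrite hnorm_sqr ripDl// !ripDr sqrrD !hnorm_sqr (C v u).
have := ler_normlW (cauchy_schwarz u v); lra.
Qed.
Lemma hnorm_tri w u v : hnorm (u - v) <= hnorm (u - w) + hnorm (w - v).
Proof. by rewrite -[u - v](subrKA w) hnormD. Qed.

Definition hcvg (u : nat -> V) l := hnorm (u n - l) @[n --> \oo] --> (0 : R).

Lemma hcvg_ripl u l s : hcvg u l -> rip (u n) s @[n --> \oo] --> rip l s.
Proof.
move=> h; apply/subr_cvg0.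
have h0 : hnorm (u n - l) * hnorm s @[n --> \oo] --> (0 : R).
  by rewrite -[X in _ --> X](mul0r (hnorm s)); apply: cvgMl.
apply: (@squeeze_cvgr _ _ _ _ (fun n => - (hnorm (u n - l) * hnorm s))
  (fun n => hnorm (u n - l) * hnorm s)).
- by near=> n; rewrite -ler_norml -ripBl cauchy_schwarz.
- by rewrite -oppr0; apply: cvgN.
- exact: h0.
Unshelve. all: by end_near. Qed.

Lemma hcvg_norm u l : hcvg u l -> hnorm (u n) @[n --> \oo] --> hnorm l.
Proof.
move=> h; apply/subr_cvg0.
apply: (@squeeze_cvgr _ _ _ _ (fun n => - hnorm (u n - l))
  (fun n => hnorm (u n - l))) => //.
- near=> n; rewrite -ler_norml ler_norml; apply/andP; split.
    by have := hnorm_tri (u n) l 0; rewrite !subr0 (hnormB l); lra.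
  by have := hnorm_tri l (u n) 0; rewrite !subr0; lra.
- by rewrite -oppr0; apply: cvgN.
Unshelve. all: by end_near. Qed.

Lemma geom_tail (u : nat -> V) (q : R) : 0 <= q ->
  (forall i, hnorm (u i.+1 - u i) <= q * 4^-1 ^+ i) ->
  forall n k, hnorm (u (n + k)%N - u n) <= q * 4^-1 ^+ n * (4 / 3).
Proof.
move=> q0 h n k.
suff: hnorm (u (n + k)%N - u n) <= q * 4^-1 ^+ n * (4 / 3) * (1 - 4^-1 ^+ k).
  move=> /le_trans; apply.
  have : 0 <= q * 4^-1 ^+ n * (4 / 3) * 4^-1 ^+ k.
    by rewrite !mulr_ge0// exprn_ge0.
  lra.
elim: k => [|k IH]; first by rewrite addn0 subrr hnorm0 expr0 subrr mulr0.
have := hnorm_tri (u (n + k)%N) (u (n + k.+1)%N) (u n); have := h (n + k)%N.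
rewrite addnS exprD exprS; set a := 4^-1 ^+ n; set b := 4^-1 ^+ k; move: IH.
rewrite -/b -/a; nra.
Qed.

(* A gliding hump: each step of length 4^-n is directed so as not to decrease the current pairing. *)
Lemma uniform_boundedness (I : Type) (Y : I -> V) :
  (forall u, exists c : R, forall i, `|rip (Y i) u| <= c) ->
  exists c : R, forall i, hnorm (Y i) <= c.
Proof.
move=> hY; apply: contrapT => nb.
have big : forall c : R, exists i, c < hnorm (Y i).
  move=> c; apply: contrapT => nc; apply: nb; exists c => i.
  by rewrite leNgt; apply/negP => ci; apply: nc; exists i.
(* With y the chosen vector at stage n, that step makes the pairing at least 4^-n |y|, and the later
   steps, of total length at most 4^-n / 3, take back at most a third of this. Since |y| > 16^(n+1),
   the pairing with the limit exceeds 4^n. *)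
have [pick Hp] : {pick : nat -> I & forall n, 16 ^+ n.+1 < hnorm (Y (pick n))}.
  by apply: (@choice _ _ (fun n i => 16 ^+ n.+1 < hnorm (Y i))) => n; exact: big.
have [st Hst] : {st : V * nat -> V & forall p,
    hnorm (st p - p.1) <= 4^-1 ^+ p.2 /\
    4^-1 ^+ p.2 * hnorm (Y (pick p.2)) <= `|rip (Y (pick p.2)) (st p)|}.
  apply: (@choice _ _ (fun p w => hnorm (w - p.1) <= 4^-1 ^+ p.2 /\
    4^-1 ^+ p.2 * hnorm (Y (pick p.2)) <= `|rip (Y (pick p.2)) w|)) => -[u n] /=.
  set y := Y (pick n); set r := 4^-1 ^+ n.
  have r0 : 0 <= r by rewrite exprn_ge0 ?invr_ge0.
  have y0 : 0 < hnorm y by apply: lt_trans (Hp n); rewrite exprn_gt0.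
  have [b|b] := leP 0 (rip y u).
    exists (u + (r / hnorm y)%:C%C *: y); split.
      rewrite [u + _]addrC addrK hnormZ normrM normfV (ger0_norm r0) (ger0_norm (ltW y0)).
      by rewrite divfK// gt_eqF.
    rewrite ripDr ripZr -hnorm_sqr.
    have -> : r / hnorm y * hnorm y ^+ 2 = r * hnorm y by field; rewrite gt_eqF.
    rewrite ger0_norm ?lerDr//; apply: addr_ge0 => //; apply: mulr_ge0 => //; exact: ltW.
  exists (u - (r / hnorm y)%:C%C *: y); split.
    rewrite [u - _]addrC addrK hnormN hnormZ normrM normfV (ger0_norm r0) (ger0_norm (ltW y0)).
    by rewrite divfK// gt_eqF.
  rewrite ripBr ripZr -hnorm_sqr.
  have -> : r / hnorm y * hnorm y ^+ 2 = r * hnorm y by field; rewrite gt_eqF.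
  have : 0 <= r * hnorm y by apply: mulr_ge0 => //; exact: ltW.
  by move=> ?; rewrite ler0_norm; lra.
pose u := fix u n := if n is k.+1 then st (u k, k) else 0 : V.
have u1 : forall i, hnorm (u i.+1 - u i) <= 1 * 4^-1 ^+ i.
  by move=> i; rewrite mul1r; have [] := Hst (u i, i).
have [l hl] : exists l, hcvg u l.
  apply: (hcomplete hH) => i; apply: (le_trans (u1 i)); rewrite mul1r.
  by apply: lerXn2r; rewrite ?nnegrE ?invr_ge0// lef_pV2 ?posrE// ler_nat.
have tl : forall n, hnorm (l - u n.+1) <= 4^-1 ^+ n * 3^-1.
  move=> n; apply/ler_addgt0Pr => e e0.
  have /cvgr0Pnorm_lt/(_ _ e0)[N _ HN] := hl.
  have := HN (N + n.+1)%N (leq_addr _ _); rewrite /= ger0_norm ?hnorm_ge0//.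
  rewrite [hnorm (_ - l)]hnormB => /ltW h1.
  have := geom_tail ler01 u1 n.+1 N; rewrite addnC => h2.
  have := hnorm_tri (u (N + n.+1)%N) l (u n.+1).
  by move: h2; rewrite exprS mul1r; lra.
have [c Hc] := hY l.
have key : forall n, 4 ^+ n <= c.
  move=> n; have [_ /=] := Hst (u n, n); rewrite -[st _]/(u n.+1) => h.
  have := Hc (pick n); have := cauchy_schwarz (Y (pick n)) (l - u n.+1).
  have := Hp n; have := tl n; have := hnorm_ge0 (l - u n.+1).
  have -> : rip (Y (pick n)) l = rip (Y (pick n)) (u n.+1) + rip (Y (pick n)) (l - u n.+1).
    by rewrite -ripDr [u n.+1 + _]addrC subrK.
  move: h; set z := rip _ (u n.+1); set d := rip _ (l - _); set y := hnorm (Y _).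
  set t := hnorm (l - _); set a := 4^-1 ^+ n => h t0 h1 h2 h3.
  have a0 : 0 < a by rewrite exprn_gt0 ?invr_gt0.
  have e1 : a * 16 ^+ n.+1 = 16 * 4 ^+ n.
    by rewrite exprS mulrCA -exprMn; congr (_ * _ ^+ _); field.
  have := ler_distD 0 z (- d); rewrite !(subr0, sub0r, opprK) => h4 h5.
  have h6 : `|z| <= `|z + d| + `|d|.
    by rewrite -[X in `|X| <= _](addrK d) (le_trans (ler_normB _ _)).
  have h7 : y * t <= y * (a * 3^-1) by rewrite ler_wpM2l ?hnorm_ge0.
  have h8 : a * 16 ^+ n.+1 <= a * y by rewrite ler_wpM2l// ltW.
  have h9 : 0 <= (4:R) ^+ n by rewrite exprn_ge0.
  rewrite e1 in h8; lra.
have := key (Num.bound c); apply/negP; rewrite -ltNge.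
have c0 : 0 <= c by apply: le_trans (key 0%N); rewrite expr0.
apply: lt_le_trans (archi_boundP c0) _.
by rewrite -natrX ler_nat ltnW// ltn_expl.
Qed.

(** The functional |s|^2 - 2 l(s) is bounded below on S, and the parallelogram identity makes a
    minimizing sequence converge; stationarity at the limit p is the claim. S is only a real
    subspace and need not be closed, so p lies in its closure. *)
Lemma riesz (S : set V) (l : V -> R) (c : R) : 0 <= c -> S 0 ->
  (forall u v, S u -> S v -> S (u + v)) ->
  (forall r u, S u -> S (r%:C%C *: u)) ->
  (forall u v, S u -> S v -> l (u + v) = l u + l v) ->
  (forall r u, S u -> l (r%:C%C *: u) = r * l u) ->
  (forall u, S u -> `|l u| <= c * hnorm u) ->
  exists p, (forall s, S s -> rip p s = l s) /\ hnorm p <= c.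
Proof.
move=> c0 S0 SD SZ lD lZ lb.
pose J s := rip s s - 2 * l s.
have Jlb : forall s, S s -> - c ^+ 2 <= J s.
  move=> s Ss; rewrite /J -hnorm_sqr.
  have := ler_normlW (lb s Ss); have := sqr_ge0 (hnorm s - c); nra.
pose E := [set J s | s in S].
have hiE : has_inf E.
  split; first by exists (J 0); exists 0.
  by exists (- c ^+ 2) => _ [s Ss <-]; exact: Jlb.
have Jinf : forall s, S s -> inf E <= J s.
  by move=> s Ss; apply: ge_inf; [exact: (proj2 hiE)|exists s].
(* The parallelogram bound 2 ep(i) + 2 ep(i+1) is then below 4^-i, the square of the rate that
   [hcomplete] asks for. *)
pose ep (k : nat) : R := 4^-1 ^+ k.+1.
have ep0 k : 0 < ep k by rewrite exprn_gt0 ?invr_gt0.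
have [u Hu] : {u : nat -> V & forall k, S (u k) /\ J (u k) < inf E + ep k}.
  apply: (@choice _ _ (fun k w => S w /\ J w < inf E + ep k)) => k.
  by have [_ [s Ss <-] h] := inf_adherent (ep0 k) hiE; exists s.
have par : forall s t, S s -> S t -> rip (s - t) (s - t) <= 2 * J s + 2 * J t - 4 * inf E.
  move=> s t Ss St.
  have := Jinf _ (SZ 2^-1 _ (SD _ _ Ss St)).
  rewrite /J ripZl// ripZr lZ ?lD// ?SD//; last exact: SD.
  rewrite ripBl !ripBr ripDl// !ripDr (C t s); lra.
have [p hp] : exists l, hcvg u l.
  apply: (hcomplete hH) => i.
  rewrite -(@ler_pXn2r _ 2)// ?nnegrE ?hnorm_ge0 ?exprn_ge0 ?invr_ge0//.
  rewrite hnorm_sqr -exprM mulnC exprM.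
  have [S1 J1] := Hu i; have [S2 J2] := Hu i.+1.
  apply: (le_trans (par _ _ S2 S1)).
  move: J1 J2; rewrite /ep !exprS -[X in _ <= X ^+ i]/(2^-1 * (2^-1 * 1)).
  have -> : 2^-1 * (2^-1 * 1) = 4^-1 :> R by field.
  have : 0 <= (4^-1 : R) ^+ i by rewrite exprn_ge0 ?invr_ge0.
  by lra.
have epc : ep k @[k --> \oo] --> (0 : R).
  rewrite -[X in _ --> X](mulr0 4^-1) /ep.
  under eq_fun do rewrite exprS.
  by apply: cvgMr; apply: cvg_expr; rewrite ger0_norm ?invr_ge0// invf_lt1// ltr1n.
have ripp : forall s, S s -> rip p s = l s.
  move=> s Ss; have h : forall t, 0 <= t ^+ 2 * rip s s + 2 * t * (rip p s - l s).
    move=> t; have cv : ep k + t ^+ 2 * rip s s + 2 * t * (rip (u k) s - l s) @[k --> \oo]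
       --> 0 + t ^+ 2 * rip s s + 2 * t * (rip p s - l s).
      apply: cvgD; first by apply: cvgD => //; exact: cvg_cst.
      by apply: cvgMr; apply: cvgB; [exact: hcvg_ripl|exact: cvg_cst].
    rewrite add0r in cv; rewrite -(cvg_lim (@Rhausdorff _) cv).
    apply: limr_ge; first by apply/cvg_ex; eexists; exact: cv.
    near=> k; have [Sk Jk] := Hu k.
    have := Jinf _ (SD _ _ Sk (SZ t _ Ss)); move: Jk; rewrite /J.
    rewrite lD ?lZ ?SZ//; last exact: SZ.
    rewrite ripDl// !ripDr ripZl// !ripZr ripZl// (C s); lra.
  have [q0|q0] := eqVneq (rip s s) 0.
    rewrite (rip_eq0 hH q0) rip0r.
    by have := lb _ S0; rewrite hnorm0 mulr0 normr_le0 => /eqP.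
  have qp : 0 < rip s s by rewrite lt_def q0 rip_ge0.
  have := h (- (rip p s - l s) / rip s s); set d := rip p s - l s.
  have -> : (- d / rip s s) ^+ 2 * rip s s + 2 * (- d / rip s s) * d = - d ^+ 2 / rip s s.
    by field; rewrite gt_eqF.
  rewrite pmulr_lge0 ?invr_gt0// oppr_ge0 => h1.
  have : d ^+ 2 == 0 by rewrite eq_le h1 sqr_ge0.
  by rewrite sqrf_eq0 subr_eq0 => /eqP.
exists p; split=> //.
have cv1 : rip (u k) p @[k --> \oo] --> rip p p by exact: hcvg_ripl.
have cv2 : c * hnorm (u k) @[k --> \oo] --> c * hnorm p by apply: cvgMr; apply: hcvg_norm.
have : rip p p <= c * hnorm p.
  rewrite -(cvg_lim (@Rhausdorff _) cv1) -(cvg_lim (@Rhausdorff _) cv2).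
  apply: ler_lim; [by apply/cvg_ex; eexists; exact: cv1|by apply/cvg_ex; eexists; exact: cv2|].
  near=> k; have [Sk _] := Hu k; rewrite C ripp//; exact/ler_normlW/lb.
rewrite -hnorm_sqr; have [p0|p0] := eqVneq (hnorm p) 0; first by rewrite p0.
have pp : 0 < hnorm p by rewrite lt_def p0 hnorm_ge0.
by rewrite expr2 ler_pM2r.
Unshelve. all: by end_near. Qed.

Lemma rip_total_eq a b : (forall u, rip a u = rip b u) -> a = b.
Proof.
move=> h; apply/eqP; rewrite -subr_eq0; apply/eqP/(rip_eq0 hH).
by rewrite ripBl h subrr.
Qed.

Definition lincomb I (e : I -> V) (l : seq (R * I)) := \sum_(p <- l) p.1%:C%C *: e p.2.

Lemma rip_lincombr I (e : I -> V) l h :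
  rip h (lincomb e l) = \sum_(p <- l) p.1 * rip h (e p.2).
Proof.
rewrite /lincomb; elim: l => [|p l IH]; first by rewrite !big_nil rip0r.
by rewrite !big_cons ripDr ripZr IH.
Qed.

Section Transfer.
Context {I : Type}.

Definition total_family (e : I -> V) := forall h, (forall i, rip h (e i) = 0) -> h = 0.

(** Equal Gram matrices make the map from a combination of the e' to the pairing of h with the same
    combination of the e well defined and bounded by |h|; Riesz on the span of e' represents it.
    [pk] picks one combination for each vector of the span. *)
Lemma transfer (e e' : I -> V) :
  (forall i j, rip (e i) (e j) = rip (e' i) (e' j)) -> forall h,
  exists w, (forall i, rip w (e' i) = rip h (e i)) /\ hnorm w <= hnorm h.
Proof.
move=> gram h.
have gl : forall l l', rip (lincomb e l) (lincomb e l') = rip (lincomb e' l) (lincomb e' l').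
  move=> l l'; rewrite !rip_lincombr; apply: eq_bigr => p _; congr (_ * _).
  by rewrite C [RHS]C !rip_lincombr; apply: eq_bigr => q _; rewrite gram.
pose S := range (lincomb e').
have [pk pkP'] : {pk : V -> seq (R * I) & forall s, S s -> lincomb e' (pk s) = s}.
  apply: (@choice _ _ (fun s l => S s -> lincomb e' l = s)) => s.
  have [[l _ hl]|ns] := pselect (S s); first by exists l.
  by exists [::] => /ns.
have pkP l : lincomb e' (pk (lincomb e' l)) = lincomb e' l by apply: pkP'; exists l.
have eqe l l' : lincomb e' l = lincomb e' l' -> lincomb e l = lincomb e l'.
  move=> h1; apply/eqP; rewrite -subr_eq0; apply/eqP/(rip_eq0 hH).
  by rewrite ripBl !ripBr !gl h1 !subrr.
have lcat f l l' : lincomb f (l ++ l') = lincomb f l + lincomb f l'.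
  by rewrite /lincomb big_cat.
have lsc f r l : lincomb f [seq (r * p.1, p.2) | p <- l] = r%:C%C *: lincomb f l.
  rewrite /lincomb big_map scaler_sumr; apply: eq_bigr => p _ /=.
  by rewrite rmorphM scalerA.
have [||||||w [hw1 hw2]] := @riesz S (fun s => rip h (lincomb e (pk s))) (hnorm h) (hnorm_ge0 _).
- by exists [::] => //; rewrite /lincomb big_nil.
- by move=> _ _ [l _ <-] [l' _ <-]; exists (l ++ l').
- by move=> r _ [l _ <-]; exists [seq (r * p.1, p.2) | p <- l].
- move=> _ _ [l _ <-] [l' _ <-]; rewrite -ripDr -lcat; congr (rip _ _).
  by rewrite -lcat; apply: eqe; rewrite pkP !lcat !pkP.
- move=> r _ [l _ <-]; rewrite -ripZr -lsc; congr (rip _ _).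
  rewrite -lsc; apply: eqe; rewrite [RHS]lsc [in RHS]pkP pkP'//.
  by exists [seq (r * p.1, p.2) | p <- l] => //; rewrite lsc.
- move=> _ [l _ <-]; apply: (le_trans (cauchy_schwarz _ _)).
  by rewrite /hnorm gl pkP.
exists w; split=> // i.
have ei f : lincomb f [:: (1, i)] = f i.
  by rewrite /lincomb big_seq1 /= rmorph1 scale1r.
rewrite -{1}[e' i]ei hw1; last by exists [:: (1, i)].
by congr (rip _ _); rewrite -[RHS]ei; apply: eqe; rewrite pkP.
Qed.

(** The transfers in the two directions are contractions, and totality makes them mutually inverse,
    hence isometric. They are only real linear by construction; stability of the families under
    multiplication by i makes them complex linear. *)
Lemma unitary_of_gram (e e' : I -> V) :
  (forall i j, rip (e i) (e j) = rip (e' i) (e' j)) ->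
  total_family e -> total_family e' ->
  (forall u v, rip ('i%C *: u) v = - rip u ('i%C *: v)) ->
  (forall i, exists j, e j = 'i%C *: e i /\ e' j = 'i%C *: e' i) ->
  exists F G : V -> V, [/\ cancel F G, cancel G F, linear F,
    forall a b, rip (F a) (F b) = rip a b & forall i, F (e i) = e' i].
Proof.
move=> gram te te' ripi ei.
have [F HF] := choice (transfer gram).
have [G HG] := choice (transfer (fun i j => esym (gram i j))).
have teq (f : I -> V) : total_family f -> forall a b, (forall i, rip a (f i) = rip b (f i)) -> a = b.
  by move=> tf a b h; apply/eqP; rewrite -subr_eq0; apply/eqP/tf => i; rewrite ripBl h subrr.
have FG : cancel F G.
  by move=> h; apply: (teq _ te) => i; rewrite (HG _).1 (HF _).1.
have GF : cancel G F.
  by move=> h; apply: (teq _ te') => i; rewrite (HF _).1 (HG _).1.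
have FD a b : F (a + b) = F a + F b.
  by apply: (teq _ te') => i; rewrite (HF _).1 !ripDl// !(HF _).1.
have FZ r a : F (r%:C%C *: a) = r%:C%C *: F a.
  by apply: (teq _ te') => i; rewrite (HF _).1 !ripZl// !(HF _).1.
have Fi a : F ('i%C *: a) = 'i%C *: F a.
  apply: (teq _ te') => i; have [j [h1 h2]] := ei i.
  by rewrite (HF _).1 !ripi -h1 -h2 (HF _).1.
have Fn a : rip (F a) (F a) = rip a a.
  rewrite -!hnorm_sqr; congr (_ ^+ 2); apply/eqP; rewrite eq_le (HF a).2 /=.
  by have := (HG (F a)).2; rewrite FG.
exists F, G; split=> //.
- move=> [x y] a b; rewrite FD; congr (_ + _).
  have cE : (x +i* y)%C = x%:C%C + y%:C%C * 'i%C.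
    by apply/eqP; rewrite eq_complex /=; apply/andP; split; apply/eqP; simpl; ring.
  by rewrite cE !scalerDl FD FZ -!scalerA FZ Fi.
- move=> a b; have := Fn (a + b).
  rewrite FD !ripDl// !ripDr !Fn (C b a) (C (F b)); lra.
- by move=> i; apply: (teq _ te') => k; rewrite (HF _).1 gram.
Qed.
End Transfer.
End Hilbert.

(** * Complex numbers, the Hermitian product and matrices at one point *)

Section Pointwise.
Context {R : realType}.
Implicit Types x y : R[i].

Lemma cReD x y : complex.Re (x + y) = complex.Re x + complex.Re y.
Proof. by case: x; case: y. Qed.
Lemma cImD x y : complex.Im (x + y) = complex.Im x + complex.Im y.
Proof. by case: x; case: y. Qed.
Lemma cReN x : complex.Re (- x) = - complex.Re x. Proof. by case: x. Qed.
Lemma cImN x : complex.Im (- x) = - complex.Im x. Proof. by case: x. Qed.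
Lemma cReM x y : complex.Re (x * y) = complex.Re x * complex.Re y - complex.Im x * complex.Im y.
Proof. by case: x; case: y. Qed.
Lemma cImM x y : complex.Im (x * y) = complex.Re x * complex.Im y + complex.Im x * complex.Re y.
Proof. by case: x; case: y => a b c d /=; rewrite addrC. Qed.
Lemma cReJ x : complex.Re (x^*)%R = complex.Re x. Proof. by case: x. Qed.
Lemma cImJ x : complex.Im (x^*)%R = - complex.Im x. Proof. by case: x. Qed.
Lemma Re_sum I (r : seq I) P (F : I -> R[i]) :
  complex.Re (\sum_(i <- r | P i) F i) = \sum_(i <- r | P i) complex.Re (F i).
Proof. by apply: big_morph => // x y; exact: cReD. Qed.
Lemma Im_sum I (r : seq I) P (F : I -> R[i]) :
  complex.Im (\sum_(i <- r | P i) F i) = \sum_(i <- r | P i) complex.Im (F i).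
Proof. by apply: big_morph => // x y; exact: cImD. Qed.
Lemma complex_ext x y :
  complex.Re x = complex.Re y -> complex.Im x = complex.Im y -> x = y.
Proof. by case: x; case: y => a b c d /= -> ->. Qed.
Lemma normc_sqr x : normc x ^+ 2 = complex.Re x ^+ 2 + complex.Im x ^+ 2.
Proof. by case: x => a b; rewrite /= sqr_sqrtr// addr_ge0 ?sqr_ge0. Qed.

Context {N : nat}.
Implicit Types u v w : 'cV[R[i]]_N.

Definition cdot u v : R[i] := (u^t* *m v) 0 0.

Lemma cdotE u v : cdot u v = \sum_i (u i 0)^* * v i 0.
Proof. by rewrite /cdot mxE; apply: eq_bigr => i _; rewrite !mxE. Qed.
Lemma cdotDr u v w : cdot u (v + w) = cdot u v + cdot u w.
Proof. by rewrite /cdot mulmxDr mxE. Qed.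
Lemma cdotZr a u v : cdot u (a *: v) = a * cdot u v.
Proof. by rewrite /cdot -scalemxAr mxE. Qed.
Lemma cdotC u v : cdot v u = (cdot u v)^*.
Proof.
by rewrite !cdotE rmorph_sum; apply: eq_bigr => i _; rewrite rmorphM /= conjCK mulrC.
Qed.
Lemma cdotDl u v w : cdot (v + w) u = cdot v u + cdot w u.
Proof. by rewrite [LHS]cdotC cdotDr rmorphD /= -!cdotC. Qed.
Lemma cdotZl a u v : cdot (a *: u) v = a^* * cdot u v.
Proof. by rewrite [LHS]cdotC cdotZr rmorphM /= -cdotC. Qed.
Lemma cdot0r u : cdot u 0 = 0. Proof. by rewrite /cdot mulmx0 mxE. Qed.
Lemma cdot0l u : cdot 0 u = 0. Proof. by rewrite cdotC cdot0r rmorph0. Qed.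
Lemma cdotNr u v : cdot u (- v) = - cdot u v.
Proof. by rewrite /cdot mulmxN mxE. Qed.
Lemma cdotNl u v : cdot (- u) v = - cdot u v.
Proof. by rewrite [LHS]cdotC cdotNr rmorphN /= -cdotC. Qed.
Lemma cdotMl (M : 'M[R[i]]_N) u v : cdot (M *m u) v = cdot u (M^t* *m v).
Proof. by rewrite /cdot trmx_mul map_mxM mulmxA. Qed.
Lemma ctrmxK (M : 'M[R[i]]_N) : (M^t*)^t* = M.
Proof. by apply/matrixP => i j; rewrite !mxE conjCK. Qed.
Lemma cdotMr (M : 'M[R[i]]_N) u v : cdot u (M *m v) = cdot (M^t* *m u) v.
Proof. by rewrite cdotMl ctrmxK. Qed.

Lemma l2norm_sqr u : l2norm u ^+ 2 = complex.Re (cdot u u).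
Proof.
rewrite sqr_sqrtr ?sumr_ge0// => [|i _]; last exact: sqr_ge0.
rewrite cdotE Re_sum; apply: eq_bigr => i _.
by rewrite normc_sqr cReM cReJ cImJ mulNr opprK -!expr2.
Qed.
Lemma Im_cdotuu u : complex.Im (cdot u u) = 0.
Proof.
rewrite cdotE Im_sum big1// => i _.
by rewrite cImM cReJ cImJ mulNr mulrC subrr.
Qed.
Lemma cdotuu u : cdot u u = (l2norm u ^+ 2)%:C%C.
Proof. by apply: complex_ext; rewrite ?Im_cdotuu// l2norm_sqr. Qed.
Lemma l2norm_ge0 u : 0 <= l2norm u. Proof. exact: sqrtr_ge0. Qed.
Lemma l2norm0 : l2norm (0 : 'cV[R[i]]_N) = 0.
Proof.
by apply/eqP; rewrite -sqrf_eq0 l2norm_sqr cdot0r.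
Qed.
Lemma l2norm_eq0 u : l2norm u = 0 -> u = 0.
Proof.
move=> h; have : \sum_(i < N) normc (u i 0) ^+ 2 = 0.
  by rewrite -[LHS]sqr_sqrtr ?sumr_ge0// -/(l2norm u) ?h ?expr0n// => i _; exact: sqr_ge0.
move=> /psumr_eq0P h1; apply/matrixP => i j; rewrite ord1 mxE.
have /eqP := h1 (fun i _ => sqr_ge0 _) i isT.
by rewrite sqrf_eq0 => /eqP; exact: Normc.eq0_normc.
Qed.
Lemma l2norm_sqrZ a u : l2norm (a *: u) ^+ 2 = normc a ^+ 2 * l2norm u ^+ 2.
Proof.
rewrite l2norm_sqr cdotZr cdotZl mulrA cdotuu cReM /= mulr0 subr0.
by rewrite normc_sqr cReM cReJ cImJ mulrN opprK -!expr2.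
Qed.
Lemma l2norm_sqrD u v : l2norm (u + v) ^+ 2 <= 2 * l2norm u ^+ 2 + 2 * l2norm v ^+ 2.
Proof.
have := sqr_ge0 (l2norm (u - v)).
rewrite !l2norm_sqr !(cdotDl, cdotDr, cdotNl, cdotNr, cReD, cReN).
set a := complex.Re _; set b := complex.Re _; set c := complex.Re _; set d := complex.Re _.
clearbody a b c d; lra.
Qed.
Lemma Re_cdot_le u v : `|complex.Re (cdot u v)| <= l2norm u ^+ 2 + l2norm v ^+ 2.
Proof.
have s : complex.Re (cdot v u) = complex.Re (cdot u v) by rewrite cdotC cReJ.
have := sqr_ge0 (l2norm (u - v)); have := sqr_ge0 (l2norm (u + v)).
have := sqr_ge0 (l2norm u); have := sqr_ge0 (l2norm v).
rewrite !l2norm_sqr !(cdotDl, cdotDr, cdotNl, cdotNr, cReD, cReN) s ler_norml.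
set a := complex.Re (cdot u u); set b := complex.Re (cdot v v); set c := complex.Re _.
clearbody a b c => h1 h2 h3 h4; apply/andP; split; lra.
Qed.
Lemma Im_cdot_le u v : `|complex.Im (cdot u v)| <= l2norm u ^+ 2 + l2norm v ^+ 2.
Proof.
have := Re_cdot_le ('i%C *: u) v; rewrite cdotZl cReM cReJ cImJ /= mul0r sub0r mulN1r opprK.
rewrite l2norm_sqrZ normc_sqr /= expr0n/= add0r expr1n mul1r.
by [].
Qed.

Lemma sum_sqr_le (F : 'I_N -> R) : (\sum_i F i) ^+ 2 <= N%:R * \sum_i F i ^+ 2.
Proof.
rewrite expr2 mulr_suml.
apply: (@le_trans _ _ (\sum_i \sum_j (F i ^+ 2 / 2 + F j ^+ 2 / 2))).
  apply: ler_sum => i _; rewrite mulr_sumr; apply: ler_sum => j _.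
  by have := sqr_ge0 (F i - F j); rewrite !expr2; lra.
set K := \sum_i F i ^+ 2.
have -> : \sum_i \sum_j (F i ^+ 2 / 2 + F j ^+ 2 / 2) = \sum_i (N%:R * (F i ^+ 2 / 2) + K / 2).
  by apply: eq_bigr => i _; rewrite big_split /= sumr_const card_ord -mulr_suml mulr_natl.
rewrite big_split /= -mulr_sumr -mulr_suml -/K sumr_const card_ord -[X in _ + X]mulr_natl -mulrDr.
by rewrite -splitr.
Qed.

(** An entrywise estimate by the squared Frobenius norm K. *)
Lemma mulmx_bounded (M : 'M[R[i]]_N) :
  exists2 c : R, 0 <= c & forall u, l2norm (M *m u) ^+ 2 <= c * l2norm u ^+ 2.
Proof.
pose K := \sum_i \sum_j normc (M i j) ^+ 2.
have K0 : 0 <= K by rewrite !sumr_ge0// => i _; rewrite sumr_ge0// => j _; exact: sqr_ge0.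
exists (2 * N%:R * K) => [|u]; first by rewrite mulr_ge0 ?mulr_ge0.
have uE w : l2norm w ^+ 2 = \sum_i (complex.Re (w i 0) ^+ 2 + complex.Im (w i 0) ^+ 2).
  rewrite l2norm_sqr cdotE Re_sum; apply: eq_bigr => i _.
  by rewrite cReM cReJ cImJ mulNr opprK -!expr2.
have lu j : complex.Re (u j 0) ^+ 2 + complex.Im (u j 0) ^+ 2 <= l2norm u ^+ 2.
  rewrite uE (bigD1 j)//= lerDl sumr_ge0// => i _.
  by rewrite addr_ge0 ?sqr_ge0.
rewrite [in X in X <= _]uE.
apply: (@le_trans _ _ (\sum_i \sum_j (2 * N%:R * normc (M i j) ^+ 2 * l2norm u ^+ 2))).
  apply: ler_sum => i _; rewrite mxE Re_sum Im_sum.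
  apply: (le_trans (lerD (sum_sqr_le _) (sum_sqr_le _))).
  rewrite -mulrDr -big_split mulr_sumr; apply: ler_sum => j _ /=.
  rewrite cReM cImM normc_sqr.
  set a := complex.Re _; set b := complex.Im _; set c := complex.Re _; set d := complex.Im _.
  have -> : (a * c - b * d) ^+ 2 + (a * d + b * c) ^+ 2 = (a ^+ 2 + b ^+ 2) * (c ^+ 2 + d ^+ 2).
    by ring.
  have := lu j; rewrite -/c -/d; set q := l2norm u ^+ 2 => h.
  have -> : 2 * N%:R * (a ^+ 2 + b ^+ 2) * q = N%:R * (2 * (a ^+ 2 + b ^+ 2) * q) by ring.
  rewrite ler_wpM2l//.
  have : 0 <= (a ^+ 2 + b ^+ 2) * (q - (c ^+ 2 + d ^+ 2)).
    by rewrite mulr_ge0 ?subr_ge0// addr_ge0 ?sqr_ge0.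
  have : 0 <= (a ^+ 2 + b ^+ 2) * (c ^+ 2 + d ^+ 2) by rewrite mulr_ge0// addr_ge0 ?sqr_ge0.
  lra.
rewrite /K !mulr_sumr mulr_suml; apply: ler_sum => i _.
by rewrite !mulr_sumr mulr_suml.
Qed.
End Pointwise.

(** * Measurability and integrals of complex functions *)

Section Integrals.
Context {R : realType} {n : nat}.
Local Notation mu := (@lebesgue_Rn R n).
Local Notation X := (Rn R n).
Implicit Types h : X -> R[i].

Lemma aeP (P : X -> Prop) : (\forall x \ae mu, P x) <-> mu.-negligible [set x | ~ P x].
Proof. by []. Qed.

Lemma cmeas_cst z : cmeasurable (fun _ : X => z).
Proof. by split; exact: measurable_cst. Qed.
Lemma cmeas_real (f : X -> R) : measurable_fun setT f -> cmeasurable (fun x => (f x)%:C%C).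
Proof. by split => //=; exact: measurable_cst. Qed.
Lemma cmeasD h1 h2 : cmeasurable h1 -> cmeasurable h2 -> cmeasurable (fun x => h1 x + h2 x).
Proof.
move=> [a b] [c d]; split.
  by under eq_fun do rewrite cReD; exact: measurable_funD.
by under eq_fun do rewrite cImD; exact: measurable_funD.
Qed.
Lemma cmeasM h1 h2 : cmeasurable h1 -> cmeasurable h2 -> cmeasurable (fun x => h1 x * h2 x).
Proof.
move=> [a b] [c d]; split.
  under eq_fun do rewrite cReM.
  by apply: measurable_funB; exact: measurable_funM.
under eq_fun do rewrite cImM.
by apply: measurable_funD; exact: measurable_funM.
Qed.
Lemma cmeasJ h : cmeasurable h -> cmeasurable (fun x => (h x)^*).
Proof.
move=> [a b]; split; first by under eq_fun do rewrite cReJ.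
by under eq_fun do rewrite cImJ; exact: measurableT_comp.
Qed.
Lemma cmeas_sum I (r : seq I) (F : I -> X -> R[i]) :
  (forall i, cmeasurable (F i)) -> cmeasurable (fun x => \sum_(i <- r) F i x).
Proof.
move=> hF; elim: r => [|i r IH].
  by under [X in cmeasurable X]eq_fun do rewrite big_nil; exact: cmeas_cst.
under [X in cmeasurable X]eq_fun do rewrite big_cons.
exact: cmeasD.
Qed.

Definition rint (f : X -> R) := mu.-integrable setT (EFin \o f).

Lemma rintD (f g : X -> R) : rint f -> rint g -> rint (fun x => f x + g x).
Proof. by move=> a b; apply: eq_integrable (integrableD measurableT a b). Qed.
Lemma rintB (f g : X -> R) : rint f -> rint g -> rint (fun x => f x - g x).
Proof. by move=> a b; apply: eq_integrable (integrableB measurableT a b). Qed.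
Lemma rintZ (r : R) (f : X -> R) : rint f -> rint (fun x => r * f x).
Proof. by move=> a; apply: eq_integrable (integrableZl measurableT r a). Qed.
Lemma rintN f : rint f -> rint (fun x => - f x).
Proof. by move=> a; apply: eq_integrable (integrableN a). Qed.
Lemma rint_meas f : rint f -> measurable_fun setT f.
Proof. by move=> /integrableP[/measurable_EFinP]. Qed.
Lemma rint_le (f g : X -> R) : measurable_fun setT f -> (forall x, `|f x| <= g x) -> rint g -> rint f.
Proof.
move=> mf h; apply: le_integrable => //; first exact/measurable_EFinP.
by move=> x _ /=; rewrite lee_fin (le_trans (h x))// ler_norm.
Qed.

Definition cintegrable h := rint (fun x => complex.Re (h x)) /\ rint (fun x => complex.Im (h x)).



Lemma cintegralD h1 h2 : cintegrable h1 -> cintegrable h2 ->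
  cintegral (fun x => h1 x + h2 x) = cintegral h1 + cintegral h2.
Proof.
move=> [a b] [c d]; apply: complex_ext => /=.
  by under eq_Rintegral do rewrite cReD; rewrite RintegralD.
by under eq_Rintegral do rewrite cImD; rewrite RintegralD.
Qed.

Lemma cintegralZ z h : cintegrable h -> cintegral (fun x => z * h x) = z * cintegral h.
Proof.
move=> [a b]; apply: complex_ext; rewrite ?cReM ?cImM /=.
  under eq_Rintegral do rewrite cReM.
  by rewrite RintegralB ?RintegralZl//; exact: rintZ.
under eq_Rintegral do rewrite cImM.
by rewrite RintegralD ?RintegralZl//; exact: rintZ.
Qed.

Lemma cintegralJ h : cintegrable h -> cintegral (fun x => (h x)^*) = (cintegral h)^*.
Proof.
move=> [a b]; apply: complex_ext; rewrite ?cReJ ?cImJ /=.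
  by apply: eq_Rintegral => x _; rewrite cReJ.
rewrite -[RHS]mulN1r -RintegralZl//.
by apply: eq_Rintegral => x _; rewrite cImJ mulN1r.
Qed.

Lemma Rintegral_ae (f g : X -> R) : measurable_fun setT f -> measurable_fun setT g ->
  f = g %[ae mu] -> \int[mu]_x f x = \int[mu]_x g x.
Proof.
move=> mf mg fg; congr fine; apply: ae_eq_integral => //.
- exact/measurable_EFinP.
- exact/measurable_EFinP.
- by apply: filterS fg => x h _; rewrite h.
Qed.

Lemma cintegral_ae h1 h2 : cmeasurable h1 -> cmeasurable h2 ->
  h1 = h2 %[ae mu] -> cintegral h1 = cintegral h2.
Proof.
move=> [a b] [c d] hh; apply: complex_ext; apply: Rintegral_ae => //;
  by apply: filterS hh => x h _; rewrite h.
Qed.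
End Integrals.

(** [aeuse] replaces an almost everywhere goal by a pointwise one in which the listed almost
    everywhere facts appear, in order, as premises. *)
Ltac fapp h := refine (filter_app _ _ h).
Tactic Notation "aeuse" constr(a) := (fapp a; apply: aeW).
Tactic Notation "aeuse" constr(a) "," constr(b) := (fapp b; fapp a; apply: aeW).
Tactic Notation "aeuse" constr(a) "," constr(b) "," constr(c) := (fapp c; fapp b; fapp a; apply: aeW).
Tactic Notation "aeuse" constr(a) "," constr(b) "," constr(c) "," constr(d) :=
  (fapp d; fapp c; fapp b; fapp a; apply: aeW).
Tactic Notation "aeuse" constr(a) "," constr(b) "," constr(c) "," constr(d) "," constr(e) :=
  (fapp e; fapp d; fapp c; fapp b; fapp a; apply: aeW).

(** * Real sequences converging at a geometric rate *)

Section RealSequences.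
Context {R : realType}.

Lemma sqr_cvg0 (h : nat -> R) : h k ^+ 2 @[k --> \oo] --> (0 : R) -> h k @[k --> \oo] --> (0 : R).
Proof.
move=> hc; apply/cvgr0Pnorm_lt => e e0.
have e2 : 0 < e ^+ 2 by rewrite exprn_gt0.
have [N _ HN] := (cvgr0Pnorm_lt (fun k => h k ^+ 2)).1 hc _ e2.
exists N => // k /HN /=; rewrite normrX ltr_pXn2r// nnegrE//; exact: ltW.
Qed.

Lemma cvg_geom_half (c : R) : c * 2^-1 ^+ k @[k --> \oo] --> (0 : R).
Proof.
rewrite -[X in _ --> X](mulr0 c); apply: cvgMr; apply: cvg_expr.
by rewrite ger0_norm ?invr_ge0// invf_lt1// ltr1n.
Qed.

Lemma fast_cauchy (r : nat -> R) (c : R) :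
  (forall n k, (r (n + k)%N - r n) ^+ 2 <= c * 2^-1 ^+ n) ->
  exists l, r n @[n --> \oo] --> l /\ forall n, (l - r n) ^+ 2 <= c * 2^-1 ^+ n.
Proof.
move=> h.
have cv : cvg (r n @[n --> \oo]).
  apply/cauchy_cvgP; apply: cauchy_exP => e e0.
  have e2 : 0 < e ^+ 2 by rewrite exprn_gt0.
  have [N _ HN] := (cvgr0Pnorm_lt (fun k => c * 2^-1 ^+ k)).1 (cvg_geom_half c) _ e2.
  exists (r N); exists N => // k /= Nk; rewrite /ball /= distrC.
  rewrite -(@ltr_pXn2r _ 2)// ?nnegrE ?(ltW e0)// real_normK ?num_real//.
  rewrite -(subnKC Nk); apply: le_lt_trans (h _ _) _.
  by apply: le_lt_trans (HN N _) => //=; rewrite ler_norm.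
exists (lim (r n @[n --> \oo])); split=> // n.
have cv2 : (r (n + k)%N - r n) ^+ 2 @[k --> \oo] --> (lim (r n @[n --> \oo]) - r n) ^+ 2.
  rewrite expr2; under eq_fun do rewrite expr2.
  have h1 : r (n + k)%N - r n @[k --> \oo] --> lim (r n @[n --> \oo]) - r n.
    apply: cvgB; last exact: cvg_cst.
    under eq_fun do rewrite addnC.
    by move: cv => /=; rewrite -{1}(cvg_shiftn n).
  exact: cvgM.
rewrite -(cvg_lim (@Rhausdorff _) cv2); apply: limr_le.
  by apply/cvg_ex; eexists; exact: cv2.
exact: nearW.
Qed.
End RealSequences.

(** * Square-integrable vector functions and their inner product *)

Section L2Space.
Context {R : realType} {n N : nat}.
Local Notation mu := (@lebesgue_Rn R n).
Local Notation X := (Rn R n).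
Implicit Types f g h : vfun R n N.

Definition vmeas f := forall i, cmeasurable (fun x => f x i 0).
Definition mmeas (M : X -> 'M[R[i]]_N) := forall i j, cmeasurable (fun x => M x i j).

Lemma aeeqI f g : (\forall x \ae mu, f x = g x) -> aeeq f g.
Proof. by apply: filterS => x h _. Qed.
Lemma aeeqE f g : aeeq f g -> \forall x \ae mu, f x = g x.
Proof. by apply: filterS => x; exact. Qed.
Lemma aeeq_refl f : aeeq f f. Proof. exact: ae_eq_refl. Qed.
Lemma aeeq_sym f g : aeeq f g -> aeeq g f. Proof. exact: ae_eq_sym. Qed.
Lemma aeeq_trans f g h : aeeq f g -> aeeq g h -> aeeq f h. Proof. exact: ae_eq_trans. Qed.

Lemma vmeasD f g : vmeas f -> vmeas g -> vmeas (fun x => f x + g x).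
Proof. by move=> a b i; under [X in cmeasurable X]eq_fun do rewrite mxE; exact: cmeasD. Qed.
Lemma vmeasZ (s : X -> R[i]) f : cmeasurable s -> vmeas f -> vmeas (fun x => s x *: f x).
Proof. by move=> a b i; under [X in cmeasurable X]eq_fun do rewrite mxE; exact: cmeasM. Qed.
Lemma vmeasM M f : mmeas M -> vmeas f -> vmeas (fun x => M x *m f x).
Proof.
move=> a b i; under [X in cmeasurable X]eq_fun do rewrite mxE.
by apply: cmeas_sum => j; exact: cmeasM.
Qed.
Lemma mmeas_cst M : mmeas (fun _ => M). Proof. by move=> i j; exact: cmeas_cst. Qed.
Lemma mmeasD M M' : mmeas M -> mmeas M' -> mmeas (fun x => M x + M' x).
Proof. by move=> a b i j; under [X in cmeasurable X]eq_fun do rewrite mxE; exact: cmeasD. Qed.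
Lemma mmeasZ s M : cmeasurable s -> mmeas M -> mmeas (fun x => s x *: M x).
Proof. by move=> a b i j; under [X in cmeasurable X]eq_fun do rewrite mxE; exact: cmeasM. Qed.
Lemma mmeasM M M' : mmeas M -> mmeas M' -> mmeas (fun x => M x *m M' x).
Proof.
move=> a b i j; under [X in cmeasurable X]eq_fun do rewrite mxE.
by apply: cmeas_sum => k; exact: cmeasM.
Qed.
Lemma vmeas_cdot f g : vmeas f -> vmeas g -> cmeasurable (fun x => cdot (f x) (g x)).
Proof.
move=> a b; under [X in cmeasurable X]eq_fun do rewrite cdotE.
by apply: cmeas_sum => i; apply: cmeasM => //; exact: cmeasJ.
Qed.
Lemma meas_l2norm_sqr f : vmeas f -> measurable_fun setT (fun x => l2norm (f x) ^+ 2).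
Proof.
by move=> a; under eq_fun do rewrite l2norm_sqr; have [] := vmeas_cdot a a.
Qed.
Lemma L2_vmeas f : L2 f -> vmeas f. Proof. by case. Qed.

Lemma L2P f : L2 f <-> vmeas f /\ rint (fun x => l2norm (f x) ^+ 2).
Proof.
split=> -[a b]; split=> //.
  apply/integrableP; split; first by apply/measurable_EFinP; apply: meas_l2norm_sqr.
  by under eq_integral do rewrite /= ger0_norm ?sqr_ge0//.
have /integrableP[_] := b.
by under eq_integral do rewrite /= ger0_norm ?sqr_ge0//.
Qed.

Lemma L2_dom f g (c : R) : vmeas g ->
  (forall x, l2norm (g x) ^+ 2 <= c * l2norm (f x) ^+ 2) -> L2 f -> L2 g.
Proof.
move=> mg h /L2P[_ fi]; apply/L2P; split=> //.
apply: (@rint_le _ _ _ (fun x => c * l2norm (f x) ^+ 2)).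
- exact: meas_l2norm_sqr.
- by move=> x; rewrite ger0_norm ?sqr_ge0.
- exact: rintZ.
Qed.

Lemma L2_0 : L2 ((fun=> 0) : vfun R n N).
Proof.
apply/L2P; split=> [i|].
  by under [X in cmeasurable X]eq_fun do rewrite mxE; exact: cmeas_cst.
under eq_fun do rewrite l2norm0 expr0n /=.
exact: integrable0.
Qed.

Lemma L2_D f g : L2 f -> L2 g -> L2 (fun x => f x + g x).
Proof.
move=> /L2P[a b] /L2P[c d]; apply/L2P; split; first exact: vmeasD.
apply: (@rint_le _ _ _ (fun x => 2 * l2norm (f x) ^+ 2 + 2 * l2norm (g x) ^+ 2)).
- by apply: meas_l2norm_sqr; exact: vmeasD.
- by move=> x; rewrite ger0_norm ?sqr_ge0 ?l2norm_sqrD.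
- by apply: rintD; exact: rintZ.
Qed.

Lemma L2_Z z f : L2 f -> L2 (fun x => z *: f x).
Proof.
move=> fL; apply: (L2_dom (c := normc z ^+ 2) _ _ fL) => [|x].
  by apply: vmeasZ; [exact: cmeas_cst|exact: L2_vmeas].
by rewrite l2norm_sqrZ.
Qed.


Lemma L2_cdot f g : L2 f -> L2 g -> cintegrable (fun x => cdot (f x) (g x)).
Proof.
move=> /L2P[a b] /L2P[c d]; have [e e'] := vmeas_cdot a c.
have h : rint (fun x => l2norm (f x) ^+ 2 + l2norm (g x) ^+ 2) by exact: rintD.
split; apply: rint_le h => // x; [exact: Re_cdot_le|exact: Im_cdot_le].
Qed.

Lemma innerDr f g h : L2 f -> L2 g -> L2 h ->
  inner f (fun x => g x + h x) = inner f g + inner f h.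
Proof.
move=> a b c; rewrite /inner -cintegralD; try exact: L2_cdot.
by congr cintegral; apply/funext => x; rewrite -/(cdot _ _) cdotDr.
Qed.
Lemma innerZr z f g : L2 f -> L2 g -> inner f (fun x => z *: g x) = z * inner f g.
Proof.
move=> a b; rewrite /inner -cintegralZ; try exact: L2_cdot.
by congr cintegral; apply/funext => x; rewrite -/(cdot _ _) cdotZr.
Qed.
Lemma innerC f g : L2 f -> L2 g -> inner g f = (inner f g)^*.
Proof.
move=> a b; rewrite /inner -cintegralJ; try exact: L2_cdot.
by congr cintegral; apply/funext => x; rewrite -/(cdot _ _) cdotC.
Qed.
Lemma inner_aeeq f f' g g' : L2 f -> L2 f' -> L2 g -> L2 g' ->
  aeeq f f' -> aeeq g g' -> inner f g = inner f' g'.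
Proof.
move=> a a' b b' h h'; apply: cintegral_ae.
- by apply: vmeas_cdot; exact: L2_vmeas.
- by apply: vmeas_cdot; exact: L2_vmeas.
- by apply: filterS2 h h' => x h h' t; rewrite h ?h'.
Qed.
Lemma inner_self f : inner f f = (\int[mu]_x (l2norm (f x) ^+ 2))%:C%C.
Proof.
apply: complex_ext => /=.
  by apply: eq_Rintegral => x _; rewrite l2norm_sqr.
under eq_Rintegral do rewrite Im_cdotuu.
by rewrite Rintegral_cst ?mul0r.
Qed.
End L2Space.

(** * The space of classes of square-integrable functions *)

Section Class.
Context (R : realType) (n N : nat).
Local Notation mu := (@lebesgue_Rn R n).

(** A class is the set of its representatives, so that almost everywhere equality becomes Leibniz
    equality and a module structure can be put on the type. *)
Definition L2class : Type := {A : set (vfun R n N) |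
  exists2 f, L2 f & A = [set g | L2 g /\ aeeq f g]}.

HB.instance Definition _ := gen_eqMixin L2class.
HB.instance Definition _ := gen_choiceMixin L2class.
End Class.

Section ClassTheory.
Context {R : realType} {n N : nat}.
Local Notation mu := (@lebesgue_Rn R n).
Local Notation H := (L2class R n N).

Definition rep (a : H) : vfun R n N := projT1 (cid2 (projT2 a)).

(** The default 0 makes [cls] a total function. *)
Definition L2fun (f : vfun R n N) : vfun R n N := if pselect (L2 f) then f else fun=> 0.

Lemma L2fun_L2 f : L2 (L2fun f).
Proof. by rewrite /L2fun; case: pselect => // nL; exact: L2_0. Qed.

(* Locked, like the operations below, to keep unification from looking inside. *)
Definition cls : vfun R n N -> H := locked (fun f =>
  exist _ [set g | L2 g /\ aeeq (L2fun f) g] (ex_intro2 _ _ _ (L2fun_L2 f) erefl)).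

Lemma L2_rep a : L2 (rep a). Proof. by rewrite /rep; case: cid2. Qed.
Lemma rep_vmeas a : vmeas (rep a). Proof. exact/L2_vmeas/L2_rep. Qed.

Lemma rep_cls f : L2 f -> aeeq (rep (cls f)) f.
Proof.
move=> fL; rewrite /rep /cls -lock; case: cid2 => g gL /= h.
have : [set h | L2 h /\ aeeq g h] f.
  by rewrite -h /L2fun; case: pselect => // nL; split=> //; exact: aeeq_refl.
by case.
Qed.
Lemma rep_clsE f : L2 f -> \forall x \ae mu, rep (cls f) x = f x.
Proof. by move=> /rep_cls/aeeqE. Qed.

Lemma rep_inj a b : aeeq (rep a) (rep b) -> a = b.
Proof.
have ext : projT1 a = projT1 b -> a = b.
  by case: a b => [A hA] [B hB] /= h; exact: eq_exist.
rewrite /rep; case: cid2 => f fL ha; case: cid2 => g gL hb fg.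
apply: ext; rewrite ha hb.
apply/seteqP; split=> h [hL e]; split=> //; last exact: aeeq_trans e.
by apply: aeeq_trans e; exact: aeeq_sym.
Qed.

Lemma clsK a : cls (rep a) = a.
Proof. exact/rep_inj/rep_cls/L2_rep. Qed.

Lemma cls_eq f g : L2 f -> L2 g -> (\forall x \ae mu, f x = g x) -> cls f = cls g.
Proof.
move=> fL gL fg; apply: rep_inj; apply: (aeeq_trans (rep_cls fL)).
by apply: aeeq_trans (aeeq_sym (rep_cls gL)); exact: aeeqI.
Qed.
Lemma cls_inj f g : L2 f -> L2 g -> cls f = cls g -> aeeq f g.
Proof.
move=> fL gL h; apply: aeeq_trans (aeeq_sym (rep_cls fL)) _.
by rewrite h; exact: rep_cls.
Qed.

Opaque rep cls.

Definition addc : H -> H -> H := locked (fun a b => cls (fun x => rep a x + rep b x)).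
Definition scalec : R[i] -> H -> H := locked (fun z a => cls (fun x => z *: rep a x)).
Definition oppc a : H := scalec (-1) a.
Definition zeroc : H := cls (fun=> 0).

Let L2a a b := L2_D (L2_rep a) (L2_rep b).
Let L2z z a := L2_Z z (L2_rep a).

Lemma rep_addc a b : \forall x \ae mu, rep (addc a b) x = rep a x + rep b x.
Proof. by rewrite /addc -lock; exact: rep_clsE. Qed.
Lemma rep_scalec z a : \forall x \ae mu, rep (scalec z a) x = z *: rep a x.
Proof. by rewrite /scalec -lock; exact: rep_clsE. Qed.
Lemma rep_zeroc : \forall x \ae mu, rep zeroc x = 0.
Proof. exact/rep_clsE/L2_0. Qed.

Let repI a b : (\forall x \ae mu, rep a x = rep b x) -> a = b.
Proof. by move=> /aeeqI/rep_inj. Qed.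

Fact addcA : associative addc.
Proof.
move=> a b c; apply: repI.
aeuse (rep_addc a (addc b c)), (rep_addc b c), (rep_addc (addc a b) c), (rep_addc a b).
by move=> x -> -> -> ->; rewrite addrA.
Qed.
Fact addcC : commutative addc.
Proof.
move=> a b; apply: repI; aeuse (rep_addc a b), (rep_addc b a).
by move=> x -> ->; rewrite addrC.
Qed.
Fact add0c : left_id zeroc addc.
Proof.
move=> a; apply: repI; aeuse (rep_addc zeroc a), rep_zeroc.
by move=> x -> ->; rewrite add0r.
Qed.
Fact addNc : left_inverse zeroc oppc addc.
Proof.
move=> a; apply: repI.
aeuse (rep_addc (oppc a) a), rep_zeroc, (rep_scalec (-1) a).
by move=> x -> ->; rewrite -/(oppc a) => ->; rewrite scaleN1r addNr.
Qed.
HB.instance Definition _ := GRing.isZmodule.Build H addcA addcC add0c addNc.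

Lemma repD a b : \forall x \ae mu, rep (a + b) x = rep a x + rep b x.
Proof. exact: rep_addc. Qed.

Fact scalecA (z w : R[i]) a : scalec z (scalec w a) = scalec (z * w) a.
Proof.
apply: repI; aeuse (rep_scalec z (scalec w a)), (rep_scalec w a), (rep_scalec (z * w) a).
by move=> x -> -> ->; rewrite scalerA.
Qed.
Fact scale1c : left_id 1 scalec.
Proof. by move=> a; apply: repI; aeuse (rep_scalec 1 a) => x ->; rewrite scale1r. Qed.
Fact scalecDr : right_distributive scalec +%R.
Proof.
move=> z a b; apply: repI; aeuse (rep_scalec z (a + b)), (repD a b), (repD (scalec z a) (scalec z b)), (rep_scalec z a), (rep_scalec z b).
by move=> x -> -> -> -> ->; rewrite scalerDr.
Qed.
Fact scalecDl a : {morph scalec^~ a : z w / z + w}.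
Proof.
move=> z w; apply: repI; aeuse (rep_scalec (z + w) a), (repD (scalec z a) (scalec w a)), (rep_scalec z a), (rep_scalec w a).
by move=> x -> -> -> ->; rewrite scalerDl.
Qed.
HB.instance Definition _ := GRing.Zmodule_isLmodule.Build R[i] H
  scalecA scale1c scalecDr scalecDl.

Implicit Types a b c : H.

Lemma repZ z a : \forall x \ae mu, rep (z *: a) x = z *: rep a x.
Proof. exact: rep_scalec. Qed.
Lemma rep0 : \forall x \ae mu, rep (0 : H) x = 0.
Proof. exact: rep_zeroc. Qed.
Lemma repN a : \forall x \ae mu, rep (- a) x = - rep a x.
Proof. by rewrite -scaleN1r; aeuse (repZ (-1) a) => x ->; rewrite scaleN1r. Qed.
Lemma repB a b : \forall x \ae mu, rep (a - b) x = rep a x - rep b x.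
Proof. by aeuse (repD a (- b)), (repN b) => x -> ->. Qed.
Lemma rep_ext a b : (\forall x \ae mu, rep a x = rep b x) -> a = b.
Proof. exact: repI. Qed.
Lemma clsD f g : L2 f -> L2 g -> cls (fun x => f x + g x) = cls f + cls g.
Proof.
move=> fL gL; apply: rep_ext; aeuse (repD (cls f) (cls g)), (rep_clsE fL), (rep_clsE gL), (rep_clsE (L2_D fL gL)).
by move=> x -> -> -> ->.
Qed.
Lemma clsZ z f : L2 f -> cls (fun x => z *: f x) = z *: cls f.
Proof.
move=> fL; apply: rep_ext; aeuse (repZ z (cls f)), (rep_clsE fL), (rep_clsE (L2_Z z fL)).
by move=> x -> -> ->.
Qed.

Definition ip : H -> H -> R[i] := locked (fun a b => inner (rep a) (rep b)).
Definition rip a b : R := complex.Re (ip a b).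

Lemma ip_cls f g : L2 f -> L2 g -> ip (cls f) (cls g) = inner f g.
Proof.
by move=> fL gL; rewrite /ip -lock; apply: inner_aeeq; rewrite ?L2_rep//; try exact: L2_rep; exact: rep_cls.
Qed.
Lemma ipC a b : ip b a = (ip a b)^*.
Proof. by rewrite /ip -lock; apply: innerC; exact: L2_rep. Qed.
Lemma ipDr a b c : ip a (b + c) = ip a b + ip a c.
Proof.
rewrite /ip -lock -innerDr; try exact: L2_rep.
by apply: inner_aeeq; rewrite ?L2_rep//; try exact: L2_rep; [exact: aeeq_refl|exact/aeeqI/repD].
Qed.
Lemma ipZr z a b : ip a (z *: b) = z * ip a b.
Proof.
rewrite /ip -lock -innerZr; try exact: L2_rep.
by apply: inner_aeeq; rewrite ?L2_rep//; try exact: L2_rep; [exact: aeeq_refl|exact/aeeqI/repZ].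
Qed.
Lemma ipDl a b c : ip (a + b) c = ip a c + ip b c.
Proof. by rewrite [LHS](ipC c (a + b)) ipDr rmorphD /= (ipC c a) (ipC c b). Qed.
Lemma ipZl z a b : ip (z *: a) b = z^* * ip a b.
Proof. by rewrite [LHS](ipC b (z *: a)) ipZr rmorphM /= (ipC b a). Qed.
Lemma ipNr a b : ip a (- b) = - ip a b.
Proof. by rewrite -scaleN1r ipZr mulN1r. Qed.
Lemma ipNl a b : ip (- a) b = - ip a b.
Proof. by rewrite [LHS](ipC b (- a)) ipNr rmorphN /= (ipC b a). Qed.

Lemma rip_self a : rip a a = \int[mu]_x (l2norm (rep a x) ^+ 2).
Proof. by rewrite /rip /ip -lock inner_self. Qed.
Lemma rint_rep a : rint (fun x => l2norm (rep a x) ^+ 2).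
Proof. by have /L2P[] := L2_rep a. Qed.
Opaque ip.

Lemma Im_ip a b : complex.Im (ip a b) = rip ('i%C *: a) b.
Proof. by rewrite /rip ipZl cReM cReJ cImJ /= mul0r sub0r mulN1r opprK. Qed.
Lemma ip_ext a b c d : rip a b = rip c d -> rip ('i%C *: a) b = rip ('i%C *: c) d -> ip a b = ip c d.
Proof. by move=> h1 h2; exact: (complex_ext h1 (etrans (Im_ip a b) (etrans h2 (esym (Im_ip c d))))). Qed.

Lemma rip_self_eq0 a : rip a a = 0 -> a = 0.
Proof.
move=> h; apply: rep_ext; have := rint_rep a => ri.
have h0 : (\int[mu]_x (l2norm (rep a x) ^+ 2)%:E = 0)%E.
  rewrite -[LHS]fineK; first by rewrite -/(Rintegral _ _ _) -rip_self h.
  exact: integrable_fin_num.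
have /ae_eq_integral_abs : measurable_fun setT (fun x => (l2norm (rep a x) ^+ 2)%:E).
  by apply/measurable_EFinP; apply: meas_l2norm_sqr; exact: rep_vmeas.
move=> /(_ mu measurableT) [h1 _].
have h2 : (\int[mu]_x `|(l2norm (rep a x) ^+ 2)%:E| = 0)%E.
  by rewrite -[RHS]h0; apply: eq_integral => x _; rewrite /= ger0_norm ?sqr_ge0.
have h3 := h1 h2; aeuse h3, (@rep0) => x h4 ->.
have [/eqP] := h4 I; rewrite sqrf_eq0 => /eqP; exact: l2norm_eq0.
Qed.
End ClassTheory.
#[global] Opaque rep cls ip addc oppc zeroc scalec.

(** * Completeness of the space of classes *)

Section Completeness.
Context {R : realType} {n N : nat}.
Local Notation mu := (@lebesgue_Rn R n).
Local Notation X := (Rn R n).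
Local Notation H := (L2class R n N).

Lemma l2norm_sqr_sum (u : 'cV[R[i]]_N) :
  l2norm u ^+ 2 = \sum_i (complex.Re (u i 0) ^+ 2 + complex.Im (u i 0) ^+ 2).
Proof.
rewrite l2norm_sqr cdotE Re_sum; apply: eq_bigr => i _.
by rewrite cReM cReJ cImJ mulNr opprK -!expr2.
Qed.
Lemma entry_le_l2norm (u : 'cV[R[i]]_N) i :
  complex.Re (u i 0) ^+ 2 + complex.Im (u i 0) ^+ 2 <= l2norm u ^+ 2.
Proof.
rewrite l2norm_sqr_sum (bigD1 i)//= lerDl sumr_ge0// => j _.
by rewrite addr_ge0 ?sqr_ge0.
Qed.

(** Iterating |a + b|^2 <= 2 |a|^2 + 2 |b|^2 costs a factor 2 per step, which the weights 2^i
    absorb. For increments of squared norm 4^-i the weighted sum still has a finite integral. *)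
Lemma telescope_sqr_le (u : nat -> 'cV[R[i]]_N) k m :
  l2norm (u (m + k)%N - u m) ^+ 2 <=
  2 * 2^-1 ^+ m * \sum_(m <= i < m + k) 2 ^+ i * l2norm (u i.+1 - u i) ^+ 2.
Proof.
elim: k m => [|k IH] m.
  by rewrite addn0 subrr l2norm0 expr0n/= big_geq// mulr0.
rewrite -addSnnS -[u (m.+1 + k)%N - u m](subrKA (u m.+1)).
apply: (le_trans (l2norm_sqrD _ _)).
rewrite (big_ltn (F := fun i => 2 ^+ i * l2norm (u i.+1 - u i) ^+ 2)) ?addSn ?ltnS ?leq_addr//.
have := IH m.+1; rewrite addSn.
set S := \sum_(_ <= i < _) _; set a := l2norm (u (m + k).+1 - _) ^+ 2; set b := l2norm _ ^+ 2.
have -> : 2 * 2^-1 ^+ m * (2 ^+ m * b + S) = 2 * b + 2 * 2^-1 ^+ m * S.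
  by rewrite exprVn; field; rewrite expf_neq0.
by rewrite exprS; lra.
Qed.

(** Riesz-Fischer: the weighted sum T of the squared increments is integrable, so it is finite
    almost everywhere, and where it is finite the representatives converge pointwise at a rate
    controlled by T. The limit g is put to 0 elsewhere. *)
Lemma L2class_complete (u : nat -> H) :
  (forall i, hnorm (@rip R n N) (u i.+1 - u i) <= 2^-1 ^+ i) ->
  exists l, hnorm (@rip R n N) (u k - l) @[k --> \oo] --> (0 : R).
Proof.
move=> hu.
pose d i x := l2norm (rep (u i.+1) x - rep (u i) x) ^+ 2.
have md i : measurable_fun setT (d i).
  apply: (@meas_l2norm_sqr _ _ _ (fun x => rep (u i.+1) x - rep (u i) x)).
  have -> : (fun x => rep (u i.+1) x - rep (u i) x) = (fun x => rep (u i.+1) x + (-1) *: rep (u i) x).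
    by apply/funext => x; rewrite scaleN1r.
  by apply: vmeasD; [|apply: vmeasZ; [exact: cmeas_cst|]]; exact: rep_vmeas.
have d0 i x : 0 <= d i x by exact: sqr_ge0.
have hd i : (\int[mu]_x (d i x)%:E <= (4^-1 ^+ i)%:E)%E.
  have dae : (fun x => (d i x)%:E) = (fun x => (l2norm (rep (u i.+1 - u i) x) ^+ 2)%:E) %[ae mu].
    by aeuse (repB (u i.+1) (u i)) => x e t; rewrite /d e.
  have -> : (\int[mu]_x (d i x)%:E = \int[mu]_x (l2norm (rep (u i.+1 - u i) x) ^+ 2)%:E)%E.
    apply: ae_eq_integral => //; first exact/measurable_EFinP.
    by apply/measurable_EFinP; apply: meas_l2norm_sqr; exact: rep_vmeas.
  have := rint_rep (u i.+1 - u i) => ri.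
  rewrite -[X in (X <= _)%E]fineK; last exact: integrable_fin_num.
  rewrite lee_fin -/(Rintegral _ _ _) -rip_self.
  have r0 : 0 <= rip (u i.+1 - u i) (u i.+1 - u i).
    by rewrite rip_self; apply: Rintegral_ge0 => x _; exact: sqr_ge0.
  rewrite -(sqr_sqrtr r0) -/(hnorm _ _).
  have -> : (4^-1 : R) ^+ i = (2^-1 ^+ i) ^+ 2.
    by rewrite -exprM mulnC exprM expr2 -invfM -natrM.
  by apply: lerXn2r; rewrite ?nnegrE ?sqrtr_ge0 ?exprn_ge0 ?invr_ge0.
pose w i x := 2 ^+ i * d i x.
have w0 i x : 0 <= w i x by rewrite /w; apply: mulr_ge0 => //; exact: exprn_ge0.
have mw i : measurable_fun setT (w i) by apply: measurable_funM.
pose T x := (\sum_(0 <= i <oo) (w i x)%:E)%E.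
have T0 x : (0 <= T x)%E by apply: nneseries_ge0 => i _ _; rewrite lee_fin.
have mT : measurable_fun setT T.
  apply: (ge0_emeasurable_sum (h := fun i x => (w i x)%:E) (P := xpredT)) => [k x _ _|k _].
    by rewrite lee_fin.
  exact/measurable_EFinP.
have iT : (\int[mu]_x T x < +oo)%E.
  rewrite integral_nneseries//; last 2 first.
    by move=> i; apply/measurable_EFinP; exact: mw.
    by move=> i x _; rewrite lee_fin.
  apply: (@le_lt_trans _ _ 2%:E); last exact: ltry.
  apply: lime_le; first by apply: is_cvg_nneseries => i _ _; apply: integral_ge0 => x _; rewrite lee_fin.
  apply: nearW => k; rewrite big_mkord.
  apply: (@le_trans _ _ (\sum_(i < k) (2^-1 ^+ i)%:E)%E).
    apply: lee_sum => i _; rewrite /w.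
    under eq_integral do rewrite EFinM.
    rewrite ge0_integralZl_EFin ?exprn_ge0//; last 2 first.
      by move=> x _; rewrite lee_fin.
      by apply/measurable_EFinP; exact: md.
    apply: (@le_trans _ _ ((2 ^+ i)%:E * (4^-1 ^+ i)%:E)%E).
      by apply: lee_wpmul2l => //; rewrite lee_fin exprn_ge0.
    rewrite -EFinM lee_fin -exprMn.
    by have -> : 2 * 4^-1 = 2^-1 :> R by field.
  rewrite sumEFin lee_fin.
  have : \sum_(i < k) 2^-1 ^+ i = 2 - 2 * 2^-1 ^+ k :> R.
    elim: (k) => [|j IH]; first by rewrite big_ord0 expr0; lra.
    by rewrite big_ord_recr /= IH exprS; lra.
  have : 0 <= (2^-1 : R) ^+ k by rewrite exprn_ge0 ?invr_ge0.
  lra.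
have intT : mu.-integrable setT T.
  apply/integrableP; split=> //.
  by under eq_integral do rewrite gee0_abs//.
pose E := [set x | (T x < +oo)%E].
have mE : measurable E by have := emeasurable_fun_infty_o measurableT mT +oo%E; rewrite setTI.
have aeE : \forall x \ae mu, E x.
  have h := integrable_ae measurableT intT.
  by aeuse h => x /(_ I); rewrite ge0_fin_numE.
pose t x := fine (T x).
have t0 x : 0 <= t x by exact: fine_ge0.
have mt : measurable_fun setT t.
  by apply: measurableT_comp => //; exact: fine_measurable.
have it : rint t.
  apply: le_integrable intT => //; first exact/measurable_EFinP.
  move=> x _ /=; rewrite ger0_norm// gee0_abs// /t.
  by case: (T x) (T0 x) => //= *; rewrite leey.
have tE x k m : E x -> \sum_(m <= i < m + k) w i x <= t x.
  move=> Ex; have fx : T x \is a fin_num by rewrite ge0_fin_numE.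
  apply: (@le_trans _ _ (\sum_(0 <= i < m + k) w i x)).
    by rewrite [leRHS](big_cat_nat _ (leq_addr k m))//= lerDr sumr_ge0.
  rewrite -lee_fin fineK// -sumEFin.
  by apply: (nneseries_lim_ge (u_ := fun i => (w i x)%:E) (P := xpredT)) => i _ _; rewrite lee_fin.
have key x m k : E x -> l2norm (rep (u (m + k)%N) x - rep (u m) x) ^+ 2 <= (2 * t x) * 2^-1 ^+ m.
  move=> Ex; apply: (le_trans (telescope_sqr_le (fun i => rep (u i) x) k m)).
  rewrite [leRHS]mulrAC ler_wpM2l ?mulr_ge0 ?exprn_ge0 ?invr_ge0//.
  exact: tE.
pose rr i m x := complex.Re (rep (u m) x i 0).
pose ri i m x := complex.Im (rep (u m) x i 0).
have crr i x : E x -> exists l, rr i m x @[m --> \oo] --> l /\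
    forall m, (l - rr i m x) ^+ 2 <= (2 * t x) * 2^-1 ^+ m.
  move=> Ex; apply: fast_cauchy => m k; apply: le_trans (key x m k Ex).
  apply: le_trans (entry_le_l2norm _ i); rewrite !mxE cReD cReN lerDl sqr_ge0//.
have cri i x : E x -> exists l, ri i m x @[m --> \oo] --> l /\
    forall m, (l - ri i m x) ^+ 2 <= (2 * t x) * 2^-1 ^+ m.
  move=> Ex; apply: fast_cauchy => m k; apply: le_trans (key x m k Ex).
  apply: le_trans (entry_le_l2norm _ i); rewrite !mxE cImD cImN lerDr sqr_ge0//.
(* The limit is chosen point by point, with value 0 off E; it is measurable as the everywhere limit
   of the sequence cut to E. *)
have lims (r : 'I_N -> nat -> X -> R) : (forall i m, measurable_fun setT (r i m)) ->
   (forall i x, E x -> exists l, r i m x @[m --> \oo] --> l /\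
    forall m, (l - r i m x) ^+ 2 <= (2 * t x) * 2^-1 ^+ m) ->
   exists L : 'I_N -> X -> R, (forall i, measurable_fun setT (L i)) /\
     (forall i x, E x -> forall m, (L i x - r i m x) ^+ 2 <= (2 * t x) * 2^-1 ^+ m).
  move=> mr hr.
  have [L HL] : {L : 'I_N * X -> R & forall p, (E p.2 -> r p.1 m p.2 @[m --> \oo] --> L p /\
     forall m, (L p - r p.1 m p.2) ^+ 2 <= (2 * t p.2) * 2^-1 ^+ m) /\ (~ E p.2 -> L p = 0)}.
    apply: (@choice _ _ (fun p l => (E p.2 -> r p.1 m p.2 @[m --> \oo] --> l /\
     forall m, (l - r p.1 m p.2) ^+ 2 <= (2 * t p.2) * 2^-1 ^+ m) /\ (~ E p.2 -> l = 0))) => -[i x].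
    have [Ex|nEx] := pselect (E x); last by exists 0; split.
    by have [l hl] := hr i x Ex; exists l; split.
  exists (fun i x => L (i, x)); split; last by move=> i x Ex m; have [/(_ Ex)[]] := HL (i, x).
  move=> i; apply: (measurable_fun_cvg (h := fun m x => r i m x * \1_E x)) => [m|x _].
    by apply: measurable_funM => //; exact: measurable_indic.
  have [Ex|nEx] := pselect (E x).
    rewrite indicE mem_set//; under eq_fun do rewrite mulr1.
    by have [/(_ Ex)[]] := HL (i, x).
  rewrite indicE memNset//; under eq_fun do rewrite mulr0.
  by have [_ ->//] := HL (i, x); exact: cvg_cst.
have [Lr [mLr HLr]] := lims rr (fun i m => (rep_vmeas (u m) i).1) crr.
have [Li [mLi HLi]] := lims ri (fun i m => (rep_vmeas (u m) i).2) cri.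
pose g : vfun R n N := fun x => (\1_E x)%:C%C *: \col_i (Complex (Lr i x) (Li i x)).
have mg : vmeas g.
  apply: vmeasZ; first by apply: cmeas_real; exact: measurable_indic.
  by move=> i; under [X in cmeasurable X]eq_fun do rewrite mxE; split; [exact: mLr|exact: mLi].
have gE x m : E x -> l2norm (g x - rep (u m) x) ^+ 2 <= (N%:R * 4 * 2^-1 ^+ m) * t x.
  move=> Ex; rewrite l2norm_sqr_sum.
  apply: (@le_trans _ _ (\sum_(i < N) (4 * 2^-1 ^+ m * t x))).
    apply: ler_sum => i _; rewrite !mxE indicE mem_set// rmorph1 mul1r cReD cImD cReN cImN /=.
    have := HLr i x Ex m; have := HLi i x Ex m; rewrite /rr /ri; lra.
  by rewrite sumr_const card_ord -[leLHS]mulr_natl !mulrA.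
have gL : L2 g.
  apply/L2P; split=> //.
  apply: (@rint_le _ _ _ (fun x => (2 * (N%:R * 4 * 2^-1 ^+ 0)) * t x + 2 * l2norm (rep (u 0%N) x) ^+ 2)).
  - exact: meas_l2norm_sqr.
  - move=> x; rewrite ger0_norm ?sqr_ge0//.
    have [Ex|nEx] := pselect (E x).
      rewrite -{1}[g x](subrK (rep (u 0%N) x)); apply: (le_trans (l2norm_sqrD _ _)).
      by rewrite lerD2r -mulrA ler_wpM2l//; exact: gE.
    rewrite /g indicE memNset// rmorph0 scale0r l2norm0 expr0n /=.
    have := mulr_ge0 (ler0n R N) (t0 x); have := sqr_ge0 (l2norm (rep (u 0%N) x)).
    by rewrite expr0; lra.
  - by apply: rintD; apply: rintZ => //; exact: rint_rep.
exists (cls g); apply: sqr_cvg0.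
pose K := N%:R * 4 * \int[mu]_x t x.
have bd m : hnorm (@rip R n N) (u m - cls g) ^+ 2 <= K * 2^-1 ^+ m.
  have r0 : 0 <= rip (u m - cls g) (u m - cls g).
    by rewrite rip_self; apply: Rintegral_ge0 => x _; exact: sqr_ge0.
  rewrite sqr_sqrtr// rip_self.
  pose q x := \1_E x * l2norm (g x - rep (u m) x) ^+ 2.
  have mq : measurable_fun setT q.
    apply: measurable_funM; first exact: measurable_indic.
    apply: (@meas_l2norm_sqr _ _ _ (fun x => g x - rep (u m) x)).
    have -> : (fun x => g x - rep (u m) x) = (fun x => g x + (-1) *: rep (u m) x).
      by apply/funext => x; rewrite scaleN1r.
    by apply: vmeasD => //; apply: vmeasZ; [exact: cmeas_cst|exact: rep_vmeas].
  have qle x : q x <= (N%:R * 4 * 2^-1 ^+ m) * t x.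
    rewrite /q indicE; have [Ex|nEx] := pselect (E x).
      by rewrite mem_set// mul1r; exact: gE.
    by rewrite memNset// mul0r !mulr_ge0// ?exprn_ge0 ?invr_ge0.
  have it' : rint (fun x => (N%:R * 4 * 2^-1 ^+ m) * t x) by exact: rintZ.
  rewrite (@Rintegral_ae _ _ _ q)//; last 2 first.
  - by apply: meas_l2norm_sqr; exact: rep_vmeas.
  - aeuse (repB (u m) (cls g)), (rep_clsE gL), aeE => x e1 e2 Ex _.
    rewrite /q indicE mem_set// mul1r e1 e2 -opprB.
    by rewrite !l2norm_sqr cdotNl cdotNr opprK.
  - apply: (@le_trans _ _ (\int[mu]_x ((N%:R * 4 * 2^-1 ^+ m) * t x))).
      apply: le_Rintegral => //.
      apply: (rint_le mq _ it') => x; rewrite ger0_norm//.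
      by rewrite /q mulr_ge0 ?sqr_ge0// indicE.
    by rewrite RintegralZl// /K mulrAC.
apply: (@squeeze_cvgr _ _ _ _ (fun=> 0) (fun m => K * 2^-1 ^+ m)).
- by apply: nearW => m; rewrite sqr_ge0 bd.
- exact: cvg_cst.
- exact: cvg_geom_half.
Qed.

Lemma L2class_hilbert : is_hilbert (@rip R n N).
Proof.
split.
- by move=> u v; rewrite /rip ipC cReJ.
- by move=> u v w; rewrite /rip ipDl cReD.
- by move=> r u w; rewrite /rip ipZl cReM cReJ cImJ /= oppr0 mul0r subr0.
- by move=> u; rewrite rip_self; apply: Rintegral_ge0 => x _; exact: sqr_ge0.
- exact: rip_self_eq0.
- exact: L2class_complete.
Qed.
End Completeness.

(** * Dominated convergence for real integrals *)

Section DominatedReal.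
Context {R : realType} d (T : measurableType d) (mu : {measure set T -> \bar R}).

Lemma integrable_le (f g : T -> R) : measurable_fun setT f -> (forall x, `|f x| <= g x) ->
  mu.-integrable setT (EFin \o g) -> mu.-integrable setT (EFin \o f).
Proof.
move=> mf h; apply: le_integrable => //; first exact/measurable_EFinP.
by move=> x _ /=; rewrite lee_fin (le_trans (h x))// ler_norm.
Qed.

Lemma Rdominated_cvg (f_ : nat -> T -> R) (f g : T -> R) :
  (forall k, measurable_fun setT (f_ k)) ->
  (forall x, f_ k x @[k --> \oo] --> f x) ->
  mu.-integrable setT (EFin \o g) ->
  (forall k x, `|f_ k x| <= g x) ->
  mu.-integrable setT (EFin \o f) /\
  \int[mu]_x f_ k x @[k --> \oo] --> \int[mu]_x f x.
Proof.
move=> mf cf ig fg.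
have mff : measurable_fun setT f by exact: (measurable_fun_cvg mf (fun x _ => cf x)).
have [|||||h1 _ h2] := @dominated_convergence _ _ _ mu setT measurableT
  (fun k x => (f_ k x)%:E) (EFin \o f) (EFin \o g).
- by move=> k; exact/measurable_EFinP.
- exact/measurable_EFinP.
- by apply: aeW => x _; apply: cvg_EFin; [exact: nearW|exact: cf].
- exact: ig.
- by apply: aeW => x k _; rewrite /= lee_fin.
split=> //; apply: fine_cvg; rewrite fineK; last exact: integrable_fin_num.
exact: h2.
Qed.
End DominatedReal.

(** * Derivatives of functions of one real variable *)

Section Derivation1.
Context {R : realType}.
Implicit Types (f g : R -> R) (x a b : R).

Lemma derive1_congr f x a b : is_derive x 1 f a -> a = b -> is_derive x 1 f b.
Proof. by move=> h <-. Qed.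
Lemma is_derive1M f g x a b : is_derive x 1 f a -> is_derive x 1 g b ->
  is_derive x 1 (fun y => f y * g y) (a * g x + f x * b).
Proof.
move=> hf hg; apply: derive1_congr (is_deriveM hf hg) _.
by rewrite /GRing.scale /= addrC mulrC.
Qed.
Lemma is_derive1D f g x a b : is_derive x 1 f a -> is_derive x 1 g b ->
  is_derive x 1 (fun y => f y + g y) (a + b).
Proof. by move=> hf hg; exact: is_deriveD. Qed.
Lemma is_derive1Z f x (c a : R) : is_derive x 1 f a -> is_derive x 1 (fun y => c * f y) (c * a).
Proof. by move=> hf; exact: is_deriveZ. Qed.
Lemma is_derive_pow (j : nat) (x : R) : is_derive x 1 (fun y => y ^+ j) (j%:R * x ^+ j.-1).
Proof.
have -> : (fun y : R => y ^+ j) = (id : R -> R) ^+ j by apply/funext => y; rewrite exprfctE.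
by apply: derive1_congr (is_deriveX j (is_derive_id x 1)) _; rewrite /GRing.scale /= mulr1.
Qed.
Lemma is_derive_continuous f g : (forall x, is_derive x 1 f (g x)) -> continuous f.
Proof.
by move=> h x; apply/differentiable_continuous/derivable1_diffP; case: (h x).
Qed.
Lemma measurable_continuous f : continuous f -> measurable_fun [set: measurableTypeR R] f.
Proof. by move=> cf; exact: continuous_measurable_fun. Qed.
End Derivation1.

(** * Gaussians on the line and their moments *)

Section Gaussian1.
Context {R : realType}.
Local Notation lam := (@lebesgue_measure R).
Implicit Types s t x : R.

(** The parameter is the inverse variance: products add it, and the Fourier transform inverts it. *)
Definition gauss s x := expR (- (s / 2 * x ^+ 2)).

Lemma gauss_gt0 s x : 0 < gauss s x. Proof. exact: expR_gt0. Qed.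
Lemma gauss_ge0 s x : 0 <= gauss s x. Proof. exact: expR_ge0. Qed.
Lemma gaussM s t x : gauss s x * gauss t x = gauss (s + t) x.
Proof. by rewrite /gauss -expRD; congr expR; field. Qed.
Lemma gauss_le1 s x : 0 <= s -> gauss s x <= 1.
Proof.
move=> s0; rewrite /gauss -expR0 ler_expR oppr_le0.
by rewrite mulr_ge0 ?sqr_ge0 ?divr_ge0.
Qed.
Lemma is_derive_gauss s x : is_derive x 1 (gauss s) (- s * x * gauss s x).
Proof.
have h : is_derive x 1 (fun y => - (s / 2) * y ^+ 2) (- s * x).
  by apply: derive1_congr (is_derive1Z _ (is_derive_pow 2 x)) _; rewrite /= expr1; field.
have -> : gauss s = expR \o (fun y => - (s / 2) * y ^+ 2).
  by apply/funext => y; rewrite /gauss /= mulNr.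
by apply: derive1_congr (is_derive1_comp (is_derive_expR _) h) _; rewrite /= mulrC.
Qed.
Lemma continuous_gauss s : continuous (gauss s).
Proof.
exact: is_derive_continuous (is_derive_gauss s).
Qed.
Lemma measurable_gauss s : measurable_fun [set: measurableTypeR R] (gauss s).
Proof. by apply: measurable_continuous; exact: continuous_gauss. Qed.

Lemma norm_gauss_bounded t x : 0 < t -> `|x| * gauss t x <= 1 + 2 / t.
Proof.
move=> t0; have h1 : `|x| <= 1 + x ^+ 2.
  rewrite -real_normK ?num_real//; have := sqr_ge0 (`|x| - 1).
  have := normr_ge0 x; set a := `|x|; nra.
have h2 : x ^+ 2 * gauss t x <= 2 / t.
  have := expR_ge1Dx (t / 2 * x ^+ 2).
  have -> : gauss t x = (expR (t / 2 * x ^+ 2))^-1 by rewrite /gauss expRN.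
  move=> h; rewrite ler_pdivrMr ?expR_gt0//.
  have e : x ^+ 2 = 2 / t * (t / 2 * x ^+ 2) by field; rewrite gt_eqF.
  by rewrite {1}e ler_wpM2l ?divr_ge0 ?(ltW t0)//; lra.
have := gauss_le1 x (ltW t0); have := gauss_ge0 t x.
have := ler_wpM2r (gauss_ge0 t x) h1; rewrite mulrDl mul1r; lra.
Qed.

(** Each factor x is paid for with half of the remaining exponent. *)
Lemma pow_gauss_bounded (j : nat) t : 0 < t ->
  exists2 c : R, 0 <= c & forall x, `|x ^+ j| * gauss t x <= c.
Proof.
elim: j t => [|j IH] t t0.
  by exists 1 => // x; rewrite expr0 normr1 mul1r gauss_le1// ltW.
have t2 : 0 < t / 2 by rewrite divr_gt0.
have [c c0 hc] := IH _ t2; exists (c * (1 + 2 / (t / 2))).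
  by rewrite mulr_ge0 ?addr_ge0 ?divr_ge0// ltW.
move=> x; rewrite exprSr normrM.
have -> : gauss t x = gauss (t / 2) x * gauss (t / 2) x by rewrite gaussM -splitr.
rewrite mulrACA ler_pM ?mulr_ge0 ?gauss_ge0//; exact: norm_gauss_bounded.
Qed.

Lemma integrable_gauss s : 0 < s -> lam.-integrable setT (EFin \o gauss s).
Proof.
move=> s0; pose sg := (Num.sqrt s)^-1.
have sg0 : sg != 0 by rewrite invr_neq0// gt_eqF// sqrtr_gt0.
have ss : sg ^+ 2 = s^-1 by rewrite exprVn sqr_sqrtr// ltW.
have h := integrable_normal_pdf 0 sg.
have pk : normal_peak sg != 0.
  by rewrite invr_neq0// gt_eqF// sqrtr_gt0 pmulrn_lgt0// mulr_gt0 ?pi_gt0// ss invr_gt0.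
apply: eq_integrable (integrableZl measurableT (normal_peak sg)^-1 h) => // x _ /=.
rewrite -EFinM; congr EFin.
rewrite normal_pdfE// mulKf// /normal_fun /gauss subr0 ss.
by congr expR; rewrite -mulNr; field; rewrite gt_eqF.
Qed.

Lemma integral_gauss s : 0 < s -> \int[lam]_x gauss s x = Num.sqrt (2 * pi) * (Num.sqrt s)^-1.
Proof.
move=> s0; pose sg := (Num.sqrt s)^-1.
have sg0 : sg != 0 by rewrite invr_neq0// gt_eqF// sqrtr_gt0.
have ss : sg ^+ 2 = s^-1 by rewrite exprVn sqr_sqrtr// ltW.
have pk : normal_peak sg = (Num.sqrt (2 * pi) * (Num.sqrt s)^-1)^-1.
  rewrite /normal_peak ss; congr (_ ^-1).
  rewrite -sqrtrV ?ltW// -sqrtrM ?mulr_ge0 ?pi_ge0//; congr Num.sqrt.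
  by rewrite -mulr_natl; ring.
have nz : Num.sqrt (2 * pi) * (Num.sqrt s)^-1 != 0.
  by rewrite mulf_neq0// gt_eqF// sqrtr_gt0 mulr_gt0 ?pi_gt0.
have h := integral_normal_pdf 0 sg.
have e x : gauss s x = (Num.sqrt (2 * pi) * (Num.sqrt s)^-1) * normal_pdf 0 sg x.
  rewrite normal_pdfE// pk mulVKf// /normal_fun /gauss subr0 ss.
  by congr expR; rewrite -mulNr; field; rewrite gt_eqF.
under eq_Rintegral do rewrite e.
rewrite RintegralZl//; last exact: integrable_normal_pdf.
by rewrite /Rintegral h /= mulr1.
Qed.

Lemma integrable_pow_gauss (j : nat) s : 0 < s ->
  lam.-integrable setT (EFin \o (fun x => x ^+ j * gauss s x)).
Proof.
move=> s0; have s2 : 0 < s / 2 by rewrite divr_gt0.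
have [c c0 hc] := pow_gauss_bounded j s2.
apply: (@integrable_le _ _ _ lam _ (fun x => c * gauss (s / 2) x)).
- by apply: measurable_funM; [exact: exprn_measurable|exact: measurable_gauss].
- move=> x; have -> : gauss s x = gauss (s / 2) x * gauss (s / 2) x by rewrite gaussM -splitr.
  rewrite mulrA normrM [`|gauss _ _|]ger0_norm ?gauss_ge0//.
  rewrite ler_wpM2r ?gauss_ge0// normrM [`|gauss _ _|]ger0_norm ?gauss_ge0//.
- by apply: eq_integrable (integrableZl measurableT c (integrable_gauss s2)).
Qed.

(** The fundamental theorem on the intervals [-(k+1), k+1], followed by dominated convergence with
    |f| as the bound. *)
Lemma integral_derive_eq0 (F f : R -> R) :
  (forall x, is_derive x 1 F (f x)) -> continuous f ->
  lam.-integrable setT (EFin \o f) ->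
  F k.+1%:R @[k --> \oo] --> (0 : R) -> F (- k.+1%:R) @[k --> \oo] --> (0 : R) ->
  \int[lam]_x f x = 0.
Proof.
move=> dF cf intf F0 F1.
pose I (k : nat) : set R := `[- k.+1%:R, k.+1%:R]%classic.
pose f_ k x := f x * \1_(I k) x.
have mf : measurable_fun [set: measurableTypeR R] f by exact: measurable_continuous.
have mI k : measurable (I k : set (measurableTypeR R)) by exact: measurable_itv.
have [||||_ cv] := @Rdominated_cvg R _ _ lam f_ f (fun x => `|f x|).
- by move=> k; apply: measurable_funM => //; exact: measurable_indic (mI k).
- move=> x; apply: cvg_near_cst; exists (Num.bound `|x|) => // k /= hk.
  suff Ik : I k x by rewrite /f_ indicE mem_set ?mulr1.
  rewrite /I /= in_itv /= -ler_norml.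
  have := archi_boundP (normr_ge0 x) => /ltW/le_trans; apply.
  by rewrite ler_nat (leq_trans hk).
- exact: (integrable_abse intf).
- move=> k x; rewrite /f_ normrM ler_piMr// indicE.
  by case: (_ \in _); rewrite ?normr1 ?normr0.
have e k : \int[lam]_x f_ k x = F k.+1%:R - F (- k.+1%:R).
  have ab : - k.+1%:R < k.+1%:R :> R by rewrite gtrN ?ltr0Sn.
  have cF : continuous F.
    exact: is_derive_continuous dF.
  rewrite /f_ /Rintegral.
  have -> : (\int[lam]_x (f x * \1_(I k) x)%:E = \int[lam]_(x in I k) (f x)%:E)%E.
    rewrite [RHS]integral_mkcond; apply: eq_integral => x _.
    by rewrite patchE indicE; case: ifP => _; rewrite ?mulr1 ?mulr0.
  rewrite (continuous_FTC2 ab (F := F))//.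
  - exact: continuous_subspaceT.
  - split; [by move=> x _; case: (dF x)|apply: cvg_at_right_filter; exact: cF|apply: cvg_at_left_filter; exact: cF].
  - by move=> x _; rewrite derive1E; case: (dF x).
have cv2 : \int[lam]_x f_ k x @[k --> \oo] --> (0 : R).
  under eq_fun do rewrite e.
  by rewrite -(subr0 (0 : R)); apply: cvgB.
exact: (cvg_unique _ cv cv2).
Qed.

Lemma is_derive_pow_gauss (j : nat) s x :
  is_derive x 1 (fun y => y ^+ j.+1 * gauss s y)
    (j.+1%:R * (x ^+ j * gauss s x) - s * (x ^+ j.+2 * gauss s x)).
Proof.
apply: derive1_congr (is_derive1M (is_derive_pow j.+1 x) (is_derive_gauss s x)) _.
by rewrite /= !exprS; ring.
Qed.

Lemma pow_gauss_cvg0 (j : nat) s (u : nat -> R) : 0 < s -> (forall k, `|u k| = k.+1%:R) ->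
  u k ^+ j * gauss s (u k) @[k --> \oo] --> (0 : R).
Proof.
move=> s0 hu; have [c c0 hc] := pow_gauss_bounded j.+1 s0.
have b k : `|u k ^+ j * gauss s (u k)| <= c / k.+1%:R.
  rewrite ler_pdivlMr ?ltr0Sn// -(hu k) normrM [`|gauss _ _|]ger0_norm ?gauss_ge0//.
  by rewrite mulrAC -normrM -exprSr.
have cv : c / k.+1%:R @[k --> \oo] --> (0 : R).
  by rewrite -[X in _ --> X](mulr0 c); apply: cvgMr; exact: cvg_harmonic.
apply: (@squeeze_cvgr _ _ _ _ (fun k => - (c / k.+1%:R)) (fun k => c / k.+1%:R)) => //.
- by apply: nearW => k; rewrite -ler_norml.
- by rewrite -oppr0; exact: cvgN.
Qed.

Lemma continuous_pow_gauss (j : nat) s : continuous (fun x => x ^+ j * gauss s x).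
Proof.
move=> x; apply: cvgM; last exact: continuous_gauss.
exact: exprn_continuous.
Qed.

(** The derivative of x^(j+1) exp(-s x^2 / 2) has integral zero. *)
Lemma moment_rec (j : nat) s : 0 < s ->
  s * \int[lam]_x (x ^+ j.+2 * gauss s x) = j.+1%:R * \int[lam]_x (x ^+ j * gauss s x).
Proof.
move=> s0; have i1 := integrable_pow_gauss j s0; have i2 := integrable_pow_gauss j.+2 s0.
apply/esym/eqP; rewrite -subr_eq0; apply/eqP.
have i1' : lam.-integrable setT (EFin \o (fun x => j.+1%:R * (x ^+ j * gauss s x))).
  by apply: eq_integrable (integrableZl measurableT j.+1%:R i1).
have i2' : lam.-integrable setT (EFin \o (fun x => s * (x ^+ j.+2 * gauss s x))).
  by apply: eq_integrable (integrableZl measurableT s i2).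
rewrite -!RintegralZl// -RintegralB//.
apply: (@integral_derive_eq0 (fun y => y ^+ j.+1 * gauss s y)).
- by move=> x; exact: is_derive_pow_gauss.
- move=> x; apply: cvgB; (apply: cvgM; [exact: cvg_cst|exact: continuous_pow_gauss]).
- by apply: eq_integrable (integrableB measurableT i1' i2').
- by apply: pow_gauss_cvg0 => // k; rewrite ger0_norm.
- by apply: pow_gauss_cvg0 => // k; rewrite normrN ger0_norm.
Qed.

Lemma moment1 s : 0 < s -> \int[lam]_x (x ^+ 1 * gauss s x) = 0.
Proof.
move=> s0; have i1 := integrable_pow_gauss 1 s0.
have : \int[lam]_x (- s * (x ^+ 1 * gauss s x)) = 0.
  apply: (@integral_derive_eq0 (gauss s)).
  - by move=> x; rewrite expr1 mulrA; exact: is_derive_gauss.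
  - by move=> x; apply: cvgM; [exact: cvg_cst|exact: continuous_pow_gauss].
  - by apply: eq_integrable (integrableZl measurableT (- s) i1).
  - have := @pow_gauss_cvg0 0 s (fun k => k.+1%:R) s0.
    by under eq_fun do rewrite expr0 mul1r; apply => k; rewrite ger0_norm.
  - have := @pow_gauss_cvg0 0 s (fun k => - k.+1%:R) s0.
    by under eq_fun do rewrite expr0 mul1r; apply => k; rewrite normrN ger0_norm.
rewrite RintegralZl// => /eqP; rewrite mulf_eq0 oppr_eq0 gt_eqF//= => /eqP.
by [].
Qed.
End Gaussian1.

(** * Fubini on R^(n+1) and integrals of products over the coordinates *)

Section TupleFubini.
Context {R : realType}.
Local Notation lam := (@lebesgue_measure R).
Local Notation mu n := (@lebesgue_Rn R n).

Section step.
Context {n : nat}.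
Implicit Types f : Rn R n.+1 -> \bar R.

Lemma Rn_ge0_integral f : measurable_fun setT f -> (forall x, (0 <= f x)%E) ->
  (\int[mu n.+1]_x f x = \int[lam \x mu n]_p f (Rn_cons p))%E.
Proof.
move=> mf f0.
exact: (ge0_integral_pushforward (@measurable_Rn_cons R n) (lam \x mu n)%E measurableT mf
  (fun x _ => f0 x)).
Qed.

Lemma Rn_integrableP f : measurable_fun setT f ->
  (mu n.+1).-integrable setT f <-> (lam \x mu n)%E.-integrable setT (f \o @Rn_cons R n).
Proof.
move=> mf; have e := @Rn_ge0_integral (fun x => `|f x|%E) _ (fun x => abse_ge0 _).
have mc : measurable_fun setT (f \o @Rn_cons R n).
  by apply: measurableT_comp mf _; exact: measurable_Rn_cons.
split=> /integrableP[_ h]; apply/integrableP; split=> //.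
  by move: h; rewrite e//; exact: measurableT_comp.
by rewrite e//; exact: measurableT_comp.
Qed.

Lemma Rn_integral f : (mu n.+1).-integrable setT f ->
  (\int[mu n.+1]_x f x = \int[lam \x mu n]_p f (Rn_cons p))%E.
Proof.
move=> intf; have mf := measurable_int _ intf.
have := (Rn_integrableP mf).1 intf => h.
exact: (integral_pushforward (@measurable_Rn_cons R n) (mu := (lam \x mu n)%E) (D := setT) mf h measurableT).
Qed.

Lemma Rn_fubini_out f : (mu n.+1).-integrable setT f ->
  (\int[mu n.+1]_x f x = \int[lam]_t \int[mu n]_y f (Rn_cons (t, y)))%E.
Proof.
move=> intf; rewrite Rn_integral//; have mf := measurable_int _ intf.
by rewrite -(integral12_prod_meas1 ((Rn_integrableP mf).1 intf)).
Qed.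

Lemma Rn_fubini_in f : (mu n.+1).-integrable setT f ->
  (\int[mu n.+1]_x f x = \int[mu n]_y \int[lam]_t f (Rn_cons (t, y)))%E.
Proof.
move=> intf; rewrite Rn_integral//; have mf := measurable_int _ intf.
by rewrite -(integral21_prod_meas1 ((Rn_integrableP mf).1 intf)).
Qed.

Lemma Rn_integrable_iter f : measurable_fun setT f ->
  (mu n.+1).-integrable setT f <->
  (\int[lam]_t \int[mu n]_y `|f (Rn_cons (t, y))| < +oo)%E.
Proof.
move=> mf; rewrite Rn_integrableP//.
have mc : measurable_fun setT (f \o @Rn_cons R n).
  by apply: measurableT_comp mf _; exact: measurable_Rn_cons.
exact: (integrable12ltyP lam (mu n) mc).
Qed.
End step.

Lemma tnth_Rn_cons0 n (t : R) (y : Rn R n) : tnth (Rn_cons (t, y)) ord0 = t.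
Proof. by rewrite /Rn_cons tnth0. Qed.
Lemma tnth_Rn_consS n (t : R) (y : Rn R n) i : tnth (Rn_cons (t, y)) (lift ord0 i) = tnth y i.
Proof. by rewrite /Rn_cons tnthS. Qed.

Lemma measurable_tnth_comp n (k : 'I_n) (c : measurableTypeR R -> R) :
  measurable_fun setT c -> measurable_fun [set: Rn R n] (fun x => c (tnth x k)).
Proof. by move=> mc; apply: measurableT_comp mc _; exact: measurable_tnth. Qed.

Definition coord_prod n (c : 'I_n -> R -> R) (x : Rn R n) : R := \prod_k c k (tnth x k).

Lemma measurable_coord_prod n (c : 'I_n -> measurableTypeR R -> R) :
  (forall k, measurable_fun setT (c k)) -> measurable_fun setT (coord_prod c).
Proof.
move=> mc; rewrite /coord_prod; elim: (index_enum _) => [|i r IH].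
  by under eq_fun do rewrite big_nil; exact: measurable_cst.
under eq_fun do rewrite big_cons; apply: measurable_funM => //.
exact: measurable_tnth_comp.
Qed.

Lemma coord_prod_cons n (c : 'I_n.+1 -> R -> R) t (y : Rn R n) :
  coord_prod c (Rn_cons (t, y)) = c ord0 t * coord_prod (fun k => c (lift ord0 k)) y.
Proof.
rewrite /coord_prod big_ord_recl tnth_Rn_cons0; congr (_ * _).
by apply: eq_bigr => k _; rewrite tnth_Rn_consS.
Qed.

Lemma coord_prod_integral n (c : 'I_n -> measurableTypeR R -> R) :
  (forall k, lam.-integrable setT (EFin \o c k)) ->
  rint (coord_prod c) /\
  \int[mu n]_x coord_prod c x = \prod_k \int[lam]_t c k t.
Proof.
elim: n c => [|n IH] c ic.
  have e x : coord_prod c x = 1 by rewrite /coord_prod big_ord0.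
  have i1 : rint (fun _ : Rn R 0 => 1 : R).
    apply/integrableP; split; first exact: measurable_cst.
    by rewrite integral_dirac//= diracT mul1e normr1 ltry.
  split; first by apply: eq_integrable i1 => // x _; rewrite /= e.
  under eq_Rintegral do rewrite e.
  by rewrite big_ord0 /Rintegral integral_dirac// diracT mul1e.
have mc k : measurable_fun setT (c k) by have /integrableP[/measurable_EFinP] := ic k.
have [i1 e1] := IH (fun k => c (lift ord0 k)) (fun k => ic _).
have i0 := ic ord0.
set c' := fun k => c (lift ord0 k) in i1 e1.
have mcp : measurable_fun setT (coord_prod c) by exact: measurable_coord_prod.
have ip : rint (coord_prod c).
  apply/Rn_integrable_iter; first exact/measurable_EFinP.
  have e t : (\int[mu n]_y `|(EFin \o coord_prod c) (Rn_cons (t, y))| =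
      (`|c ord0 t|)%:E * \int[mu n]_y `|(coord_prod c' y)%:E|)%E.
    rewrite -ge0_integralZl_EFin//.
      by apply: eq_integral => y _; rewrite /= coord_prod_cons normrM EFinM.
    by apply: measurableT_comp => //; apply/measurable_EFinP; exact: rint_meas.
  under eq_integral do rewrite e.
  have f1 : (\int[mu n]_y `|(coord_prod c' y)%:E|)%E \is a fin_num.
    by rewrite ge0_fin_numE ?integral_ge0//; have /integrableP[] := i1.
  rewrite -(fineK f1); under eq_integral do rewrite muleC.
  rewrite ge0_integralZl_EFin ?fine_ge0 ?integral_ge0//; last first.
    by apply/measurable_EFinP; exact: measurableT_comp.
  apply: lte_mul_pinfty => //; first by rewrite lee_fin fine_ge0 ?integral_ge0.
  by have /integrableP[] := i0.
split=> //; rewrite big_ord_recl -e1 {1}/Rintegral Rn_fubini_out//.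
have e t : (\int[mu n]_y (coord_prod c (Rn_cons (t, y)))%:E =
    (c ord0 t * \int[mu n]_y coord_prod c' y)%:E)%E.
  under eq_integral do rewrite coord_prod_cons EFinM.
  rewrite integralZl// EFinM; congr (_ * _)%E.
  by rewrite /Rintegral fineK//; exact: integrable_fin_num.
under eq_integral do rewrite e.
by rewrite -/(Rintegral _ _ _) RintegralZr.
Qed.
End TupleFubini.

(** * Polynomial approximation of the sign function *)

Section CubicIteration.
Context {R : realType}.
Implicit Types y : R.

(** The Newton-Schulz iteration for the sign: an odd polynomial with fixed points 0, 1 and -1 that
    maps [-1, 1] to itself. *)
Definition cubic y := y * (3 - y ^+ 2) / 2.

(** The iterates have no constant term, so evaluated at a polynomial Gaussian they are finite sums
    of polynomial Gaussians. *)
Lemma iter_cubic_poly k : exists q : {poly R}, forall y, iter k cubic y = q.[y] * y.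
Proof.
elim: k => [|k [q hq]]; first by exists 1 => y; rewrite hornerC mul1r.
exists (q * (3%:P - q ^+ 2 * 'X^2) * (2^-1)%:P) => y.
by rewrite iterS hq /cubic !hornerM hornerD hornerN hornerM horner_exp hornerXn !hornerC; field.
Qed.

Lemma iter_cubicN k y : iter k cubic (- y) = - iter k cubic y.
Proof. by elim: k => [//|k IH] /=; rewrite IH /cubic sqrrN !mulNr. Qed.

Lemma iter_cubic_pos k y : 0 < y <= 1 -> 0 < iter k cubic y <= 1 /\ iter k cubic y <= iter k.+1 cubic y.
Proof.
move=> y01.
have h z : 0 < z <= 1 -> 0 < cubic z <= 1 /\ z <= cubic z.
  move=> /andP[z0 z1]; rewrite /cubic; have : 0 < z * (3 - z ^+ 2) by nra.
  have : z * (3 - z ^+ 2) <= 2.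
    have := mulr_ge0 (sqr_ge0 (z - 1)) (_ : 0 <= z + 2); nra.
  have : 2 * z <= z * (3 - z ^+ 2) by nra.
  by move=> *; split; [apply/andP; split|]; lra.
elim: k => [|k [IH _]] /=; first by split=> //; have [] := h y y01.
by have [h1 _] := h _ IH; split=> //; have [] := h _ h1.
Qed.

(** On (0, 1] the iterates increase and stay below 1; their limit l is positive and satisfies l (1 -
    l^2) = 0. Oddness gives the negative side. *)
Lemma iter_cubic_cvg y : `|y| <= 1 -> iter k cubic y @[k --> \oo] --> Num.sg y.
Proof.
have pos z : 0 < z <= 1 -> iter k cubic z @[k --> \oo] --> (1 : R).
  move=> z01; pose u k := iter k cubic z.
  have nd : nondecreasing_seq u.
    by apply/nondecreasing_seqP => k; have [] := iter_cubic_pos k z01.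
  have cv : cvgn u.
    apply: nondecreasing_is_cvgn => //; exists 1 => _ [k _ <-].
    by have [/andP[]] := iter_cubic_pos k z01.
  set l := limn u in cv *.
  have l1 : l <= 1.
    by apply: limr_le => //; apply: nearW => k; have [/andP[]] := iter_cubic_pos k z01.
  have l0 : z <= l.
    by apply: limr_ge => //; apply: nearW => k; rewrite -[z]/(u 0%N); exact: nd.
  have cvu : u k @[k --> \oo] --> l by exact: cv.
  have cv2 : u k.+1 @[k --> \oo] --> cubic l.
    apply: cvgM; last exact: cvg_cst.
    by apply: cvgM => //; apply: cvgB; [exact: cvg_cst|exact: (cvgM cvu cvu)].
  have : cubic l = l.
    have h : u k.+1 @[k --> \oo] --> l by move: cvu; rewrite -(cvg_shiftS u).
    exact: (cvg_unique _ cv2 h).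
  rewrite /cubic => e; have lp : 0 < l by case/andP: z01 => z0 _; exact: lt_le_trans l0.
  have e2 : l * (1 - l ^+ 2) = 0 by lra.
  suff l1' : l = 1 by move: cvu; rewrite l1'.
  have : l ^+ 2 = 1 by move/eqP: e2; rewrite mulf_eq0 gt_eqF//= subr_eq0 => /eqP.
  by move/eqP; rewrite sqrf_eq1 => /orP[/eqP ->//|/eqP]; lra.
move=> y1; have [y0|y0|->] := ltgtP y 0.
- rewrite ltr0_sg// -[y]opprK; under eq_fun do rewrite iter_cubicN.
  by apply: cvgN; apply: pos; move: y1; rewrite ltr0_norm// oppr_gt0 y0.
- by rewrite gtr0_sg//; apply: pos; rewrite y0; move: y1; rewrite gtr0_norm.
- rewrite sgr0; have -> : (fun k => iter k cubic 0) = (fun=> 0 : R); last exact: cvg_cst.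
  by apply/funext => k; elim: k => //= k ->; rewrite /cubic !mul0r.
Qed.

Lemma iter_cubic_norm k y : `|y| <= 1 -> `|iter k cubic y| <= 1.
Proof.
move=> y1; have [y0|y0|->] := ltgtP y 0.
- rewrite -[y]opprK iter_cubicN normrN.
  have /(iter_cubic_pos k)[/andP[h h' _]] : 0 < - y <= 1.
    by move: y1; rewrite ltr0_norm// oppr_gt0 y0.
  by rewrite gtr0_norm.
- have /(iter_cubic_pos k)[/andP[h h' _]] : 0 < y <= 1.
    by rewrite y0; move: y1; rewrite gtr0_norm.
  by rewrite gtr0_norm.
- suff -> : iter k cubic 0 = 0 by rewrite normr0.
  by elim: k => //= k ->; rewrite /cubic !mul0r.
Qed.
End CubicIteration.

(** * From orthogonality to Gaussians in one variable to orthogonality to Borel sets *)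

Section GaussVanishing.
Context {R : realType} d (T : measurableType d) (mu : {measure set T -> \bar R}).
Variables (g : T -> R) (p : T -> measurableTypeR R).
Hypothesis ig : mu.-integrable setT (EFin \o g).
Hypothesis mp : measurable_fun setT p.
Implicit Types b : measurableTypeR R -> R.

Definition bmeas b := measurable_fun setT b /\ exists C, forall x, `|b x| <= C.
Definition vanishes b := \int[mu]_x (g x * b (p x)) = 0.

Lemma bmeas_integrable b : bmeas b -> mu.-integrable setT (EFin \o (fun x => g x * b (p x))).
Proof.
move=> [mb [C hC]]; have /integrableP[/measurable_EFinP mg _] := ig.
apply: (@integrable_le _ _ _ mu _ (fun x => C * `|g x|)).
- by apply: measurable_funM => //; exact: measurableT_comp.
- by move=> x; rewrite normrM mulrC ler_wpM2r.
- by apply: eq_integrable (integrableZl measurableT C (integrable_abse ig)).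
Qed.

Lemma bmeasD b1 b2 : bmeas b1 -> bmeas b2 -> bmeas (fun x => b1 x + b2 x).
Proof.
move=> [m1 [C1 h1]] [m2 [C2 h2]]; split; first exact: measurable_funD.
by exists (C1 + C2) => x; rewrite (le_trans (ler_normD _ _))// lerD.
Qed.
Lemma bmeasZ c b : bmeas b -> bmeas (fun x => c * b x).
Proof.
move=> [m1 [C1 h1]]; split; first by apply: measurable_funM.
by exists (`|c| * C1) => x; rewrite normrM ler_wpM2l.
Qed.
Lemma vanishesD b1 b2 : bmeas b1 -> bmeas b2 -> vanishes b1 -> vanishes b2 ->
  vanishes (fun x => b1 x + b2 x).
Proof.
move=> m1 m2 v1 v2; rewrite /vanishes.
under eq_Rintegral do rewrite mulrDr.
by rewrite RintegralD ?v1 ?v2 ?addr0//; exact: bmeas_integrable.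
Qed.
Lemma vanishesZ c b : bmeas b -> vanishes b -> vanishes (fun x => c * b x).
Proof.
move=> m1 v1; rewrite /vanishes.
under eq_Rintegral do rewrite mulrCA.
by rewrite RintegralZl ?v1 ?mulr0//; exact: bmeas_integrable.
Qed.

Lemma vanishes_lim (b_ : nat -> measurableTypeR R -> R) b C :
  (forall k, measurable_fun setT (b_ k)) -> (forall k x, `|b_ k x| <= C) ->
  (forall x, b_ k x @[k --> \oo] --> b x) -> (forall k, vanishes (b_ k)) ->
  bmeas b /\ vanishes b.
Proof.
move=> mb bC cb vb; have /integrableP[/measurable_EFinP mg _] := ig.
split.
  split; first exact: (measurable_fun_cvg mb (fun x _ => cb x)).
  exists C => x; have h : `|b_ k x| @[k --> \oo] --> `|b x| by apply: cvg_norm; exact: cb.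
  rewrite -(cvg_lim (@Rhausdorff _) h).
  by apply: limr_le; [apply/cvg_ex; eexists; exact: h|exact: nearW].
have [||||_ cv] := @Rdominated_cvg _ _ _ mu (fun k x => g x * b_ k (p x))
   (fun x => g x * b (p x)) (fun x => C * `|g x|).
- by move=> k; apply: measurable_funM => //; exact: measurableT_comp.
- by move=> x; apply: cvgM; [exact: cvg_cst|exact: cb].
- by apply: eq_integrable (integrableZl measurableT C (integrable_abse ig)).
- by move=> k x; rewrite normrM mulrC ler_wpM2r.
apply: (cvg_unique _ cv).
- exact: Rhausdorff.
- by rewrite /=; under eq_fun do rewrite vb; exact: cvg_cst.
Qed.

Hypothesis gauss_even : forall s, 0 < s -> vanishes (gauss s).
Hypothesis gauss_odd : forall s, 0 < s -> vanishes (fun x => x * gauss s x).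

Lemma measurable_pow_gauss j s : measurable_fun [set: measurableTypeR R] (fun x : R => x ^+ j * gauss s x).
Proof. by apply: measurable_continuous; exact: continuous_pow_gauss. Qed.

Lemma bmeas_pow_gauss j s : 0 < s -> bmeas (fun x : R => x ^+ j * gauss s x).
Proof.
move=> s0; split; first exact: measurable_pow_gauss.
have [c _ hc] := pow_gauss_bounded j s0; exists c => x.
by rewrite normrM [`|gauss _ _|]ger0_norm ?gauss_ge0.
Qed.

(* [x ^+ 2] is the derivative in [s] of [-2 gauss s x / gauss s x], so difference quotients in [s] raise the degree by two. *)
Lemma vanishes_pow_gauss j s : 0 < s -> vanishes (fun x : R => x ^+ j * gauss s x).
Proof.
have step i : (forall s, 0 < s -> vanishes (fun x : R => x ^+ i * gauss s x)) ->
  forall s, 0 < s -> vanishes (fun x : R => x ^+ i.+2 * gauss s x).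
  move=> hi {}s s0; pose h (k : nat) : R := k.+1%:R^-1.
  have h0 k : 0 < h k by rewrite invr_gt0.
  pose b_ k (x : R) := 2 / h k * (x ^+ i * gauss s x + -1 * (x ^+ i * gauss (s + h k) x)).
  have sh k : 0 < s + h k by rewrite addr_gt0.
  have [C C0 hC] := pow_gauss_bounded i.+2 s0.
  (* With u = h x^2 / 2 this encloses the difference quotient between x^2 / (1 + h x^2 / 2) and x^2;
     the upper side also dominates it uniformly in h. *)
  have u1 (u : R) : 0 <= u -> u / (1 + u) <= 1 - expR (- u) <= u.
    move=> u0; have h1 := expR_ge1Dx (- u); have h2 := expR_ge1Dx u.
    apply/andP; split; last by lra.
    rewrite expRN; have -> : u / (1 + u) = 1 - (1 + u)^-1 by field; lra.
    by rewrite lerD2l lerN2 lef_pV2 ?posrE ?expR_gt0//; lra.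
  have bE k x : b_ k x = x ^+ i * gauss s x * (2 / h k * (1 - expR (- (h k / 2 * x ^+ 2)))).
    by rewrite /b_ -gaussM -/(gauss (h k) x); ring.
  have bd k (x : R) : x ^+ 2 / (1 + h k / 2 * x ^+ 2) <= 2 / h k * (1 - expR (- (h k / 2 * x ^+ 2))) <= x ^+ 2.
    have u0 : 0 <= h k / 2 * x ^+ 2 by rewrite mulr_ge0 ?sqr_ge0// divr_ge0// ltW.
    have /andP[l1 l2] := u1 _ u0.
    have hp : 0 < 2 / h k by rewrite divr_gt0.
    have e : x ^+ 2 = 2 / h k * (h k / 2 * x ^+ 2) by field; rewrite gt_eqF.
    apply/andP; split; last by rewrite [leRHS]e ler_pM2l.
    have -> : x ^+ 2 / (1 + h k / 2 * x ^+ 2) = 2 / h k * (h k / 2 * x ^+ 2 / (1 + h k / 2 * x ^+ 2)).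
      by rewrite [X in _ = X]mulrA -e.
    by rewrite ler_pM2l.
  have bb k (x : R) : `|b_ k x| <= C.
    rewrite bE; apply: le_trans (hC x).
    have -> : `|x ^+ i.+2| = `|x ^+ i| * x ^+ 2.
      by rewrite -addn2 exprD normrM [`|x ^+ 2|]ger0_norm ?sqr_ge0.
    have /andP[l1 l2] := bd k x.
    have w0 : 0 <= 2 / h k * (1 - expR (- (h k / 2 * x ^+ 2))).
      apply: le_trans l1; rewrite divr_ge0 ?sqr_ge0// addr_ge0//.
      by rewrite mulr_ge0 ?sqr_ge0// divr_ge0// ltW.
    rewrite normrM [`|_ * gauss _ _|]normrM [`|gauss _ _|]ger0_norm ?gauss_ge0// (ger0_norm w0).
    by rewrite [leRHS]mulrAC ler_wpM2l// mulr_ge0 ?gauss_ge0.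
  have cc (x : R) : b_ k x @[k --> \oo] --> x ^+ i.+2 * gauss s x.
    under eq_fun do rewrite bE.
    rewrite -addn2 exprD mulrAC; apply: cvgM; first exact: cvg_cst.
    apply: (@squeeze_cvgr _ _ _ _ (fun k => x ^+ 2 / (1 + h k / 2 * x ^+ 2)) (fun=> x ^+ 2)).
    - by apply: nearW => k; exact: bd.
    - have hc : h k @[k --> \oo] --> (0 : R) by exact: cvg_harmonic.
      rewrite -[X in _ --> X]mulr1; apply: cvgM; first exact: cvg_cst.
      rewrite -[X in _ --> X]invr1; apply: cvgV; first exact: oner_neq0.
      rewrite -[X in _ --> X]addr0; apply: cvgD; first exact: cvg_cst.
      have z : 0 = 0 / 2 * x ^+ 2 :> R by rewrite !mul0r.
      by rewrite [X in _ --> X]z; apply: cvgMl; apply: cvgMl.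
    - exact: cvg_cst.
  have [||||_ //] := @vanishes_lim b_ (fun x : R => x ^+ i.+2 * gauss s x) C.
  - move=> k; apply: measurable_funM => //; apply: measurable_funD; first exact: measurable_pow_gauss.
    by apply: measurable_funM => //; exact: measurable_pow_gauss.
  - exact: bb.
  - exact: cc.
  - move=> k; apply: vanishesZ; first by apply: bmeasD; [|apply: bmeasZ]; exact: bmeas_pow_gauss.
    apply: vanishesD; [exact: bmeas_pow_gauss|by apply: bmeasZ; exact: bmeas_pow_gauss|exact: hi|].
    by apply: vanishesZ; [exact: bmeas_pow_gauss|exact: hi].
elim/ltn_ind: j s => -[|[|j]] IH s s0.
- have := gauss_even s0; rewrite /vanishes => <-.
  by apply: eq_Rintegral => x _; rewrite expr0 mul1r.
- have := gauss_odd s0; rewrite /vanishes => <-.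
  by apply: eq_Rintegral => x _; rewrite expr1.
- by apply: step => // s' s'0; exact: IH.
Qed.

Lemma vanishes_poly_gauss (P : {poly R}) j s : 0 < s ->
  bmeas (fun x : R => P.[x] * (x ^+ j * gauss s x)) /\
  vanishes (fun x : R => P.[x] * (x ^+ j * gauss s x)).
Proof.
move=> s0; elim/poly_ind: P j => [|P c IH] j.
  have -> : (fun x : R => (0 : {poly R}).[x] * (x ^+ j * gauss s x)) = (fun x => 0 * (x ^+ j * gauss s x)).
    by apply/funext => x; rewrite horner0.
  split; first by apply: bmeasZ; exact: bmeas_pow_gauss.
  by apply: vanishesZ; [exact: bmeas_pow_gauss|exact: vanishes_pow_gauss].
have -> : (fun x : R => (P * 'X + c%:P).[x] * (x ^+ j * gauss s x)) =
   (fun x => P.[x] * (x ^+ j.+1 * gauss s x) + c * (x ^+ j * gauss s x)).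
  by apply/funext => x; rewrite hornerMXaddC exprS; ring.
have [b1 v1] := IH j.+1; have b2 := bmeas_pow_gauss j s0.
split; first by apply: bmeasD => //; exact: bmeasZ.
apply: vanishesD => //; first exact: bmeasZ.
by apply: vanishesZ => //; exact: vanishes_pow_gauss.
Qed.

Lemma gauss_exp m s x : gauss s x ^+ m = gauss (m%:R * s) x :> R.
Proof.
by rewrite /gauss -expRM_natl; congr expR; rewrite -mulr_natl; ring.
Qed.

(** A polynomial Gaussian with the sign of x - a; the prefactor keeps its values in [-1, 1], where
    the cubic iteration converges. *)
Definition osc (a x : R) := (1 + `|a|)^-1 * (x - a) * gauss 1 x.

Lemma osc_norm a x : `|osc a x| <= 1.
Proof.
have a1 : 0 < 1 + `|a| by rewrite ltr_pwDl.
rewrite /osc !normrM normfV (gtr0_norm a1) [`|gauss _ _|]ger0_norm ?gauss_ge0//.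
rewrite -mulrA ler_pdivrMl// mulr1.
have h1 : `|x| * gauss 1 x <= 1.
  rewrite -(@ler_pXn2r _ 2)// ?nnegrE ?mulr_ge0 ?gauss_ge0// exprMn real_normK ?num_real//.
  rewrite expr1n gauss_exp mulr1 /gauss expRN ler_pdivrMr ?expR_gt0// mul1r.
  by have := expR_ge1Dx (2 / 2 * x ^+ 2); rewrite divff// mul1r; lra.
have := ler_wpM2r (gauss_ge0 1 x) (ler_normB x a).
have := ler_wpM2l (normr_ge0 a) (gauss_le1 x (@ler01 R)).
rewrite mulrDl; lra.
Qed.

(** At least one factor [osc] is kept, so every term carries a Gaussian of positive parameter. *)
Lemma vanishes_poly_osc (q : {poly R}) a m : 
  bmeas (fun x : R => q.[osc a x] * osc a x ^+ m.+1) /\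
  vanishes (fun x : R => q.[osc a x] * osc a x ^+ m.+1).
Proof.
have om i : bmeas (fun x : R => osc a x ^+ i.+1) /\ vanishes (fun x : R => osc a x ^+ i.+1).
  have -> : (fun x : R => osc a x ^+ i.+1) =
     (fun x => (((1 + `|a|)^-1)%:P * ('X - a%:P) ^+ i.+1 * ((1 + `|a|)^-1 ^+ i)%:P).[x] *
        (x ^+ 0 * gauss (i.+1%:R * 1) x)).
    apply/funext => x; rewrite /osc !exprMn gauss_exp !hornerM horner_exp hornerXsubC !hornerC expr0 mul1r.
    by rewrite [(1 + `|a|)^-1 ^+ i.+1]exprS; ring.
  by apply: vanishes_poly_gauss; rewrite mulr1.
elim/poly_ind: q m => [|q c IH] m.
  have [b1 v1] := om m.
  have -> : (fun x : R => (0 : {poly R}).[osc a x] * osc a x ^+ m.+1) = (fun x => 0 * osc a x ^+ m.+1).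
    by apply/funext => x; rewrite horner0.
  by split; [exact: bmeasZ|exact: vanishesZ].
have [b1 v1] := IH m.+1; have [b2 v2] := om m.
have -> : (fun x : R => (q * 'X + c%:P).[osc a x] * osc a x ^+ m.+1) =
   (fun x => q.[osc a x] * osc a x ^+ m.+2 + c * osc a x ^+ m.+1).
  by apply/funext => x; rewrite hornerMXaddC [osc a x ^+ m.+2]exprS; ring.
by split; [apply: bmeasD => //; exact: bmeasZ|apply: vanishesD => //; [exact: bmeasZ|exact: vanishesZ]].
Qed.

(** The cubic iterates of [osc a] converge to the sign of x - a and stay bounded by 1. *)
Lemma vanishes_sg a : bmeas (fun x : R => Num.sg (x - a)) /\ vanishes (fun x : R => Num.sg (x - a)).
Proof.
have h k : bmeas (fun x : R => iter k cubic (osc a x)) /\ vanishes (fun x : R => iter k cubic (osc a x)).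
  have [q hq] := @iter_cubic_poly R k.
  have -> : (fun x : R => iter k cubic (osc a x)) = (fun x => q.[osc a x] * osc a x ^+ 1).
    by apply/funext => x; rewrite hq expr1.
  exact: vanishes_poly_osc.
apply: (@vanishes_lim (fun k (x : R) => iter k cubic (osc a x)) _ 1).
- by move=> k; have [[]] := h k.
- by move=> k x; apply: iter_cubic_norm; exact: osc_norm.
- move=> x; have -> : Num.sg (x - a) = Num.sg (osc a x).
    have c0 : 0 < (1 + `|a|)^-1 by rewrite invr_gt0 ltr_pwDl.
    by rewrite /osc !sgrM (gtr0_sg c0) (gtr0_sg (gauss_gt0 1 x)) mul1r mulr1.
  by apply: iter_cubic_cvg; exact: osc_norm.
- by move=> k; have [_] := h k.
Qed.

Lemma vanishes_cst1 : bmeas (fun=> 1) /\ vanishes (fun=> 1).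
Proof.
apply: (@vanishes_lim (fun k (x : R) => Num.sg (x - (- k%:R))) _ 1).
- by move=> k; have [[]] := vanishes_sg (- k%:R).
- by move=> k x; rewrite normr_sg lern1 leq_b1.
- move=> x; apply: cvg_near_cst; exists (Num.bound `|x|) => // k /= hk.
  rewrite gtr0_sg// opprK; have := archi_boundP (normr_ge0 x).
  have : (Num.bound `|x|)%:R <= k%:R :> R by rewrite ler_nat.
  by have := ler_norm (- x); rewrite normrN; lra.
- by move=> k; have [_] := vanishes_sg (- k%:R).
Qed.

(** The step (sg(x - a') + 1) / 2 takes the value 1/2 at a'; letting a' = a - 1/(k+1) increase to a
    puts the endpoint a into the ray. *)
Lemma vanishes_indic_ray a : vanishes (\1_(`[a, +oo[%classic : set R)).
Proof.
pose b_ k (x : R) := 2^-1 * (Num.sg (x - (a - k.+1%:R^-1)) + 1).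
have hc : k.+1%:R^-1 @[k --> \oo] --> (0 : R) by exact: cvg_harmonic.
have cc (x : R) : b_ k x @[k --> \oo] --> (\1_(`[a, +oo[%classic : set R) x : R).
  rewrite indicE; have [ax|xa] := leP a x.
    rewrite mem_set/= ?in_itv/= ?ax//; apply: cvg_near_cst; apply: nearW => k.
    rewrite /b_ gtr0_sg ?mulVf//; rewrite subr_gt0; apply: lt_le_trans ax.
    by rewrite ltrBlDr ltrDl invr_gt0.
  rewrite memNset/= ?in_itv/= ?andbT; last by apply/negP; rewrite -ltNge.
  have ax : 0 < a - x by rewrite subr_gt0.
  have [N _ HN] := (cvgr0Pnorm_lt (fun k => k.+1%:R^-1 : R)).1 hc _ ax.
  apply: cvg_near_cst; exists N => // k /HN /=.
  rewrite ger0_norm ?invr_ge0// => h; rewrite /b_ ltr0_sg; last by rewrite subr_lt0 ltrBrDr addrC -ltrBrDr.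
  by rewrite addNr mulr0.
have [||||_ //] := @vanishes_lim b_ (\1_(`[a, +oo[%classic : set R)) 1.
- move=> k; apply: measurable_funM => //; apply: measurable_funD => //.
  by have [[]] := vanishes_sg (a - k.+1%:R^-1).
- move=> k x; rewrite /b_ normrM ger0_norm ?invr_ge0//.
  rewrite ler_pdivrMl// mulr1; apply: (le_trans (ler_normD _ _)).
  by rewrite normr1 lerD2r normr_sg lern1 leq_b1.
- exact: cc.
- have [b1 v1] := vanishes_cst1 => k; have [b2 v2] := vanishes_sg (a - k.+1%:R^-1).
  by apply: vanishesZ; [exact: bmeasD|exact: vanishesD].
Qed.

Lemma bmeas_indic (U : set (measurableTypeR R)) : measurable U -> bmeas (\1_U).
Proof.
move=> mU; split; first exact: measurable_indic.
by exists 1 => x; rewrite indicE; case: (_ \in _); rewrite ?normr1 ?normr0.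
Qed.

(** Closed rays are stable under intersection and generate the Borel sets, and the sets with
    vanishing integral form a Dynkin system. *)
Lemma vanishes_indic (U : set (measurableTypeR R)) : measurable U -> vanishes (\1_U).
Proof.
move=> mU; have [b1 v1] := vanishes_cst1.
apply: (@dynkin_induction _ (measurableTypeR R) (@RGenCInfty.G R) (fun U => vanishes (\1_U))).
- exact: RGenCInfty.measurableE.
- move=> _ _ [a ->] [b ->]; exists (Num.max a b); apply/seteqP; split=> x /=; rewrite !in_itv/= !andbT ge_max.
    by move=> [-> ->].
  by move=> /andP[].
- move: v1; rewrite /vanishes => <-; apply: eq_Rintegral => x _.
  by rewrite indicE in_setT.
- by move=> _ [a ->]; exact: vanishes_indic_ray.
- move=> S mS vS; have bS := bmeas_indic mS.
  have : vanishes (fun x => 1 + (-1) * \1_S x).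
    by apply: vanishesD => //; [exact: bmeasZ|exact: vanishesZ].
  rewrite /vanishes => <-; apply: eq_Rintegral => x _; congr (_ * _).
  by rewrite !indicE in_setC; case: (_ \in S); rewrite ?mulr1 ?mulr0 ?subrr ?addr0.
- move=> F mF tF vF; pose U_ k := \big[setU/set0]_(i < k) F i.
  have mU_ k : measurable (U_ k) by apply: bigsetU_measurable.
  have vU k : vanishes (\1_(U_ k)).
    elim: k => [|k IH].
      rewrite /vanishes; under eq_Rintegral do rewrite /U_ big_ord0 indic0 mulr0.
      by rewrite Rintegral_cst ?mul0r.
    have : vanishes (fun x => \1_(U_ k) x + \1_(F k) x).
      by apply: vanishesD; try exact: bmeas_indic; [exact: IH|exact: vF].
    rewrite /vanishes => <-; apply: eq_Rintegral => x _; congr (_ * _).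
    rewrite !indicE; have [Fk|nFk] := pselect (F k (p x)).
      have nU : ~ U_ k (p x).
        rewrite /U_ -bigcup_mkord => -[i /= ik Fi].
        by move/trivIsetP : tF => /(_ i k I I); rewrite neq_ltn ik => /(_ isT) e; have : (F i `&` F k) (p x) by []; rewrite e.
      rewrite (mem_set Fk) (memNset nU) mem_set ?add0r// /U_ big_ord_recr /=.
      by right.
    rewrite (memNset nFk) addr0 /U_ big_ord_recr /= -/(U_ k).
    by congr (_ %:R); congr nat_of_bool; rewrite in_setU (memNset nFk) orbF.
  have [|||//|_ //] := @vanishes_lim (fun k => \1_(U_ k)) (\1_(\bigcup_k F k)) 1.
  + by move=> k; exact: measurable_indic.
  + by move=> k x; rewrite indicE; case: (_ \in _); rewrite ?normr1 ?normr0.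
  + move=> x; have [[k _ Fx]|nF] := pselect ((\bigcup_k F k) x).
      rewrite indicE mem_set; last by exists k.
      apply: cvg_near_cst; exists k.+1 => // m /= km.
      by rewrite indicE mem_set// /U_ -bigcup_mkord; exists k.
    rewrite indicE memNset//; apply: cvg_near_cst; apply: nearW => m.
    by rewrite indicE memNset// /U_ -bigcup_mkord => -[i _ Fx]; apply: nF; exists i.
- by have := mU; rewrite RGenCInfty.measurableE.
Qed.
End GaussVanishing.

(** * Products of polynomial Gaussians over the coordinates *)

Section GaussProducts.
Context {R : realType} {n : nat}.
Local Notation lam := (@lebesgue_measure R).
Local Notation mu := (@lebesgue_Rn R n).
Local Notation X := (Rn R n).
Implicit Types (j : 'I_n -> nat) (s : 'I_n -> R) (x : X).

Definition gprod j s : X -> R := coord_prod (fun k t => t ^+ j k * gauss (s k) t).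

Lemma measurable_gprod j s : measurable_fun setT (gprod j s).
Proof. by apply: measurable_coord_prod => k; exact: measurable_pow_gauss. Qed.

Lemma gprodM j j' s s' x :
  gprod j s x * gprod j' s' x = gprod (fun k => j k + j' k)%N (fun k => s k + s' k) x.
Proof.
rewrite /gprod /coord_prod -big_split; apply: eq_bigr => k _ /=.
by rewrite exprD -gaussM mulrACA.
Qed.

Lemma gprod_integral j s : (forall k, 0 < s k) ->
  rint (gprod j s) /\
  \int[mu]_x gprod j s x = \prod_k \int[lam]_t (t ^+ j k * gauss (s k) t).
Proof.
move=> s0; apply: (coord_prod_integral (c := fun k t => t ^+ j k * gauss (s k) t)) => k.
exact: integrable_pow_gauss.
Qed.

Lemma gprod_gt0 s x : 0 < gprod (fun=> 0%N) s x.
Proof. by apply: prodr_gt0 => k _; rewrite expr0 mul1r gauss_gt0. Qed.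

(* The degrees only cost a loss of half of each rate. *)
Lemma gprod_bound j s : (forall k, 0 < s k) ->
  exists2 C : R, 0 <= C & forall x, `|gprod j s x| <= C * gprod (fun=> 0%N) (fun k => s k / 2) x.
Proof.
move=> s0; have [c Hc] : {c : 'I_n -> R & forall k, 0 <= c k /\
    forall t, `|t ^+ j k| * gauss (s k / 2) t <= c k}.
  apply: (@choice _ _ (fun k c => 0 <= c /\ forall t, `|t ^+ j k| * gauss (s k / 2) t <= c)) => k.
  by have [c c0 hc] := @pow_gauss_bounded R (j k) (s k / 2) (divr_gt0 (s0 k) (ltr0Sn _ _)); exists c.
exists (\prod_k c k) => [|x]; first by apply: prodr_ge0 => k _; case: (Hc k).
rewrite /gprod /coord_prod normr_prod -big_split; apply: ler_prod => k _ /=.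
rewrite normr_ge0 expr0 mul1r normrM [`|gauss _ _|]ger0_norm ?gauss_ge0//=.
have -> : gauss (s k) (tnth x k) = gauss (s k / 2) (tnth x k) * gauss (s k / 2) (tnth x k).
  by rewrite gaussM -splitr.
by rewrite mulrA ler_wpM2r ?gauss_ge0//; case: (Hc k).
Qed.

Lemma gprod_le1 s x : (forall k, 0 <= s k) -> gprod (fun=> 0%N) s x <= 1.
Proof.
move=> s0; rewrite /gprod /coord_prod; apply: prodr_ile1 => k _.
by rewrite expr0 mul1r gauss_ge0 gauss_le1.
Qed.
End GaussProducts.

(** * Polynomial Gaussians of degree at most one in each coordinate separate functions on R^n *)

Section Totality.
Context {R : realType} {n : nat}.
Local Notation mu := (@lebesgue_Rn R n).
Local Notation X := (Rn R n).
Local Notation MR := (measurableTypeR R).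

Definition box (U : 'I_n -> set MR) : set X := [set x | forall k, U k (tnth x k)].

Lemma measurable_box U : (forall k, measurable (U k)) -> measurable (box U).
Proof.
move=> mU; have -> : box U = \bigcap_(k in [set: 'I_n]) ((@tnth n MR)^~ k @^-1` U k).
  by apply/seteqP; split=> x h k; [move=> _|]; exact: h.
apply: fin_bigcap_measurable => // k _.
by rewrite -[X in measurable X]setTI; apply: measurable_tnth.
Qed.

Lemma measurable_boxE :
  @measurable _ X = <<s [set box U | U in [set U | forall k, measurable (U k)]] >>.
Proof.
apply/seteqP; split; last first.
  apply: smallest_sub; first exact: sigma_algebra_measurable.
  by move=> _ [U mU <-]; exact: measurable_box.
apply: smallest_sub; first exact: smallest_sigma_algebra.
set S := <<s _ >>; apply: (big_ind (fun B => B `<=` S)) => [//|B C hB hC A [/hB|/hC]//|k _ A [B mB <-]].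
apply: sub_gen_smallest; exists (fun i => if i == k then B else setT).
  by move=> i; case: ifP.
rewrite setTI; apply/seteqP; split=> x h.
  by have := h k; rewrite eqxx.
by move=> i; case: eqP => [->|].
Qed.

Lemma box_indic (U : 'I_n -> set MR) x : \1_(box U) x = coord_prod (fun k => \1_(U k)) x :> R.
Proof.
rewrite /coord_prod indicE; have [b|nb] := pselect (box U x).
  by rewrite mem_set// big1// => k _; rewrite indicE mem_set.
rewrite memNset//; have [k nk] : exists k, ~ U k (tnth x k) by apply/existsNP.
by rewrite (bigD1 k)//= indicE memNset// mul0r.
Qed.

Lemma rint_indic (g : X -> R) (S : set X) : rint g -> measurable S -> rint (fun x => g x * \1_S x).
Proof.
move=> ig mS; have /integrableP[/measurable_EFinP mg _] := ig.
apply: (@integrable_le _ _ _ mu _ (fun x => `|g x|)).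
- by apply: measurable_funM => //; exact: measurable_indic.
- by move=> x; rewrite normrM ler_piMr// indicE; case: (_ \in _); rewrite ?normr1 ?normr0.
- exact: (integrable_abse ig).
Qed.

Section Borel.
Variable g : X -> R.
Hypothesis ig : rint g.
Hypothesis g_gauss : forall (j : 'I_n -> bool) (s : 'I_n -> R), (forall k, 0 < s k) ->
  \int[mu]_x (g x * gprod j s x) = 0.

Let gauss_fun_1 (c : R -> R) := exists b s, [/\ 0 < s & forall t, c t = t ^+ (b : bool) * gauss s t].
Let indic_fun_1 (c : R -> R) := exists2 U : set MR, measurable U & forall t, c t = \1_U t.

Let bmeas_gauss c : gauss_fun_1 c -> bmeas c.
Proof.
move=> [b [s [s0 /funext ->]]]; exact: bmeas_pow_gauss.
Qed.
Let bmeas_indic_1 c : indic_fun_1 c -> bmeas c.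
Proof. by move=> [U mU /funext ->]; exact: bmeas_indic. Qed.

Lemma bmeas_prod (I : Type) (r : seq I) (P : pred I) (c : I -> R -> R) (q : I -> 'I_n) :
  (forall k, bmeas (c k)) -> rint (fun x => g x * \prod_(k <- r | P k) c k (tnth x (q k))).
Proof.
move=> bc; have /integrableP[/measurable_EFinP mg _] := ig.
have [mp [C hC]] : measurable_fun setT (fun x : X => \prod_(k <- r | P k) c k (tnth x (q k))) /\
    exists C : R, forall x : X, `|\prod_(k <- r | P k) c k (tnth x (q k))| <= C.
  elim: r => [|k r [IH [C hC]]].
    under eq_fun do rewrite big_nil; split; first exact: measurable_cst.
    by exists 1 => x; rewrite big_nil normr1.
  case Pk : (P k); under eq_fun do rewrite big_cons Pk; last first.
    by split=> //; exists C => x; rewrite big_cons Pk.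
  have [mc [C' hC']] := bc k; split.
    by apply: measurable_funM => //; exact: measurable_tnth_comp.
  exists (C' * C) => x; rewrite big_cons Pk normrM ler_pM//.
apply: (@integrable_le _ _ _ mu _ (fun x => C * `|g x|)).
- exact: measurable_funM.
- by move=> x; rewrite normrM mulrC ler_wpM2r.
- by apply: eq_integrable (integrableZl measurableT C (integrable_abse ig)).
Qed.

(** The Gaussian factors are turned into indicators one coordinate at a time: all factors but one
    are absorbed into the integrable function g', and the one-variable result applies to the
    remaining coordinate. *)
Let mixed i : forall c : 'I_n -> R -> R,
  (forall k : 'I_n, (k < i)%N -> indic_fun_1 (c k)) ->
  (forall k : 'I_n, (i <= k)%N -> gauss_fun_1 (c k)) ->
  \int[mu]_x (g x * coord_prod c x) = 0.
Proof.
elim: i => [|i IH] c hi hg.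
  have [bs Hbs] : {bs : 'I_n -> bool * R & forall k, 0 < (bs k).2 /\
      forall t, c k t = t ^+ (bs k).1 * gauss (bs k).2 t}.
    apply: (@choice _ _ (fun k p => 0 < p.2 /\ forall t, c k t = t ^+ (p.1 : bool) * gauss p.2 t)) => k.
    by have [b [s [s0 h]]] := hg k (leq0n _); exists (b, s).
  rewrite -[RHS](g_gauss (fun k => (bs k).1) (s := fun k => (bs k).2)); last by move=> k; case: (Hbs k).
  apply: eq_Rintegral => x _; congr (_ * _); apply: eq_bigr => k _.
  by have [_ ->] := Hbs k.
have [ni|ini] := leqP n i.
  apply: IH => [k _|k ik]; first by apply: hi; rewrite ltnS (leq_trans (ltnW (ltn_ord k))).
  by have := ltn_ord k; rewrite ltnNge (leq_trans ni ik).
pose o := Ordinal ini; have [U mU hU] := hi o (ltnSn i).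
have bc k : bmeas (c k).
  have [ki|ik] := ltnP k i.+1; [exact/bmeas_indic_1/hi|exact/bmeas_gauss/hg].
pose g' x := g x * \prod_(k | k != o) c k (tnth x k).
have ig' : rint g' by exact: (@bmeas_prod _ _ _ c id).
have upd (e : R -> R) : gauss_fun_1 e -> \int[mu]_x (g' x * e (tnth x o)) = 0.
  move=> he; rewrite -[RHS](IH (fun k => if k == o then e else c k)).
  - apply: eq_Rintegral => x _; rewrite /g' /coord_prod -mulrA; congr (_ * _).
    rewrite [RHS](bigD1 o)//= eqxx mulrC; congr (_ * _).
    by apply: eq_bigr => k /negbTE ->.
  - move=> k ki; case: eqP => [e0|_]; last by apply: hi; rewrite ltnS ltnW.
    by move: ki; rewrite e0 ltnn.
  - move=> k ik; case: eqP => // /eqP ne; apply: hg.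
    by rewrite ltn_neqAle ik andbT; apply: contra ne => /eqP e0; apply/eqP/val_inj.
have := @vanishes_indic R _ X mu g' ((@tnth n MR)^~ o) ig' (measurable_tnth o) _ _ U mU.
rewrite /vanishes => h; rewrite -[RHS]h.
- apply: eq_Rintegral => x _; rewrite /g' /coord_prod -mulrA; congr (_ * _).
  by rewrite (bigD1 o)//= hU mulrC.
- by move=> s s0; apply: (upd (gauss s)); exists false, s; split=> // t; rewrite expr0 mul1r.
- by move=> s s0; apply: (upd (fun t => t * gauss s t)); exists true, s; split=> // t; rewrite expr1.
Qed.

Lemma gauss_borel_vanish (A : set X) : measurable A -> \int[mu]_x (g x * \1_A x) = 0.
Proof.
have vbox (U : 'I_n -> set MR) : (forall k, measurable (U k)) -> \int[mu]_x (g x * \1_(box U) x) = 0.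
  move=> mU; rewrite -[RHS](mixed (i := n) (c := fun k => \1_(U k))).
  - by apply: eq_Rintegral => x _; rewrite box_indic.
  - by move=> k _; exists (U k).
  - by move=> k; rewrite leqNgt ltn_ord.
have vT : \int[mu]_x g x = 0.
  rewrite -[RHS](vbox (fun=> setT))//; apply: eq_Rintegral => x _.
  by rewrite indicE mem_set// mulr1.
move=> mA; apply: (dynkin_induction measurable_boxE (P := fun A => \int[mu]_x (g x * \1_A x) = 0)).
- move=> _ _ [U mU <-] [U' mU' <-]; exists (fun k => U k `&` U' k).
    by move=> k; exact: measurableI.
  by apply/seteqP; split=> x; [move=> h; split=> k; case: (h k)|move=> [h h'] k].
- by rewrite -[RHS]vT; apply: eq_Rintegral => x _; rewrite indicE in_setT mulr1.
- by move=> _ [U mU <-]; exact: vbox.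
- move=> S mS vS; have := RintegralB measurableT ig (rint_indic ig mS).
  rewrite vT vS subr0 => <-; apply: eq_Rintegral => x _.
  by rewrite !indicE in_setC; case: (_ \in S); rewrite ?mulr1 ?mulr0 ?subrr ?subr0.
- move=> F mF tF vF; pose U_ k := \big[setU/set0]_(i < k) F i.
  have mU_ k : measurable (U_ k) by apply: bigsetU_measurable.
  have vU k : \int[mu]_x (g x * \1_(U_ k) x) = 0.
    elim: k => [|k IH].
      under eq_Rintegral do rewrite /U_ big_ord0 indic0 mulr0.
      by rewrite Rintegral_cst ?mul0r.
    have := RintegralD measurableT (rint_indic ig (mU_ k)) (rint_indic ig (mF k)).
    rewrite IH vF addr0 => <-; apply: eq_Rintegral => x _; rewrite -mulrDr; congr (_ * _).
    rewrite !indicE; have [Fk|nFk] := pselect (F k x).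
      have nU : ~ U_ k x.
        rewrite /U_ -bigcup_mkord => -[i /= ik Fi].
        by move/trivIsetP : tF => /(_ i k I I); rewrite neq_ltn ik => /(_ isT) e; have : (F i `&` F k) x by []; rewrite e.
      rewrite (mem_set Fk) (memNset nU) mem_set ?add0r// /U_ big_ord_recr /=.
      by right.
    rewrite (memNset nFk) addr0 /U_ big_ord_recr /= -/(U_ k).
    by congr (_ %:R); congr nat_of_bool; rewrite in_setU (memNset nFk) orbF.
  have /integrableP[/measurable_EFinP mg _] := ig.
  have [||||_ cv] := @Rdominated_cvg _ _ _ mu (fun k x => g x * \1_(U_ k) x)
    (fun x => g x * \1_(\bigcup_k F k) x) (fun x => `|g x|).
  + by move=> k; apply: measurable_funM => //; exact: measurable_indic.
  + move=> x; have [[k _ Fx]|nF] := pselect ((\bigcup_k F k) x).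
      apply: cvg_near_cst; exists k.+1 => // m /= km; congr (_ * _).
      rewrite !indicE [in RHS]mem_set; last by exists k.
      by rewrite mem_set// /U_ -bigcup_mkord; exists k.
    apply: cvg_near_cst; apply: nearW => m; congr (_ * _).
    rewrite !indicE [in RHS]memNset//.
    by rewrite memNset// /U_ -bigcup_mkord => -[i _ Fx]; apply: nF; exists i.
  + exact: (integrable_abse ig).
  + by move=> k x; rewrite normrM ler_piMr// indicE; case: (_ \in _); rewrite ?normr1 ?normr0.
  apply: (cvg_unique _ cv); first exact: Rhausdorff.
  by rewrite /=; under eq_fun do rewrite vU; exact: cvg_cst.
- by rewrite -measurable_boxE.
Qed.
End Borel.

(** Rate 1 is spent on the Gaussian that makes f integrable; what remains, s - 1 > 0, is the rate
    for [gauss_borel_vanish]. Thus f itself may grow at infinity. *)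
Lemma gprod_total (f : X -> R) : measurable_fun setT f ->
  rint (fun x => f x * gprod (fun=> 0%N) (fun=> 1) x) ->
  (forall (j : 'I_n -> bool) (s : 'I_n -> R), (forall k, 1 < s k) ->
    \int[mu]_x (f x * gprod j s x) = 0) ->
  \forall x \ae mu, f x = 0.
Proof.
move=> mf iW hf; set g := fun x => f x * _ in iW.
have hg (j : 'I_n -> bool) (s : 'I_n -> R) : (forall k, 0 < s k) ->
    \int[mu]_x (g x * gprod j s x) = 0.
  move=> s0; rewrite -[RHS](hf j (fun k => 1 + s k)); last by move=> k; rewrite ltrDl.
  apply: eq_Rintegral => x _; rewrite /g -mulrA; congr (_ * _).
  by rewrite gprodM.
have v := gauss_borel_vanish iW hg.
have h : (EFin \o g) = (EFin \o (fun=> 0 : R)) %[ae mu].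
  apply: integral_ae_eq => //.
  - exact: measurable_cst.
  - move=> E _ mE; have := v E mE.
    have -> : (\int[mu]_(x in E) (EFin \o g) x = \int[mu]_x (g x * \1_E x)%:E)%E.
      rewrite integral_mkcond; apply: eq_integral => x _.
      by rewrite patchE indicE; case: ifP => _; rewrite ?mulr1 ?mulr0.
    move=> h; rewrite -[LHS]fineK; last exact/integrable_fin_num/rint_indic.
    by rewrite -/(Rintegral _ _ _) h integral0.
by aeuse h => x /(_ I) []; rewrite /g => /eqP; rewrite mulf_eq0 [X in _ || X]gt_eqF ?orbF ?gprod_gt0// => /eqP.
Qed.
End Totality.

(** * Gaussian vectors in L^2, their Gram matrix, and existence of the Fourier transform *)

Section GaussVectors.
Context {R : realType} {n N : nat}.
Local Notation lam := (@lebesgue_measure R).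
Local Notation mu := (@lebesgue_Rn R n).
Local Notation X := (Rn R n).
Local Notation H := (L2class R n N).
Implicit Types (j : 'I_n -> nat) (s : 'I_n -> R) (a b : H) (h : X -> R).

Definition rvec h (i : 'I_N) : vfun R n N := fun x => (h x)%:C%C *: delta_mx i 0.

Lemma rvec_entry h i x k : rvec h i x k 0 = if k == i then (h x)%:C%C else 0.
Proof. by rewrite !mxE eqxx andbT; case: eqP => _; rewrite ?mulr1 ?mulr0. Qed.

Lemma cdot_rvec u h i x : cdot u (rvec h i x) = (u i 0)^* * (h x)%:C%C.
Proof.
rewrite cdotE (bigD1 i)//= rvec_entry eqxx big1 ?addr0// => k /negbTE ki.
by rewrite rvec_entry ki mulr0.
Qed.

Lemma l2norm_rvec h i x : l2norm (rvec h i x) ^+ 2 = h x ^+ 2.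
Proof.
by rewrite l2norm_sqr cdot_rvec rvec_entry eqxx cReM cReJ cImJ /= mulr0 subr0 expr2.
Qed.

Lemma L2_rvec h i : measurable_fun setT h -> rint (fun x => h x ^+ 2) -> L2 (rvec h i).
Proof.
move=> mh ih; apply/L2P; split.
  move=> k; under [X in cmeasurable X]eq_fun do rewrite rvec_entry.
  by case: eqP => _; [exact: cmeas_real|exact: cmeas_cst].
by under eq_fun do rewrite l2norm_rvec.
Qed.

Definition gv j s (i : 'I_N) : H := cls (rvec (gprod j s) i).

Lemma gprod_sqr_rint j s : (forall k, 0 < s k) -> rint (fun x : X => gprod j s x ^+ 2).
Proof.
move=> s0; under eq_fun do rewrite expr2 gprodM.
by apply: (gprod_integral _ _).1 => k; rewrite addr_gt0.
Qed.

Lemma L2_gv j s i : (forall k, 0 < s k) -> L2 (rvec (gprod j s) i).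
Proof.
move=> s0; apply: L2_rvec; [exact: measurable_gprod|exact: gprod_sqr_rint].
Qed.

Lemma ip_rvec a h i : measurable_fun setT h -> rint (fun x => h x ^+ 2) ->
  ip a (cls (rvec h i)) = cintegral (fun x => (rep a x i 0)^* * (h x)%:C%C).
Proof.
move=> mh ih; rewrite -{1}[a]clsK ip_cls; [|exact: L2_rep|exact: L2_rvec].
by congr cintegral; apply/funext => x; rewrite -/(cdot _ _) cdot_rvec.
Qed.

Lemma ip_gv j s i a : (forall k, 0 < s k) ->
  ip a (gv j s i) = cintegral (fun x => (rep a x i 0)^* * (gprod j s x)%:C%C).
Proof.
by move=> s0; apply: ip_rvec; [exact: measurable_gprod|exact: gprod_sqr_rint].
Qed.

Lemma ip_rvec_rvec (h h' : X -> R) i i' :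
  measurable_fun setT h -> rint (fun x => h x ^+ 2) ->
  measurable_fun setT h' -> rint (fun x => h' x ^+ 2) ->
  ip (cls (rvec h i)) (cls (rvec h' i')) = (i == i')%:R * (\int[mu]_x (h x * h' x))%:C%C.
Proof.
move=> mh ih mh' ih'; rewrite ip_cls; [|exact: L2_rvec|exact: L2_rvec].
rewrite /inner; under [X in cintegral X]eq_fun do rewrite -/(cdot _ _) cdot_rvec rvec_entry.
rewrite eq_sym; case: eqVneq => _; rewrite ?mul1r ?mul0r; apply: complex_ext => /=.
- by apply: eq_Rintegral => x _; rewrite oppr0 mulr0 subr0.
- under eq_Rintegral do rewrite oppr0 mulr0 mul0r addr0.
  by rewrite Rintegral_cst ?mul0r.
- under eq_Rintegral do rewrite oppr0 mulr0 mul0r subr0.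
  by rewrite Rintegral_cst ?mul0r.
- under eq_Rintegral do rewrite oppr0 mulr0 mul0r addr0.
  by rewrite Rintegral_cst ?mul0r.
Qed.

Lemma ip_gv_gv j j' s s' i i' : (forall k, 0 < s k) -> (forall k, 0 < s' k) ->
  ip (gv j s i) (gv j' s' i') =
  (i == i')%:R * (\prod_k \int[lam]_t (t ^+ (j k + j' k) * gauss (s k + s' k) t))%:C%C.
Proof.
move=> s0 s0'; rewrite ip_rvec_rvec; try exact: measurable_gprod; try exact: gprod_sqr_rint.
have [_ <-] := @gprod_integral R n (fun k => j k + j' k)%N (fun k => s k + s' k)
  (fun k => addr_gt0 (s0 k) (s0' k)).
by congr (_ * _%:C%C); apply: eq_Rintegral => x _; rewrite gprodM.
Qed.

Lemma rint_mul (f h : X -> R) : measurable_fun setT f -> rint (fun x => f x ^+ 2) ->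
  measurable_fun setT h -> rint (fun x => h x ^+ 2) -> rint (fun x => f x * h x).
Proof.
move=> mf fi mh hi; apply: (@rint_le _ _ _ (fun x => f x ^+ 2 + h x ^+ 2)).
- exact: measurable_funM.
- move=> x; have := sqr_ge0 (f x - h x); have := sqr_ge0 (f x + h x).
  by rewrite ler_norml => *; apply/andP; split; nra.
- exact: rintD.
Qed.

Lemma L2_entry_rint (f : vfun R n N) i : L2 f ->
  (measurable_fun setT (fun x => complex.Re (f x i 0)) /\
    rint (fun x => complex.Re (f x i 0) ^+ 2)) /\
  (measurable_fun setT (fun x => complex.Im (f x i 0)) /\
    rint (fun x => complex.Im (f x i 0) ^+ 2)).
Proof.
move=> /L2P[mf ri]; have [m1 m2] := mf i.
have h x := entry_le_l2norm (f x) i.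
split; split=> //; apply: (rint_le _ _ ri); try exact: measurable_funX.
  move=> x; rewrite ger0_norm ?sqr_ge0//; apply: le_trans (h x); rewrite lerDl sqr_ge0//.
by move=> x; rewrite ger0_norm ?sqr_ge0//; apply: le_trans (h x); rewrite lerDr sqr_ge0.
Qed.

(** Pairing with the i-th Gaussian vector isolates the i-th entry, whose real and imaginary parts
    are treated by [gprod_total]. *)
Lemma gv_total a :
  (forall (j : 'I_n -> bool) s i, (forall k, 0 < s k) -> ip a (gv j s i) = 0) -> a = 0.
Proof.
move=> ha; apply: rep_ext.
have z0 i : \forall x \ae mu, rep a x i 0 = 0.
  have [[m1 r1] [m2 r2]] := L2_entry_rint i (L2_rep a).
  have W0 : rint (fun x : X => gprod (fun=> 0%N) (fun=> 1) x ^+ 2).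
    by apply: gprod_sqr_rint => k.
  have mW : measurable_fun setT (@gprod R n (fun=> 0%N) (fun=> 1)) by exact: measurable_gprod.
  have hre : \forall x \ae mu, complex.Re (rep a x i 0) = 0.
    apply: gprod_total => //; first exact: rint_mul.
    move=> j s s1; have s0 k : 0 < s k by exact: lt_trans (s1 k).
    have := ha j s i s0; rewrite ip_gv// => /(congr1 (@complex.Re R)) /= h.
    rewrite -[RHS]h; apply: eq_Rintegral => x _.
    by rewrite cReM cReJ cImJ /= mulr0 subr0.
  have him : \forall x \ae mu, complex.Im (rep a x i 0) = 0.
    apply: gprod_total => //; first exact: rint_mul.
    move=> j s s1; have s0 k : 0 < s k by exact: lt_trans (s1 k).
    have := ha j s i s0; rewrite ip_gv// => /(congr1 (@complex.Im R)) /= h.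
    have e : \int[mu]_x (-1 * (complex.Im (rep a x i 0) * gprod j s x)) = 0.
      rewrite -[RHS]h; apply: eq_Rintegral => x _.
      by rewrite cImM cReJ cImJ /= mulr0 add0r mulN1r mulNr.
    move: e; rewrite RintegralZl//; first by rewrite mulN1r => /eqP; rewrite oppr_eq0 => /eqP.
    by apply: rint_mul => //; [exact: measurable_gprod|exact: gprod_sqr_rint].
  by aeuse hre, him => x e1 e2; exact: complex_ext.
have all0 : \forall x \ae mu, forall i, rep a x i 0 = 0.
  have : forall r : seq 'I_N, \forall x \ae mu, forall i, i \in r -> rep a x i 0 = 0.
    elim=> [|i r IH]; first by apply: aeW.
    by aeuse (z0 i), IH => x e1 e2 k; rewrite inE => /orP[/eqP ->|/e2].
  move=> /(_ (enum 'I_N)) h; aeuse h => x e i; apply: e; exact: mem_enum.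
aeuse all0, (@rep0 R n N) => x e ->; apply/matrixP => i k.
by rewrite ord1 e mxE.
Qed.

(* The transform of t^b exp(-s t^2 / 2) is this coefficient times t^b exp(-t^2 / (2 s)), for b <= 1. *)
Definition fcoef1 (b : bool) (s : R) : R[i] :=
  (- 'i%C) ^+ b * ((Num.sqrt s)^-1 * s^-1 ^+ b)%:C%C.

(** Equal parities lead to the zeroth or second moment, matched through s^-1 + s'^-1 = (s + s') / (s
    s'); unequal parities lead to first moments, which vanish on both sides. *)
Lemma fcoef1_gram (b b' : bool) (s s' : R) : 0 < s -> 0 < s' ->
  (fcoef1 b s)^* * fcoef1 b' s' * (\int[lam]_t (t ^+ (b + b') * gauss (s^-1 + s'^-1) t))%:C%C
  = (\int[lam]_t (t ^+ (b + b') * gauss (s + s') t))%:C%C.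
Proof.
move=> s0 s0'; have v0 : 0 < s^-1 + s'^-1 by rewrite addr_gt0 ?invr_gt0.
have u0 : 0 < s + s' by rewrite addr_gt0.
have q0 : 0 < Num.sqrt s by rewrite sqrtr_gt0.
have q0' : 0 < Num.sqrt s' by rewrite sqrtr_gt0.
have sq : Num.sqrt (s^-1 + s'^-1) = Num.sqrt (s + s') / (Num.sqrt s * Num.sqrt s').
  have -> : s^-1 + s'^-1 = (s + s') * (s * s')^-1 by field; rewrite !gt_eqF.
  by rewrite sqrtrM ?ltW// sqrtrV ?mulr_ge0 ?ltW// sqrtrM ?ltW.
have qu : 0 < Num.sqrt (s + s') by rewrite sqrtr_gt0.
have m0 w : \int[lam]_t (t ^+ 0 * gauss w t) = \int[lam]_t gauss w t :> R.
  by apply: eq_Rintegral => t _; rewrite expr0 mul1r.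
have m2 w : 0 < w -> \int[lam]_t (t ^+ 2 * gauss w t) = w^-1 * \int[lam]_t gauss w t :> R.
  move=> w0; have := moment_rec 0 w0; rewrite m0 mul1r => <-.
  by rewrite mulrA mulVf ?mul1r// gt_eqF.
rewrite /fcoef1; case: b b' => -[].
- rewrite !addn1 !m2// !integral_gauss// sq !expr1.
  apply: complex_ext; rewrite !(cReM, cImM, cReJ, cImJ, cReN, cImN) /=; last by ring.
  by field; rewrite !gt_eqF//= addr_gt0.
- by rewrite !moment1// mulr0.
- by rewrite !moment1// mulr0.
- rewrite !m0 !integral_gauss// sq !expr0.
  apply: complex_ext; rewrite !(cReM, cImM, cReJ, cImJ, cReN, cImN) /=; last by ring.
  by field; rewrite !gt_eqF.
Qed.

Lemma fcoef1_neq0 (b : bool) (s : R) : 0 < s -> fcoef1 b s != 0.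
Proof.
move=> s0; rewrite mulf_neq0//; first by rewrite expf_neq0// oppr_eq0 eq_complex /= oner_eq0 andbF.
rewrite eq_complex /= eqxx andbT mulf_neq0//.
  by rewrite invr_neq0// gt_eqF// sqrtr_gt0.
by rewrite expf_neq0// invr_neq0// gt_eqF.
Qed.

Definition fcoef (j : 'I_n -> bool) s : R[i] := \prod_k fcoef1 (j k) (s k).
Definition sinv s : 'I_n -> R := fun k => (s k)^-1.

Lemma fcoef_neq0 (j : 'I_n -> bool) s : (forall k, 0 < s k) -> fcoef j s != 0.
Proof. by move=> s0; apply/prodf_neq0 => k _; exact: fcoef1_neq0. Qed.

Lemma fcoef_gram (j j' : 'I_n -> bool) s s' i i' : (forall k, 0 < s k) -> (forall k, 0 < s' k) ->
  ip (fcoef j s *: gv j (sinv s) i) (fcoef j' s' *: gv j' (sinv s') i') =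
  ip (gv j s i) (gv j' s' i').
Proof.
move=> s0 s0'; rewrite ipZl ipZr !ip_gv_gv//; try by move=> k; rewrite invr_gt0.
rewrite !mulrA [_ * (i == i')%:R]mulrC -!mulrA; congr (_ * _).
have cprod (f : 'I_n -> R) : (\prod_k f k)%:C%C = \prod_k (f k)%:C%C :> R[i].
  by apply: (big_morph (fun x : R => x%:C%C)) => // x y; rewrite rmorphM.
have jprod (f : 'I_n -> R[i]) : (\prod_k f k)^* = \prod_k (f k)^*.
  by apply: (big_morph (fun x : R[i] => x^*)) => [x y|]; rewrite ?rmorphM ?rmorph1.
rewrite !cprod mulrA /fcoef jprod -!big_split /=.
apply: eq_bigr => k _; exact: fcoef1_gram.
Qed.

Lemma ip_isometry (F : H -> H) : linear F -> (forall a b, rip (F a) (F b) = rip a b) ->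
  forall a b, ip (F a) (F b) = ip a b.
Proof.
move=> linF ripF a b; apply: ip_ext; first exact: ripF.
have F0 : F 0 = 0 by have := linF (-1) 0 0; rewrite scaler0 addr0 scaleN1r addNr.
have Fi : F ('i%C *: a) = 'i%C *: F a by have := linF 'i%C a 0; rewrite F0 !addr0.
by rewrite -Fi; exact: ripF.
Qed.

Lemma ip_scale (c c' : R[i]) (u v u' v' : H) : ip u v = ip u' v' ->
  ip (c *: u) (c' *: v) = ip (c *: u') (c' *: v').
Proof.
move=> h; apply: etrans (ipZl _ _ _) _; apply: etrans (esym (ipZl _ _ _)).
apply: (congr1 (fun z => c^* * z)).
apply: etrans (ipZr _ _ _) _; apply: etrans (esym (ipZr _ _ _)).
exact: (congr1 (fun z => c' * z) h).
Qed.

(** Degrees 0 and 1 in each coordinate form a total family on which the transform is a single term,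
    with the rates inverted. *)
Lemma fourier_exists : exists F G : H -> H,
  [/\ cancel F G, cancel G F, linear F,
      forall a b, ip (F a) (F b) = ip a b
    & forall (j : 'I_n -> bool) s i, (forall k, 0 < s k) ->
        F (gv j s i) = fcoef j s *: gv j (sinv s) i].
Proof.
(* The natural number is an exponent of i. With these multiples in the family, vanishing real inner
   products force vanishing complex ones, and the family is stable under multiplication by i. *)
pose I := (nat * 'I_N * ('I_n -> bool) * {s : 'I_n -> R | forall k, 0 < s k})%type.
pose un (m : nat) : R[i] := 'i%C ^+ m.
pose e (p : I) : H := un p.1.1.1 *: gv p.1.2 (sval p.2) p.1.1.2.
pose e' (p : I) : H := un p.1.1.1 *: (fcoef p.1.2 (sval p.2) *: gv p.1.2 (sinv (sval p.2)) p.1.1.2).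
have ripi (u v : H) : rip ('i%C *: u) v = - rip u ('i%C *: v).
  by rewrite /rip ipZl ipZr !cReM cReJ cImJ /=; ring.
have ipz (a v : H) : rip a v = 0 -> rip a ('i%C *: v) = 0 -> ip a v = 0.
  move=> h1 h2; apply: complex_ext; first exact: h1.
  by rewrite Im_ip ripi h2 oppr0.
(* One statement for both families: it is used with coefficient 1 and the identity on rates, and
   with [fcoef] and inverted rates. *)
have teE (z : ('I_n -> bool) -> ('I_n -> R) -> R[i]) (q : ('I_n -> R) -> ('I_n -> R)) a :
    (forall (j : 'I_n -> bool) s, (forall k, 0 < s k) -> z j s != 0) ->
    (forall s, (forall k, 0 < s k) -> forall k, 0 < q s k) -> (forall s, q (q s) = s) ->
    (forall p : I, rip a (un p.1.1.1 *: (z p.1.2 (sval p.2) *: gv p.1.2 (q (sval p.2)) p.1.1.2)) = 0) -> a = 0.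
  move=> z0 q0 qq h; apply: gv_total => j s i s0.
  have h1 := h (0%N, i, j, exist _ (q s) (q0 _ s0)).
  have h2 := h (1%N, i, j, exist _ (q s) (q0 _ s0)).
  rewrite /= qq /un expr0 scale1r in h1; rewrite /= qq /un expr1 in h2.
  have /eqP := ipz _ _ h1 h2; rewrite ipZr mulf_eq0 (negbTE (z0 _ _ _))//=; last exact: q0.
  by move=> /eqP.
have te : total_family (@rip R n N) e.
  move=> a h; apply: (@teE (fun _ _ => 1) id a).
  - by move=> *; exact: oner_neq0.
  - by move=> s s0; exact: s0.
  - by [].
  - by move=> p; rewrite scale1r; exact: h.
have te' : total_family (@rip R n N) e'.
  move=> a h; apply: (@teE fcoef sinv a).
  - by move=> *; exact: fcoef_neq0.
  - by move=> s s0 k; rewrite invr_gt0.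
  - by move=> s; apply/funext => k; rewrite /sinv invrK.
  - exact: h.
have gram p q : rip (e p) (e q) = rip (e' p) (e' q).
  have g := fcoef_gram p.1.2 q.1.2 p.1.1.2 q.1.1.2 (svalP p.2) (svalP q.2).
  exact: (congr1 (@complex.Re R) (ip_scale _ _ (esym g))).
have ei p : exists q, e q = 'i%C *: e p /\ e' q = 'i%C *: e' p.
  have su m (v : H) : un m.+1 *: v = 'i%C *: (un m *: v) by rewrite scalerA /un exprS.
  case: p => [[[m i] j] s]; exists (m.+1, i, j, s).
  by split; exact: su.
have [F [G [FG GF linF ripF Fe]]] := unitary_of_gram L2class_hilbert gram te te' ripi ei.
have Fg (j : 'I_n -> bool) s i : (forall k, 0 < s k) ->
    F (gv j s i) = fcoef j s *: gv j (sinv s) i.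
  move=> s0; have := Fe (0%N, i, j, exist _ s s0).
  by rewrite /e /e' /un /= expr0 !scale1r.
exists F; exists G.
exact: (And5 FG GF linF (ip_isometry linF ripF) Fg).
Qed.
End GaussVectors.

(** * The Fourier transform on L^2 *)

Section Fourier.
Context {R : realType} {n N : nat}.
Local Notation mu := (@lebesgue_Rn R n).
Local Notation X := (Rn R n).
Local Notation H := (L2class R n N).
Implicit Types (s : 'I_n -> R) (a b : H) (h : X -> R).

Definition fourier : H -> H := sval (cid (@fourier_exists R n N)).
Definition ifourier : H -> H := sval (cid (svalP (cid (@fourier_exists R n N)))).

Let fourier_spec := svalP (cid (svalP (cid (@fourier_exists R n N)))).

Lemma fourierK : cancel fourier ifourier.
Proof. by case: fourier_spec. Qed.
Lemma ifourierK : cancel ifourier fourier.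
Proof. by case: fourier_spec. Qed.
Lemma ip_fourier a b : ip (fourier a) (fourier b) = ip a b.
Proof. by case: fourier_spec. Qed.
Let fourier_lin : linear fourier.
Proof. by case: fourier_spec. Qed.
Lemma fourier_gv (j : 'I_n -> bool) s i : (forall k, 0 < s k) ->
  fourier (gv j s i) = fcoef j s *: gv j (sinv s) i.
Proof. by case: fourier_spec => _ _ _ _; exact. Qed.

Lemma fourier0 : fourier 0 = 0.
Proof. by have := fourier_lin (-1) 0 0; rewrite scaler0 addr0 scaleN1r addNr. Qed.
Lemma fourierD a b : fourier (a + b) = fourier a + fourier b.
Proof. by have := fourier_lin 1 a b; rewrite !scale1r. Qed.
Lemma fourierZ c a : fourier (c *: a) = c *: fourier a.
Proof. by have := fourier_lin c a 0; rewrite fourier0 !addr0. Qed.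

Lemma gvE (j : 'I_n -> nat) s i : gv j s i = cls (rvec (gprod j s) i) :> H.
Proof. by []. Qed.

End Fourier.
#[global] Opaque fourier ifourier gv.

(** * Smooth functions of one variable and a smooth cutoff *)

Section Smooth.
Context {R : realType}.
Implicit Types (f g : R -> R) (x y : R).

Fixpoint smooth1 (r : nat) f : Prop :=
  if r is r'.+1 then
    exists2 f', (forall x, is_derive x 1 f (f' x)) & smooth1 r' f'
  else continuous f.

Lemma smooth1S r f : smooth1 r.+1 f -> smooth1 r f.
Proof.
elim: r f => [|r IH] f [f' df hf']; first exact: is_derive_continuous df.
by exists f' => //; exact: IH.
Qed.

Lemma smooth1_cst r (c : R) : smooth1 r (fun=> c).
Proof.
elim: r c => [|r IH] c; first by move=> x; exact: cvg_cst.
by exists (fun=> 0) => // x; exact: is_derive_cst.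
Qed.

Lemma smooth1_id r : smooth1 r (fun x => x).
Proof.
case: r => [|r]; first by move=> x; exact: cvg_id.
exists (fun=> 1); last exact: smooth1_cst.
by move=> x; exact: is_derive_id.
Qed.

Lemma smooth1D r f g : smooth1 r f -> smooth1 r g -> smooth1 r (fun x => f x + g x).
Proof.
elim: r f g => [|r IH] f g; first by move=> cf cg x; apply: cvgD; [exact: cf|exact: cg].
move=> [f' df hf] [g' dg hg]; exists (fun x => f' x + g' x); last exact: IH.
by move=> x; exact: is_derive1D.
Qed.

Lemma smooth1M r f g : smooth1 r f -> smooth1 r g -> smooth1 r (fun x => f x * g x).
Proof.
elim: r f g => [|r IH] f g; first by move=> cf cg x; apply: cvgM; [exact: cf|exact: cg].
move=> sf sg; have sf' := smooth1S sf; have sg' := smooth1S sg.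
case: sf sg => [f' df hf] [g' dg hg]; exists (fun x => f' x * g x + f x * g' x).
  by move=> x; exact: is_derive1M.
by apply: smooth1D; exact: IH.
Qed.

Lemma smooth1X r j : smooth1 r (fun x => x ^+ j).
Proof.
elim: j => [|j IH]; first by under eq_fun do rewrite expr0; exact: smooth1_cst.
by under eq_fun do rewrite exprS; apply: smooth1M => //; exact: smooth1_id.
Qed.

Lemma is_derive1_compf f g x a b : is_derive (g x) 1 f a -> is_derive x 1 g b ->
  is_derive x 1 (fun y => f (g y)) (a * b).
Proof. exact: is_derive1_comp. Qed.

Lemma smooth1_comp r f g : smooth1 r f -> smooth1 r g -> smooth1 r (fun x => f (g x)).
Proof.
elim: r f g => [|r IH] f g; first by move=> cf cg x; exact: (continuous_comp (cg x) (cf _)).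
move=> [f' df hf] sg; have sg' := smooth1S sg; case: sg => [g' dg hg].
exists (fun x => f' (g x) * g' x); last by apply: smooth1M => //; exact: IH.
by move=> x; exact: (is_derive1_comp (df (g x)) (dg x)).
Qed.

Lemma smooth1_gauss r s : smooth1 r (gauss s).
Proof.
elim: r => [|r IH]; first by move=> x; exact: continuous_gauss.
exists (fun x => - s * x * gauss s x); first by move=> x; exact: is_derive_gauss.
by apply: smooth1M => //; apply: smooth1M; [exact: smooth1_cst|exact: smooth1_id].
Qed.

Lemma is_derive_sqr_bound f x (c : R) :
  (forall h, `|f (x + h) - f x| <= c * h ^+ 2) -> is_derive x 1 f 0.
Proof.
move=> hf.
have cv0 : c * `|h| @[h --> (0 : R)^'] --> (0 : R).
  rewrite -[X in _ --> X](mulr0 c); apply: cvgMr.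
  by rewrite -[X in _ --> X](normr0 R); apply: cvg_norm; exact: nbhs_dnbhs.
have cv : h^-1 *: ((f \o shift x) (h *: 1) - f x) @[h --> 0^'] --> (0 : R).
  apply: (@squeeze_cvgr _ _ _ _ (fun h : R => - (c * `|h|)) (fun h : R => c * `|h|)).
  - near=> h; rewrite -ler_norml /GRing.scale /= mulr1 normrM normfV.
    have h0 : h != 0 by near: h; exact: nbhs_dnbhs_neq.
    rewrite ler_pdivrMl ?normr_gt0// mulrCA -expr2 real_normK ?num_real// [h + x]addrC; exact: hf.
  - by rewrite -[X in _ --> X]oppr0; exact: cvgN.
  - exact: cv0.
by apply: DeriveDef; [exact: cvgP cv|exact: cvg_lim cv].
Unshelve. all: by end_near. Qed.

(** The function y^-k exp(-1 / (2 y^2)) on y > 0: for k = 0 the classical flat function, and the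
    family as a whole is closed under differentiation up to linear combinations. *)
Definition flat (k : nat) y : R := if 0 < y then y^-1 ^+ k * gauss 1 y^-1 else 0.

Lemma flat_bound k : exists2 c : R, 0 <= c & forall y, `|flat k y| <= c.
Proof.
have [c c0 hc] := pow_gauss_bounded k (@ltr01 R); exists c => // y.
by rewrite /flat; case: ifP => _; rewrite ?normr0// normrM [X in _ * X]ger0_norm ?gauss_ge0.
Qed.

(** For y <= 0 the identity [flat k] = y^2 [flat k.+2] on the positive side, with a bounded second
    factor, gives a quadratic bound on the increment and hence derivative 0. *)
Lemma is_derive_flat k y :
  is_derive y 1 (flat k) (- k%:R * flat k.+1 y + flat k.+3 y).
Proof.
case: (ltP 0 y) => y0; last first.
  have f0 l z : z <= 0 -> flat l z = 0 by move=> z0; rewrite /flat ltNge z0.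
  rewrite !f0// mulr0 addr0; have [c c0 hc] := flat_bound k.+2.
  apply: (@is_derive_sqr_bound _ _ c) => h; rewrite [flat k y]f0// subr0.
  have [h0|h0] := leP (y + h) 0; first by rewrite f0// normr0 mulr_ge0// sqr_ge0.
  have -> : flat k (y + h) = (y + h) ^+ 2 * flat k.+2 (y + h).
    by rewrite /flat h0 !exprS; field; rewrite gt_eqF.
  rewrite normrM mulrC ler_pM// ger0_norm ?sqr_ge0// lerXn2r ?nnegrE//; lra.
have y1 : y != 0 by rewrite gt_eqF.
have dV : is_derive y 1 (fun z : R => z^-1) (- y ^- 2).
  by apply: derive1_congr (is_deriveV y1 (is_derive_id y 1)) _; rewrite /GRing.scale /= mulr1.
have dg : is_derive y 1 (fun z : R => z^-1 ^+ k * gauss 1 z^-1) (- k%:R * flat k.+1 y + flat k.+3 y).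
  apply: derive1_congr (is_derive1_comp
    (is_derive1M (is_derive_pow k y^-1) (is_derive_gauss 1 y^-1)) dV) _.
  rewrite /flat y0; set g := gauss _ _; clearbody g; case: (k) => [|l] /=.
    by rewrite !exprS; field.
  by rewrite !exprS; field.
apply: near_eq_is_derive dg.
near=> z; have z0 : 0 < z by near: z; exact: lt_nbhsr.
by rewrite /flat z0.
Unshelve. all: by end_near. Qed.

Lemma smooth1_flat r k : smooth1 r (flat k).
Proof.
elim: r k => [|r IH] k; first by apply: is_derive_continuous => x; exact: is_derive_flat.
exists (fun y => - k%:R * flat k.+1 y + flat k.+3 y); first by move=> y; exact: is_derive_flat.
by apply: smooth1D => //; apply: smooth1M => //; exact: smooth1_cst.
Qed.

(** Normalised to the value 1 at 0. It is not constant near 0; only continuity there enters when the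
    radius grows. *)
Definition cutoff (x : R) : R := (flat 0 1)^-1 * flat 0 (1 - x ^+ 2).

Lemma flat1_gt0 : 0 < flat 0 1.
Proof. by rewrite /flat ltr01 expr0 mul1r gauss_gt0. Qed.

Lemma smooth1_cutoff r : smooth1 r cutoff.
Proof.
apply: smooth1M; first exact: smooth1_cst.
apply: smooth1_comp; first exact: smooth1_flat.
apply: smooth1D; first exact: smooth1_cst.
have -> : (fun x : R => - x ^+ 2) = (fun x => -1 * x ^+ 2) by apply/funext => x; rewrite mulN1r.
by apply: smooth1M; [exact: smooth1_cst|exact: smooth1X].
Qed.

Lemma cutoff0 : cutoff 0 = 1.
Proof. by rewrite /cutoff expr0n /= subr0 mulVf// gt_eqF// flat1_gt0. Qed.

Lemma cutoff_eq0 x : 1 <= `|x| -> cutoff x = 0.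
Proof.
move=> x1; rewrite /cutoff /flat.
suff -> : (0 < 1 - x ^+ 2) = false by rewrite mulr0.
apply/negbTE; rewrite -leNgt subr_le0.
by rewrite -real_normK ?num_real// exprn_ege1.
Qed.

Lemma cutoff_bounded : exists2 c : R, 0 <= c & forall x, `|cutoff x| <= c.
Proof.
have [c c0 hc] := flat_bound 0; exists (`|(flat 0 1)^-1| * c); first by rewrite mulr_ge0.
by move=> x; rewrite normrM ler_wpM2l.
Qed.

Lemma cutoff_derive : exists2 c' : R -> R, forall x, is_derive x 1 cutoff (c' x) &
  exists2 c : R, 0 <= c & forall x, `|c' x| <= c.
Proof.
pose q x : R := (flat 0 1)^-1 * (flat 3 (1 - x ^+ 2) * (- (2 * x))).
have d2 x : is_derive x 1 (fun x : R => 1 - x ^+ 2) (- (2 * x)).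
  have -> : (fun x : R => 1 - x ^+ 2) = (fun x => 1 + -1 * x ^+ 2).
    by apply/funext => z; rewrite mulN1r.
  have d1 : is_derive x 1 (fun=> 1 : R) 0 by exact: is_derive_cst.
  apply: derive1_congr (is_derive1D d1 (is_derive1Z (-1) (is_derive_pow 2 x))) _.
  by rewrite /= add0r mulN1r expr1.
exists q.
  move=> x; have dc : is_derive x 1 (fun y : R => flat 0 (1 - y ^+ 2))
      (flat 3 (1 - x ^+ 2) * (- (2 * x))).
    apply: derive1_congr (@is_derive1_compf _ _ x _ _ (is_derive_flat 0 (1 - x ^+ 2)) (d2 x)) _.
    by rewrite oppr0 mul0r add0r.
  exact: is_derive1Z.
have [c c0 hc] := flat_bound 3; exists (`|(flat 0 1)^-1| * (c * 2)).
  by rewrite !mulr_ge0.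
move=> x; rewrite /q normrM normrM ler_wpM2l//.
have [x1|x1] := leP 1 `|x|.
  rewrite [flat _ _](_ : _ = 0) ?normr0 ?mul0r ?mulr_ge0//.
  rewrite /flat; suff -> : (0 < 1 - x ^+ 2) = false by [].
  apply/negbTE; rewrite -leNgt subr_le0.
  by rewrite -real_normK ?num_real// exprn_ege1.
rewrite ler_pM// normrN normrM ger0_norm// -[leRHS]mulr1 ler_wpM2l// ltW//.
Qed.
End Smooth.

(** * Test functions that are products over the coordinates *)

Section ProductTestFunctions.
Context {R : realType} {n : nat}.
Implicit Types (f q : 'I_n -> R -> R) (x : 'rV[R]_n).

Definition fupd (T : Type) (f : 'I_n -> T) k (g : T) : 'I_n -> T :=
  fun l => if l == k then g else f l.

Definition mprod f x : R := \prod_k f k (x 0 k).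

Lemma mprod_row_of f (x : Rn R n) : mprod f (row_of x) = coord_prod f x.
Proof. by apply: eq_bigr => k _; rewrite mxE. Qed.

Lemma mprod_continuous f : (forall k, continuous (f k)) -> continuous (mprod f).
Proof.
move=> cf x; suff h (r : seq 'I_n) :
    \prod_(k <- r) f k (y 0 k) @[y --> nbhs x] --> \prod_(k <- r) f k (x 0 k) by exact: h.
elim: r => [|k r IH]; first by under eq_fun do rewrite big_nil; rewrite big_nil; exact: cvg_cst.
under eq_fun do rewrite big_cons; rewrite big_cons.
have ck : f k (y 0 k) @[y --> nbhs x] --> f k (x 0 k).
  exact: (continuous_comp (@coord_continuous _ _ _ 0 k x) (cf k _)).
exact: cvgM ck IH.
Qed.

Lemma is_derive_mprod f k (f' : R -> R) x : (forall t : R, is_derive t 1 (f k) (f' t)) ->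
  is_derive x (delta_mx 0 k) (mprod f) (mprod (fupd f k f') x).
Proof.
move=> df; have [dv e] := df (x 0 k).
pose c := \prod_(l | l != k) f l (x 0 l).
have -> : mprod (fupd f k f') x = f' (x 0 k) * c.
  rewrite /mprod (bigD1 k)//= /fupd eqxx; congr (_ * _).
  by apply: eq_bigr => l /negbTE ->.
have cv : h^-1 *: ((mprod f \o shift x) (h *: delta_mx 0 k) - mprod f x) @[h --> (0 : R)^']
    --> f' (x 0 k) * c.
  have -> : (fun h : R => h^-1 *: ((mprod f \o shift x) (h *: delta_mx 0 k) - mprod f x))
      = (fun h : R => h^-1 *: ((f k \o shift (x 0 k)) (h *: 1) - f k (x 0 k)) * c).
    apply/funext => h; rewrite /mprod /= (bigD1 k)//= [in X in _ - X](bigD1 k)//=.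
    rewrite !mxE !eqxx /GRing.scale /= -mulrA; congr (_ * _).
    rewrite mulrBl; congr (_ * _ - _).
    apply: eq_bigr => l /negbTE lk; rewrite !mxE eqxx lk /= mulr0 add0r//.
  by apply: cvgMl; rewrite -e; exact: dv.
by apply: DeriveDef; [exact: cvgP cv|exact: cvg_lim cv].
Qed.

Lemma mprod_class_C r f : (forall k, smooth1 r (f k)) -> of_class_C r (mprod f).
Proof.
elim: r f => [|r IH] f sf; first by split=> //; exact: mprod_continuous.
split.
  by apply: mprod_continuous => k; have [f' df _] := sf k; exact: is_derive_continuous df.
move=> k; have [f' df sf'] := sf k; split; first by move=> x; case: (is_derive_mprod x df).
rewrite (_ : partial k (mprod f) = mprod (fupd f k f')).
  by apply: IH => l; rewrite /fupd; case: eqP => // _; exact/smooth1S/sf.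
by apply/funext => x; rewrite /partial; case: (is_derive_mprod x df).
Qed.

Lemma mprod_test_function f (r : R) : (forall k m, smooth1 m (f k)) ->
  (forall k t, r <= `|t| -> f k t = 0) -> test_function (mprod f).
Proof.
move=> sf f0; split; first by move=> m; exact: mprod_class_C.
have cK : compact [set v : 'rV[R]_n | forall k, `[- r, r]%classic (v ord0 k)].
  by apply: (@rV_compact _ _ (fun=> `[- r, r]%classic)) => k; exact: segment_compact.
have clK : closed [set v : 'rV[R]_n | forall k, `[- r, r]%classic (v ord0 k)].
  by apply: compact_closed cK; exact: norm_hausdorff.
apply: subclosed_compact cK _; first exact: closed_closure.
rewrite closureE; apply: bigcap_inf; split=> // x /= nz k.
rewrite in_itv /= -ler_norml leNgt; apply/negP => /ltW h.
by move/eqP: nz; apply; rewrite /mprod (bigD1 k)//= f0 ?mul0r.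
Qed.
End ProductTestFunctions.

(** * Partial derivatives of Gaussian products, and dominated limits of products *)

Section GaussianTests.
Context {R : realType} {n : nat}.
Local Notation mu := (@lebesgue_Rn R n).
Local Notation X := (Rn R n).
Implicit Types (j : 'I_n -> nat) (s : 'I_n -> R).

(** The derivative of t^b exp(-s t^2 / 2); at b = 0 the factor b cancels the truncated
    predecessor. *)
Definition dpow_gauss (b : nat) (s t : R) : R :=
  b%:R * (t ^+ b.-1 * gauss s t) - s * (t ^+ b.+1 * gauss s t).

Lemma is_derive_dpow_gauss (b : nat) (s t : R) :
  is_derive t 1 (fun y : R => y ^+ b * gauss s y) (dpow_gauss b s t).
Proof.
apply: derive1_congr (is_derive1M (is_derive_pow b t) (is_derive_gauss s t)) _.
by rewrite /dpow_gauss exprS; ring.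
Qed.

Definition dgprod k j s : X -> R :=
  coord_prod (fupd (fun l t => t ^+ j l * gauss (s l) t) k (dpow_gauss (j k) (s k))).

Lemma dgprodE k j s x : dgprod k j s x =
  (j k)%:R * gprod (fupd j k (j k).-1) s x - s k * gprod (fupd j k (j k).+1) s x.
Proof.
rewrite /dgprod /gprod /coord_prod !(bigD1 k (P := xpredT))//= /fupd eqxx /dpow_gauss.
set a := \prod_(l | l != k) _; set b := \prod_(l | l != k) _; set c := \prod_(l | l != k) _.
have -> : b = a by apply: eq_bigr => l /negbTE ->.
have -> : c = a by apply: eq_bigr => l /negbTE ->.
by ring.
Qed.

Lemma coord_prod_cvg (q_ : nat -> 'I_n -> R -> R) (q : 'I_n -> R -> R) (x : X) :
  (forall l, q_ m l (tnth x l) @[m --> \oo] --> q l (tnth x l)) ->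
  coord_prod (q_ m) x @[m --> \oo] --> coord_prod q x.
Proof.
move=> h; rewrite /coord_prod; elim: (index_enum _) => [|k r IH].
  by under eq_fun do rewrite big_nil; rewrite big_nil; exact: cvg_cst.
by under eq_fun do rewrite big_cons; rewrite big_cons; apply: cvgM.
Qed.

Lemma coord_prod_bound (q : 'I_n -> R -> R) (c s : 'I_n -> R) (x : X) :
  (forall l t, `|q l t| <= c l * gauss (s l) t) ->
  `|coord_prod q x| <= (\prod_l c l) * gprod (fun=> 0%N) s x.
Proof.
move=> h; rewrite /coord_prod normr_prod /gprod /coord_prod -big_split /=.
apply: ler_prod => l _; rewrite normr_ge0 /= expr0 mul1r; exact: h.
Qed.

Lemma coord_prod_dominated (q_ : nat -> 'I_n -> R -> R) (q : 'I_n -> R -> R) (c s : 'I_n -> R)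
    (u : X -> R) : (forall l, 0 < s l) ->
  (forall m l, measurable_fun [set: measurableTypeR R] (q_ m l)) ->
  (forall m l t, `|q_ m l t| <= c l * gauss (s l) t) ->
  (forall l t, q_ m l t @[m --> \oo] --> q l t) ->
  measurable_fun setT u -> rint (fun x => u x ^+ 2) ->
  \int[mu]_x (coord_prod (q_ m) x * u x) @[m --> \oo] --> \int[mu]_x (coord_prod q x * u x).
Proof.
move=> s0 mq bq cq mea_u iu.
pose C := \prod_l c l; pose g := @gprod R n (fun=> 0%N) s.
have [||||_ cv] := @Rdominated_cvg _ _ _ mu (fun m x => coord_prod (q_ m) x * u x)
  (fun x => coord_prod q x * u x) (fun x => (C * g x) ^+ 2 + u x ^+ 2); last exact: cv.
- by move=> m; apply: measurable_funM => //; exact: measurable_coord_prod.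
- by move=> x; apply: cvgMl; apply: coord_prod_cvg => l; exact: cq.
- apply: rintD => //; under eq_fun do rewrite exprMn.
  by apply: rintZ; exact: gprod_sqr_rint.
- move=> m x; rewrite normrM; have := coord_prod_bound x (bq m).
  rewrite -/C -/(g x) => h1; have h0 := normr_ge0 (coord_prod (q_ m) x).
  rewrite -[u x ^+ 2]real_normK ?num_real//; set a := `|_|; set b := `|u x|.
  have b0 : 0 <= b by exact: normr_ge0.
  rewrite -/a in h1 h0; have := ler_wpM2r b0 h1; have := sqr_ge0 (C * g x - b).
  have := sqr_ge0 (C * g x + b); set z := C * g x; clearbody z a b; nra.
Qed.
End GaussianTests.

(** * Weak derivatives tested against Gaussians *)

Section WeakGaussian.
Context {R : realType} {n N : nat}.
Local Notation mu := (@lebesgue_Rn R n).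
Local Notation X := (Rn R n).
Implicit Types (j : 'I_n -> nat) (s : 'I_n -> R).

Lemma pow_gauss_le (b : nat) (s : R) : 0 < s ->
  exists2 c : R, 0 <= c & forall t, `|t ^+ b * gauss s t| <= c * gauss (s / 2) t.
Proof.
move=> s0; have [c c0 hc] := pow_gauss_bounded b (divr_gt0 s0 (@ltr0Sn R 1)).
exists c => // t; rewrite normrM [X in _ * X]ger0_norm ?gauss_ge0//.
have -> : gauss s t = gauss (s / 2) t * gauss (s / 2) t by rewrite gaussM -splitr.
by rewrite mulrA ler_wpM2r ?gauss_ge0.
Qed.

Lemma dpow_gauss_le (b : nat) (s : R) : 0 < s ->
  exists2 c : R, 0 <= c & forall t, `|dpow_gauss b s t| <= c * gauss (s / 2) t.
Proof.
move=> s0; have [c c0 hc] := pow_gauss_le b.-1 s0; have [d d0 hd] := pow_gauss_le b.+1 s0.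
exists (b%:R * c + s * d) => [|t]; first by rewrite addr_ge0 ?mulr_ge0// ltW.
rewrite /dpow_gauss (le_trans (ler_normB _ _))// mulrDl !normrM -!mulrA.
rewrite !(ger0_norm (ler0n _ _)) (ger0_norm (ltW s0)) -!normrM.
by apply: lerD; apply: ler_wpM2l => //; exact: ltW.
Qed.

Lemma continuous_dpow_gauss (b : nat) (s : R) : continuous (dpow_gauss b s).
Proof.
by move=> x; apply: cvgB; (apply: cvgM; [exact: cvg_cst|exact: continuous_pow_gauss]).
Qed.

Lemma cvg_div_nat (t : R) : t / m.+1%:R @[m --> \oo] --> (0 : R).
Proof. by rewrite -[X in _ --> X](mulr0 t); apply: cvgMr; exact: cvg_harmonic. Qed.

(* Cutting off at radius m + 1 and letting m grow tests a weak derivative against Gaussians. *)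
Lemma weak_partial_gprod k (f w : vfun R n N) j s i : weak_partial k f w -> (forall l, 0 < s l) ->
  \int[mu]_x (dgprod k j s x * complex.Re (f x i 0)) =
    - (\int[mu]_x (gprod j s x * complex.Re (w x i 0))) /\
  \int[mu]_x (dgprod k j s x * complex.Im (f x i 0)) =
    - (\int[mu]_x (gprod j s x * complex.Im (w x i 0))).
Proof.
move=> [fL wL hw] s0.
pose p l t := t ^+ j l * gauss (s l) t.
pose e (m : nat) (t : R) : R := cutoff (t / m.+1%:R).
have [c' dc' [B B0 hB]] := @cutoff_derive R; have [A A0 hA] := @cutoff_bounded R.
have de m t : is_derive (t : R) 1 (e m) (c' (t / m.+1%:R) / m.+1%:R).
  have dd : is_derive (t : R) 1 (fun y : R => y / m.+1%:R) m.+1%:R^-1.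
    have -> : (fun y : R => y / m.+1%:R) = (fun y => m.+1%:R^-1 * y) by apply/funext => y; rewrite mulrC.
    by apply: derive1_congr (is_derive1Z _ (is_derive_id t 1)) _; rewrite mulr1.
  exact: (@is_derive1_compf _ cutoff (fun y : R => y / m.+1%:R) t _ _ (dc' (t / m.+1%:R)) dd).
have se m r : smooth1 r (e m).
  apply: smooth1_comp; first exact: smooth1_cutoff.
  by apply: smooth1M; [exact: smooth1_id|exact: smooth1_cst].
pose q m l t := p l t * e m t.
pose d m l t := dpow_gauss (j l) (s l) t * e m t + p l t * (c' (t / m.+1%:R) / m.+1%:R).
have dq m l t : is_derive (t : R) 1 (q m l) (d m l t).
  exact: (is_derive1M (is_derive_dpow_gauss (j l) (s l) t) (de m t)).
have sq m l r : smooth1 r (q m l).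
  by apply: smooth1M => //; apply: smooth1M; [exact: smooth1X|exact: smooth1_gauss].
have q0 m l t : m.+1%:R <= `|t| -> q m l t = 0.
  move=> h; rewrite /q /e cutoff_eq0 ?mulr0// normrM normfV (ger0_norm (ler0n _ _)).
  by rewrite ler_pdivlMr ?ltr0Sn// mul1r.
have E m := hw _ (mprod_test_function (sq m) (q0 m)) i.
have Ep m x : partial k (mprod (q m)) (row_of x) = coord_prod (fupd (q m) k (d m k)) x.
  rewrite -mprod_row_of /partial.
  by case: (is_derive_mprod (f' := d m k) (row_of x) (dq m k)).
have s20 l : 0 < s l / 2 by rewrite divr_gt0.
(* One Gaussian bound serves all m, because the derivative of the cutoff carries the factor 1 / (m +
   1) <= 1. *)
have [c Hc] : {c : 'I_n -> R & forall l, 0 <= c l /\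
    (forall m t, `|q m l t| <= c l * gauss (s l / 2) t) /\
    (forall m t, `|d m l t| <= c l * gauss (s l / 2) t)}.
  apply: (@choice _ _ (fun l c => 0 <= c /\ (forall m t, `|q m l t| <= c * gauss (s l / 2) t) /\
    (forall m t, `|d m l t| <= c * gauss (s l / 2) t))) => l.
  have [a a0 ha] := pow_gauss_le (j l) (s0 l); have [b b0 hb] := dpow_gauss_le (j l) (s0 l).
  exists (a * A + (b * A + a * B)); split; first by rewrite !addr_ge0 ?mulr_ge0.
  have g0 t := gauss_ge0 (s l / 2) t.
  have h1 m t : `|q m l t| <= a * A * gauss (s l / 2) t.
    by rewrite normrM mulrAC ler_pM// ?hA// ha.
  have h2 m t : `|d m l t| <= (b * A + a * B) * gauss (s l / 2) t.
    apply: (le_trans (ler_normD _ _)); rewrite [leRHS]mulrDl; apply: lerD.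
      by rewrite normrM mulrAC ler_pM// ?hA// hb.
    rewrite normrM mulrAC ler_pM//; first exact: ha.
    rewrite normrM normfV (ger0_norm (ler0n _ _)) ler_pdivrMr ?ltr0Sn//.
    by rewrite (le_trans (hB _))// ler_peMr// ler1n.
  split=> m t.
    by rewrite mulrDl (le_trans (h1 m t))// lerDl mulr_ge0// addr_ge0 ?mulr_ge0.
  by rewrite [leRHS]mulrDl (le_trans (h2 m t))// lerDr !mulr_ge0.
have ce t : e m t @[m --> \oo] --> (1 : R).
  rewrite -(@cutoff0 R).
  apply: (@continuous_cvg _ _ _ _ _ _ (@cutoff R) 0); last exact: cvg_div_nat.
  exact: (smooth1_cutoff 0).
have cq l t : q m l t @[m --> \oo] --> p l t.
  by rewrite -[X in _ --> X]mulr1; apply: cvgMr; exact: ce.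
have cd l t : d m l t @[m --> \oo] --> dpow_gauss (j l) (s l) t.
  rewrite -[X in _ --> X]addr0; apply: cvgD.
    by rewrite -[X in _ --> X]mulr1; apply: cvgMr; exact: ce.
  rewrite -(mulr0 (p l t)); apply: cvgMr.
  apply: (@squeeze_cvgr _ _ _ _ (fun m => - (B / m.+1%:R)) (fun m => B / m.+1%:R)).
  - apply: nearW => m; rewrite -ler_norml normrM normfV (ger0_norm (ler0n _ _)).
    by rewrite ler_wpM2r ?invr_ge0.
  - by rewrite -[X in _ --> X]oppr0; apply: cvgN; exact: cvg_div_nat.
  - exact: cvg_div_nat.
have mq m l : measurable_fun [set: measurableTypeR R] (q m l).
  by apply: measurable_continuous; exact: (sq m l 0).
have md m l : measurable_fun [set: measurableTypeR R] (d m l).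
  have [d' dd' cd'] := sq m l 1.
  have -> : d m l = d' by apply/funext => t; case: (dq m l t) => _ <-; case: (dd' t).
  exact: measurable_continuous.
have main (u v : X -> R) : measurable_fun setT u -> rint (fun x => u x ^+ 2) ->
    measurable_fun setT v -> rint (fun x => v x ^+ 2) ->
    (forall m, \int[mu]_x (coord_prod (fupd (q m) k (d m k)) x * u x) =
      - (\int[mu]_x (coord_prod (q m) x * v x))) ->
    \int[mu]_x (dgprod k j s x * u x) = - (\int[mu]_x (gprod j s x * v x)).
  move=> mu_ iu mv iv h.
  have l1 := @coord_prod_dominated _ _ (fun m => fupd (q m) k (d m k))
    (fupd p k (dpow_gauss (j k) (s k))) c (fun l => s l / 2) u s20.
  have l2 := @coord_prod_dominated _ _ q p c (fun l => s l / 2) v s20.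
  have {}l2 := l2 mq (fun m l => (Hc l).2.1 m) cq mv iv.
  have {}l1 : \int[mu]_x (coord_prod (fupd (q m) k (d m k)) x * u x) @[m --> \oo] -->
      \int[mu]_x (dgprod k j s x * u x).
    apply: l1 => //.
    - by move=> m l; rewrite /fupd; case: eqP => _.
    - by move=> m l t; rewrite /fupd; case: eqP => [->|_]; [exact: (Hc k).2.2|exact: (Hc l).2.1].
    - by move=> l t; rewrite /fupd; case: eqP => _; [exact: cd|exact: cq].
  have l3 := cvgN l2.
  rewrite (_ : - _ = fun m => \int[mu]_x (coord_prod (fupd (q m) k (d m k)) x * u x)) in l3; last first.
    by apply/funext => m; rewrite h.
  exact: (cvg_unique (@Rhausdorff R) l1 (l3 _)).
have [[mf1 rf1] [mf2 rf2]] := L2_entry_rint i fL; have [[mw1 rw1] [mw2 rw2]] := L2_entry_rint i wL.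
split; apply: main => // m; have := E m.
- move/(congr1 (@complex.Re R)) => /= h.
  rewrite -[RHS](_ : - (\int[mu]_x complex.Re ((mprod (q m) (row_of x))%:C%C * w x i 0)) = _).
    rewrite -h; apply: eq_Rintegral => x _.
    by rewrite Ep cReM /= mul0r subr0.
  by congr (- _); apply: eq_Rintegral => x _; rewrite mprod_row_of cReM /= mul0r subr0.
- move/(congr1 (@complex.Im R)) => /= h.
  rewrite -[RHS](_ : - (\int[mu]_x complex.Im ((mprod (q m) (row_of x))%:C%C * w x i 0)) = _).
    rewrite -h; apply: eq_Rintegral => x _.
    by rewrite Ep cImM /= mul0r addr0.
  by congr (- _); apply: eq_Rintegral => x _; rewrite mprod_row_of cImM /= mul0r addr0.
Qed.
End WeakGaussian.

(** * The Fourier transform turns derivatives into multiplication by i x_k *)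

Section FourierDerivative.
Context {R : realType} {n N : nat}.
Local Notation lam := (@lebesgue_measure R).
Local Notation mu := (@lebesgue_Rn R n).
Local Notation X := (Rn R n).
Local Notation H := (L2class R n N).
Implicit Types (s : 'I_n -> R) (a b : H).

(** One coordinate of the rule for derivatives: the transform of the derivative of t^b exp(-s t^2 /
    2) is i t times the transform of that function, tested here against the transforms of the other
    Gaussians. *)
Lemma dpow_gauss_moment (b b' : bool) (s s' : R) : 0 < s -> 0 < s' ->
  (\int[lam]_t (dpow_gauss b s t * (t ^+ b' * gauss s' t)))%:C%C =
  ('i%C * fcoef1 b s)^* * fcoef1 b' s' *
    (\int[lam]_t (t ^+ (b.+1 + b') * gauss (s^-1 + s'^-1) t))%:C%C.
Proof.
move=> s0 s0'; have v0 : 0 < s^-1 + s'^-1 by rewrite addr_gt0 ?invr_gt0.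
have u0 : 0 < s + s' by rewrite addr_gt0.
have q0 : 0 < Num.sqrt s by rewrite sqrtr_gt0.
have q0' : 0 < Num.sqrt s' by rewrite sqrtr_gt0.
have sq : Num.sqrt (s^-1 + s'^-1) = Num.sqrt (s + s') / (Num.sqrt s * Num.sqrt s').
  have -> : s^-1 + s'^-1 = (s + s') * (s * s')^-1 by field; rewrite !gt_eqF.
  by rewrite sqrtrM ?ltW// sqrtrV ?mulr_ge0 ?ltW// sqrtrM ?ltW.
have qu : 0 < Num.sqrt (s + s') by rewrite sqrtr_gt0.
have m0 w : \int[lam]_t (t ^+ 0 * gauss w t) = \int[lam]_t gauss w t :> R.
  by apply: eq_Rintegral => t _; rewrite expr0 mul1r.
have m2 w : 0 < w -> \int[lam]_t (t ^+ 2 * gauss w t) = w^-1 * \int[lam]_t gauss w t :> R.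
  move=> w0; have := moment_rec 0 w0; rewrite m0 mul1r => <-.
  by rewrite mulrA mulVf ?mul1r// gt_eqF.
have m3 w : 0 < w -> \int[lam]_t (t ^+ 3 * gauss w t) = 0 :> R.
  move=> w0; have /eqP := moment_rec 1 w0; rewrite moment1// mulr0 mulf_eq0 (gt_eqF w0) /=.
  by move=> /eqP.
have -> : \int[lam]_t (dpow_gauss b s t * (t ^+ b' * gauss s' t)) =
    b%:R * \int[lam]_t (t ^+ (b.-1 + b') * gauss (s + s') t)
    - s * \int[lam]_t (t ^+ (b.+1 + b') * gauss (s + s') t).
  have i1 := integrable_pow_gauss (b.-1 + b') u0; have i2 := integrable_pow_gauss (b.+1 + b') u0.
  have i1' := integrableZl measurableT b%:R i1; have i2' := integrableZl measurableT s i2.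
  rewrite -!RintegralZl// -RintegralB//.
  apply: eq_Rintegral => t _; rewrite /dpow_gauss -gaussM !exprD; ring.
rewrite /fcoef1; case: b b' => -[] /=; rewrite ?addn0 ?addn1 ?m0 ?m2 ?m3 ?moment1 ?integral_gauss ?sq ?expr0 ?expr1//.
- by rewrite !mulr0 subr0.
- apply: complex_ext; rewrite !(cReM, cImM, cReJ, cImJ, cReN, cImN) /=; last by ring.
  by field; rewrite !gt_eqF//= addr_gt0.
- apply: complex_ext; rewrite !(cReM, cImM, cReJ, cImJ, cReN, cImN) /=; last by ring.
  by field; rewrite !gt_eqF//= addr_gt0.
- by rewrite mul0r !mulr0 subr0.
Qed.

Lemma prod_gram (A f f' M : 'I_n -> R[i]) (c : R[i]) k : A k = (c * f k)^* * f' k * M k ->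
  (forall l, l != k -> A l = (f l)^* * f' l * M l) ->
  \prod_l A l = (c * \prod_l f l)^* * (\prod_l f' l * \prod_l M l).
Proof.
move=> hk hl; rewrite !(bigD1 k (P := xpredT))//= hk (eq_bigr _ hl) !big_split /= !rmorphM /=.
have -> : (\prod_(l | l != k) f l)^* = \prod_(l | l != k) (f l)^*.
  by apply: (big_morph (fun x : R[i] => x^*)) => [x y|]; rewrite ?rmorphM ?rmorph1.
by ring.
Qed.

Lemma dgprod_rint k (j : 'I_n -> nat) s : (forall l, 0 < s l) ->
  measurable_fun setT (dgprod k j s) /\ rint (fun x => dgprod k j s x ^+ 2).
Proof.
move=> s0; pose g1 := @gprod R n (fupd j k (j k).-1) s; pose g2 := @gprod R n (fupd j k (j k).+1) s.
have m1 : measurable_fun setT g1 by exact: measurable_gprod.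
have m2 : measurable_fun setT g2 by exact: measurable_gprod.
have i1 : rint (fun x => g1 x ^+ 2) by exact: gprod_sqr_rint.
have i2 : rint (fun x => g2 x ^+ 2) by exact: gprod_sqr_rint.
have e : dgprod k j s = (fun x => (j k)%:R * g1 x - s k * g2 x) by apply/funext => x; exact: dgprodE.
have me : measurable_fun setT (dgprod k j s).
  by rewrite e; apply: measurable_funB; apply: measurable_funM => //; exact: measurable_cst.
split=> //.
apply: (@rint_le _ _ _ (fun x => 2 * (j k)%:R ^+ 2 * g1 x ^+ 2 + 2 * s k ^+ 2 * g2 x ^+ 2)).
- exact: measurable_funX.
- move=> x; rewrite ger0_norm ?sqr_ge0// e.
  set a := (j k)%:R; set u := g1 x; set w := g2 x.
  by have := sqr_ge0 (a * u + s k * w); nra.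
- by apply: rintD; exact: rintZ.
Qed.

Lemma ip_dgprod_gv k (j j' : 'I_n -> bool) s s' i i' : (forall l, 0 < s l) -> (forall l, 0 < s' l) ->
  ip (cls (rvec (dgprod k j s) i) : H) (gv j' s' i') =
  ip (('i%C * fcoef j s) *: cls (rvec (gprod (fupd (fun l => j l : nat) k (j k).+1) (sinv s)) i) : H)
     (fcoef j' s' *: gv j' (sinv s') i').
Proof.
move=> s0 s0'; have [m1 i1] := dgprod_rint k (fun l => j l) s0.
have v0 l : 0 < sinv s l by rewrite invr_gt0.
have v0' l : 0 < sinv s' l by rewrite invr_gt0.
rewrite ip_rvec_rvec//; [|exact: measurable_gprod|exact: gprod_sqr_rint].
rewrite ipZl ipZr ip_gv_gv// !mulrA [_ * (i == i')%:R]mulrC -!mulrA; congr (_ * _).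
have cprod (f : 'I_n -> R) : (\prod_l f l)%:C%C = \prod_l (f l)%:C%C :> R[i].
  by apply: (big_morph (fun x : R => x%:C%C)) => // x y; rewrite rmorphM.
pose c l t : R := fupd (fun l t => t ^+ j l * gauss (s l) t) k (dpow_gauss (j k) (s k)) l t
  * (t ^+ j' l * gauss (s' l) t).
have -> : \int[mu]_x (dgprod k j s x * gprod j' s' x) = \int[mu]_x coord_prod c x.
  by apply: eq_Rintegral => x _; rewrite /dgprod /gprod /coord_prod -big_split.
have ic l : lam.-integrable setT (EFin \o c l).
  have u0 : 0 < s l + s' l by rewrite addr_gt0.
  rewrite /c /fupd; case: eqP => [lk|_].
    have i3 := integrableZl measurableT (j k)%:R (integrable_pow_gauss ((j k).-1 + j' l) u0).
    have i4 := integrableZl measurableT (s k) (integrable_pow_gauss ((j k).+1 + j' l) u0).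
    apply: eq_integrable (integrableB measurableT i3 i4) => // t _ /=.
    by rewrite /dpow_gauss -!EFinM -?EFinN -?EFinD -lk -gaussM !exprD; congr (_%:E); ring.
  apply: eq_integrable (integrable_pow_gauss (j l + j' l) u0) => // t _ /=.
  by rewrite -gaussM exprD mulrACA.
have hk : (\int[lam]_t c k t)%:C%C = ('i%C * fcoef1 (j k) (s k))^* * fcoef1 (j' k) (s' k) *
    (\int[lam]_t (t ^+ ((j k).+1 + j' k) * gauss ((s k)^-1 + (s' k)^-1) t))%:C%C.
  rewrite -dpow_gauss_moment//; congr (_%:C%C); apply: eq_Rintegral => t _.
  by rewrite /c /fupd eqxx.
have hl l : l != k -> (\int[lam]_t c l t)%:C%C = (fcoef1 (j l) (s l))^* * fcoef1 (j' l) (s' l) *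
    (\int[lam]_t (t ^+ (j l + j' l) * gauss ((s l)^-1 + (s' l)^-1) t))%:C%C.
  move=> /negbTE lk; rewrite fcoef1_gram//; congr (_%:C%C); apply: eq_Rintegral => t _.
  by rewrite /c /fupd lk -gaussM exprD mulrACA.
rewrite (coord_prod_integral (c := c) ic).2 !cprod /fcoef; apply: (prod_gram (k := k)).
  by rewrite hk /fupd eqxx.
by move=> l lk; rewrite hl// /fupd (negbTE lk).
Qed.

(** Inverting the rates twice is the identity, so every Gaussian vector is a multiple of a
    transform, and the transforms are total as well. *)
Lemma fourier_gvV (j : 'I_n -> bool) s i : (forall l, 0 < s l) ->
  gv j s i = (fcoef j (sinv s))^-1 *: fourier (gv j (sinv s) i) :> H.
Proof.
move=> s0; have v0 l : 0 < sinv s l by rewrite invr_gt0.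
rewrite fourier_gv// scalerA mulVf ?fcoef_neq0// scale1r.
have e : sinv (sinv s) = s by apply/funext => l; rewrite /sinv invrK.
by rewrite e.
Qed.

Lemma fourier_ext a b : (forall (j : 'I_n -> bool) s i, (forall k, 0 < s k) ->
  ip a (fourier (gv j s i)) = ip b (fourier (gv j s i))) -> a = b.
Proof.
move=> h; apply/eqP; rewrite -subr_eq0; apply/eqP; apply: gv_total => j s i s0.
have v0 l : 0 < sinv s l by rewrite invr_gt0.
by rewrite fourier_gvV// ipZr ipDl ipNl h// subrr mulr0.
Qed.

Lemma fourier_dgprod k (j : 'I_n -> bool) s i : (forall l, 0 < s l) ->
  fourier (cls (rvec (dgprod k j s) i) : H) =
  ('i%C * fcoef j s) *: cls (rvec (gprod (fupd (fun l => j l : nat) k (j k).+1) (sinv s)) i).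
Proof.
move=> s0; apply: fourier_ext => j' s' i' s0'.
apply: etrans (ip_fourier _ _) _; apply: etrans (ip_dgprod_gv _ _ _ _ _ s0 s0') _.
by rewrite [in RHS](fourier_gv _ _ s0').
Qed.

(** Multiplication by i x_k, the symbol of the k-th derivative, as a relation because it is
    unbounded. *)
Definition xmul k a b : Prop := \forall x \ae mu, rep b x = ('i%C * (tnth x k)%:C%C) *: rep a x.

Lemma ipE a b : ip a b = cintegral (fun x => cdot (rep a x) (rep b x)).
Proof. by rewrite -[in LHS](clsK a) -[in LHS](clsK b) ip_cls//; exact: L2_rep. Qed.

Lemma xmul_ip k a b c d : xmul k a b -> xmul k c d -> ip b c = - ip a d.
Proof.
rewrite /xmul => h1 h2; rewrite !ipE -mulN1r -cintegralZ; last by apply: L2_cdot; exact: L2_rep.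
apply: cintegral_ae.
- by apply: vmeas_cdot; exact: rep_vmeas.
- by apply: cmeasM; [exact: cmeas_cst|apply: vmeas_cdot; exact: rep_vmeas].
aeuse h1, h2 => x -> -> _; rewrite cdotZl cdotZr mulrA; congr (_ * _).
by apply: complex_ext; rewrite !(cReJ, cImJ, cReM, cImM, cReN, cImN) /=; ring.
Qed.

Lemma gprod_inc k (j : 'I_n -> nat) s (x : X) :
  gprod (fupd j k (j k).+1) s x = tnth x k * gprod j s x.
Proof.
rewrite /gprod /coord_prod !(bigD1 k (P := xpredT))//= /fupd eqxx exprS -!mulrA.
by congr (_ * (_ * (_ * _))); apply: eq_bigr => l /negbTE ->.
Qed.

(** The product x_k v need not be square integrable; [gprod_total] asks only for integrability
    against a Gaussian. *)
Lemma gauss_coord_ae k (u v : X -> R) : measurable_fun setT u -> rint (fun x => u x ^+ 2) ->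
  measurable_fun setT v -> rint (fun x => v x ^+ 2) ->
  (forall (j : 'I_n -> bool) s, (forall l, 0 < s l) -> \int[mu]_x (u x * gprod j s x) =
    \int[mu]_x (v x * gprod (fupd (fun l => j l : nat) k (j k).+1) s x)) ->
  \forall x \ae mu, u x = tnth x k * v x.
Proof.
move=> mu_ iu mv iv h.
have mk : measurable_fun setT (fun x : X => tnth x k : R) by exact: measurable_tnth.
have r1 (j : 'I_n -> bool) s : (forall l, 0 < s l) -> rint (fun x => u x * gprod j s x).
  by move=> s0; apply: rint_mul => //; [exact: measurable_gprod|exact: gprod_sqr_rint].
have r2 (j : 'I_n -> nat) s : (forall l, 0 < s l) -> rint (fun x => v x * gprod j s x).
  by move=> s0; apply: rint_mul => //; [exact: measurable_gprod|exact: gprod_sqr_rint].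
have e (j : 'I_n -> nat) s x : (u x - tnth x k * v x) * gprod j s x =
    u x * gprod j s x - v x * gprod (fupd j k (j k).+1) s x.
  by rewrite gprod_inc; ring.
have : \forall x \ae mu, u x - tnth x k * v x = 0.
  apply: gprod_total.
  - by apply: measurable_funB => //; exact: measurable_funM.
  - under eq_fun do rewrite e; apply: rintB; first exact: (r1 (fun=> false)).
    exact: r2.
  - move=> j s s1; have s0 l : 0 < s l by exact: lt_trans (s1 l).
    under eq_Rintegral do rewrite e.
    by rewrite RintegralB// ?h ?subrr//; [exact: r1|exact: r2].
by move=> h'; aeuse h' => x /eqP; rewrite subr_eq0 => /eqP.
Qed.

Lemma xmul_gauss k a b : (forall (j : 'I_n -> bool) s i, (forall l, 0 < s l) ->
  ip b (gv j s i) = - 'i%C * ip a (cls (rvec (gprod (fupd (fun l => j l : nat) k (j k).+1) s) i))) -> xmul k a b.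
Proof.
move=> h.
have hi i : \forall x \ae mu, rep b x i 0 = ('i%C * (tnth x k)%:C%C) * rep a x i 0.
  have [[ma1 ra1] [ma2 ra2]] := L2_entry_rint i (L2_rep a).
  have [[mb1 rb1] [mb2 rb2]] := L2_entry_rint i (L2_rep b).
  have mN : measurable_fun setT (fun x => - complex.Im (rep a x i 0)) by exact: measurable_funN.
  have rN : rint (fun x => (- complex.Im (rep a x i 0)) ^+ 2) by under eq_fun do rewrite sqrrN.
  have e1 : \forall x \ae mu, complex.Re (rep b x i 0) = tnth x k * (- complex.Im (rep a x i 0)).
    apply: gauss_coord_ae => // j s s0; have := h j s i s0.
    rewrite ip_gv// ip_rvec; [|exact: measurable_gprod|exact: gprod_sqr_rint].
    move/(congr1 (@complex.Re R)); rewrite cReM /= oppr0 mul0r sub0r mulN1r opprK => e.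
    rewrite -[RHS](_ : \int[mu]_x complex.Im ((rep a x i 0)^* *
        (gprod (fupd (fun l => j l : nat) k (j k).+1) s x)%:C%C) = _).
      by rewrite -e; apply: eq_Rintegral => x _; rewrite cReM cReJ /= mulr0 subr0.
    by apply: eq_Rintegral => x _; rewrite cImM cReJ cImJ /= mulr0 add0r.
  have e2 : \forall x \ae mu, complex.Im (rep b x i 0) = tnth x k * complex.Re (rep a x i 0).
    apply: gauss_coord_ae => // j s s0; have := h j s i s0.
    rewrite ip_gv// ip_rvec; [|exact: measurable_gprod|exact: gprod_sqr_rint].
    move/(congr1 (@complex.Im R)); rewrite cImM /= oppr0 mul0r add0r mulN1r => e.
    rewrite -[RHS](_ : \int[mu]_x complex.Re ((rep a x i 0)^* *
        (gprod (fupd (fun l => j l : nat) k (j k).+1) s x)%:C%C) = _); last first.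
      by apply: eq_Rintegral => x _; rewrite cReM cReJ /= mulr0 subr0.
    apply: oppr_inj; rewrite -e.
    have r3 : rint (fun x => complex.Im (rep b x i 0) * gprod j s x).
      by apply: rint_mul => //; [exact: measurable_gprod|exact: gprod_sqr_rint].
    rewrite -mulN1r -RintegralZl//.
    by apply: eq_Rintegral => x _; rewrite cImM cReJ cImJ /= mulr0 add0r mulN1r mulNr.
  aeuse e1, e2 => x h1 h2; apply: complex_ext.
    by rewrite h1 !(cReM, cImM) /=; ring.
  by rewrite h2 !(cReM, cImM) /=; ring.
have all0 : \forall x \ae mu, forall i, rep b x i 0 = ('i%C * (tnth x k)%:C%C) * rep a x i 0.
  have : forall r : seq 'I_N, \forall x \ae mu, forall i, i \in r ->
      rep b x i 0 = ('i%C * (tnth x k)%:C%C) * rep a x i 0.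
    elim=> [|i r IH]; first by apply: aeW.
    by aeuse (hi i), IH => x e1 e2 l; rewrite inE => /orP[/eqP ->|/e2].
  move=> /(_ (enum 'I_N)) h'; aeuse h' => x e i; apply: e; exact: mem_enum.
by rewrite /xmul; aeuse all0 => x e; apply/matrixP => i l; rewrite ord1 e !mxE.
Qed.

(** The hypothesis says that b is the k-th weak derivative of a, tested against Gaussians. *)
Lemma fourier_xmul k a b : (forall (j : 'I_n -> bool) s i, (forall l, 0 < s l) ->
  ip b (gv j s i) = - ip a (cls (rvec (dgprod k j s) i))) -> xmul k (fourier a) (fourier b).
Proof.
move=> h; apply: xmul_gauss => j s i s0; have v0 l : 0 < sinv s l by rewrite invr_gt0.
rewrite fourier_gvV// ipZr ip_fourier h// -(ip_fourier a) fourier_dgprod// ipZr.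
have -> : sinv (sinv s) = s by apply/funext => l; rewrite /sinv invrK.
have c0 := @fcoef_neq0 R n j _ v0; set c := fcoef _ _ in c0 *; set z := ip _ _.
by rewrite mulrN mulNr; apply: congr1; rewrite ['i%C * c]mulrC -mulrA mulKf.
Qed.
End FourierDerivative.

(** * Continuous functions of row vectors are Borel on tuples *)

Section RowMeasurability.
Context {R : realType} {n : nat}.
Local Notation X := (Rn R n).
Implicit Types (phi : 'rV[R]_n -> R) (x : X).

Let grid (m : nat) x : n.-tuple int := [tuple Num.floor (m.+1%:R * tnth x l) | l < n].
Let point (m : nat) (z : n.-tuple int) : 'rV[R]_n := \row_l ((tnth z l)%:~R / m.+1%:R).

Let measurable_cell m z : measurable [set x | grid m x = z].
Proof.
rewrite (_ : [set x | _] = box (fun l =>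
    [set t : measurableTypeR R | (tnth z l)%:~R <= m.+1%:R * t < (tnth z l)%:~R + 1])).
  apply: measurable_box => l.
  rewrite (_ : [set t | _] = (fun t : R => m.+1%:R * t) @^-1` `[(tnth z l)%:~R, (tnth z l)%:~R + 1[).
    have mf : measurable_fun [set: measurableTypeR R] (fun t : R => m.+1%:R * t).
      exact: measurable_funM.
    by rewrite -[X in measurable X]setTI; apply: mf => //; exact: measurable_itv.
  by apply/seteqP; split=> t /=; rewrite in_itv.
apply/seteqP; split=> x /=.
  move=> <- l; rewrite tnth_mktuple; apply/andP; split; first exact: floor_le_tmp.
  by rewrite -intrD1; exact: floorD1_gt.
move=> h; apply: eq_from_tnth => l; rewrite tnth_mktuple; apply: floor_def.
by rewrite intrD1; exact: h.
Qed.

(** The topology lives on row vectors and the sigma-algebra on tuples. The bridge is the value at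
    the grid point of mesh 1/(m+1) below x: it is constant on each of countably many measurable
    boxes, and it converges by continuity. *)
Lemma measurable_continuous_row phi : continuous phi ->
  measurable_fun setT (fun x : X => phi (row_of x)).
Proof.
move=> cphi.
apply: (@measurable_fun_cvg _ _ _ _ (fun m x => phi (point m (grid m x)))).
  move=> m _ Y mY; rewrite setTI.
  rewrite (_ : _ @^-1` _ = \bigcup_z [set x | grid m x = z /\ Y (phi (point m z))]).
    apply: countable_bigcupT_measurable => [|z]; first exact: countableP.
    have [yz|nz] := pselect (Y (phi (point m z))).
      rewrite (_ : [set x | _] = [set x | grid m x = z]); first exact: measurable_cell.
      by apply/seteqP; split=> x /= => [[]|].
    rewrite (_ : [set x | _] = set0); first exact: measurable0.
    by apply/seteqP; split=> x /= => [[]|].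
  apply/seteqP; split=> x /=; first by move=> h; exists (grid m x).
  by move=> [z _ [<-]].
move=> x _; apply: (@continuous_cvg _ _ _ _ _ _ phi (row_of x)); first exact: cphi.
move=> A [B hB sub]; rewrite /nbhs /=.
have ev i l : \forall m \near \oo, B i l (point m (grid m x) i l).
  have cv : (tnth (grid m x) l)%:~R / m.+1%:R @[m --> \oo] --> tnth x l.
    apply: (@squeeze_cvgr _ _ _ _ (fun m => tnth x l - m.+1%:R^-1) (fun=> tnth x l)).
    - apply: nearW => m; rewrite tnth_mktuple; have m0 : 0 < m.+1%:R :> R by exact: ltr0Sn.
      have f1 := floor_le_tmp (m.+1%:R * tnth x l); have f2 := floorD1_gt (m.+1%:R * tnth x l).
      rewrite intrD1 in f2; rewrite ler_pdivrMr// ler_pdivlMr// mulrBl mulVf ?gt_eqF//.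
      by rewrite [tnth x l * _]mulrC; apply/andP; split=> //; rewrite lerBlDr ltW.
    - by rewrite -[X in _ --> X]subr0; apply: cvgB; [exact: cvg_cst|exact: cvg_harmonic].
    - exact: cvg_cst.
  rewrite (ord1 i); have := hB 0 l; rewrite mxE => h.
  have e : (fun m => point m (grid m x) 0 l) = (fun m => (tnth (grid m x) l)%:~R / m.+1%:R).
    by apply/funext => m; rewrite mxE.
  by rewrite -e in cv; exact: cv _ h.
have : \forall m \near \oo, forall i l, B i l (point m (grid m x) i l).
  by apply: filter_forall => i; apply: filter_forall => l; exact: ev.
by apply: filterS => m h; apply: sub => i l; exact: h.
Qed.
End RowMeasurability.

(** * A partial derivative of a function supported in a slab has integral zero *)

Section Divergence.
Context {R : realType}.
Local Notation lam := (@lebesgue_measure R).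
Local Notation mu n := (@lebesgue_Rn R n).

Definition upd n (k : 'I_n) (x : Rn R n) (t : R) : Rn R n :=
  [tuple if l == k then t else tnth x l | l < n].

Lemma upd_cons0 n (y : Rn R n) (t u : R) : upd ord0 (Rn_cons (u, y)) t = Rn_cons (t, y).
Proof.
apply: eq_from_tnth => l; rewrite tnth_mktuple.
case: (unliftP ord0 l) => [l'|] ->; last by rewrite eqxx tnth_Rn_cons0.
by rewrite eq_sym (negbTE (neq_lift _ _)) !tnth_Rn_consS.
Qed.

Lemma upd_consS n (k : 'I_n) (y : Rn R n) (t u : R) :
  upd (lift ord0 k) (Rn_cons (u, y)) t = Rn_cons (u, upd k y t).
Proof.
apply: eq_from_tnth => l; rewrite tnth_mktuple.
case: (unliftP ord0 l) => [l'|] ->; last by rewrite (negbTE (neq_lift _ _)) !tnth_Rn_cons0.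
by rewrite (inj_eq lift_inj) !tnth_Rn_consS tnth_mktuple.
Qed.

Lemma gprod_cons n (t : R) (y : Rn R n) :
  gprod (fun=> 0%N) (fun=> 1) (Rn_cons (t, y)) = gauss 1 t * gprod (fun=> 0%N) (fun=> 1) y.
Proof. by rewrite /gprod coord_prod_cons expr0 mul1r. Qed.

(** Fubini reduces to lines in direction k: coordinates before k are integrated last and removed by
    induction. The Gaussian bound is inherited by every slice, so all inner integrals exist. *)
Lemma integral_partial_eq0 n (k : 'I_n) (G G' : Rn R n -> R) (c r : R) :
  measurable_fun setT G' ->
  (forall x, `|G' x| <= c * gprod (fun=> 0%N) (fun=> 1) x) ->
  (forall x (t : R), is_derive t 1 (fun u : R => G (upd k x u)) (G' (upd k x t))) ->
  (forall x, continuous (fun u : R => G' (upd k x u))) ->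
  (forall x t, r <= `|t| -> G (upd k x t) = 0) ->
  \int[mu n]_x G' x = 0.
Proof.
elim: n k G G' c => [[]//|n IH] k G G' c mG' bG' dG cG' G0.
have g1 : forall k : 'I_n.+1, 0 < (1 : R) by [].
have iG' : rint G'.
  apply: (rint_le mG' bG'); apply: rintZ; exact: (gprod_integral _ g1).1.
have mGc t : measurable_fun [set: Rn R n] (fun y => G' (Rn_cons (t, y))).
  by apply: (measurableT_comp mG'); apply: (measurableT_comp (@measurable_Rn_cons R n)); exact: measurable_fun_pair.
case: (unliftP ord0 k) => [k'|] kE; rewrite kE in dG cG' G0.
  rewrite /Rintegral Rn_fubini_out//.
  have e t : (\int[mu n]_y (G' (Rn_cons (t, y)))%:E = 0)%E.
    have i1 : rint (fun y => G' (Rn_cons (t, y))).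
      have b y : `|G' (Rn_cons (t, y))| <= (c * gauss 1 t) * gprod (fun=> 0%N) (fun=> 1) y.
        by rewrite -mulrA -gprod_cons.
      by apply: (rint_le (mGc t) b); apply: rintZ; exact: (gprod_integral _ (fun=> ltr01)).1.
    rewrite -[LHS]fineK; last exact: integrable_fin_num.
    congr (_%:E); apply: (IH k' (fun y => G (Rn_cons (t, y))) _ (c * gauss 1 t)) => //.
    - by move=> y; rewrite -mulrA -gprod_cons.
    - move=> y u; have := dG (Rn_cons (t, y)) u; rewrite upd_consS.
      by under eq_fun do rewrite upd_consS.
    - by move=> y; have := cG' (Rn_cons (t, y)); under eq_fun do rewrite upd_consS.
    - by move=> y u h; rewrite -upd_consS; exact: G0.
  by under eq_integral do rewrite e; rewrite integral0.
rewrite /Rintegral Rn_fubini_in//.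
have e y : (\int[lam]_t (G' (Rn_cons (t, y)))%:E = 0)%E.
  have cy : continuous (fun t : R => G' (Rn_cons (t, y))).
    by have := cG' (Rn_cons (0, y)); under eq_fun do rewrite upd_cons0.
  have i1 : lam.-integrable setT (EFin \o (fun t : R => G' (Rn_cons (t, y)))).
    have b t : `|G' (Rn_cons (t, y))| <= (c * gprod (fun=> 0%N) (fun=> 1) y) * gauss 1 t.
      by rewrite -mulrA [_ * gauss _ _]mulrC -gprod_cons.
    apply: (integrable_le (measurable_continuous cy) b).
    by apply: eq_integrable (integrableZl measurableT _ (integrable_gauss (@ltr01 R))) => // t _.
  rewrite -[LHS]fineK; last exact: integrable_fin_num.
  congr (_%:E); apply: (@integral_derive_eq0 _ (fun t => G (Rn_cons (t, y)))) => //.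
  - move=> u; have := dG (Rn_cons (0, y)) u; rewrite upd_cons0.
    by under eq_fun do rewrite upd_cons0.
  - apply: cvg_near_cst; near=> m; rewrite -(upd_cons0 _ _ 0); apply: G0.
    rewrite ger0_norm//; apply: (@le_trans _ _ m%:R); last by rewrite ler_nat.
    near: m; exact: nbhs_infty_ger.
  - apply: cvg_near_cst; near=> m; rewrite -(upd_cons0 _ _ 0); apply: G0.
    rewrite normrN ger0_norm//; apply: (@le_trans _ _ m%:R); last by rewrite ler_nat.
    near: m; exact: nbhs_infty_ger.
by under eq_integral do rewrite e; rewrite integral0.
Unshelve. all: by end_near. Qed.
End Divergence.

(** * Weak derivatives are exactly multiplication by i x_k on the Fourier side *)

Section WeakFourier.
Context {R : realType} {n N : nat}.
Local Notation lam := (@lebesgue_measure R).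
Local Notation mu := (@lebesgue_Rn R n).
Local Notation X := (Rn R n).
Local Notation H := (L2class R n N).
Implicit Types (phi : 'rV[R]_n -> R) (f w : vfun R n N).

Lemma ip_cls_rvec f (h : X -> R) i : L2 f ->
  measurable_fun setT h -> rint (fun x => h x ^+ 2) ->
  ip (cls f) (cls (rvec h i)) = cintegral (fun x => (f x i 0)^* * (h x)%:C%C).
Proof.
move=> fL mh ih; rewrite ip_cls//; last exact: L2_rvec.
by congr cintegral; apply/funext => x; rewrite -/(cdot _ _) cdot_rvec.
Qed.

Lemma weak_partial_xmul k f w : weak_partial k f w -> xmul k (fourier (cls f)) (fourier (cls w)).
Proof.
move=> h; have [fL wL _] := h; apply: fourier_xmul => j s i s0.
have [e1 e2] := weak_partial_gprod (fun l => j l) i h s0.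
have [m1 r1] := dgprod_rint k (fun l => j l) s0.
have mg : measurable_fun setT (@gprod R n j s) by exact: measurable_gprod.
have rg : rint (fun x => @gprod R n j s x ^+ 2) by exact: gprod_sqr_rint.
have [[mf1 rf1] [mf2 rf2]] := L2_entry_rint i fL; have [[mw1 rw1] [mw2 rw2]] := L2_entry_rint i wL.
rewrite gvE !ip_cls_rvec//; apply: complex_ext => /=.
- rewrite (_ : \int[mu]_x _ = \int[mu]_x (gprod j s x * complex.Re (w x i 0))); last first.
    by apply: eq_Rintegral => x _; rewrite cReM cReJ /= mulr0 subr0 mulrC.
  rewrite -[LHS]opprK -e1; congr (- _).
  by apply: eq_Rintegral => x _; rewrite cReM cReJ /= mulr0 subr0 mulrC.
- rewrite (_ : \int[mu]_x _ = \int[mu]_x (-1 * (gprod j s x * complex.Im (w x i 0)))); last first.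
    by apply: eq_Rintegral => x _; rewrite cImM cReJ cImJ /= mulr0 add0r mulN1r mulNr mulrC.
  rewrite RintegralZl//; last by apply: rint_mul.
  rewrite mulN1r -e2 -[LHS]opprK; congr (- _); rewrite -mulN1r -RintegralZl//; last exact: rint_mul.
  by apply: eq_Rintegral => x _; rewrite cImM cReJ cImJ /= mulr0 add0r mulN1r mulNr mulrC.
Qed.

Lemma row_of_upd k (x : X) (t : R) :
  row_of (upd k x t) = row_of x + (t - tnth x k) *: delta_mx 0 k.
Proof.
apply/rowP => l; rewrite !mxE tnth_mktuple eqxx /=.
by case: eqP => [->|_]; rewrite ?mulr1 ?mulr0 ?addr0// addrC subrK.
Qed.

Lemma is_derive_upd phi k (x : X) (t d : R) :
  is_derive (row_of (upd k x t)) (delta_mx 0 k) phi d ->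
  is_derive t 1 (fun u : R => phi (row_of (upd k x u))) d.
Proof.
move=> [dv e].
have cv : h^-1 *: (((fun u : R => phi (row_of (upd k x u))) \o shift t) (h *: 1) -
    phi (row_of (upd k x t))) @[h --> (0 : R)^'] --> d.
  have -> : (fun h : R => h^-1 *: (((fun u : R => phi (row_of (upd k x u))) \o shift t) (h *: 1) -
      phi (row_of (upd k x t)))) = (fun h => h^-1 *: ((phi \o shift (row_of (upd k x t))) (h *: delta_mx 0 k)
      - phi (row_of (upd k x t)))).
    apply/funext => h; congr (_ *: (phi _ - _)); rewrite /= !row_of_upd /GRing.scale /= mulr1.
    by rewrite -/(GRing.scale _ _) [RHS]addrCA -scalerDl addrA.
  by rewrite -e; exact: dv.
by apply: DeriveDef; [exact: cvgP cv|exact: cvg_lim cv].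
Qed.

Lemma continuous_upd phi k (x : X) : continuous phi ->
  continuous (fun u : R => phi (row_of (upd k x u))).
Proof.
move=> cphi u; apply: (@continuous_comp _ _ _ (fun u : R => row_of (upd k x u)) phi); last exact: cphi.
have -> : (fun u : R => row_of (upd k x u)) = (fun u => row_of x + (u - tnth x k) *: delta_mx 0 k).
  by apply/funext => v; exact: row_of_upd.
apply: cvgD; first exact: cvg_cst.
apply: cvgZr_tmp; apply: cvgB; [exact: cvg_id|exact: cvg_cst].
Qed.

(** The radius |M| + 2 exceeds by 1 the radius |M| + 1 beyond which phi vanishes; this margin makes
    the difference quotients vanish, so the derivative does too. *)
Lemma test_functionP k phi : test_function phi -> exists r c : R,
  [/\ forall x : 'rV[R]_n, (exists l, r <= `|x 0 l|) -> phi x = 0,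
      forall x : 'rV[R]_n, (exists l, r <= `|x 0 l|) -> partial k phi x = 0,
      forall x, `|phi x| <= c & forall x, `|partial k phi x| <= c].
Proof.
move=> [sphi cK]; have [c0 c1] : continuous phi /\ continuous (partial k phi).
  by have [cp /(_ k)[_ [cd _]]] := sphi 1%N.
have [M [_ hM]] := compact_bounded cK.
pose r : R := `|M| + 2.
have z0 (x : 'rV[R]_n) : (exists l, `|M| + 1 < `|x 0 l|) -> phi x = 0.
  move=> [l hl]; apply/eqP; apply: contraT => nz.
  have Mr : M < `|M| + 1 by apply: le_lt_trans (ler_norm M) _; rewrite ltrDl.
  have := hM _ Mr x (@subset_closure _ [set x | phi x != 0] x nz).
  have e : `|x 0 l| <= `|x|.
    rewrite [leRHS]mx_normrE; exact: (le_bigmax _ (fun ij : 'I_1 * 'I_n => `|x ij.1 ij.2|) (0, l)).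
  by move=> /= /(le_trans e); rewrite leNgt hl.
have z1 (x : 'rV[R]_n) : (exists l, r <= `|x 0 l|) -> partial k phi x = 0.
  move=> [l hl]; have px : phi x = 0.
    by apply: z0; exists l; apply: lt_le_trans hl; rewrite /r ltrD2l ltr1n.
  rewrite /partial /derive; apply: cvg_lim => //; apply: cvg_near_cst.
  near=> h; rewrite px subr0 /= z0 ?scaler0//; exists l; rewrite !mxE.
  have h1 : `|h| < 1.
    near: h; apply: dnbhs0_lt; exact: ltr01.
  have e1 : `|h * ((0 == 0 :> 'I_1) && (l == k))%:R| <= `|h|.
    by rewrite normrM ler_piMr// normr_nat lern1; case: (_ && _).
  have := lerB_normD (x 0 l) (h * ((0 == 0 :> 'I_1) && (l == k))%:R).
  rewrite [x 0 l + _]addrC; set a := `|_ + _|; set b := `|_ * _| in e1 *; rewrite /r in hl; lra.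
have cB : compact [set v : 'rV[R]_n | forall l, `[- r, r]%classic (v ord0 l)].
  by apply: (@rV_compact _ _ (fun=> `[- r, r]%classic)) => l; exact: segment_compact.
have bd (u : 'rV[R]_n -> R) : continuous u -> (forall x : 'rV[R]_n, (exists l, r <= `|x 0 l|) -> u x = 0) ->
    exists c, forall x, `|u x| <= c.
  move=> cu u0; have /compact_bounded[c [_ hc]] :
      compact (u @` [set v : 'rV[R]_n | forall l, `[- r, r]%classic (v ord0 l)]).
    by apply: continuous_compact cB; exact: continuous_subspaceT.
  exists (`|c| + 1) => x; have [h|h] := pselect (exists l, r <= `|x 0 l|).
    by rewrite u0// normr0 addr_ge0.
  apply: (hc (`|c| + 1)); first by apply: le_lt_trans (ler_norm c) _; rewrite ltrDl.
  exists x => // l; rewrite /= in_itv /= -ler_norml ltW// ltNge; apply/negP => hl.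
  by apply: h; exists l.
have z0' (x : 'rV[R]_n) : (exists l, r <= `|x 0 l|) -> phi x = 0.
  by move=> [l hl]; apply: z0; exists l; apply: lt_le_trans hl; rewrite /r ltrD2l ltr1n.
have [a ha] := bd _ c0 z0'; have [b hb] := bd _ c1 z1.
exists r, (Num.max a b); split=> // x; rewrite le_max ?ha// hb orbT//.
Unshelve. all: by end_near. Qed.

(** Integration by parts against Gaussians: the derivative of phi times a Gaussian product has
    integral zero by [integral_partial_eq0], which is what [fourier_xmul] asks for. *)
Lemma test_function_xmul k phi i : test_function phi ->
  [/\ measurable_fun setT (fun x : X => phi (row_of x)),
      rint (fun x : X => phi (row_of x) ^+ 2),
      measurable_fun setT (fun x : X => partial k phi (row_of x)),
      rint (fun x : X => partial k phi (row_of x) ^+ 2)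
    & xmul k (fourier (cls (rvec (fun x => phi (row_of x)) i) : H))
             (fourier (cls (rvec (fun x => partial k phi (row_of x)) i)))].
Proof.
move=> tphi; have [r [c [p0 d0 pb db]]] := test_functionP k tphi.
have [c0 c1] : continuous phi /\ continuous (partial k phi).
  by have [/(_ 1%N)[cp /(_ k)[_ [cd _]]] _] := tphi.
have dphi x : derivable phi x (delta_mx 0 k) by have [/(_ 1%N)[_ /(_ k)[]]] := tphi.
have mp : measurable_fun setT (fun x : X => phi (row_of x)) by exact: measurable_continuous_row.
have md : measurable_fun setT (fun x : X => partial k phi (row_of x)) by exact: measurable_continuous_row.

pose r1 := Num.max r 0.
have r10 : 0 <= r1 by rewrite le_max lexx orbT.
(* The inverse of C bounds the standard Gaussian from below on the cube of half-side r1, so C times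
   that Gaussian is at least 1 where phi or its derivative may be nonzero. *)
pose C := ((gauss 1 r1) ^+ n)^-1.
have C0 : 0 <= C by rewrite invr_ge0 exprn_ge0// gauss_ge0.
have gb (u : 'rV[R]_n -> R) d : (forall x : 'rV[R]_n, (exists l, r <= `|x 0 l|) -> u x = 0) ->
    (forall x, `|u x| <= d) -> forall x : X, `|u (row_of x)| <= d * C * gprod (fun=> 0%N) (fun=> 1) x.
  move=> u0 ub x; have dd0 : 0 <= d by apply: le_trans (ub 0).
  have g0 := ltW (gprod_gt0 (fun=> 1 : R) x).
  have [[l hl]|nl] := pselect (exists l : 'I_n, r <= `|row_of x 0 l|).
    by rewrite u0 ?normr0 ?mulr_ge0//; exists l.
  apply: le_trans (ub _) _; rewrite -mulrA ler_peMr// /C mulrC ler_pdivlMr ?exprn_gt0 ?gauss_gt0// mul1r.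
  rewrite /gprod /coord_prod -[n in _ ^+ n]card_ord -prodr_const; apply: ler_prod => l _.
  rewrite gauss_ge0 expr0 mul1r /gauss ler_expR lerN2 ler_wpM2l//.
  rewrite -[tnth x l ^+ 2]real_normK ?num_real// lerXn2r ?nnegrE//.
  rewrite le_max; apply/orP; left; apply: ltW; rewrite ltNge; apply/negP => h.
  by apply: nl; exists l; rewrite mxE.
have G1s (l : 'I_n) : 0 < (1 : R) by [].
have L2b (u : 'rV[R]_n -> R) d : measurable_fun setT (fun x : X => u (row_of x)) ->
    (forall x : X, `|u (row_of x)| <= d * gprod (fun=> 0%N) (fun=> 1) x) ->
    rint (fun x : X => u (row_of x) ^+ 2).
  move=> mu_ ub; apply: (@rint_le _ _ _ (fun x => d ^+ 2 * gprod (fun=> 0%N) (fun=> 1) x ^+ 2)).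
  - exact: measurable_funX.
  - move=> x; rewrite normrX -exprMn lerXn2r ?nnegrE//.
    exact: le_trans (ub x).
  - by apply: rintZ; exact: gprod_sqr_rint.
have bp := gb _ _ p0 pb; have bdd := gb _ _ d0 db.
have rp := L2b _ _ mp bp; have rd := L2b _ _ md bdd.
split=> //; apply: fourier_xmul => j s i' s0.
have [mg rg] := dgprod_rint k (fun l => j l) s0.
have mgp : measurable_fun setT (@gprod R n (fun l => j l) s) by exact: measurable_gprod.
have rgp : rint (fun x => @gprod R n (fun l => j l) s x ^+ 2) by exact: gprod_sqr_rint.
rewrite gvE !ip_rvec_rvec// -mulrN; congr (_ * _).
rewrite -[RHS]rmorphN; congr (_%:C%C).
pose f l (t : R) := t ^+ j l * gauss (s l) t.
pose f' := fupd f k (dpow_gauss (j k) (s k)).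
pose G (v : 'rV[R]_n) := phi v * mprod f v.
pose G' (v : 'rV[R]_n) := partial k phi v * mprod f v + phi v * mprod f' v.
have fE x : mprod f (row_of x) = gprod (fun l => j l) s x by rewrite mprod_row_of.
have f'E x : mprod f' (row_of x) = dgprod k (fun l => j l) s x by rewrite mprod_row_of.
have dG v : is_derive v (delta_mx 0 k) G (G' v).
  have d1 : is_derive v (delta_mx 0 k) phi (partial k phi v) by exact: derivableP.
  have d2 : is_derive v (delta_mx 0 k) (mprod f) (mprod f' v).
    by apply: is_derive_mprod => t; exact: is_derive_dpow_gauss.
  have := is_deriveM d1 d2; rewrite /G /G' /GRing.scale /= addrC [mprod f v * _]mulrC.
  exact.
have cf : continuous (mprod f) by apply: mprod_continuous => l; exact: continuous_pow_gauss.
have cf' : continuous (mprod f').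
  apply: mprod_continuous => l; rewrite /f' /fupd; case: eqP => _; last exact: continuous_pow_gauss.
  exact: continuous_dpow_gauss.
have cG' : continuous G'.
  by move=> v; exact: (cvgD (cvgM (c1 v) (cf v)) (cvgM (c0 v) (cf' v))).
have bounded_gprod (j0 : 'I_n -> nat) : exists2 e : R, 0 <= e & forall x, `|gprod j0 s x| <= e.
  have [e e0 he] := gprod_bound j0 s0; exists e => // x; apply: le_trans (he x) _.
  by rewrite ler_piMr// gprod_le1// => l; rewrite divr_ge0// ltW.
have [e1 e10 he1] := bounded_gprod (fun l => j l).
have [e2 e20 he2] : exists2 e : R, 0 <= e & forall x, `|dgprod k (fun l => j l) s x| <= e.
  have [a a0 ha] := bounded_gprod (fupd (fun l => j l : nat) k (j k).-1).
  have [b b0 hb] := bounded_gprod (fupd (fun l => j l : nat) k (j k).+1).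
  exists ((j k)%:R * a + s k * b) => [|x]; first by rewrite addr_ge0 ?mulr_ge0// ltW.
  rewrite dgprodE (le_trans (ler_normB _ _))// !normrM (ger0_norm (ler0n _ _)) (ger0_norm (ltW (s0 k))).
  by apply: lerD; apply: ler_wpM2l => //; exact: ltW.
have c00 : 0 <= c by apply: le_trans (pb 0).
have I0 : \int[mu]_x G' (row_of x) = 0.
  apply: (@integral_partial_eq0 R n k (fun x => G (row_of x)) (fun x => G' (row_of x))
      (c * C * (e1 + e2)) r).
  - exact: measurable_continuous_row.
  - move=> x; rewrite /G' fE f'E; have g0 := ltW (gprod_gt0 (fun=> 1 : R) x).
    apply: le_trans (ler_normD _ _) _; rewrite mulrDr mulrDl !normrM.
    by apply: lerD; rewrite mulrAC; apply: ler_pM.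
  - by move=> x t; apply: is_derive_upd; exact: dG.
  - by move=> x; exact: continuous_upd.
  - by move=> x t h; rewrite /G p0 ?mul0r//; exists k; rewrite mxE tnth_mktuple eqxx.
have i1 : rint (fun x : X => partial k phi (row_of x) * gprod (fun l => j l) s x) by exact: rint_mul.
have i2 : rint (fun x : X => phi (row_of x) * dgprod k (fun l => j l) s x) by exact: rint_mul.
apply/eqP; rewrite -addr_eq0 -RintegralD//; apply/eqP; rewrite -[RHS]I0.
by apply: eq_Rintegral => x _; rewrite /G' fE f'E.
Qed.

(** Multiplication by i x_k is skew-symmetric, and on the Fourier side test functions lie in its
    domain; pairing with them gives the weak derivative. *)
Lemma xmul_weak_partial k f w : L2 f -> L2 w ->
  xmul k (fourier (cls f)) (fourier (cls w)) -> weak_partial k f w.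
Proof.
move=> fL wL h; split=> // phi tphi i.
have [m1 r1 m2 r2 x1] := test_function_xmul k i tphi.
have := xmul_ip x1 h; rewrite !ip_fourier ipC [in RHS]ipC !ip_cls_rvec//.
have [[mf1 rf1] [mf2 rf2]] := L2_entry_rint i fL; have [[mw1 rw1] [mw2 rw2]] := L2_entry_rint i wL.
have e (u : vfun R n N) (g : X -> R) : L2 u -> measurable_fun setT g -> rint (fun x => g x ^+ 2) ->
    (cintegral (fun x => (u x i 0)^* * (g x)%:C%C))^* = cintegral (fun x => (g x)%:C%C * u x i 0).
  move=> uL mg rg; have [[mu1 ru1] [mu2 ru2]] := L2_entry_rint i uL.
  rewrite -cintegralJ.
    congr cintegral; apply/funext => x; rewrite rmorphM /= mulrC.
    by apply: complex_ext; rewrite !(cReM, cImM, cReJ, cImJ) /=; ring.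
  split.
    under eq_fun do rewrite cReM cReJ /= mulr0 subr0; exact: rint_mul.
  under eq_fun do rewrite cImM cReJ cImJ /= mulr0 add0r mulNr.
  by apply: rintN; exact: rint_mul.
by rewrite !e.
Qed.
End WeakFourier.

(** * Matrix multipliers and restrictions to sets *)

Section Multipliers.
Context {R : realType} {n N : nat}.
Local Notation mu := (@lebesgue_Rn R n).
Local Notation X := (Rn R n).
Local Notation H := (L2class R n N).
Local Notation nrm := (hnorm (@rip R n N)).
Local Opaque hnorm l2norm.
Implicit Types (M : X -> 'M[R[i]]_N) (a b c d : H) (s : X -> R[i]) (U : set X).

Lemma ae_foralln (P : nat -> X -> Prop) :
  (forall k, \forall x \ae mu, P k x) -> \forall x \ae mu, forall k, P k x.
Proof.
move=> h; apply/aeP; rewrite (_ : [set _ | _] = \bigcup_k [set x | ~ P k x]).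
  exact: negligible_bigcup.
apply/seteqP; split => [x /= /existsNP[k nk]|x [k _ nk] /= hx]; last by apply: nk.
by exists k.
Qed.

Definition mulrel M a b : Prop := \forall x \ae mu, rep b x = M x *m rep a x.

Definition mbounded M := mmeas M /\
  exists2 c : R, 0 <= c & forall x u, l2norm (M x *m u) ^+ 2 <= c * l2norm u ^+ 2.

(** By the default of [cls] the value is 0 when the product is not square integrable. *)
Definition mop M a : H := cls (fun x => M x *m rep a x).

Lemma L2_mop M a : mbounded M -> L2 (fun x => M x *m rep a x).
Proof.
move=> [mM [c _ hc]]; apply: (L2_dom (c := c) _ _ (L2_rep a)) => //.
by apply: vmeasM => //; exact: rep_vmeas.
Qed.

Lemma rep_mop M a : mbounded M -> mulrel M a (mop M a).
Proof. by move=> bM; exact/rep_clsE/L2_mop. Qed.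

Lemma mulrel_fun M a b c : mulrel M a b -> mulrel M a c -> b = c.
Proof. by move=> h1 h2; apply: rep_ext; aeuse h1, h2 => x -> ->. Qed.

Lemma mop_unique M a b : mbounded M -> mulrel M a b -> mop M a = b.
Proof. by move=> bM; apply: mulrel_fun; exact: rep_mop. Qed.

Lemma mulrelD M a b c d : mulrel M a c -> mulrel M b d -> mulrel M (a + b) (c + d).
Proof.
by rewrite /mulrel => h1 h2; aeuse h1, h2, (repD a b), (repD c d) => x h h' -> ->; rewrite mulmxDr h h'.
Qed.
Lemma mulrelZ M z a b : mulrel M a b -> mulrel M (z *: a) (z *: b).
Proof. by rewrite /mulrel => h; aeuse h, (repZ z a), (repZ z b) => x h' -> ->; rewrite -scalemxAr h'. Qed.
Lemma mopD M a b : mbounded M -> mop M (a + b) = mop M a + mop M b.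
Proof. by move=> bM; apply: mop_unique => //; apply: mulrelD; exact: rep_mop. Qed.
Lemma mopZ M z a : mbounded M -> mop M (z *: a) = z *: mop M a.
Proof. by move=> bM; apply: mop_unique => //; apply: mulrelZ; exact: rep_mop. Qed.
Lemma mop0 M : mbounded M -> mop M 0 = 0.
Proof. by move=> bM; have := mopZ 0 0 bM; rewrite !scale0r. Qed.

Lemma mulrel_ip M a b c d : mulrel M a b -> mulrel (fun x => (M x)^t*) c d -> ip b c = ip a d.
Proof.
rewrite /mulrel => h1 h2; rewrite !ipE; apply: cintegral_ae.
- by apply: vmeas_cdot; exact: rep_vmeas.
- by apply: vmeas_cdot; exact: rep_vmeas.
by aeuse h1, h2 => x -> -> _; rewrite cdotMl.
Qed.

Lemma nrm_sqr a : nrm a ^+ 2 = \int[mu]_x (l2norm (rep a x) ^+ 2).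
Proof. by rewrite (hnorm_sqr L2class_hilbert) rip_self. Qed.

Lemma nrm_le a b (c : R) : (\forall x \ae mu, l2norm (rep a x) ^+ 2 <= c * l2norm (rep b x) ^+ 2) ->
  nrm a ^+ 2 <= c * nrm b ^+ 2.
Proof.
move=> h; rewrite [X in X <= _](nrm_sqr a) [X in _ <= _ * X](nrm_sqr b).
rewrite -RintegralZl; [|exact: measurableT|exact: rint_rep]; rewrite -subr_ge0.
have ii := rintB (rintZ c (rint_rep b)) (rint_rep a).
rewrite -RintegralB; [|exact: measurableT|exact: (rintZ c (rint_rep b))|exact: rint_rep].
rewrite -(@Rintegral_ae _ _ (fun x => `|c * l2norm (rep b x) ^+ 2 - l2norm (rep a x) ^+ 2|)).
- by apply: Rintegral_ge0.
- by apply: measurableT_comp => //; exact: rint_meas ii.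
- exact: rint_meas ii.
- by aeuse h => x hx _ /=; rewrite ger0_norm// subr_ge0.
Qed.

Lemma le_of_sqr (x y : R) : 0 <= y -> x ^+ 2 <= y ^+ 2 -> x <= y.
Proof. by move=> y0 h; rewrite leNgt; apply/negP => xy; nra. Qed.

Lemma nrm_le1 a b : (\forall x \ae mu, l2norm (rep a x) <= l2norm (rep b x)) -> nrm a <= nrm b.
Proof.
move=> h; apply: le_of_sqr; first exact: hnorm_ge0.
rewrite -[leRHS]mul1r; apply: nrm_le.
by aeuse h => x hx; rewrite mul1r ler_sqr ?nnegrE ?l2norm_ge0.
Qed.

Lemma nrm_mop M : mbounded M -> exists2 c : R, 0 <= c & forall a, nrm (mop M a) <= c * nrm a.
Proof.
move=> bM; have [_ [c c0 hc]] := bM; exists (Num.sqrt c) => [|a]; first exact: sqrtr_ge0.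
apply: le_of_sqr; first by rewrite mulr_ge0 ?sqrtr_ge0 ?hnorm_ge0.
rewrite exprMn (sqr_sqrtr c0).
by apply: nrm_le; aeuse (rep_mop a bM) => x ->.
Qed.



Lemma mboundedM M M' : mbounded M -> mbounded M' -> mbounded (fun x => M x *m M' x).
Proof.
move=> [m1 [c1 p1 h1]] [m2 [c2 p2 h2]]; split; first exact: mmeasM.
exists (c1 * c2) => [|x u]; first exact: mulr_ge0.
rewrite -mulmxA -mulrA; apply: le_trans (h1 _ _) _; exact: ler_wpM2l.
Qed.

Lemma mmeasJ M : mmeas M -> mmeas (fun x => (M x)^t*).
Proof. by move=> h i j; under [X in cmeasurable X]eq_fun do rewrite !mxE; exact: cmeasJ. Qed.

Lemma mmeas_scalar s : cmeasurable s -> mmeas (fun x => (s x)%:M : 'M[R[i]]_N).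
Proof.
move=> h i j; under [X in cmeasurable X]eq_fun do rewrite mxE.
by case: eqP => _ /=; [under [X in cmeasurable X]eq_fun do rewrite mulr1n|
   under [X in cmeasurable X]eq_fun do rewrite mulr0n]; rewrite //; exact: cmeas_cst.
Qed.

Lemma mbounded_scalar s (c : R) : cmeasurable s -> (forall x, normc (s x) <= c) ->
  mbounded (fun x => (s x)%:M : 'M[R[i]]_N).
Proof.
move=> ms hs; split; first exact: mmeas_scalar.
exists (c ^+ 2) => [|x u]; first exact: sqr_ge0.
rewrite mul_scalar_mx l2norm_sqrZ ler_wpM2r ?sqr_ge0//.
have n0 : 0 <= normc (s x) by case: (s x) => p q; exact: sqrtr_ge0.
by rewrite ler_sqr ?nnegrE// (le_trans n0).
Qed.

Lemma mbounded_adj M : mbounded M -> mbounded (fun x => (M x)^t*).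
Proof.
move=> [mM [c c0 hc]]; split; first exact: mmeasJ.
exists c => // x u; set w := _ *m u.
(* |M^* u|^2 = Re <u, M M^* u> <= (c |u|^2 + |M M^* u|^2 / c) / 2 <= (c |u|^2 + |M^* u|^2) / 2 *)
have := hc x w; set z := M x *m w => h.
have e : l2norm w ^+ 2 = complex.Re (cdot u z) by rewrite l2norm_sqr /z cdotMr.
have k (r : R) : 2 * r * complex.Re (cdot u z) <= r ^+ 2 * l2norm u ^+ 2 + l2norm z ^+ 2.
  have : 0 <= l2norm (r%:C%C *: u - z) ^+ 2 by exact: sqr_ge0.
  rewrite l2norm_sqr cdotDl !cdotDr !(cdotZl, cdotZr, cdotNl, cdotNr) (cdotC u z).
  rewrite !(cReD, cReN, cReM, cReJ, cImJ, cImN) /= !l2norm_sqr; lra.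
have [c00|cp] := eqVneq c 0.
  have z0 : l2norm z ^+ 2 <= 0 by rewrite (le_trans h)// c00 mul0r.
  rewrite c00 mul0r; rewrite leNgt; apply/negP => wp.
  have u0 := sqr_ge0 (l2norm u).
  (* For c = 0 the vector z vanishes, so 2 |w|^2 <= r |u|^2 for every r > 0; this choice of r makes
     the right side smaller than |w|^2. *)
  have := k (l2norm w ^+ 2 / (1 + l2norm u ^+ 2)); rewrite -e => k'.
  set p := l2norm w ^+ 2 in wp k'; set q := l2norm u ^+ 2 in u0 k'.
  set t := p / (1 + q) in k'.
  have t0 : 0 < t by rewrite divr_gt0//; lra.
  have tE : t * (1 + q) = p by rewrite divfK// gt_eqF//; lra.
  have : 2 * p <= t * q by rewrite -(ler_pM2l t0); lra.
  by have := mulrDr t 1 q; rewrite mulr1; lra.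
have cp' : 0 < c by rewrite lt_def cp.
have := k c; rewrite -e => k'; rewrite -(ler_pM2l cp').
move: k' h; rewrite !expr2; set p := l2norm w * _; set q := l2norm u * _; set r := l2norm z * _; lra.
Qed.

Lemma mop_adj M a b : mbounded M -> ip (mop M a) b = ip a (mop (fun x => (M x)^t*) b).
Proof. by move=> bM; apply: mulrel_ip; apply: rep_mop => //; exact: mbounded_adj. Qed.

Lemma scalar_adj (z : R[i]) : (z%:M : 'M[R[i]]_N)^t* = (z^*)%:M.
Proof. by apply/matrixP => i j; rewrite !mxE eq_sym; case: eqP; rewrite /= ?mulr1n// mulr0n rmorph0. Qed.

Definition restr U a := mop (fun x => ((\1_U x : R)%:C%C)%:M) a.

Lemma mbounded_restr U : measurable U -> mbounded (fun x => ((\1_U x : R)%:C%C)%:M : 'M[R[i]]_N).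
Proof.
move=> mU; apply: (@mbounded_scalar _ 1) => [|x]; first by apply: cmeas_real; exact: measurable_indic.
by rewrite /normc /= expr0n /= addr0 sqrtr_sqr indicE; case: (x \in U); rewrite ?normr1 ?normr0.
Qed.

Lemma rep_restr U a : measurable U ->
  \forall x \ae mu, rep (restr U a) x = if x \in U then rep a x else 0.
Proof.
move=> mU; aeuse (rep_mop a (mbounded_restr mU)) => x ->.
by rewrite indicE mul_scalar_mx; case: ifP => _ /=; rewrite ?scale1r// scale0r.
Qed.

Lemma restr_split U a : measurable U -> a = restr U a + restr (~` U) a.
Proof.
move=> mU; apply: rep_ext.
aeuse (repD (restr U a) (restr (~` U) a)), (rep_restr a mU), (rep_restr a (measurableC mU)) => x -> -> ->.
by rewrite in_setC; case: ifP; rewrite /= ?addr0 ?add0r.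
Qed.

Lemma restr_norm U a : measurable U -> nrm (restr U a) <= nrm a.
Proof.
move=> mU; apply: nrm_le1; aeuse (rep_restr a mU) => x ->.
by case: ifP => _; rewrite ?lexx// l2norm0 l2norm_ge0.
Qed.

Lemma restr_nrm_split U a : measurable U -> nrm a ^+ 2 = nrm (restr U a) ^+ 2 + nrm (restr (~` U) a) ^+ 2.
Proof.
move=> mU; rewrite [LHS]nrm_sqr [X in _ = X + _]nrm_sqr [X in _ = _ + X]nrm_sqr.
rewrite -RintegralD; [|exact: measurableT|exact: rint_rep|exact: rint_rep].
have h := rint_meas (rint_rep a).
apply: Rintegral_ae => //.
  by apply: measurable_funD; [exact: rint_meas (rint_rep (restr U a))|exact: rint_meas (rint_rep (restr (~` U) a))].
aeuse (rep_restr a mU), (rep_restr a (measurableC mU)) => x -> -> _.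
by rewrite in_setC; case: ifP; rewrite /= l2norm0 expr0n /= ?addr0 ?add0r.
Qed.

Definition exhausts (U : nat -> set X) :=
  (forall k, measurable (U k)) /\
  \forall x \ae mu, exists k0, forall k, (k0 <= k)%N -> U k x.

Lemma restr_cvg (U : nat -> set X) a (e : R) : exhausts U -> 0 < e ->
  exists k0, forall k, (k0 <= k)%N -> nrm (restr (~` U k) a) < e.
Proof.
move=> [mU [Z [mZ Z0 sZ]]] e0.
(* The second indicator removes the null set where the exhaustion may fail, so that convergence
   holds at every point. *)
pose f k x := l2norm (rep a x) ^+ 2 * (\1_(~` U k) x * \1_(~` Z) x).
have mf k : measurable_fun setT (f k).
  apply: measurable_funM; first exact: rint_meas (rint_rep a).
  by apply: measurable_funM; apply: measurable_indic; exact: measurableC.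
have fE k : nrm (restr (~` U k) a) ^+ 2 = \int[mu]_x f k x.
  rewrite [LHS]nrm_sqr; apply: Rintegral_ae => //; first exact: rint_meas (rint_rep (restr (~` U k) a)).
  have hZ : \forall x \ae mu, x \in ~` Z.
    by exists Z; split => // x /= /negP; rewrite in_setC negbK inE.
  aeuse (rep_restr a (measurableC (mU k))), hZ => x -> hx _; rewrite /f !indicE hx mulr1.
  by case: ifP; rewrite /= ?mulr1// l2norm0 expr0n mulr0.
have [|||_ c] := @Rdominated_cvg R _ _ mu f (fun=> 0) (fun x => l2norm (rep a x) ^+ 2) mf.
- move=> x; have [Zx|nZx] := pselect (Z x).
    rewrite (_ : (fun k => f k x) = fun=> 0); first exact: cvg_cst.
    apply/funext => k; rewrite /f !indicE !in_setC (_ : x \in Z); last by rewrite inE.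
    by rewrite !mulr0.
  have [k0 hk0] : exists k0, forall k, (k0 <= k)%N -> U k x.
    by apply: contrapT => h; apply: nZx; apply: sZ.
  apply: cvg_near_cst; near=> k.
  have Uk : x \in U k by rewrite inE; apply: hk0; near: k; exact: nbhs_infty_ge.
  by rewrite /f [X in _ * (X * _)]indicE in_setC Uk mul0r mulr0.
- exact: rint_rep.
- move=> k x; rewrite /f !indicE; case: (_ \in _); case: (_ \in _);
  by rewrite ?mulr1 ?mulr0 ?normr0 ?sqr_ge0// ger0_norm ?sqr_ge0.
move: c; rewrite (_ : \int[mu]_x 0 = 0); last by rewrite Rintegral_cst// mul0r.
move/cvgrPdist_lt => /(_ (e ^+ 2)); rewrite exprn_gt0// => /(_ isT)[k0 _ hk]; exists k0 => k kk.
rewrite ltNge; apply/negP => ek.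
have ek2 : e ^+ 2 <= nrm (restr (~` U k) a) ^+ 2.
  by apply: lerXn2r => //; rewrite nnegrE; [exact: ltW|exact: hnorm_ge0].
have := hk k kk; rewrite /= sub0r normrN => h.
by move: ek2; rewrite fE leNgt => /negP; apply; exact: le_lt_trans (ler_norm _) h.
Unshelve. all: by end_near.
Qed.

Lemma restr_ae (U : nat -> set X) (P : X -> Prop) : exhausts U ->
  (forall k, \forall x \ae mu, U k x -> P x) -> \forall x \ae mu, P x.
Proof.
by move=> [_ hU] /ae_foralln h; aeuse h, hU => x h1 [k hk]; apply: (h1 k); exact: hk.
Qed.


Lemma restr_nrm_le (U : nat -> set X) a (c : R) : exhausts U ->
  (forall k, nrm (restr (U k) a) <= c) -> nrm a <= c.
Proof.
move=> hU h; have [mU _] := hU; rewrite leNgt; apply/negP => ca.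
have ca' : 0 < nrm a - c by rewrite subr_gt0.
have [k0 /(_ _ (leqnn _)) hk] := restr_cvg a hU ca'.
have := hnormD L2class_hilbert (restr (U k0) a) (restr (~` U k0) a).
rewrite -restr_split; last exact: mU.
by move: hk (h k0) => {ca ca'}; move: (nrm a) (nrm (restr (U k0) a)) (nrm (restr (~` U k0) a)) => p q r; lra.
Qed.

Lemma mbounded_restrM U M (c : R) : measurable U -> mmeas M -> 0 <= c ->
  (forall x u, U x -> l2norm (M x *m u) ^+ 2 <= c * l2norm u ^+ 2) ->
  mbounded (fun x => M x *m ((\1_U x : R)%:C%C)%:M).
Proof.
move=> mU mM c0 h; split.
  by apply: mmeasM => //; apply: mmeas_scalar; apply: cmeas_real; exact: measurable_indic.
exists c => // x u; rewrite indicE -mulmxA mul_scalar_mx.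
have [|] := boolP (x \in U); first by rewrite inE => Ux; rewrite scale1r h.
by move=> _; rewrite scale0r mulmx0 l2norm0 expr0n /= mulr_ge0 ?sqr_ge0.
Qed.

End Multipliers.

(** * Adjoints of unbounded multipliers *)

Section MultiplierAdjoint.
Context {R : realType} {n N : nat}.
Local Notation mu := (@lebesgue_Rn R n).
Local Notation X := (Rn R n).
Local Notation H := (L2class R n N).
Local Opaque hnorm l2norm.
Implicit Types (M : X -> 'M[R[i]]_N) (a b c d : H) (s : X -> R[i]) (U : set X).

Lemma ip_total_eq a b : (forall u, ip a u = ip b u) -> a = b.
Proof. by move=> h; apply: (rip_total_eq L2class_hilbert) => u; rewrite /rip h. Qed.

Lemma restr_adj U a b : measurable U -> ip (restr U a) b = ip a (restr U b).
Proof.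
move=> mU; have bU := mbounded_restr (N := N) mU.
rewrite [LHS](mop_adj a b bU) /restr; congr (ip a (mop _ b)); apply/funext => x; rewrite scalar_adj.
by congr (_%:M); apply: complex_ext; rewrite ?cReJ ?cImJ//= oppr0.
Qed.

(** On each U k the multiplier is bounded and its adjoint is pointwise; testing on vectors supported
    in one U k identifies b there, and the sets exhaust the space. *)
Lemma adj_mulrel (U : nat -> set X) M (c : nat -> R) a b : exhausts U -> mmeas M ->
  (forall k, 0 <= c k) ->
  (forall k x u, U k x -> l2norm (M x *m u) ^+ 2 <= c k * l2norm u ^+ 2) ->
  (forall k u w, restr (U k) u = u -> mulrel M u w -> ip a w = ip b u) ->
  mulrel (fun x => (M x)^t*) a b.
Proof.
move=> hU mM c0 hM h; have [mU _] := hU; apply: (restr_ae hU) => k.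
have bM := mbounded_restrM (mU k) mM (c0 k) (hM k).
have br := mbounded_restr (N := N) (mU k).
suff e : mop (fun x => (M x *m ((\1_(U k) x : R)%:C%C)%:M)^t*) a = restr (U k) b.
  aeuse (rep_restr b (mU k)), (rep_mop a (mbounded_adj bM)) => x + + Ux.
  rewrite e => ->; have Uk : x \in U k by rewrite inE.
  by rewrite Uk => ->; rewrite indicE Uk /= mulmx1.
apply: ip_total_eq => u.
have -> : ip (mop (fun x => (M x *m ((\1_(U k) x : R)%:C%C)%:M)^t*) a) u =
    ip a (mop (fun x => M x *m ((\1_(U k) x : R)%:C%C)%:M) u).
  rewrite mop_adj; last exact: mbounded_adj.
  by congr (ip a (mop _ u)); apply/funext => x; rewrite ctrmxK.
have -> : ip (restr (U k) b) u = ip b (restr (U k) u).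
  exact: restr_adj.
apply: (h k).
  apply: rep_ext; aeuse (rep_restr (restr (U k) u) (mU k)), (rep_restr u (mU k)) => x -> ->.
  by case: (x \in U k).
have := rep_mop u br; rewrite /mulrel -/(restr (U k) u) => hr.
aeuse (rep_mop u bM), hr => x -> ->.
by rewrite mulmxA.
Qed.
End MultiplierAdjoint.

(** * Operators on functions as relations on the Fourier side *)

Section FourierLift.
Context {R : realType} {n N : nat}.
Local Notation mu := (@lebesgue_Rn R n).
Local Notation H := (L2class R n N).
Local Notation nrm := (hnorm (@rip R n N)).
Local Notation F := (@fourier R n N).
Local Notation G := (@ifourier R n N).
Local Opaque l2norm L2 ip.
Implicit Types (S T : H -> H -> Prop) (a b c d : H) (f g h : vfun R n N).

(** The operators of the theorem are brought to this form; sums, compositions, inverses and adjoints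
    of graphs then become the same operations on relations in the Hilbert space. *)
Definition flift T : op R n N := fun f g => [/\ L2 f, L2 g & T (F (cls f)) (F (cls g))].

Definition hadd S T a c := exists b1 b2, [/\ S a b1, T a b2 & c = b1 + b2].
Definition hcomp S T a c := exists2 b, T a b & S b c.
Definition hadj T a b := forall u w, T u w -> ip a w = ip b u.
Definition hscal (z : R[i]) a b := b = z *: a.

Lemma op_ext (S T : op R n N) : (forall f g, S f g <-> T f g) -> S = T.
Proof. by move=> h; apply/funext => f; apply/funext => g; apply/propext. Qed.

Lemma repG a : F (cls (rep (G a))) = a.
Proof. by rewrite clsK ifourierK. Qed.

Lemma Fcls_inj f g : L2 f -> L2 g -> F (cls f) = F (cls g) -> aeeq f g.
Proof. by move=> fL gL /(can_inj fourierK); exact: cls_inj. Qed.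

Lemma Fcls_eq f g : L2 f -> L2 g -> aeeq f g -> F (cls f) = F (cls g).
Proof. by move=> fL gL /aeeqE h; congr F; exact: cls_eq. Qed.

Lemma lift_add S T : op_add (flift S) (flift T) = flift (hadd S T).
Proof.
apply: op_ext => f h; split.
  move=> [g1 [g2 [[fL g1L Sg] [_ g2L Tg] hL e]]]; split=> //.
  exists (F (cls g1)), (F (cls g2)); split=> //.
  rewrite -fourierD -(clsD g1L g2L); apply: Fcls_eq; [exact: hL|exact: L2_D|exact: e].
move=> [fL hL [b1 [b2 [Sb Tb e]]]]; exists (rep (G b1)), (rep (G b2)).
have [L1 L2'] := (L2_rep (G b1), L2_rep (G b2)).
split; [by rewrite /flift (repG b1)|by rewrite /flift (repG b2)|by []|].
apply: Fcls_inj; [exact: hL|exact: L2_D|rewrite (clsD L1 L2')].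
by rewrite fourierD (repG b1) (repG b2).
Qed.

Lemma lift_scalar z : op_scalar z = flift (hscal z).
Proof.
apply: op_ext => f g; split=> -[fL gL e]; split=> //.
  by rewrite /hscal -fourierZ -clsZ//; apply: Fcls_eq => //; exact: L2_Z.
by apply: Fcls_inj; [exact: gL|exact: L2_Z|rewrite (clsZ z fL) fourierZ].
Qed.

Lemma lift_comp S T : op_comp (flift S) (flift T) = flift (hcomp S T).
Proof.
apply: op_ext => f h; split.
  by move=> [g [fL gL Tg] [_ hL Sg]]; split=> //; exists (F (cls g)).
by move=> [fL hL [b Tb Sb]]; have L1 := L2_rep (G b); exists (rep (G b)); rewrite /flift (repG b).
Qed.

Lemma lift_inv T : op_inv (flift T) = flift (fun a b => T b a).
Proof. by apply: op_ext => f g; split=> -[fL gL e]; split. Qed.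

Lemma lift_adj T : op_adj (flift T) = flift (hadj T).
Proof.
apply: op_ext => f g; split=> -[fL gL h]; (split; [exact: fL|exact: gL|]).
  move=> u w Tuw.
  have [L1 L2'] := (L2_rep (G u), L2_rep (G w)).
  have := h (rep (G u)) (rep (G w)); rewrite /flift (repG u) (repG w) => /(_ (And3 L1 L2' Tuw)).
  rewrite -(ip_cls fL L2') -(ip_cls gL L1).
  by rewrite -(ip_fourier (cls f)) -(ip_fourier (cls g)) (repG u) (repG w).
by move=> u w [uL wL /h]; rewrite (ip_fourier (cls f)) (ip_fourier (cls g)) (ip_cls fL wL) (ip_cls gL uL).
Qed.

Lemma lift_ext S T : (forall a b, S a b <-> T a b) -> flift S = flift T.
Proof. by move=> h; apply: op_ext => f g; split=> -[fL gL /h e]. Qed.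

Lemma nrm_fourier a : nrm (F a) = nrm a.
Proof. by rewrite /hnorm /rip ip_fourier. Qed.

Lemma L2norm_cls f : L2 f -> L2norm f = nrm (F (cls f)).
Proof.
by move=> fL; rewrite nrm_fourier /hnorm /rip ip_cls// inner_self.
Qed.

Lemma lift_injective T : (forall a1 a2 b, T a1 b -> T a2 b -> a1 = a2) -> injective_op (flift T).
Proof. by move=> h f1 f2 g [f1L _ T1] [f2L _ T2]; apply: Fcls_inj => //; exact: h T1 T2. Qed.

Lemma lift_surjective T : surjective_op (flift T) <-> forall b, exists a, T a b.
Proof.
split=> h.
  by move=> b; have [f [_ _]] := h (rep (G b)) (L2_rep _); rewrite (repG b); exists (F (cls f)).
move=> g gL; have [a Ta] := h (F (cls g)); exists (rep (G a)).
by have L1 := L2_rep (G a); rewrite /flift (repG a).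
Qed.

Lemma lift_bounded T (c : R) : (forall a b, T a b -> nrm b <= c * nrm a) -> bounded_op (flift T).
Proof. by move=> h; exists c => f g [fL gL /h]; rewrite -!L2norm_cls. Qed.

Lemma lift_dense T : (forall b (e : R), 0 < e -> exists a b', T a b' /\ nrm (b - b') < e) ->
  dense_set (range_op (flift T)).
Proof.
move=> h f fL e e0; have [a [b [Tab ab]]] := h (F (cls f)) e e0.
exists (rep (G b)).
  have [L1 L2'] := (L2_rep (G a), L2_rep (G b)).
  by exists (rep (G a)); rewrite /flift (repG a) (repG b).
have L1 : L2 (fun x => (-1 : R[i]) *: rep (G b) x) by apply: L2_Z; exact: L2_rep.
rewrite (_ : (fun x => _) = fun x => f x + (-1 : R[i]) *: rep (G b) x); last first.
  by apply/funext => x; rewrite scaleN1r.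
rewrite (L2norm_cls (L2_D fL L1)).
by rewrite (clsD fL L1) (clsZ (-1) (L2_rep (G b))) fourierD fourierZ (repG b) scaleN1r.
Qed.

Lemma lift_point_spectrum T z : point_spectrum (flift T) z -> exists2 a, T a (z *: a) & a <> 0.
Proof.
move=> [f [g [[fL gL Tfg] e nf]]]; exists (F (cls f)).
  have zL := L2_Z z fL; rewrite -fourierZ -(clsZ z fL).
  by rewrite -(Fcls_eq gL zL e).
move=> f0; apply: nf; apply: Fcls_inj => //; first exact: L2_0.
by rewrite f0 -(fourier0 (R := R) (n := n) (N := N)); congr F.
Qed.
End FourierLift.

(** * Real multipliers and supports *)

Section RealMultipliers.
Context {R : realType} {n N : nat}.
Local Notation mu := (@lebesgue_Rn R n).
Local Notation X := (Rn R n).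
Local Notation H := (L2class R n N).
Local Notation nrm := (hnorm (@rip R n N)).
Local Opaque hnorm l2norm L2 ip.
Implicit Types (a b c d f g : H) (s t : X -> R) (U : set X).

Definition rmulrel s a b : Prop := \forall x \ae mu, rep b x = (s x)%:C%C *: rep a x.

Lemma rmulrelE s : rmulrel s = mulrel (fun x => ((s x)%:C%C)%:M).
Proof.
apply/funext => a; apply/funext => b; apply/propext.
by split=> h; aeuse h => x ->; rewrite mul_scalar_mx.
Qed.

Definition supp U f : Prop := \forall x \ae mu, ~ U x -> rep f x = 0.

Lemma supp_restr U f : measurable U -> supp U (restr U f).
Proof. by move=> mU; aeuse (rep_restr f mU) => x -> nU; case: ifP => //; rewrite inE. Qed.

Lemma restr_supp U f : measurable U -> restr U f = f -> supp U f.
Proof. by move=> mU <-; exact: supp_restr. Qed.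

Lemma supp_sub U V f : U `<=` V -> supp U f -> supp V f.
Proof. by move=> UV h; aeuse h => x h' nV; apply: h' => /UV. Qed.

Lemma supp_restrI U V f : measurable U -> supp V f -> supp (U `&` V) (restr U f).
Proof.
move=> mU h; aeuse (rep_restr f mU), h => x -> h' nUV; case: ifP => //; rewrite inE => Ux.
by apply: h' => Vx; apply: nUV.
Qed.

Lemma rmul_supp s U (k : R) f : measurable_fun setT s -> measurable U ->
  (forall x, U x -> `|s x| <= k) -> supp U f -> exists b, rmulrel s f b.
Proof.
move=> ms mU sk h; pose M x : 'M[R[i]]_N := ((s x * \1_U x)%:C%C)%:M.
have bM : mbounded M.
  apply: (@mbounded_scalar R n N (fun x => (s x * \1_U x)%:C%C) `|k|).
    by apply: cmeas_real; apply: measurable_funM => //; exact: measurable_indic.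
  move=> x; rewrite /normc /= expr0n /= addr0 sqrtr_sqr indicE.
  have [|_] := boolP (x \in U); last by rewrite mulr0 normr0.
  by rewrite inE mulr1 => /sk h'; exact: le_trans h' (ler_norm _).
exists (mop M f); aeuse (rep_mop f bM), h => x -> hx; rewrite mul_scalar_mx indicE.
have [_|nU] := boolP (x \in U); first by rewrite mulr1.
by rewrite hx ?scaler0// => Ux; move/negP: nU; apply; rewrite inE.
Qed.

(** The continuous functions y / (y^2 + 1/(k+1)) converge to the inverse at every point, including y
    = 0, where the inverse is 0. *)
Lemma measurable_inv : measurable_fun [set: measurableTypeR R] (fun y : R => y^-1).
Proof.
pose f (k : nat) (y : R) := y / (y ^+ 2 + k.+1%:R^-1).
have k0 (k : nat) : 0 < k.+1%:R^-1 :> R by rewrite invr_gt0.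
apply: (@measurable_fun_cvg _ _ _ _ f) => [k|y _].
  apply: measurable_continuous => y; apply: cvgM; first exact: cvg_id.
  apply: cvgV; first by rewrite gt_eqF// ltr_wpDl ?sqr_ge0.
  by apply: cvgD; [exact: exprn_continuous|exact: cvg_cst].
have [->|y0] := eqVneq y 0.
  rewrite invr0 (_ : (fun k => f k 0) = fun=> 0); first exact: cvg_cst.
  by apply/funext => k; rewrite /f mul0r.
have -> : y^-1 = y / (y ^+ 2 + 0) by rewrite addr0; field.
apply: cvgM; first exact: cvg_cst.
apply: cvgV; first by rewrite addr0 sqrf_eq0.
by apply: cvgD; [exact: cvg_cst|exact: cvg_harmonic].
Qed.

Lemma rmulrelB s a b (k : R) : rmulrel s a b -> rmulrel (fun x => s x - k) a (b - k%:C%C *: a).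
Proof.
move=> h; aeuse h, (repB b (k%:C%C *: a)), (repZ k%:C%C a) => x h' -> ->.
by rewrite h' -scalerBl rmorphB.
Qed.

Lemma rmulrelD s a b c d : rmulrel s a c -> rmulrel s b d -> rmulrel s (a + b) (c + d).
Proof. by rewrite rmulrelE; exact: mulrelD. Qed.

Lemma rmul_nrm s U (k : R) f g : (forall x, U x -> (s x) ^+ 2 <= k) -> 0 <= k ->
  supp U f -> rmulrel s f g -> nrm g ^+ 2 <= k * nrm f ^+ 2.
Proof.
move=> sk k0 h1 h2; apply: nrm_le; aeuse h1, h2 => x h ->.
have [Ux|nU] := pselect (U x); last by rewrite (h nU) scaler0 l2norm0 expr0n mulr0.
rewrite l2norm_sqrZ normc_sqr /= expr0n /= addr0 ler_wpM2r ?sqr_ge0//; exact: sk.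
Qed.

Lemma rmulrel_ip s a b c d : rmulrel s a b -> rmulrel s c d -> ip b c = ip a d.
Proof.
rewrite rmulrelE => h1 h2; apply: (mulrel_ip h1); aeuse h2 => x ->; rewrite scalar_adj.
by congr (_%:M *m _); apply: complex_ext; rewrite ?cReJ ?cImJ//= oppr0.
Qed.

Lemma sqr_le_add (p q r : R) : 0 <= p -> p <= q + r -> p ^+ 2 <= 2 * (q ^+ 2 + r ^+ 2).
Proof. by move=> p0 h; have := sqr_ge0 (q - r); rewrite !expr2; nra. Qed.

Lemma nrm_sqrD2 a b : nrm (a + b) ^+ 2 <= 2 * (nrm a ^+ 2 + nrm b ^+ 2).
Proof.
exact: sqr_le_add (hnorm_ge0 _ _) (hnormD (@L2class_hilbert R n N) a b).
Qed.

Lemma nrmB2 a b c (k l : R) : nrm (a - c) ^+ 2 <= k -> nrm (b - c) ^+ 2 <= l ->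
  nrm (a - b) ^+ 2 <= 2 * (k + l).
Proof.
move=> h1 h2; have e : (a - c) + (c - b) = a - b by rewrite addrA subrK.
have h := nrm_sqrD2 (a - c) (c - b).
rewrite e (hnormB (@L2class_hilbert R n N) c b) in h.
exact: le_trans h (ler_wpM2l (ler0n _ 2) (lerD h1 h2)).
Qed.
Lemma sqr_small_eq0 (d c : R) : (forall j : nat, d ^+ 2 <= c * 2^-1 ^+ j) -> d = 0.
Proof.
move=> h; apply/eqP; rewrite -sqrf_eq0 eq_le sqr_ge0 andbT.
rewrite -(cvg_lim (@Rhausdorff R) (cvg_geom_half c)); apply: limr_ge; last exact: nearW.
exact: cvgP (cvg_geom_half c).
Qed.

Lemma ripJ a b : rip ('i%C *: a) b = - rip a ('i%C *: b).
Proof.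
by rewrite /rip ipZl ipZr !cReM cReJ cImJ /=; ring.
Qed.

End RealMultipliers.

(** * Uniqueness of the nonnegative square root of a multiplier *)

Section SquareRoot.
Context {R : realType} {n N : nat}.
Local Notation mu := (@lebesgue_Rn R n).
Local Notation X := (Rn R n).
Local Notation H := (L2class R n N).
Local Notation nrm := (hnorm (@rip R n N)).
Local Opaque hnorm l2norm L2 ip.
Implicit Types (a b c d f g : H).

Variable t : X -> R.
Hypothesis mt : measurable_fun setT t.
Hypothesis t0 : forall x, 0 <= t x.
Let r x := Num.sqrt (t x).

Lemma measurable_sqrt : measurable_fun setT r.
Proof. by apply: measurableT_comp => //; apply: measurable_continuous; exact: sqrt_continuous. Qed.

(** Small positive values of t are excluded, since the lower bound sqrt(c) of S + sqrt(c)
    degenerates there; the zero set is kept and treated separately. *)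
Definition layer (k : nat) := [set x | t x = 0 \/ (k.+1%:R^-1 <= t x /\ t x <= k.+1%:R)].

Lemma measurable_band (p q : R) : measurable [set x | p <= t x /\ t x <= q].
Proof.
rewrite (_ : [set x | _] = setT `&` t @^-1` `[p, q]); first exact: mt.
by rewrite setTI; apply/seteqP; split => x /=; rewrite in_itv /= => /andP.
Qed.

Lemma measurable_layer k : measurable (layer k).
Proof.
rewrite /layer (_ : [set x | _] = [set x | 0 <= t x /\ t x <= 0] `|` [set x | k.+1%:R^-1 <= t x /\ t x <= k.+1%:R]).
  by apply: measurableU; exact: measurable_band.
apply/seteqP; split => x /= -[h|h]; [left|by right|left|by right].
  by rewrite h lexx.
by apply/eqP; rewrite eq_le; case: h => -> ->.
Qed.

Lemma layer_exhausts : exhausts layer.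
Proof.
split; first exact: measurable_layer.
apply: aeW => x; have := t0 x; rewrite le_eqVlt => /predU1P[e|tx]; first by exists 0%N => k _; left.
have [k1 h1] : exists k1 : nat, (t x)^-1 < k1.+1%:R.
  by exists (Num.trunc (t x)^-1); rewrite truncnS_gt.
have [k2 h2] : exists k2 : nat, t x < k2.+1%:R by exists (Num.trunc (t x)); rewrite truncnS_gt.
exists (maxn k1 k2) => k; rewrite geq_max => /andP[kk1 kk2]; right; split.
  rewrite -[leRHS]invrK lef_pV2 ?posrE ?invr_gt0//; apply: ltW; apply: lt_le_trans h1 _.
  by rewrite ler_nat.
by apply: ltW; apply: lt_le_trans h2 _; rewrite ler_nat.
Qed.

Lemma layer_sqrt k f : supp (layer k) f -> exists h, rmulrel r f h.
Proof.
move=> fs; apply: (rmul_supp measurable_sqrt (measurable_layer k) (k := Num.sqrt k.+1%:R)) fs => x /= h.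
by rewrite ger0_norm ?sqrtr_ge0// ler_wsqrtr//; case: h => [->|[]].
Qed.

(** Multiplication by r equals the adjoint of its restriction to vectors supported in a single
    layer. *)
Lemma rmulrel_of_layers (u w : H) :
  (forall k (v z : H), supp (layer k) v -> rmulrel r v z -> ip u z = ip w v) -> rmulrel r u w.
Proof.
move=> h; rewrite rmulrelE.
suff h' : mulrel (fun x => (((r x)%:C%C)%:M : 'M[R[i]]_N)^t*) u w.
  by aeuse h' => x ->; rewrite scalar_adj; congr (_%:M *m _);
     apply: complex_ext; rewrite ?cReJ ?cImJ//= oppr0.
apply: (adj_mulrel (c := fun k => k.+1%:R) layer_exhausts).
- by apply: mmeas_scalar; apply: cmeas_real; exact: measurable_sqrt.
- by move=> k; exact: ler0n.
- move=> k x v /= hx; rewrite mul_scalar_mx l2norm_sqrZ normc_sqr /= expr0n /= addr0.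
  rewrite ler_wpM2r ?sqr_ge0// /r sqr_sqrtr//; case: hx => [->|[]//]; exact: ler0n.
move=> k v z sv vz; apply: h (restr_supp (measurable_layer k) sv) _.
by rewrite rmulrelE.
Qed.

Section Uniqueness.
Variable S : H -> H -> Prop.
Hypothesis S_adj : forall a b, S a b <-> hadj S a b.
Hypothesis S_ge0 : forall a b, S a b -> 0 <= ip a b.
Hypothesis S_sqr : forall a b, hcomp S S a b <-> rmulrel t a b.

Let S_D a b c d : S a c -> S b d -> S (a + b) (c + d).
Proof. by move=> /S_adj h1 /S_adj h2; apply/S_adj => u w h; rewrite !ipDl (h1 _ _ h) (h2 _ _ h). Qed.

Let S_Z (k : R[i]) a b : S a b -> S (k *: a) (k *: b).
Proof. by move=> /S_adj h1; apply/S_adj => u w h; rewrite !ipZl (h1 _ _ h). Qed.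

Let S_B a b c d : S a c -> S b d -> S (a - b) (c - d).
Proof. by move=> h1 h2; apply: S_D => //; rewrite -scaleN1r -[- d]scaleN1r; exact: S_Z. Qed.

(* T - c = (S + sqrt c) (S - sqrt c), and S + sqrt c is bounded below by sqrt c. *)
Let sqrt_step (k : R) f g h : 0 <= k -> S f g -> S g h ->
  k ^+ 2 * nrm (g - k%:C%C *: f) ^+ 2 <= nrm (h - (k ^+ 2)%:C%C *: f) ^+ 2.
Proof.
move=> k0 Sfg Sgh; set u := g - _; pose w := h - k%:C%C *: g.
have Suw : S u w by apply: S_B => //; exact: S_Z.
have e : h - (k ^+ 2)%:C%C *: f = w + k%:C%C *: u.
  by rewrite /w /u scalerBr scalerA -rmorphM -expr2 addrA subrK.
move: u w Suw e => u w Suw ->.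
have uw : 0 <= rip u w.
  by have := S_ge0 Suw; rewrite /rip lecE => /andP[_].
have hH := @L2class_hilbert R n N.
rewrite [X in _ * X](hnorm_sqr hH) [X in _ <= X](hnorm_sqr hH).
rewrite (ripDl hH) !(ripDr hH) !(ripZl hH) !(ripZr hH) (ripC hH w u).
have := rip_ge0 hH w; move: uw; move: (rip u w) (rip u u) (rip w w) => p q z p0 z0.
by have := mulr_ge0 k0 p0; nra.
Qed.

(** On a band [lo, lo + w] both S and r differ from the constant sqrt(lo) by at most a multiple of w
    / sqrt(kappa). The band is halved j times: joining two halves costs a factor 2 in the squared
    error, as the images under S are not known to be orthogonal, while halving the width gains a
    factor 4. *)
Let band_bound (kappa : R) : 0 < kappa -> forall (j : nat) (lo w : R), kappa <= lo -> 0 <= w ->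
  forall f, supp [set x | lo <= t x /\ t x <= lo + w] f ->
  exists g h, [/\ S f g, rmulrel r f h & nrm (g - h) ^+ 2 <= 4 * w ^+ 2 / kappa * 2^-1 ^+ j * nrm f ^+ 2].
Proof.
move=> kp; elim=> [|j IH] lo w klo w0 f fs.
  have lop := lt_le_trans kp klo.
  have [tf Tf] : exists tf, rmulrel t f tf.
    apply: (rmul_supp mt (measurable_band lo (lo + w)) (k := lo + w)) fs => x [h1 h2].
    by rewrite ger0_norm.
  have [h Rf] : exists h, rmulrel r f h.
    apply: (rmul_supp measurable_sqrt (measurable_band lo (lo + w)) (k := Num.sqrt (lo + w))) fs => x [h1 h2].
    by rewrite ger0_norm ?sqrtr_ge0// ler_wsqrtr.
  have [g Sfg Sgt] := (S_sqr f tf).2 Tf.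
  exists g, h; split=> //.
  pose k := Num.sqrt lo; have kk : k ^+ 2 = lo by rewrite sqr_sqrtr// ltW.
  have k0 : 0 < k by rewrite sqrtr_gt0.
  have b1 : nrm (tf - lo%:C%C *: f) ^+ 2 <= w ^+ 2 * nrm f ^+ 2.
    apply: (rmul_nrm _ _ fs (rmulrelB lo Tf)) => [x [h1 h2]|]; last exact: sqr_ge0.
    by apply: lerXn2r; rewrite ?nnegrE; lra.
  have b2 : nrm (h - k%:C%C *: f) ^+ 2 <= (w ^+ 2 / kappa) * nrm f ^+ 2.
    apply: (rmul_nrm _ _ fs (rmulrelB k Rf)) => [x [h1 h2]|]; last by rewrite divr_ge0 ?sqr_ge0// ltW.
    have rr : r x ^+ 2 = t x by rewrite sqr_sqrtr.
    have r0 : 0 <= r x by exact: sqrtr_ge0.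
    have lk : lo <= r x ^+ 2 by rewrite rr.
    have lkr : k <= r x by apply: le_of_sqr r0 _; rewrite kk.
    have e1 : (r x - k) ^+ 2 * k ^+ 2 <= (r x ^+ 2 - k ^+ 2) ^+ 2.
      rewrite subr_sqr exprMn ler_wpM2l ?sqr_ge0//.
      by apply: lerXn2r; rewrite ?nnegrE; move: r0 k0; lra.
    rewrite ler_pdivlMr//; apply: (@le_trans _ _ ((r x - k) ^+ 2 * k ^+ 2)).
      by rewrite ler_wpM2l ?sqr_ge0// kk.
    apply: le_trans e1 _; apply: lerXn2r; rewrite ?nnegrE ?rr ?kk; lra.
  have b3 : nrm (g - k%:C%C *: f) ^+ 2 <= (w ^+ 2 / kappa) * nrm f ^+ 2.
    have := sqrt_step (ltW k0) Sfg Sgt; rewrite kk => b3.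
    rewrite mulrAC ler_pdivlMr//; apply: le_trans b1; apply: le_trans b3.
    by rewrite mulrC ler_wpM2r ?sqr_ge0.
  apply: le_trans (nrmB2 b3 b2) _; rewrite expr0 mulr1.
  by move: (nrm f ^+ 2) => q; lra.
have w20 : 0 <= w / 2 by rewrite divr_ge0.
pose B1 := [set x | lo <= t x /\ t x <= lo + w / 2].
have mB1 : measurable B1 by exact: measurable_band.
have s1 : supp [set x | lo <= t x /\ t x <= lo + w / 2] (restr B1 f).
  exact: supp_restr.
have s2 : supp [set x | lo + w / 2 <= t x /\ t x <= lo + w / 2 + w / 2] (restr (~` B1) f).
  apply: supp_sub (supp_restrI (measurableC mB1) fs) => x /= [nB [h1 h2]].
  have h3 : lo + w / 2 < t x by rewrite ltNge; apply/negP => h; apply: nB.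
  by split; [exact: ltW|lra].
have [g1 [h1 [S1 R1 n1]]] := IH _ _ klo w20 _ s1.
have klo2 : kappa <= lo + w / 2 by lra.
have [g2 [h2 [S2 R2 n2]]] := IH _ _ klo2 w20 _ s2.
exists (g1 + g2), (h1 + h2); rewrite [X in S X](restr_split f mB1); split; first exact: S_D.
  by rewrite [X in rmulrel r X](restr_split f mB1); exact: rmulrelD.
have -> : g1 + g2 - (h1 + h2) = (g1 - h1) + (g2 - h2) by rewrite opprD addrACA.
apply: le_trans (nrm_sqrD2 _ _) _; rewrite [X in _ <= _ * X](restr_nrm_split f mB1) (exprS 2^-1 j).
move: n1 n2; rewrite expr_div_n.
move: (nrm (g1 - h1) ^+ 2) (nrm (g2 - h2) ^+ 2) (nrm (restr B1 f) ^+ 2) (nrm (restr (~` B1) f) ^+ 2) (2^-1 ^+ j) => p1 p2 p3 p4 p5.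
rewrite (_ : 4 * (w ^+ 2 / 2 ^+ 2) / kappa * p5 = w ^+ 2 / kappa * p5); last by field; rewrite gt_eqF.
rewrite (_ : 4 * w ^+ 2 / kappa * (2^-1 * p5) = 2 * (w ^+ 2 / kappa * p5)); last by field; rewrite gt_eqF.
move: (w ^+ 2 / kappa * p5) => q; lra.
Qed.

Let band_eq (lo w : R) f : 0 < lo -> 0 <= w -> supp [set x | lo <= t x /\ t x <= lo + w] f ->
  exists2 h, rmulrel r f h & S f h.
Proof.
move=> lop w0 fs.
have [h Rf] : exists h, rmulrel r f h.
  apply: (rmul_supp measurable_sqrt (measurable_band lo (lo + w)) (k := Num.sqrt (lo + w))) fs => x [h1 h2].
  by rewrite ger0_norm ?sqrtr_ge0// ler_wsqrtr.
exists h => //; apply/S_adj => u v Suv.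
(* S f g_j with g_j --> h: pass to the limit in ip f v = ip g_j u. *)
have gj j : exists2 g, S f g & nrm (g - h) ^+ 2 <= 4 * w ^+ 2 / lo * nrm f ^+ 2 * 2^-1 ^+ j.
  have [g [h' [Sg Rh n1]]] := band_bound lop j (lexx lo) w0 fs.
  exists g => //; rewrite (_ : h = h') 1?mulrAC//.
  by move: Rf Rh; rewrite rmulrelE; exact: mulrel_fun.
have hH := @L2class_hilbert R n N.
have [g0 Sg0] : exists g0, S f g0 by have [g Sg _] := gj 0%N; exists g.
have key (d z : H) : (forall g, S f g -> rip g d = rip f z) -> rip h d = rip f z.
  move=> hd; apply/eqP; rewrite -subr_eq0; apply/eqP.
  apply: sqr_small_eq0 (4 * w ^+ 2 / lo * nrm f ^+ 2 * nrm d ^+ 2) _ => j.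
  have [g Sg n1] := gj j; rewrite -(hd _ Sg) -(ripBl hH) -real_normK ?num_real//.
  have := cauchy_schwarz hH (h - g) d; rewrite (hnormB hH h g) => cs.
  apply: le_trans (lerXn2r 2 _ _ cs) _; rewrite ?nnegrE ?mulr_ge0 ?hnorm_ge0//.
  rewrite exprMn [X in _ <= X]mulrAC ler_wpM2r ?sqr_ge0//.
apply: ip_ext; symmetry.
  by apply: key => g /S_adj /(_ _ _ Suv) e; rewrite /rip e.
rewrite !ripJ; congr (- _).
by apply: key => g /S_adj /(_ _ _ Suv) e; rewrite /rip !ipZr e.
Qed.

(** On the zero set of t one has S^2 f = 0, hence |S f|^2 = <f, S^2 f> = 0; the rest of the layer
    lies in one band away from zero. *)
Let core k f : supp (layer k) f -> exists2 h, rmulrel r f h & S f h.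
Proof.
move=> fs; pose B0 := [set x | 0 <= t x /\ t x <= 0].
have mB0 : measurable B0 by exact: measurable_band.
have s0 : supp B0 (restr B0 f) by exact: supp_restr.
have k1 : 0 < k.+1%:R^-1 :> R by rewrite invr_gt0.
have s1 : supp [set x | k.+1%:R^-1 <= t x /\ t x <= k.+1%:R^-1 + k.+1%:R] (restr (~` B0) f).
  apply: supp_sub (supp_restrI (measurableC mB0) fs) => x /= [nB [h|[h1 h2]]].
    by case: nB; rewrite /B0 /= h.
  by split => //; rewrite (le_trans h2)// lerDr ltW.
have [h1 R1 S1] := band_eq k1 (ler0n _ _) s1.
have z0 : rmulrel r (restr B0 f) 0.
  aeuse s0, (@rep0 R n N) => x h ->; have [Bx|nB] := pselect (B0 x); last by rewrite h// scaler0.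
  have -> : r x = 0 by rewrite /r ler0_sqrtr//; case: Bx.
  by rewrite scale0r.
have S0 : S (restr B0 f) 0.
  have T0 : rmulrel t (restr B0 f) 0.
    aeuse s0, (@rep0 R n N) => x h ->; have [[b1 b2]|nB] := pselect (B0 x); last by rewrite h// scaler0.
    by rewrite (_ : t x = 0) ?scale0r//; apply/eqP; rewrite eq_le b1 b2.
  have [g Sg Sg0] := (S_sqr _ _).2 T0.
  rewrite (_ : 0 = g)//; symmetry; apply: rip_self_eq0.
  rewrite /rip; have /S_adj /(_ _ _ Sg0) <- := Sg.
  by rewrite -(scale0r (0 : H)) ipZr mul0r.
by exists (0 + h1); rewrite (restr_split f mB0); [exact: rmulrelD|exact: S_D].
Qed.

(** [core] and the symmetry of S place S inside multiplication by r. The latter is symmetric, so it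
    lies in the adjoint of S, which is S. *)
Lemma sqrt_unique a b : S a b <-> rmulrel r a b.
Proof.
have sub u w : S u w -> rmulrel r u w.
  move=> /S_adj Suw; apply: rmulrel_of_layers => k v z sv vz.
  have [h rh Svh] := core sv; rewrite (_ : z = h); first exact: Suw.
  by move: rh; move: vz; rewrite rmulrelE; exact: mulrel_fun.
split; first exact: sub.
by move=> h; apply/S_adj => u w /sub Ruw; symmetry; exact: rmulrel_ip h Ruw.
Qed.
End Uniqueness.

(** If a and c = t a are square integrable, so is r a, because r a = (r / (1 + t)) (a + c) with a
    coefficient of size at most 1. *)
Lemma rmulrel_sqrt_sqr a c : hcomp (rmulrel r) (rmulrel r) a c <-> rmulrel t a c.
Proof.
have rr x : (r x)%:C%C * (r x)%:C%C = (t x)%:C%C :> R[i] by rewrite -rmorphM /= -expr2 sqr_sqrtr.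
split.
  by move=> [b h1 h2]; aeuse h1, h2 => x e ->; rewrite e scalerA rr.
move=> h; pose s x := r x / (1 + t x).
have t1 x : 0 < 1 + t x by rewrite ltr_pwDl.
have sE x : s x * (1 + t x) = r x by rewrite divfK// gt_eqF.
have bs : mbounded (fun x => ((s x)%:C%C)%:M : 'M[R[i]]_N).
  apply: (@mbounded_scalar _ _ _ _ 1).
    apply: cmeas_real; apply: measurable_funM; first exact: measurable_sqrt.
    by apply: measurableT_comp measurable_inv _; exact: measurable_funD.
  move=> x; rewrite /normc /= expr0n /= addr0 sqrtr_sqr.
  have s0 : 0 <= s x by rewrite /s divr_ge0 ?sqrtr_ge0// ltW.
  rewrite (ger0_norm s0) /s ler_pdivrMr// mul1r.
  have : r x ^+ 2 = t x by rewrite sqr_sqrtr.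
  by have := sqr_ge0 (r x - 1); rewrite !expr2; have := t0 x; nra.
exists (mop (fun x => ((s x)%:C%C)%:M) (a + c)).
  aeuse (rep_mop (a + c) bs), (repD a c), h => x -> -> ->.
  by rewrite mul_scalar_mx -[X in X + _]scale1r -scalerDl scalerA -rmorphD -rmorphM /= sE.
aeuse (rep_mop (a + c) bs), (repD a c), h => x -> -> ->.
rewrite mul_scalar_mx -[X in X + _]scale1r -scalerDl !scalerA; congr (_ *: _).
by rewrite -rmorphD -!rmorphM /= -(mulrA (r x)) sE -expr2 sqr_sqrtr.
Qed.
End SquareRoot.

(** * The square root of a nonnegative multiplier as an operator on functions *)

Section OperatorSquareRoot.
Context {R : realType} {n N : nat}.
Local Notation mu := (@lebesgue_Rn R n).
Local Notation X := (Rn R n).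
Local Notation H := (L2class R n N).
Local Notation nrm := (hnorm (@rip R n N)).
Local Notation F := (@fourier R n N).
Local Notation G := (@ifourier R n N).
Local Opaque hnorm l2norm L2.
Implicit Types (a b c d : H) (f g h : vfun R n N).

Lemma lift_rep (T : H -> H -> Prop) a b : flift T (rep (G a)) (rep (G b)) <-> T a b.
Proof.
rewrite /flift (repG a) (repG b); split=> [[]//|Tab].
by split=> //; exact: L2_rep.
Qed.

Lemma lift_self_adjoint (T : H -> H -> Prop) :
  (forall b (e : R), 0 < e -> exists a c, T a c /\ nrm (b - a) < e) ->
  (forall a b, T a b <-> hadj T a b) -> self_adjoint (flift T).
Proof.
move=> hd ha; split.
  rewrite (_ : dom (flift T) = range_op (op_inv (flift T)))// lift_inv.
  apply: lift_dense => b e e0.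
  by have [a [c [Tac n1]]] := hd b e e0; exists c, a.
by move=> f g; rewrite lift_adj; split=> -[fL gL /ha].
Qed.

(** Equality with its own adjoint makes an operator on functions invariant under almost everywhere
    changes, so it comes from a relation on classes. This covers the unknown root S in [op_sqrt]. *)
Lemma self_adjoint_lift (S : op R n N) : self_adjoint S ->
  exists T : H -> H -> Prop, S = flift T /\ forall a b, T a b <-> hadj T a b.
Proof.
move=> [_ hS]; exists (fun a b => S (rep (G a)) (rep (G b))).
set T := fun a b => _.
have e : S = flift T.
  have inv f f' g g' : L2 f' -> L2 g' -> aeeq f f' -> aeeq g g' -> S f g -> S f' g'.
    move=> f'L g'L ef eg Sfg; have [fL gL h] := (hS f g).1 Sfg.
    apply: (hS f' g').2; split; [exact: f'L|exact: g'L|] => u w Suw.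
    have [uL wL _] := (hS u w).1 Suw.
    have e1 := inner_aeeq fL f'L wL wL ef (aeeq_refl w).
    have e2 := inner_aeeq gL g'L uL uL eg (aeeq_refl u).
    exact: etrans (esym e1) (etrans (h u w Suw) e2).
  apply: op_ext => f g; rewrite /flift /T (fourierK (cls f)) (fourierK (cls g)); split.
    move=> Sfg; have [fL gL _] := (hS f g).1 Sfg; split; [exact: fL|exact: gL|].
    apply: (inv f _ g _ _ _ _ _ Sfg); [exact: L2_rep|exact: L2_rep| |].
      exact: aeeq_sym (rep_cls fL).
    exact: aeeq_sym (rep_cls gL).
  move=> [fL gL Sfg]; exact: (inv _ f _ g fL gL (rep_cls fL) (rep_cls gL) Sfg).
split; [exact: e|] => a b; have := hS (rep (G a)) (rep (G b)).
by rewrite [in X in op_adj X]e lift_adj lift_rep.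
Qed.

Variable t : X -> R.
Hypothesis mt : measurable_fun setT t.
Hypothesis t0 : forall x, 0 <= t x.
Let r x := Num.sqrt (t x).

Lemma rmulrel_ge0 a b : rmulrel r a b -> 0 <= ip a b.
Proof.
move=> h; have mr : measurable_fun setT r by exact: measurable_sqrt.
have ma := rint_meas (rint_rep a).
rewrite ipE (_ : cintegral _ = cintegral (fun x => (r x * l2norm (rep a x) ^+ 2)%:C%C)).
  rewrite lecE /=; apply/andP; split; first by rewrite Rintegral_cst// mul0r.
  by apply: Rintegral_ge0 => x _; rewrite mulr_ge0 ?sqrtr_ge0 ?sqr_ge0.
apply: cintegral_ae.
- by apply: vmeas_cdot; exact: rep_vmeas.
- by apply: cmeas_real; exact: measurable_funM.
by aeuse h => x -> _; rewrite cdotZr cdotuu -rmorphM.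
Qed.

Lemma op_sqrt_lift : op_sqrt (flift (rmulrel (N := N) t)) = flift (rmulrel r).
Proof.
have sq := rmulrel_sqrt_sqr (N := N) mt t0.
apply: op_ext => f g; split.
  move=> [S [/self_adjoint_lift[T [-> Tadj]] pos sqr]].
  have TE a b : T a b <-> rmulrel r a b.
    apply: (sqrt_unique mt t0 Tadj).
      by move=> c d /lift_rep /pos; rewrite -(ip_cls (L2_rep _) (L2_rep _)) !clsK -ip_fourier !ifourierK.
    by move=> c d; rewrite -(lift_rep (hcomp T T)) -lift_comp sqr lift_rep.
  by move=> [fL gL /TE].
move=> Rfg; exists (flift (rmulrel r)); split; last exact: Rfg.
- apply: lift_self_adjoint.
    move=> b e e0; have lx := layer_exhausts mt t0.
    have [k0 /(_ _ (leqnn _)) hk] := restr_cvg b lx e0; have [ml _] := lx.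
    have [c hc] := layer_sqrt mt (supp_restr b (ml k0)).
    exists (restr (layer t k0) b), c; split=> //.
    by rewrite [X in nrm (X - _)](restr_split b (ml k0)) addrAC subrr add0r.
  move=> a b; split.
    by move=> h u w h'; symmetry; exact: rmulrel_ip h h'.
  by move=> h; apply: (rmulrel_of_layers mt t0) => k v z _; exact: h.
- by move=> u w [uL wL /rmulrel_ge0]; rewrite ip_fourier ip_cls.
- by move=> u w; rewrite lift_comp; split=> -[uL wL /sq].
Qed.
End OperatorSquareRoot.

(** * Constant matrices commute with the Fourier transform *)

Section FourierMatrix.
Context {R : realType} {n N : nat}.
Local Notation mu := (@lebesgue_Rn R n).
Local Notation X := (Rn R n).
Local Notation H := (L2class R n N).
Local Notation F := (@fourier R n N).
Local Notation G := (@ifourier R n N).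
Local Opaque hnorm l2norm L2.
Implicit Types (a b c d : H) (M : 'M[R[i]]_N).

Lemma mbounded_cst M : mbounded (fun _ : X => M).
Proof.
split; first exact: mmeas_cst.
by have [c c0 h] := mulmx_bounded M; exists c.
Qed.

Definition cmx M : H -> H := mop (fun=> M).

Lemma rep_cmx M a : \forall x \ae mu, rep (cmx M a) x = M *m rep a x.
Proof. exact: rep_mop (mbounded_cst M). Qed.

Lemma cmx_adj M a b : ip (cmx M a) b = ip a (cmx (M^t*) b).
Proof. exact: mop_adj (mbounded_cst M). Qed.

Lemma cmxZ M z a : cmx M (z *: a) = z *: cmx M a.
Proof. exact: mopZ (mbounded_cst M). Qed.

Lemma rep_sum I (s : seq I) (f : I -> H) :
  \forall x \ae mu, rep (\sum_(i <- s) f i) x = \sum_(i <- s) rep (f i) x.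
Proof.
elim: s => [|i s IH].
  by rewrite big_nil; aeuse (@rep0 R n N) => x ->; rewrite big_nil.
rewrite big_cons; aeuse (repD (f i) (\sum_(j <- s) f j)), IH => x -> ->.
by rewrite big_cons.
Qed.

Lemma cmx_gv M j (s : 'I_n -> R) i : (forall k, 0 < s k) ->
  cmx M (gv j s i) = \sum_l M l i *: gv j s l.
Proof.
move=> s0; apply: rep_ext.
have h1 i' : \forall x \ae mu, rep (gv j s i') x = (gprod j s x)%:C%C *: delta_mx i' 0.
  by rewrite gvE; exact: rep_clsE (L2_gv _ _ s0).
have h2 : \forall x \ae mu, forall i' : 'I_N, rep (gv j s i') x = (gprod j s x)%:C%C *: delta_mx i' 0.
  exact: filter_forall.
have h3 : \forall x \ae mu, forall l : 'I_N, rep (M l i *: gv j s l) x = M l i *: rep (gv j s l) x.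
  by apply: filter_forall => l; exact: repZ.
aeuse (rep_cmx M (gv j s i)), (rep_sum (index_enum _) (fun l => M l i *: gv j s l)), h2, h3.
move=> x -> -> e e'; under [RHS]eq_bigr do rewrite e' e.
rewrite e -scalemxAr -colE; apply/matrixP => p q; rewrite summxE !mxE.
rewrite (bigD1 p)//= big1 ?addr0 => [|l lp].
  by rewrite !mxE !eqxx ord1 /= mulr1 mulrC.
by rewrite !mxE eq_sym (negbTE lp) /= !mulr0.
Qed.

Lemma fourier_sum I (s : seq I) (f : I -> H) : F (\sum_(i <- s) f i) = \sum_(i <- s) F (f i).
Proof. by elim: s => [|i s IH]; rewrite ?big_nil ?fourier0// !big_cons fourierD IH. Qed.

(** A constant matrix only mixes the components of a Gaussian vector, and the Fourier coefficient
    does not depend on the component. *)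
Lemma fourier_cmx M a : F (cmx M a) = cmx M (F a).
Proof.
apply: fourier_ext => j s i s0.
rewrite ip_fourier cmx_adj cmx_adj -ip_fourier; congr (ip (F a) _).
rewrite (fourier_gv j i s0) cmxZ.
have si0 k : 0 < sinv s k by rewrite invr_gt0.
rewrite (cmx_gv (M^t*) (fun k => j k : nat) i s0) (cmx_gv (M^t*) (fun k => j k : nat) i si0).
rewrite fourier_sum scaler_sumr; apply: eq_bigr => l _.
by rewrite fourierZ (fourier_gv j l s0) !scalerA mulrC.
Qed.
End FourierMatrix.

(** * The symbol of the free Dirac operator and its square *)

Section DiracSymbol.
Context {R : realType} {n N : nat}.
Local Notation mu := (@lebesgue_Rn R n).
Local Notation X := (Rn R n).
Local Notation H := (L2class R n N).
Local Notation F := (@fourier R n N).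
Local Notation G := (@ifourier R n N).
Local Opaque hnorm l2norm L2.
Implicit Types (a b c d : H).
Variables (alpha : 'I_n.+1 -> 'M[R[i]]_N) (m : R).
Hypothesis halpha : dirac_matrices alpha.

Definition dsym (x : X) : 'M[R[i]]_N :=
  \sum_(k < n) ((tnth x k)%:C%C *: alpha (lift ord_max k)) + m%:C%C *: alpha ord_max.

Definition energy2 (x : X) : R := \sum_(k < n) tnth x k ^+ 2 + m ^+ 2.

Lemma dsym_adj x : (dsym x)^t* = dsym x.
Proof.
have [ha _] := halpha; apply/matrixP => p q; rewrite !mxE !summxE rmorphD rmorph_sum.
have e (r : R) k : (r%:C%C * alpha k q p)^* = r%:C%C * alpha k p q.
  rewrite rmorphM /=; congr (_ * _); first by apply: complex_ext; rewrite ?cReJ ?cImJ//= oppr0.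
  by have /matrixP/(_ p q) := ha k; rewrite !mxE.
by congr (_ + _); [apply: eq_bigr => k _; rewrite !mxE; exact: e|exact: e].
Qed.

(** Adding the double sum to itself with the two indices exchanged leaves only anticommutators. *)
Lemma clifford_sqr (c : 'I_n.+1 -> R[i]) :
  (\sum_j c j *: alpha j) *m (\sum_j c j *: alpha j) = (\sum_j c j ^+ 2)%:M.
Proof.
have [_ ha] := halpha; set S := _ *m _.
have e1 : S = \sum_j \sum_l (c j * c l) *: (alpha j *m alpha l).
  rewrite /S mulmx_suml; apply: eq_bigr => j _; rewrite mulmx_sumr; apply: eq_bigr => l _.
  by rewrite -scalemxAl -scalemxAr scalerA.
have e2 : S = \sum_j \sum_l (c j * c l) *: (alpha l *m alpha j).
  rewrite e1 exchange_big /=; apply: eq_bigr => j _; apply: eq_bigr => l _.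
  by rewrite mulrC.
have e3 : S + S = (\sum_j c j ^+ 2)%:M + (\sum_j c j ^+ 2)%:M.
  rewrite {1}e1 e2 -big_split /=.
  rewrite -raddfD /= -mulr2n -mulr_natl mulr_sumr raddf_sum; apply: eq_bigr => j _.
  rewrite -big_split /= (bigD1 j)//= big1 ?addr0 => [|l lj].
    by rewrite -scalerDr ha eqxx scale_scalar_mx expr2 mulrC.
  by rewrite -scalerDr ha eq_sym (negbTE lj) mul0rn scale_scalar_mx mulr0 raddf0.
have hf (T : 'M[R[i]]_N) : (2^-1 : R[i]) *: (T + T) = T.
  by rewrite -[T in T + _]scale1r -[T in _ + T]scale1r -scalerDl scalerA mulVf ?scale1r// pnatr_eq0.
by rewrite -[S]hf e3 hf.
Qed.

Lemma dsym_sqr x : dsym x *m dsym x = (energy2 x)%:C%C%:M.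
Proof.
pose c (j : 'I_n.+1) : R[i] := if unlift ord_max j is Some k then (tnth x k)%:C%C else m%:C%C.
have e (T : zmodType) (f : 'I_n.+1 -> T) : \sum_j f j = \sum_(k < n) f (lift ord_max k) + f ord_max.
  rewrite big_ord_recr /=; congr (_ + _); apply: eq_bigr => k _; congr f.
  by apply: val_inj; rewrite /= /bump leqNgt ltn_ord.
have -> : dsym x = \sum_j c j *: alpha j.
  rewrite e /c unlift_none; congr (_ + _); apply: eq_bigr => k _.
  by rewrite liftK.
rewrite clifford_sqr; congr (_%:M); rewrite e /c unlift_none /energy2 rmorphD rmorphXn rmorph_sum /=.
by congr (_ + _); apply: eq_bigr => k _; rewrite liftK rmorphXn.
Qed.

Lemma energy2_ge0 x : 0 <= energy2 x.
Proof. by rewrite addr_ge0 ?sqr_ge0// sumr_ge0// => k _; exact: sqr_ge0. Qed.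

Lemma dsym_norm x u : l2norm (dsym x *m u) ^+ 2 = energy2 x * l2norm u ^+ 2.
Proof.
rewrite !l2norm_sqr cdotMl mulmxA dsym_adj dsym_sqr mul_scalar_mx cdotZr cdotuu.
by rewrite -rmorphM.
Qed.

Lemma measurable_energy2 : measurable_fun setT energy2.
Proof.
apply: measurable_funD => //; apply: measurable_sum => k.
by apply: measurable_funX; exact: measurable_tnth.
Qed.

Lemma mmeas_dsym : mmeas dsym.
Proof.
move=> p q; rewrite (_ : (fun x => _) = fun x => \sum_(k < n) (tnth x k)%:C%C * alpha (lift ord_max k) p q
    + m%:C%C * alpha ord_max p q); last first.
  by apply/funext => x; rewrite !mxE summxE; congr (_ + _); apply: eq_bigr => k _; rewrite !mxE.
apply: cmeasD; last exact: cmeas_cst.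
apply: cmeas_sum => k; apply: cmeasM; last exact: cmeas_cst.
by apply: cmeas_real; exact: measurable_tnth.
Qed.
End DiracSymbol.

(** * The free Dirac operator is the multiplier with this symbol *)

Section FreeDirac.
Context {R : realType} {n N : nat}.
Local Notation mu := (@lebesgue_Rn R n).
Local Notation X := (Rn R n).
Local Notation H := (L2class R n N).
Local Notation F := (@fourier R n N).
Local Notation G := (@ifourier R n N).
Local Opaque hnorm l2norm L2.
Implicit Types (a b c d : H) (f g h : vfun R n N).
Variables (alpha : 'I_n.+1 -> 'M[R[i]]_N) (m : R).
Hypothesis halpha : dirac_matrices alpha.
Local Notation D := (dsym alpha m).
Local Notation e2 := (energy2 m).

Definition dirac_expr (b : 'I_n -> H) a : H :=
  - 'i%C *: \sum_k cmx (alpha (lift ord_max k)) (b k) + m%:C%C *: cmx (alpha ord_max) a.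

Lemma rep_dirac_expr (bs : 'I_n -> H) a : \forall x \ae mu, rep (dirac_expr bs a) x =
  - 'i%C *: \sum_k (alpha (lift ord_max k) *m rep (bs k) x) + m%:C%C *: (alpha ord_max *m rep a x).
Proof.
set s := \sum_k cmx (alpha (lift ord_max k)) (bs k).
have h1 : \forall x \ae mu, forall k : 'I_n, rep (cmx (alpha (lift ord_max k)) (bs k)) x =
    alpha (lift ord_max k) *m rep (bs k) x by apply: filter_forall => k; exact: rep_cmx.
have h2 := rep_sum (index_enum _) (fun k => cmx (alpha (lift ord_max k)) (bs k)).
have h3 := rep_cmx (alpha ord_max) a.
have h4 : \forall x \ae mu, rep (dirac_expr bs a) x = - 'i%C *: rep s x + m%:C%C *: rep (cmx (alpha ord_max) a) x.
  aeuse (repD (- 'i%C *: s) (m%:C%C *: cmx (alpha ord_max) a)), (repZ (- 'i%C) s),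
    (repZ m%:C%C (cmx (alpha ord_max) a)) => x e1 e e'.
  by rewrite /dirac_expr -/s e1 e e'.
aeuse h1, h2, h3, h4 => x e1 e e3 ->; rewrite e3 /s e; congr (_ *: _ + _).
by apply: eq_bigr => k _; exact: e1.
Qed.

Lemma fourier_dirac_expr (bs : 'I_n -> H) a : F (dirac_expr bs a) = dirac_expr (fun k => F (bs k)) (F a).
Proof.
rewrite /dirac_expr fourierD !fourierZ fourier_sum fourier_cmx; congr (_ *: _ + _).
by apply: eq_bigr => k _; rewrite fourier_cmx.
Qed.

Lemma dirac_expr_mulrel (bs : 'I_n -> H) a : (forall k, xmul k a (bs k)) -> mulrel D a (dirac_expr bs a).
Proof.
move=> hx.
have h : \forall x \ae mu, forall k : 'I_n, rep (bs k) x = ('i%C * (tnth x k)%:C%C) *: rep a x.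
  by apply: filter_forall => k; exact: hx.
aeuse h, (rep_dirac_expr bs a) => x e ->.
rewrite /dsym mulmxDl -scalemxAl mulmx_suml scaler_sumr; congr (_ + _); apply: eq_bigr => k _.
rewrite e -scalemxAr scalerA mulrA -scalemxAl; congr (_ *: _).
by rewrite mulNr -expr2 sqr_i opprK mul1r.
Qed.

(* Since (1 + e^2) a = a + D (D a), the functions x_k a are bounded multiples of a and of D a. *)
Lemma xmul_exists a b k : mulrel D a b -> exists c, xmul k a c.
Proof.
move=> h.
have p (x : X) : 0 < 1 + e2 x by rewrite ltr_pwDl// energy2_ge0.
have xe (x : X) : (tnth x k) ^+ 2 <= e2 x.
  rewrite /energy2 (bigD1 k)//= -addrA lerDl addr_ge0 ?sqr_ge0//.
  by rewrite sumr_ge0// => l _; exact: sqr_ge0.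
pose s (x : X) : R := tnth x k / (1 + e2 x).
have ms : measurable_fun setT s.
  apply: measurable_funM; first exact: measurable_tnth.
  by apply: measurableT_comp measurable_inv _; apply: measurable_funD => //; exact: measurable_energy2.
have sE x : s x * (1 + e2 x) = tnth x k by rewrite divfK// gt_eqF.
have s2 x : s x ^+ 2 * (1 + e2 x) <= 1.
  have : 0 <= (1 + e2 x)^-1 by rewrite invr_ge0 ltW.
  have e1 : (1 + e2 x)^-1 * (1 + e2 x) = 1 by rewrite mulVf// gt_eqF.
  rewrite /s exprMn [(_^-1) ^+ 2]expr2; move: (xe x) (p x) e1.
  move: (tnth x k) (e2 x) ((1 + e2 x)^-1) => u v w h1 h2 h3 h4.
  by rewrite -!mulrA h3 mulr1; nra.
have b1 : mbounded (fun x => ((s x)%:C%C)%:M : 'M[R[i]]_N).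
  apply: (@mbounded_scalar _ _ _ _ 1); first exact: cmeas_real.
  move=> x; rewrite /normc /= expr0n /= addr0 sqrtr_sqr.
  apply: le_of_sqr => //; rewrite expr1n real_normK ?num_real//.
  by have := s2 x; have := sqr_ge0 (s x); have := energy2_ge0 m x; nra.
have b2 : mbounded (fun x => ((s x)%:C%C)%:M *m D x).
  split; first by apply: mmeasM; [apply: mmeas_scalar; exact: cmeas_real|exact: mmeas_dsym].
  exists 1 => // x u; rewrite mul1r -mulmxA mul_scalar_mx l2norm_sqrZ dsym_norm//.
  rewrite mulrA normc_sqr /= expr0n /= addr0 ler_piMl ?sqr_ge0//.
  by have := s2 x; have := sqr_ge0 (s x); nra.
pose M1 x : 'M[R[i]]_N := ((s x)%:C%C)%:M.
pose M2 x : 'M[R[i]]_N := ((s x)%:C%C)%:M *m D x.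
exists ('i%C *: (mop M1 a + mop M2 b)).
aeuse (repZ 'i%C (mop M1 a + mop M2 b)), (repD (mop M1 a) (mop M2 b)), (rep_mop a b1), (rep_mop b b2), h.
move=> x -> -> -> -> ->; rewrite mulmxA -(mulmxA _ (D x) (D x)) dsym_sqr// -mulmxDl.
rewrite -scalar_mxM -raddfD mul_scalar_mx scalerA; congr (('i%C * _) *: _).
by rewrite -[X in X + _]mulr1 -mulrDr -rmorphD -rmorphM /= sE.
Qed.

(** Square integrability of D a forces that of every x_k a, so the domain given by separate weak
    derivatives is the whole multiplier domain. *)
Lemma free_dirac_lift : free_dirac alpha m = flift (mulrel D).
Proof.
apply: op_ext => f h; split.
  move=> [fL hL [g gw hE]]; split; [exact: fL|exact: hL|].
  have gL k : L2 (g k) by have [] := gw k.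
  rewrite (_ : cls h = dirac_expr (fun k => cls (g k)) (cls f)).
    by rewrite fourier_dirac_expr; apply: dirac_expr_mulrel => k; exact: weak_partial_xmul.
  apply: rep_ext.
  have h1 : \forall x \ae mu, forall k : 'I_n, rep (cls (g k)) x = g k x.
    by apply: filter_forall => k; exact: rep_clsE.
  aeuse h1, (rep_dirac_expr (fun k => cls (g k)) (cls f)), (rep_clsE hL), (rep_clsE fL), (aeeqE hE).
  move=> x e1 -> -> -> ->; congr (_ *: _ + _).
  by apply: eq_bigr => k _; rewrite e1.
move=> [fL hL Dfh]; have [c hc] := choice (fun k => xmul_exists k Dfh).
split; [exact: fL|exact: hL|]; exists (fun k => rep (G (c k))).
  move=> k; apply: xmul_weak_partial; [exact: fL|exact: L2_rep|].
  by rewrite (repG (c k)).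
have e : F (cls h) = F (dirac_expr (fun k => G (c k)) (cls f)).
  rewrite fourier_dirac_expr; apply: (mulrel_fun Dfh); apply: dirac_expr_mulrel => k.
  by rewrite ifourierK.
have e' : cls h = dirac_expr (fun k => G (c k)) (cls f) by apply: (can_inj (@fourierK R n N)).
apply: aeeqI; aeuse (rep_dirac_expr (fun k => G (c k)) (cls f)), (rep_clsE hL), (rep_clsE fL).
by move=> x + <- <-; rewrite e'.
Qed.
End FreeDirac.

(** * Bounded operators, adjoints, and boundedness of everywhere defined products *)

Section BoundedOperators.
Context {R : realType} {n N : nat}.
Local Notation mu := (@lebesgue_Rn R n).
Local Notation X := (Rn R n).
Local Notation H := (L2class R n N).
Local Notation nrm := (hnorm (@rip R n N)).
Local Notation F := (@fourier R n N).
Local Notation G := (@ifourier R n N).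
Local Opaque hnorm l2norm L2.
Implicit Types (a b c d u w : H).

Record bounded_linear (K : H -> H) : Prop := BoundedLinear {
  blD : forall a b, K (a + b) = K a + K b;
  blZ : forall z a, K (z *: a) = z *: K a;
  bl_bound : exists2 c : R, 0 <= c & forall a, nrm (K a) <= c * nrm a }.

Lemma bl0 K : bounded_linear K -> K 0 = 0.
Proof. by move=> hK; rewrite -(scale0r (0 : H)) (blZ hK) !scale0r. Qed.

Lemma blB K a b : bounded_linear K -> K (a - b) = K a - K b.
Proof. by move=> hK; rewrite (blD hK) -scaleN1r (blZ hK) scaleN1r. Qed.

Lemma bl_mop M : mbounded M -> bounded_linear (mop M).
Proof. by move=> bM; split=> [a b|z a|]; [exact: mopD|exact: mopZ|exact: nrm_mop]. Qed.

Lemma bl_comp K L : bounded_linear K -> bounded_linear L -> bounded_linear (fun a => K (L a)).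
Proof.
move=> hK hL; split=> [a b|z a|]; first by rewrite (blD hL) (blD hK).
  by rewrite (blZ hL) (blZ hK).
have [c1 p1 h1] := bl_bound hK; have [c2 p2 h2] := bl_bound hL.
exists (c1 * c2) => [|a]; first exact: mulr_ge0.
by rewrite -mulrA; apply: le_trans (h1 _) _; rewrite ler_wpM2l.
Qed.

Lemma bl_zero : bounded_linear (fun _ : H => 0 : H).
Proof.
split=> [a b|z a|]; rewrite ?addr0 ?scaler0//.
by exists 0 => // a; rewrite (hnorm0 (@L2class_hilbert R n N)) mul0r.
Qed.

(** Riesz applies to the real part of the inner product; testing with i u recovers the imaginary
    part. *)
Lemma adjoint_exists K : bounded_linear K ->
  exists Ks : H -> H, bounded_linear Ks /\ forall a u, ip (Ks a) u = ip a (K u).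
Proof.
move=> hK; have hH := @L2class_hilbert R n N; have [c c0 hc] := bl_bound hK.
have ex a : exists p, (forall u, ip p u = ip a (K u)) /\ nrm p <= c * nrm a.
  have lD u v : setT u -> setT v -> rip a (K (u + v)) = rip a (K u) + rip a (K v).
    by move=> _ _; rewrite (blD hK) (ripDr hH).
  have lZ r u : setT u -> rip a (K (r%:C%C *: u)) = r * rip a (K u).
    by move=> _; rewrite (blZ hK) (ripZr hH).
  have lb u : setT u -> `|rip a (K u)| <= c * nrm a * nrm u.
    move=> _; apply: le_trans (cauchy_schwarz hH _ _) _.
    by rewrite mulrAC [leLHS]mulrC ler_wpM2r ?hnorm_ge0.
  have ca : 0 <= c * nrm a by rewrite mulr_ge0// hnorm_ge0.
  have [p [hp np]] := riesz hH ca (S := setT) I (fun _ _ _ _ => I) (fun _ _ _ => I) lD lZ lb.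
  exists p; split=> // u; apply: ip_ext; first exact: hp I.
  by rewrite !ripJ -(blZ hK); congr (- _); exact: hp I.
have [Ks hKs] := choice ex; exists Ks; split; last by move=> a u; have [h _] := hKs a; exact: h.
have e a u : ip (Ks a) u = ip a (K u) by have [h _] := hKs a.
split=> [a b|z a|].
- by apply: ip_total_eq => u; rewrite ipDl !e ipDl.
- by apply: ip_total_eq => u; rewrite ipZl !e ipZl.
- by exists c => // a; have [_] := hKs a.
Qed.

Lemma real_mop_adj (j : X -> R) a b : mbounded (fun x => ((j x)%:C%C)%:M : 'M[R[i]]_N) ->
  ip (mop (fun x => ((j x)%:C%C)%:M) a) b = ip a (mop (fun x => ((j x)%:C%C)%:M) b).
Proof.
move=> bj; rewrite mop_adj//; congr (ip _ (mop _ _)); apply/funext => x; rewrite scalar_adj.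
by congr (_%:M); apply: complex_ext; rewrite ?cReJ ?cImJ//= oppr0.
Qed.

Section Multiplication.
Variables (s : X -> R[i]) (M : 'M[R[i]]_N) (j : X -> R).
Hypothesis ms : cmeasurable s.
Hypothesis bj : mbounded (fun x => ((j x)%:C%C)%:M : 'M[R[i]]_N).

(** Vectors are kept on the Fourier side, so a multiplication in position space acts on their
    inverse transforms. *)
Definition prel a b : Prop := \forall x \ae mu, rep (G b) x = s x *: (M *m rep (G a) x).
Let J := mop (fun x => ((j x)%:C%C)%:M : 'M[R[i]]_N).

Hypothesis total : forall a, exists b, prel (J a) b.

Let U (k : nat) := [set x | normc (s x) ^+ 2 <= k%:R].

Let mU k : measurable (U k).
Proof.
have [m1 m2] := ms.
have mn : measurable_fun setT (fun x => normc (s x) ^+ 2).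
  by under eq_fun do rewrite normc_sqr; apply: measurable_funD; exact: measurable_funX.
rewrite (_ : U k = setT `&` (fun x => normc (s x) ^+ 2) @^-1` `]-oo, k%:R]); first exact: mn.
by rewrite setTI; apply/seteqP; split => x /=; rewrite in_itv.
Qed.

Let exU : exhausts U.
Proof.
split; first exact: mU.
apply: aeW => x; exists (Num.trunc (normc (s x) ^+ 2)).+1 => k hk; rewrite /U /=.
by apply: ltW; apply: lt_le_trans (truncnS_gt _) _; rewrite ler_nat.
Qed.

Let bM k : mbounded (fun x => (s x * (\1_(U k) x)%:C%C) *: M).
Proof.
have [c c0 hc] := mulmx_bounded M; split.
  apply: mmeasZ; last exact: mmeas_cst.
  by apply: cmeasM => //; apply: cmeas_real; exact: measurable_indic.
exists (k%:R * c) => [|x u]; first by rewrite mulr_ge0.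
rewrite -scalemxAl l2norm_sqrZ indicE.
have [|_] := boolP (x \in U k); last first.
  by rewrite mulr0 normc_sqr /= expr0n /= addr0 mul0r mulr_ge0 ?sqr_ge0// mulr_ge0.
rewrite inE mulr1 => hx; rewrite -mulrA; apply: ler_pM => //; first exact: sqr_ge0.
exact: sqr_ge0.
Qed.

Lemma prel_fun a b c : prel a b -> prel a c -> b = c.
Proof.
by move=> h1 h2; apply: (can_inj (@ifourierK R n N)); apply: rep_ext; aeuse h1, h2 => x -> ->.
Qed.

(** Where |s|^2 <= k the product is bounded; the vectors Y are the images of the unit ball under the
    adjoints of these cut maps. Against a fixed a they are bounded by the norm of K a, so uniform
    boundedness gives one norm bound, which passes to K itself. *)
Lemma prel_bounded : exists K : H -> H, bounded_linear K /\ forall a, prel (J a) (K a).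
Proof.
have hH := @L2class_hilbert R n N.
have [K hK] := choice total; exists K; split=> //.
have KD a b : K (a + b) = K a + K b.
  apply: (prel_fun (hK _)); have GD c d : G (c + d) = G c + G d.
    by apply: (can_inj (@fourierK R n N)); rewrite fourierD !ifourierK.
  rewrite /prel /J mopD// !GD; aeuse (hK a), (hK b), (repD (G (K a)) (G (K b))), (repD (G (J a)) (G (J b))).
  by move=> x e1 e2 -> ->; rewrite mulmxDr scalerDr e1 e2.
have KZ z a : K (z *: a) = z *: K a.
  apply: (prel_fun (hK _)); have GZ c : G (z *: c) = z *: G c.
    by apply: (can_inj (@fourierK R n N)); rewrite fourierZ !ifourierK.
  rewrite /prel /J mopZ// !GZ; aeuse (hK a), (repZ z (G (K a))), (repZ z (G (J a))).
  by move=> x e1 -> ->; rewrite -scalemxAr scalerA mulrC -scalerA e1.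
split=> //.
pose I := {p : nat * H | nrm p.2 <= 1}.
pose Y (i : I) : H := J (F (mop (fun x => ((s x * (\1_(U (sval i).1) x)%:C%C) *: M)^t*) (sval i).2)).
have cut k a : restr (U k) (G (K a)) = mop (fun x => (s x * (\1_(U k) x)%:C%C) *: M) (G (J a)).
  apply: rep_ext; aeuse (rep_restr (G (K a)) (mU k)), (rep_mop (G (J a)) (bM k)), (hK a) => x -> -> ->.
  by rewrite indicE -scalemxAl; case: (x \in U k); rewrite /= ?mulr1// mulr0 scale0r.
have YE (i : I) a : rip (Y i) a = rip (sval i).2 (restr (U (sval i).1) (G (K a))).
  congr complex.Re; rewrite cut /Y.
  apply: etrans (real_mop_adj _ _ bj) _; rewrite -/(J a) -{1}[J a]ifourierK ip_fourier.
  rewrite (mop_adj _ _ (mbounded_adj (bM _))).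
  by congr (ip _ (mop _ _)); apply/funext => x; rewrite ctrmxK.
have [c hc] : exists c : R, forall i, nrm (Y i) <= c.
  apply: (uniform_boundedness hH) => a; exists (nrm (K a)) => -[[k p] /= hp].
  rewrite YE /=; apply: le_trans (cauchy_schwarz hH _ _) _.
  rewrite -[leRHS]mul1r; apply: ler_pM; rewrite ?hnorm_ge0//.
  apply: le_trans (restr_norm _ (mU k)) _.
  by rewrite -(nrm_fourier (G (K a))) ifourierK.
have c0 : 0 <= c.
  have h0 : nrm (0 : H) <= 1 by rewrite (hnorm0 hH).
  exact: le_trans (hnorm_ge0 _ _) (hc (exist _ (0%N, 0) h0)).
exists c => // a; rewrite -(ifourierK (K a)) nrm_fourier; apply: (restr_nrm_le exU) => k.
set w := restr (U k) (G (K a)).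
have [w0|wp] := leP (nrm w) 0; first by rewrite (le_trans w0)// mulr_ge0 ?hnorm_ge0.
have wn : nrm w != 0 by rewrite gt_eqF.
have h1 : nrm ((nrm w)^-1%:C%C *: w) <= 1.
  by rewrite (hnormZ hH) ger0_norm ?invr_ge0 ?(ltW wp)// mulVf.
have := YE (exist _ (k, (nrm w)^-1%:C%C *: w) h1) a; rewrite /= -/w (ripZl hH) -(hnorm_sqr hH).
rewrite expr2 mulrA (mulVf wn) mul1r => <-.
apply: le_trans (ler_norm _) _; apply: le_trans (cauchy_schwarz hH _ _) _.
by rewrite ler_wpM2r ?hnorm_ge0.
Qed.
End Multiplication.
End BoundedOperators.

(** * The operators |D_m|, G_0 and their square roots as multipliers *)

Section EnergyMultipliers.
Context {R : realType} {n N : nat}.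
Local Notation mu := (@lebesgue_Rn R n).
Local Notation X := (Rn R n).
Local Notation H := (L2class R n N).
Local Notation F := (@fourier R n N).
Local Notation G := (@ifourier R n N).
Local Opaque hnorm l2norm L2.
Implicit Types (a b c d : H).
Variables (alpha : 'I_n.+1 -> 'M[R[i]]_N) (m : R).
Hypothesis halpha : dirac_matrices alpha.
Local Notation D := (dsym alpha m).

Definition energy (x : X) : R := Num.sqrt (energy2 m x).
(** The symbol of G_0^(-1/2); [wdsym] is that of D_m G_0^(-1). *)
Definition weight (x : X) : R := (Num.sqrt (energy x + 1))^-1.
Definition wop : H -> H := mop (fun x => ((weight x)%:C%C)%:M).
Definition wdsym (x : X) : 'M[R[i]]_N := ((weight x ^+ 2)%:C%C)%:M *m D x.

Lemma energy_ge0 x : 0 <= energy x. Proof. exact: sqrtr_ge0. Qed.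
Lemma energy_sqr x : energy x ^+ 2 = energy2 m x.
Proof. by rewrite sqr_sqrtr// energy2_ge0. Qed.
Lemma measurable_energy : measurable_fun setT energy.
Proof. by apply: measurable_sqrt; [exact: measurable_energy2]. Qed.
Lemma measurable_weight : measurable_fun setT weight.
Proof.
apply: measurableT_comp measurable_inv _.
by apply: (measurable_sqrt (t := fun x => energy x + 1)); apply: measurable_funD => //; exact: measurable_energy.
Qed.
Lemma energy1_gt0 x : 0 < energy x + 1. Proof. by rewrite ltr_wpDl// energy_ge0. Qed.
Lemma weight_gt0 x : 0 < weight x. Proof. by rewrite invr_gt0 sqrtr_gt0 energy1_gt0. Qed.
Lemma weight_sqr x : weight x ^+ 2 = (energy x + 1)^-1.
Proof. by rewrite /weight exprVn sqr_sqrtr// ltW// energy1_gt0. Qed.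
Lemma weight_le1 x : weight x <= 1.
Proof.
apply: le_of_sqr => //; rewrite weight_sqr expr1n invf_le1 ?energy1_gt0// lerDr; exact: energy_ge0.
Qed.

Lemma mbounded_real (s : X -> R) (c : R) : measurable_fun setT s -> (forall x, `|s x| <= c) ->
  mbounded (fun x => ((s x)%:C%C)%:M : 'M[R[i]]_N).
Proof.
move=> ms h; apply: (@mbounded_scalar _ _ _ _ c); first exact: cmeas_real.
by move=> x; rewrite /normc /= expr0n /= addr0 sqrtr_sqr.
Qed.

Lemma mbounded_weight : mbounded (fun x => ((weight x)%:C%C)%:M : 'M[R[i]]_N).
Proof.
apply: (mbounded_real (c := 1)); first exact: measurable_weight.
by move=> x; rewrite ger0_norm ?weight_le1// ltW// weight_gt0.
Qed.

Lemma mbounded_wdsym : mbounded wdsym.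
Proof.
split.
  apply: mmeasM; last exact: mmeas_dsym.
  by apply: mmeas_scalar; apply: cmeas_real; apply: measurable_funX; exact: measurable_weight.
exists 1 => // x u; rewrite -mulmxA mul_scalar_mx l2norm_sqrZ dsym_norm// mulrA ler_wpM2r ?sqr_ge0//.
rewrite normc_sqr /= expr0n /= addr0 -energy_sqr -exprMn weight_sqr.
rewrite expr_le1// ?mulr_ge0 ?invr_ge0 ?energy_ge0 ?(ltW (energy1_gt0 x))//.
by rewrite mulrC ler_pdivrMr ?energy1_gt0// mul1r lerDl.
Qed.

Lemma rep_wop a : \forall x \ae mu, rep (wop a) x = (weight x)%:C%C *: rep a x.
Proof. by aeuse (rep_mop a mbounded_weight) => x ->; rewrite mul_scalar_mx. Qed.

Let q x := Num.sqrt (energy x + 1).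
Let qw x : q x * weight x = 1.
Proof. by rewrite /weight divff// gt_eqF// sqrtr_gt0 energy1_gt0. Qed.

Lemma rmulrel_wop a b : rmulrel (fun x => Num.sqrt (energy x + 1)) b a <-> b = wop a.
Proof.
split=> [h|->].
  apply: rep_ext; aeuse h, (rep_wop a) => x -> ->.
  by rewrite scalerA -rmorphM mulrC -/(q x) qw scale1r.
by aeuse (rep_wop a) => x ->; rewrite scalerA -rmorphM -/(q x) qw scale1r.
Qed.

Lemma rmulrel_wop2 a b : rmulrel (fun x => energy x + 1) b a <-> b = wop (wop a).
Proof.
have ww x : weight x * weight x * (energy x + 1) = 1.
  by rewrite -expr2 weight_sqr mulVf// gt_eqF// energy1_gt0.
split=> [h|->].
  apply: rep_ext; aeuse h, (rep_wop a), (rep_wop (wop a)) => x e -> ->.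
  by rewrite e !scalerA -!rmorphM ww scale1r.
aeuse (rep_wop a), (rep_wop (wop a)) => x -> ->.
rewrite !scalerA -!rmorphM (_ : _ * _ = 1) ?scale1r//.
by rewrite -[RHS](ww x) /=; ring.
Qed.

Lemma mulrel_wdsym a b : mulrel D (wop (wop a)) b <-> b = mop wdsym a.
Proof.
have h : mulrel D (wop (wop a)) (mop wdsym a).
  aeuse (rep_wop a), (rep_wop (wop a)), (rep_mop a mbounded_wdsym) => x -> -> ->.
  by rewrite /wdsym -mulmxA mul_scalar_mx scalerA -scalemxAr -rmorphM.
by split=> [h'|->//]; exact: mulrel_fun h' h.
Qed.

(** The symbol is Hermitian and bounded on the layers of e^2, which exhaust the space. *)
Lemma dsym_self_adjoint a b : hadj (mulrel D) a b <-> mulrel D a b.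
Proof.
have De : (fun x => (D x)^t*) = D by apply/funext => x; rewrite dsym_adj.
split=> [h|h u w h']; last first.
  by symmetry; apply: (mulrel_ip h); rewrite De.
rewrite -De; have ex := layer_exhausts (measurable_energy2 m) (@energy2_ge0 R n m).
apply: (adj_mulrel (c := fun k => k.+1%:R) ex (mmeas_dsym alpha m)).
- by move=> k; exact: ler0n.
- move=> k x u hx; rewrite dsym_norm// ler_wpM2r ?sqr_ge0//.
  by case: hx => [->|[]//]; exact: ler0n.
- by move=> k u w _; exact: h.
Qed.

(** With c = e^2 a, the intermediate vector D a equals (1 + e^2)^(-1) D (a + c), a bounded
    multiplier applied to a + c. *)
Lemma dsym_square a c : hcomp (mulrel D) (mulrel D) a c <-> rmulrel (energy2 m) a c.
Proof.
split.
  by move=> [b h1 h2]; aeuse h1, h2 => x e ->; rewrite e mulmxA dsym_sqr// mul_scalar_mx.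
move=> h; pose s (x : X) : R := (1 + energy2 m x)^-1.
have p (x : X) : 0 < 1 + energy2 m x by rewrite ltr_pwDl// energy2_ge0.
have ms : measurable_fun setT s.
  by apply: measurableT_comp measurable_inv _; apply: measurable_funD => //; exact: measurable_energy2.
have sE x : s x * (1 + energy2 m x) = 1 by rewrite mulVf// gt_eqF.
have s0 x : 0 < s x by rewrite invr_gt0.
have bM : mbounded (fun x => ((s x)%:C%C)%:M *m D x).
  split; first by apply: mmeasM; [apply: mmeas_scalar; exact: cmeas_real|exact: mmeas_dsym].
  exists 1 => // x u; rewrite -mulmxA mul_scalar_mx l2norm_sqrZ dsym_norm// mulrA ler_wpM2r ?sqr_ge0//.
  rewrite normc_sqr /= expr0n /= addr0.
  by have := sE x; have := s0 x; have := energy2_ge0 m x; nra.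
have DE x (u w : 'cV[R[i]]_N) : w = (energy2 m x)%:C%C *: u ->
    ((s x)%:C%C)%:M *m D x *m (u + w) = D x *m u.
  move=> ->; rewrite -mulmxA mul_scalar_mx mulmxDr -scalemxAr -[X in X + _]scale1r -scalerDl scalerA.
  by rewrite -rmorphD -rmorphM /= sE scale1r.
exists (mop (fun x => ((s x)%:C%C)%:M *m D x) (a + c)).
  by aeuse (rep_mop (a + c) bM), (repD a c), h => x -> -> e; rewrite (DE _ _ _ e).
aeuse (rep_mop (a + c) bM), (repD a c), h => x -> -> e; rewrite (DE _ _ _ e).
by rewrite mulmxA dsym_sqr// mul_scalar_mx.
Qed.

Lemma op_abs_lift : op_abs (free_dirac alpha m) = flift (rmulrel energy).
Proof.
rewrite /op_abs free_dirac_lift// lift_adj lift_comp.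
rewrite -(op_sqrt_lift (N := N) (measurable_energy2 m) (@energy2_ge0 R n m)); congr op_sqrt.
apply: lift_ext => a c; rewrite -dsym_square; split=> -[b h1 h2]; exists b => //.
  exact/dsym_self_adjoint.
exact/dsym_self_adjoint.
Qed.

Lemma G0_lift : G0 alpha m = flift (rmulrel (fun x => energy x + 1)).
Proof.
rewrite /G0 op_abs_lift lift_scalar lift_add; apply: lift_ext => a c; split.
  move=> [b1 [b2 [h1 -> ->]]]; aeuse h1, (repD b1 (1 *: a)), (repZ 1 a) => x e -> ->.
  by rewrite e -scalerDl rmorphD.
move=> h; exists (c - a), a; split; last by rewrite subrK.
  by aeuse h, (repB c a) => x e ->; rewrite e rmorphD scalerDl scale1r addrK.
by rewrite /hscal scale1r.
Qed.

Lemma sqrt_G0_lift : op_sqrt (G0 alpha m) = flift (rmulrel (fun x => Num.sqrt (energy x + 1))).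
Proof.
rewrite G0_lift op_sqrt_lift//.
  by apply: measurable_funD => //; exact: measurable_energy.
by move=> x; exact: ltW (energy1_gt0 x).
Qed.

Lemma sqrt_abs_lift : op_sqrt (op_abs (free_dirac alpha m)) = flift (rmulrel (fun x => Num.sqrt (energy x))).
Proof. by rewrite op_abs_lift op_sqrt_lift//; [exact: measurable_energy|exact: energy_ge0]. Qed.

(** The range of G_0^(-1/2) lies in the domain of |D_m|^(1/2), where the standing assumption
    speaks. *)
Lemma sqrt_energy_wop a : exists b, rmulrel (fun x => Num.sqrt (energy x)) (wop a) b.
Proof.
have bs : mbounded (fun x => ((Num.sqrt (energy x) * weight x)%:C%C)%:M : 'M[R[i]]_N).
  apply: (mbounded_real (c := 1)).
    by apply: measurable_funM; [apply: measurable_sqrt; exact: measurable_energy|exact: measurable_weight].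
  move=> x; rewrite ger0_norm ?mulr_ge0 ?sqrtr_ge0 ?(ltW (weight_gt0 x))//.
  by rewrite ler_pdivrMr ?sqrtr_gt0 ?energy1_gt0// mul1r ler_wsqrtr// lerDl.
exists (mop (fun x => ((Num.sqrt (energy x) * weight x)%:C%C)%:M) a).
aeuse (rep_mop a bs), (rep_wop a) => x -> ->.
by rewrite mul_scalar_mx scalerA rmorphM.
Qed.
End EnergyMultipliers.

(** * The perturbed operator on the Fourier side *)

Section PerturbedDirac.
Context {R : realType} {n N : nat}.
Local Notation mu := (@lebesgue_Rn R n).
Local Notation X := (Rn R n).
Local Notation H := (L2class R n N).
Local Notation F := (@fourier R n N).
Local Notation G := (@ifourier R n N).
Local Opaque hnorm l2norm L2.
Implicit Types (a b c d : H).
Variables (alpha : 'I_n.+1 -> 'M[R[i]]_N) (m : R).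
Hypothesis halpha : dirac_matrices alpha.
Local Notation J := (@wop R n N m).
Local Notation Q := (mop (wdsym alpha m)).

Lemma mult_op_lift (s : X -> R[i]) (M : 'M[R[i]]_N) : mult_op s M = flift (prel s M).
Proof.
apply: op_ext => f g; rewrite /flift /prel !fourierK; split=> -[fL gL h]; split; try by [].
  by aeuse (rep_clsE fL), (rep_clsE gL), (aeeqE h) => x -> ->.
by apply: aeeqI; aeuse (rep_clsE fL), (rep_clsE gL), h => x -> ->.
Qed.

Lemma prel_ae (s s' : X -> R[i]) (M : 'M[R[i]]_N) : (\forall x \ae mu, s x = s' x) ->
  prel s M = prel s' M.
Proof.
move=> e; apply/funext => a; apply/funext => b; apply/propext.
by split=> h; aeuse e, h => x es ->; rewrite es.
Qed.

Lemma normcE (z : R[i]) : normc z = Num.sqrt (normc z ^+ 2).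
Proof. by rewrite sqrtr_sqr ger0_norm//; case: z => p q; exact: sqrtr_ge0. Qed.

Lemma measurable_normc (s : X -> R[i]) : cmeasurable s -> measurable_fun setT (fun x => normc (s x)).
Proof.
move=> [m1 m2]; under eq_fun do rewrite normcE normc_sqr.
by apply: measurable_sqrt; apply: measurable_funD; exact: measurable_funX.
Qed.

Lemma cmeas_sqrt_normc (s : X -> R[i]) : cmeasurable s -> cmeasurable (fun x => (Num.sqrt (normc (s x)))%:C%C).
Proof. by move=> ms; apply: cmeas_real; apply: measurable_sqrt; exact: measurable_normc. Qed.

Lemma cmeas_csgn (s : X -> R[i]) : cmeasurable s -> cmeasurable (fun x => (csgn (s x))^*%C).
Proof.
move=> ms; apply: (cmeasJ (h := fun x => csgn (s x))).
have e (z : R[i]) : csgn z = z * ((normc z)^-1)%:C%C by rewrite /csgn fmorphV.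
under [X in cmeasurable X]eq_fun do rewrite e.
by apply: cmeasM => //; apply: cmeas_real; apply: measurableT_comp measurable_inv _; exact: measurable_normc.
Qed.

(* The perturbed operator on the Fourier side, with phi = G_0^(1/2) psi: [J] is G_0^(-1/2), [Q] is D_m G_0^(-1),
   and KA, KBs stand for A G_0^(-1/2) and for the adjoint of B G_0^(-1/2). *)
Definition dvrel (KA KBs : H -> H) a h := exists2 phi, a = J phi & J h = Q phi + KBs (KA phi).

(** The domain inclusion makes the product with G_0^(-1/2) everywhere defined, and [prel_bounded]
    bounds it; a Borel version s' of s supplies the measurability. The last clause holds because M
    commutes with the Fourier transform. *)
Lemma weighted_mult (s s' : X -> R[i]) (M : 'M[R[i]]_N) : cmeasurable s' -> s = s' %[ae mu] ->
  dom (op_sqrt (op_abs (free_dirac alpha m))) `<=` dom (mult_op s M) ->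
  exists K : H -> H, [/\ bounded_linear K,
    forall a, hcomp (prel s M) (fun b c => rmulrel (fun x => Num.sqrt (energy m x + 1)) c b) a = [set K a]
    & forall a, (\forall x \ae mu, M *m rep a x = 0) -> K a = 0].
Proof.
move=> ms' ss' hdom.
have -> : prel s M = prel s' M by apply: prel_ae; aeuse ss' => x /(_ I).
have tot a : exists b, prel s' M (J a) b.
  have [b hb] := sqrt_energy_wop m a.
  have [] : dom (mult_op s M) (rep (G (J a))).
    apply: hdom; exists (rep (G b)); rewrite sqrt_abs_lift//; exact/lift_rep.
  move=> g; rewrite mult_op_lift (prel_ae (s' := s')); last by aeuse ss' => x /(_ I).
  by move=> [_ gL]; rewrite (repG (J a)); exists (F (cls g)).
have [K [bK hK]] := prel_bounded ms' (mbounded_weight m) tot.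
exists K; split=> // [a|a ha].
  apply/seteqP; split=> [b [c /rmulrel_wop -> h]|b ->] /=; first exact: prel_fun h (hK a).
  by exists (J a); [exact/rmulrel_wop|exact: hK].
apply: (prel_fun (hK a)).
have z : cmx M (J a) = 0.
  apply: rep_ext; aeuse (rep_cmx M (J a)), (rep_wop m a), ha, (@rep0 R n N) => x -> -> e ->.
  by rewrite -scalemxAr e scaler0.
have z' : cmx M (G (J a)) = 0.
  by apply: (can_inj (@fourierK R n N)); rewrite fourier_cmx ifourierK z fourier0.
have G0 : G 0 = 0 by apply: (can_inj (@fourierK R n N)); rewrite ifourierK fourier0.
have h := rep_cmx M (G (J a)); rewrite z' in h.
by rewrite /prel G0; aeuse h, (@rep0 R n N) => x e1 e2; rewrite -e1 !e2 scaler0.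
Qed.

Variables (v : X -> R[i]) (A B : 'M[R[i]]_N).
Hypothesis hv : lebesgue_measurable v.
Hypothesis hdom : dom (op_sqrt (op_abs (free_dirac alpha m))) `<=` dom (pert_A v A) `&` dom (pert_B v B).

(** [KBs] is the adjoint of the weighted product by B. If M B^* = 0 then B M^* = 0, so that product
    vanishes on the range of M^* and M annihilates the range of [KBs]. *)
Lemma perturbed_lift : exists KA KBs : H -> H,
  [/\ bounded_linear KA, bounded_linear KBs,
      forall a, (\forall x \ae mu, A *m rep a x = 0) -> KA a = 0,
      forall M a, mbounded M -> (forall x, M x *m B^t* = 0) -> mop M (KBs a) = 0
    & perturbed_dirac alpha m v A B = flift (dvrel KA KBs)].
Proof.
have [v' mv' vv'] := hv.
have [||KA [bA eA kA]] := @weighted_mult (fun x => (Num.sqrt (normc (v x)))%:C%C)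
    (fun x => (Num.sqrt (normc (v' x)))%:C%C) A (cmeas_sqrt_normc mv').
- by aeuse vv' => x h /h ->.
- by move=> f /hdom [].
have [|||KB [bB eB kB]] := @weighted_mult (fun x => (csgn (v x))^*%C * (Num.sqrt (normc (v x)))%:C%C)
    (fun x => (csgn (v' x))^*%C * (Num.sqrt (normc (v' x)))%:C%C) B.
- by apply: cmeasM; [exact: cmeas_csgn|exact: cmeas_sqrt_normc].
- by aeuse vv' => x h /h ->.
- by move=> f /hdom [].
have [KBs [bBs aBs]] := adjoint_exists bB.
exists KA, KBs; split=> //.
  move=> M a bM MB; apply: ip_total_eq => u; rewrite mop_adj// aBs.
  rewrite kB ?(ipZr 0 _ 0)//; last first.
    aeuse (rep_mop u (mbounded_adj bM)) => x ->; rewrite mulmxA.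
    have -> : B *m (M x)^t* = (M x *m B^t*)^t*.
      by rewrite -[in LHS](ctrmxK B); apply/matrixP => p q; rewrite !mxE rmorph_sum; apply: eq_bigr => k _;
         rewrite !mxE rmorphM mulrC.
    by rewrite MB; apply/matrixP => p q; rewrite !mxE big1// => k _; rewrite !mxE rmorph0 mul0r.
  by rewrite -(scale0r (0 : H)) ipZl ipZr rmorph0 !mul0r.
rewrite /perturbed_dirac sqrt_G0_lift// G0_lift// free_dirac_lift// /pert_A /pert_B !mult_op_lift.
rewrite !lift_inv !lift_comp lift_adj !lift_comp lift_add !lift_comp; apply: lift_ext => a h.
have HA phi c : hcomp (prel (fun x => (Num.sqrt (normc (v x)))%:C%C) A)
   (fun b c => rmulrel (fun x => Num.sqrt (energy m x + 1)) c b) phi c <-> c = KA phi.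
  by rewrite eA.
have HB' phi c : hadj (hcomp (prel (fun x => (csgn (v x))^*%C * (Num.sqrt (normc (v x)))%:C%C) B)
   (fun b c => rmulrel (fun x => Num.sqrt (energy m x + 1)) c b)) phi c <-> c = KBs phi.
  split=> [hc|-> u w].
    apply: ip_total_eq => u; rewrite aBs; symmetry; apply: hc; by rewrite eB.
  by rewrite eB => ->; rewrite aBs.
split.
  move=> [w [phi /rmulrel_wop -> [b1 [b2 [[c /rmulrel_wop2 -> /(mulrel_wdsym m halpha) ->] [d /HA -> /HB' ->] ->]]] /rmulrel_wop hw]].
  by exists phi.
move=> [phi -> hJ]; exists (J h); last exact/rmulrel_wop.
exists phi; first exact/rmulrel_wop.
exists (Q phi), (KBs (KA phi)); split=> //.
  by exists (J (J phi)); [exact/rmulrel_wop2|exact/mulrel_wdsym].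
by exists (KA phi); [exact/HA|exact/HB'].
Qed.

(** The free operator is the case of zero perturbation, so that a single spectral analysis covers
    both operators. What has to be shown is that its domain lies in the range of G_0^(-1/2). *)
Lemma free_dirac_dvrel : free_dirac alpha m = flift (dvrel (fun=> 0) (fun=> 0)).
Proof.
rewrite free_dirac_lift//; apply: lift_ext => a h.
have JD : mulrel (dsym alpha m) (J a) (J h) <-> mulrel (dsym alpha m) a h.
  have w0 (x : X) : (weight m x)%:C%C != 0 :> R[i].
    by rewrite eq_complex /= eqxx andbT gt_eqF// weight_gt0.
  split=> hD; aeuse hD, (rep_wop m a), (rep_wop m h) => x e ea eh.
    by move: e; rewrite ea eh -scalemxAr => /(scalerI (w0 x)).
  by rewrite ea eh e -scalemxAr.
split=> [hD|[phi aE hJ]]; last first.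
  by apply/JD; rewrite aE; apply/(mulrel_wdsym m halpha); rewrite hJ addr0.
(* As (1 + e^2) a = a + D h, so is sqrt (e + 1) a a bounded combination of a and h. *)
pose s (x : X) : R := Num.sqrt (energy m x + 1) / (1 + energy2 m x).
have p (x : X) : 0 < 1 + energy2 m x by rewrite ltr_pwDl// energy2_ge0.
have q (x : X) : 0 < Num.sqrt (energy m x + 1) by rewrite sqrtr_gt0 energy1_gt0.
have ms : measurable_fun setT s.
  apply: measurable_funM.
    by apply: (measurable_sqrt (t := fun x => energy m x + 1)); apply: measurable_funD => //; exact: measurable_energy.
  by apply: measurableT_comp measurable_inv _; apply: measurable_funD => //; exact: measurable_energy2.
have sE x : weight m x * s x * (1 + energy2 m x) = 1.
  by rewrite /s /weight mulrA mulVf ?gt_eqF// mul1r mulVf// gt_eqF.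
have sb x : s x ^+ 2 * (1 + energy2 m x) <= 2.
  rewrite -(@ler_pM2r _ (1 + energy2 m x))// -mulrA -expr2 -exprMn divfK ?gt_eqF//.
  rewrite sqr_sqrtr ?(ltW (energy1_gt0 m x))// -energy_sqr.
  by have := sqr_ge0 (energy m x - 1); have := energy_ge0 m x; rewrite !expr2; nra.
have b1 : mbounded (fun x => ((s x)%:C%C)%:M : 'M[R[i]]_N).
  apply: (mbounded_real (c := 2) ms) => x; apply: le_of_sqr => //.
  rewrite real_normK ?num_real//.
  by have := sb x; have := sqr_ge0 (s x); have := energy2_ge0 m x; nra.
have b2 : mbounded (fun x => ((s x)%:C%C)%:M *m dsym alpha m x).
  split; first by apply: mmeasM; [apply: mmeas_scalar; exact: cmeas_real|exact: mmeas_dsym].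
  exists 2 => // x u; rewrite -mulmxA mul_scalar_mx l2norm_sqrZ dsym_norm// mulrA ler_wpM2r ?sqr_ge0//.
  rewrite normc_sqr /= expr0n /= addr0.
  by have := sb x; have := sqr_ge0 (s x); have := energy2_ge0 m x; nra.
pose phi := mop (fun x => ((s x)%:C%C)%:M) a + mop (fun x => ((s x)%:C%C)%:M *m dsym alpha m x) h.
have aE : a = J phi.
  apply: rep_ext; aeuse (rep_wop m phi), (repD (mop (fun x => ((s x)%:C%C)%:M) a)
    (mop (fun x => ((s x)%:C%C)%:M *m dsym alpha m x) h)), (rep_mop a b1), (rep_mop h b2), hD.
  move=> x ep e1 e2 e3 e4; rewrite ep /phi e1 e2 e3 e4.
  rewrite mulmxA -(mulmxA _ (dsym alpha m x) (dsym alpha m x)) dsym_sqr// -mulmxDl -scalar_mxM -raddfD.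
  rewrite mul_scalar_mx scalerA -[X in X + _]mulr1 -mulrDr mulrA -rmorphD -!rmorphM /=.
  by rewrite sE scale1r.
exists phi => //; rewrite addr0; apply/(mulrel_wdsym m halpha); rewrite -aE; exact/JD.
Qed.
End PerturbedDirac.

(** * Null level sets, and almost everywhere inequalities between continuous functions *)

Section NullSets.
Context {R : realType}.
Local Notation lam := (@lebesgue_measure R).
Local Notation mu n := (@lebesgue_Rn R n).

Lemma Rintegral_eq0_ae n (f : Rn R n -> R) : rint f -> (forall x, 0 <= f x) ->
  \int[mu n]_x f x = 0 -> \forall x \ae mu n, f x = 0.
Proof.
move=> ri f0 h.
have h0 : (\int[mu n]_x (f x)%:E = 0)%E.
  by rewrite -[LHS]fineK ?integrable_fin_num// -/(Rintegral _ _ _) h.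
have /ae_eq_integral_abs : measurable_fun setT (fun x => (f x)%:E).
  by apply/measurable_EFinP; exact: rint_meas.
move=> /(_ (mu n) measurableT)[h1 _].
have h2 : (\int[mu n]_x `|(f x)%:E| = 0)%E.
  by rewrite -[RHS]h0; apply: eq_integral => x _; rewrite /= ger0_norm.
by have h3 := h1 h2; aeuse h3 => x /(_ I) [].
Qed.

Lemma gaussian_rint n : rint (gprod (fun=> 0%N) (fun=> 1) : Rn R n -> R).
Proof. by have [] := @gprod_integral R n (fun=> 0%N) (fun=> 1) (fun=> ltr01). Qed.

(** Fubini in the first coordinate, where a level set meets each line in at most two points; the
    Gaussian weight keeps the integrals finite. *)
Lemma energy2_level_null n (m r : R) : (0 < n)%N -> \forall x \ae mu n, energy2 m x != r.
Proof.
case: n => // n _.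
pose E := [set x : Rn R n.+1 | energy2 m x = r].
have mE : measurable E.
  rewrite (_ : E = setT `&` energy2 m @^-1` [set r]); first exact: measurable_energy2.
  by rewrite setTI.
pose g := gprod (fun=> 0%N) (fun=> 1) : Rn R n.+1 -> R.
have ri : rint (fun x => g x * \1_E x) by apply: rint_indic => //; exact: gaussian_rint.
have g0 x : 0 < g x by exact: gprod_gt0.
have I0 : (\int[mu n.+1]_x (g x * \1_E x)%:E = 0)%E.
  rewrite Rn_fubini_in//; apply: integral0_eq => y _.
  rewrite (@ae_eq_integral _ _ _ lam setT (cst 0%E))//; first by rewrite integral0.
  - apply/measurable_EFinP.
    apply: (@measurableT_comp _ _ _ _ _ _ (fun x => g x * \1_E x) _ (fun t => Rn_cons (t, y))).
      exact: rint_meas ri.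
    apply: (@measurableT_comp _ _ _ _ _ _ (@Rn_cons R n)); first exact: measurable_Rn_cons.
    exact: measurable_pair2.
  pose c := r - m ^+ 2 - \sum_(k < n) tnth y k ^+ 2.
  have cnt : countable [set t : R | t ^+ 2 = c].
    apply: (@sub_countable _ _ _ [set Num.sqrt c; - Num.sqrt c]); last exact/finite_set_countable.
    apply: subset_card_le => t /= tc.
    have : t ^+ 2 = Num.sqrt c ^+ 2 by rewrite sqr_sqrtr// -tc sqr_ge0.
    by move/eqP; rewrite eqf_sqr => /orP[] /eqP ->; [left|right].
  exists [set t : R | t ^+ 2 = c]; split; first exact: countable_measurable.
    exact: countable_lebesgue_measure0.
  move=> t /= /not_implyP[_ ne]; apply: contrapT => tc; apply: ne.
  rewrite indicE [_ \in _](_ : _ = false) ?mulr0//; apply/negbTE/negP; rewrite inE /E /= => e.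
  apply: tc; rewrite /c -e /energy2 big_ord_recl tnth_Rn_cons0.
  under eq_bigr do rewrite tnth_Rn_consS.
  ring.
have [] := @Rintegral_eq0_ae n.+1 _ ri.
- by move=> x; rewrite mulr_ge0 ?(ltW (g0 x)).
- by rewrite /Rintegral I0.
move=> Z hZ; exists Z; case: hZ => mZ Z0 sZ; split=> // x /= /negP/negPn/eqP ex; apply: sZ => /= /eqP.
by rewrite indicE mem_set// mulr1 gt_eqF.
Qed.

(** A negative value would persist on an open cube around x, and a cube has positive measure. *)
Lemma ae_ge0_continuous n (P : 'rV[R]_n -> R) : continuous P ->
  (\forall x \ae mu n, 0 <= P (row_of x)) -> forall x, 0 <= P x.
Proof.
move=> cP h x; rewrite leNgt; apply/negP => Px.
have /nbhs_ballP[d /= d0 hd] : \forall y \near x, P y < 0.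
  exact: (cP x _ (lt_nbhsl Px)).
pose U (k : 'I_n) : set (measurableTypeR R) := `]x 0 k - d, x 0 k + d[%classic.
have mU k : measurable (U k) by exact: measurable_itv.
have lU k : lam (U k) = (2 * d)%:E.
  rewrite lebesgue_measure_itv/= lte_fin ltrBlDr -addrA ltrDl addr_gt0//.
  by rewrite -EFinB; congr EFin; ring.
have sU k : (\int[lam]_t (\1_(U k) t)%:E = (2 * d)%:E)%E.
  by rewrite integral_indic// setIT; exact: lU.
have iU k : lam.-integrable setT (EFin \o (\1_(U k) : R -> R)).
  apply/integrableP; split; first by apply/measurable_EFinP; exact: measurable_indic.
  under eq_integral do rewrite /= ger0_norm//.
  by rewrite sU ltry.
have vU k : \int[lam]_t (\1_(U k) : R -> R) t = 2 * d by rewrite /Rintegral sU.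
have [ri vi] := @coord_prod_integral R n (fun k => \1_(U k)) iU.
have : \int[mu n]_z coord_prod (fun k => \1_(U k)) z = 0.
  rewrite (@Rintegral_ae _ _ _ (fun=> 0)); first by rewrite Rintegral_cst// mul0r.
  - exact: rint_meas ri.
  - exact: measurable_cst.
  aeuse h => z Pz _; rewrite -box_indic indicE [_ \in _](_ : _ = false)//.
  apply/negbTE/negP; rewrite inE => bz; move: Pz; rewrite leNgt => /negP; apply; apply: hd.
  split=> // i j; rewrite ord1 /ball /= !mxE distrC ltr_distl.
  by have := bz j; rewrite /U /= in_itv.
rewrite vi => /eqP; apply/negP; apply/prodf_neq0 => k _.
by rewrite vU mulf_neq0 ?gt_eqF.
Qed.
End NullSets.

(** * From the norm of a multiplier to a pointwise bound *)

Section OperatorBound.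
Context {R : realType} {n N : nat}.
Local Notation mu := (@lebesgue_Rn R n).
Local Notation X := (Rn R n).
Local Notation H := (L2class R n N).
Local Notation nrm := (hnorm (@rip R n N)).
Local Opaque hnorm l2norm L2.

(** The norm bound is tested on v times a Gaussian cut to the set E where the pointwise bound fails;
    this makes the integral of a nonnegative function, positive exactly on E, vanish. *)
Lemma mop_bound_ae M (c : R) (v : 'cV[R[i]]_N) : mbounded M ->
  (forall a : H, nrm (mop M a) <= c * nrm a) -> 
  \forall x \ae mu, l2norm (M x *m v) ^+ 2 <= c ^+ 2 * l2norm v ^+ 2.
Proof.
move=> bM h.
pose f x := l2norm (M x *m v) ^+ 2 - c ^+ 2 * l2norm v ^+ 2.
have mf : measurable_fun setT f.
  apply: measurable_funB => //.
  apply: (@meas_l2norm_sqr R n N (fun x => M x *m v)); apply: vmeasM; first by case: bM.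
  by move=> i; exact: cmeas_cst.
pose E := [set x | 0 < f x].
have mE : measurable E.
  rewrite (_ : E = setT `&` f @^-1` `]0, +oo[); first exact: mf.
  by rewrite setTI; apply/seteqP; split => x /=; rewrite in_itv /= andbT.
pose g := gprod (fun=> 0%N) (fun=> 1) : X -> R.
have g0 x : 0 < g x by exact: gprod_gt0.
have g1 x : g x <= 1 by apply: gprod_le1 => k; exact: ler01.
have mg : measurable_fun setT (fun x => g x * \1_E x).
  by apply: measurable_funM; [exact: measurable_gprod|exact: measurable_indic].
pose w : vfun R n N := fun x => (g x * \1_E x)%:C%C *: v.
have wE x : l2norm (w x) ^+ 2 = (g x ^+ 2 * \1_E x) * l2norm v ^+ 2.
  rewrite /w l2norm_sqrZ normc_sqr /= expr0n /= addr0 exprMn indicE.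
  by case: (x \in E); rewrite /= ?expr1n ?expr0n.
have rg : rint (fun x => g x ^+ 2 * \1_E x).
  apply: rint_indic => //; apply: (rint_le (g := g)) (gaussian_rint n).
    by apply: measurable_funX; exact: measurable_gprod.
  by move=> x; rewrite ger0_norm ?sqr_ge0// expr2 ler_piMl// ltW.
have wL : L2 w.
  apply/L2P; split.
    apply: vmeasZ; first exact: cmeas_real.
    by move=> i; exact: cmeas_cst.
  by under eq_fun do rewrite wE mulrC; exact: rintZ.
have hn := h (cls w).
have n0 : 0 <= nrm (mop M (cls w)) by exact: hnorm_ge0.
have hn2 : nrm (mop M (cls w)) ^+ 2 <= (c * nrm (cls w)) ^+ 2.
  by apply: lerXn2r; rewrite ?nnegrE// (le_trans n0).
rewrite exprMn in hn2.
have e1 : nrm (cls w) ^+ 2 = \int[mu]_x (g x ^+ 2 * \1_E x * l2norm v ^+ 2).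
  rewrite [LHS]nrm_sqr; apply: Rintegral_ae.
  - exact: rint_meas (rint_rep (cls w)).
  - by apply: measurable_funM => //; exact: rint_meas rg.
  by aeuse (rep_clsE wL) => x -> _; rewrite wE.
have mM2 : measurable_fun setT (fun x => l2norm (M x *m v) ^+ 2).
  apply: (@meas_l2norm_sqr R n N (fun x => M x *m v)); apply: vmeasM; first by case: bM.
  by move=> i; exact: cmeas_cst.
have e2 : nrm (mop M (cls w)) ^+ 2 = \int[mu]_x (g x ^+ 2 * \1_E x * l2norm (M x *m v) ^+ 2).
  rewrite [LHS]nrm_sqr; apply: Rintegral_ae.
  - exact: rint_meas (rint_rep (mop M (cls w))).
  - by apply: measurable_funM => //; exact: rint_meas rg.
  aeuse (rep_mop (cls w) bM), (rep_clsE wL) => x -> -> _.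
  rewrite /w -scalemxAr l2norm_sqrZ normc_sqr /= expr0n /= addr0 exprMn indicE.
  by case: (x \in E); rewrite /= ?expr1n ?expr0n.
have [_ [k k0 hk]] := bM.
have rM : rint (fun x => g x ^+ 2 * \1_E x * l2norm (M x *m v) ^+ 2).
  apply: (rint_le (g := fun x => (k * l2norm v ^+ 2) * (g x ^+ 2 * \1_E x))) => [|x|].
  - by apply: measurable_funM => //; exact: rint_meas rg.
  - have q0 : 0 <= g x ^+ 2 * \1_E x by rewrite mulr_ge0 ?sqr_ge0.
    by rewrite (ger0_norm (mulr_ge0 q0 (sqr_ge0 _))) mulrC ler_wpM2r.
  - exact: rintZ.
have rv : rint (fun x => g x ^+ 2 * \1_E x * l2norm v ^+ 2).
  by under eq_fun do rewrite mulrC; exact: rintZ.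
have rf : rint (fun x => g x ^+ 2 * \1_E x * f x).
  rewrite (_ : (fun x => _) = fun x => g x ^+ 2 * \1_E x * l2norm (M x *m v) ^+ 2
      - c ^+ 2 * (g x ^+ 2 * \1_E x * l2norm v ^+ 2)); last by apply/funext => x; rewrite /f; ring.
  by apply: rintB => //; exact: rintZ.
have f0 x : 0 <= g x ^+ 2 * \1_E x * f x.
  rewrite indicE; have [|_] := boolP (x \in E); last by rewrite mulr0 mul0r.
  by rewrite inE /E /= => fx; rewrite !mulr_ge0 ?sqr_ge0// ltW.
have If : \int[mu]_x (g x ^+ 2 * \1_E x * f x) = 0.
  apply/eqP; rewrite eq_le; apply/andP; split; last exact: Rintegral_ge0.
  rewrite (_ : (fun x => _) = fun x => g x ^+ 2 * \1_E x * l2norm (M x *m v) ^+ 2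
      - c ^+ 2 * (g x ^+ 2 * \1_E x * l2norm v ^+ 2)); last by apply/funext => x; rewrite /f; ring.
  rewrite RintegralB//; last exact: rintZ.
  by rewrite RintegralZl// -e1 -e2 subr_le0.
aeuse (Rintegral_eq0_ae rf f0 If) => x /eqP.
rewrite mulf_eq0 mulf_eq0 sqrf_eq0 gt_eqF//= => hx; rewrite -subr_le0 -/(f x) leNgt; apply/negP => fx.
by move: hx; rewrite (gt_eqF fx) orbF indicE mem_set// oner_eq0.
Qed.
End OperatorBound.

(** * Injectivity, approximate solutions and dense range *)

Section SpectralAnalysis.
Context {R : realType} {n N : nat}.
Local Notation mu := (@lebesgue_Rn R n).
Local Notation X := (Rn R n).
Local Notation H := (L2class R n N).
Local Notation nrm := (hnorm (@rip R n N)).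
Local Opaque hnorm l2norm L2.
Implicit Types (a b c d h phi : H) (z : R[i]) (x : X).
Variables (alpha : 'I_n.+1 -> 'M[R[i]]_N) (m : R).
Hypothesis halpha : dirac_matrices alpha.
Hypothesis hn : (0 < n)%N.
Local Notation D := (dsym alpha m).
Local Notation J := (@wop R n N m).
Local Notation w := (@weight R n m).
Local Notation e := (@energy R n m).

Variables (KA KBs : H -> H) (A : 'M[R[i]]_N).
Hypothesis bA : bounded_linear KA.
Hypothesis bB : bounded_linear KBs.
Hypothesis kA : forall a, (\forall x \ae mu, A *m rep a x = 0) -> KA a = 0.
Hypothesis kB : forall z a, \forall x \ae mu, A *m ((D x + z%:M) *m rep (KBs a) x) = 0.

(** The scalar value e^2 - z^2 of the product (D - z)(D + z); it is complex, and zero exactly where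
    D - z is singular. *)
Definition edist z x : R[i] := (energy2 m x)%:C%C - z ^+ 2.
Definition dvshift z := hadd (dvrel alpha m KA KBs) (hscal (- z)).

Lemma dsym_mul_shift z x : (D x + z%:M) *m (D x - z%:M) = (edist z x)%:M.
Proof.
rewrite mulmxDl !mulmxBr dsym_sqr// scalar_mxC -scalar_mxM /edist expr2 raddfB /=.
by rewrite addrA subrK.
Qed.

Lemma dsym_shift_mul z x : (D x - z%:M) *m (D x + z%:M) = (edist z x)%:M.
Proof.
rewrite -dsym_mul_shift; move: (D x) => a.
rewrite mulmxBl mulmxDr mulmxDr.
rewrite [in RHS]mulmxDl !mulmxBr (scalar_mxC z a).
by rewrite opprD addrA addrK addrA subrK.
Qed.

(** The equation (D_mV - z) a = h with a = G_0^(-1/2) phi, after multiplication by G_0^(-1/2). *)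
Lemma dvshiftE z a h : dvshift z a h <-> exists2 phi, a = J phi &
  \forall x \ae mu, (w x)%:C%C *: rep h x =
    (w x ^+ 2)%:C%C *: ((D x - z%:M) *m rep phi x) + rep (KBs (KA phi)) x.
Proof.
have E phi b1 : J b1 = mop (wdsym alpha m) phi + KBs (KA phi) <->
    \forall x \ae mu, (w x)%:C%C *: rep b1 x = (w x ^+ 2)%:C%C *: (D x *m rep phi x) + rep (KBs (KA phi)) x.
  have bw := mbounded_wdsym m halpha.
  split=> [eJ|hx]; last first.
    apply: rep_ext; aeuse hx, (rep_wop m b1), (repD (mop (wdsym alpha m) phi) (KBs (KA phi))), (rep_mop phi bw).
    by move=> x e1 -> -> ->; rewrite e1 /wdsym -mulmxA mul_scalar_mx.
  have h1 := rep_wop m b1; rewrite eJ in h1.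
  aeuse h1, (repD (mop (wdsym alpha m) phi) (KBs (KA phi))), (rep_mop phi bw).
  by move=> x <- -> ->; rewrite /wdsym -mulmxA mul_scalar_mx.
have zE x (u v k y : 'cV[R[i]]_N) : y = - z *: ((w x)%:C%C *: v) ->
    (w x)%:C%C *: u = (w x ^+ 2)%:C%C *: (D x *m v) + k <->
    (w x)%:C%C *: (u + y) = (w x ^+ 2)%:C%C *: ((D x - z%:M) *m v) + k.
  move=> ->; rewrite mulmxBl mul_scalar_mx scalerBr scalerDr scalerA mulrN [_ * z]mulrC.
  rewrite scaleNr -[z * _ *: _]scalerA !scalerA.
  rewrite [in X in _ <-> X]addrAC (_ : z * (w x)%:C%C * (w x)%:C%C = (w x ^+ 2)%:C%C * z); last first.
    by rewrite -mulrA -rmorphM -expr2 mulrC.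
  by split=> [->//|/addIr].
split.
  move=> [b1 [b2 [[phi aE Jb] b2E hE]]]; have hb := (E _ _).1 Jb; exists phi; first exact: aE.
  rewrite /hscal aE in b2E.
  have h1 := repD b1 b2; rewrite -hE in h1.
  have h2 := repZ (- z) (J phi); rewrite -b2E in h2.
  aeuse hb, h1, h2, (rep_wop m phi) => x e1 e2 e3 e4; rewrite e2.
  by apply: (zE x _ (rep phi x) _ _ _).1 e1; rewrite e3 e4.
move=> [phi aE hx]; exists (h - - z *: a), (- z *: a); split; [|by []|by rewrite subrK].
exists phi; first exact: aE.
apply: (E _ _).2.
have h2 := rep_wop m phi; rewrite -aE in h2.
aeuse hx, (repB h (- z *: a)), (repZ (- z) a), h2 => x e1 e3 e4 e2.
rewrite e3 e4; apply: (zE x _ (rep phi x) _ (- z *: rep a x) _).2; first by rewrite e2.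
by rewrite subrK.
Qed.

Lemma edist_neq0 z : \forall x \ae mu, edist z x != 0.
Proof.
aeuse (energy2_level_null m (complex.Re (z ^+ 2)) hn) => x h; apply: contra h => /eqP.
by move=> /(congr1 (@complex.Re R)); rewrite /edist cReD cReN /= => /eqP; rewrite subr_eq0.
Qed.

Lemma weight_neq0 x : (w x)%:C%C != 0 :> R[i].
Proof. by rewrite eq_complex /= eqxx andbT gt_eqF// weight_gt0. Qed.

Lemma shift_cancel z x (u v k : 'cV[R[i]]_N) :
  (w x)%:C%C *: u = (w x ^+ 2)%:C%C *: ((D x - z%:M) *m v) + k ->
  (w x)%:C%C *: ((D x + z%:M) *m u) = ((w x ^+ 2)%:C%C * edist z x) *: v + (D x + z%:M) *m k.
Proof.
move=> /(congr1 (mulmx (D x + z%:M))); rewrite mulmxDr -!scalemxAr => ->.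
by rewrite mulmxA dsym_mul_shift mul_scalar_mx scalerA.
Qed.

Lemma dvshift_injective z a : dvshift z a 0 -> a = 0.
Proof.
move=> /dvshiftE[phi aE hx].
have r0 := @rep0 R n N.
have eq1 : \forall x \ae mu, ((w x ^+ 2)%:C%C * edist z x) *: rep phi x + (D x + z%:M) *m rep (KBs (KA phi)) x = 0.
  by aeuse hx, r0 => x h1 h2; rewrite -(shift_cancel h1) h2 mulmx0 scaler0.
have c0 x : edist z x != 0 -> (w x ^+ 2)%:C%C * edist z x != 0.
  by move=> ed; rewrite mulf_neq0// rmorphXn expf_neq0// weight_neq0.
have KA0 : KA phi = 0.
  apply: kA; aeuse eq1, (kB z (KA phi)), (edist_neq0 z) => x h1 h2 ed.
  have := congr1 (mulmx A) h1; rewrite mulmxDr h2 addr0 mulmx0 -scalemxAr => /eqP.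
  by rewrite scaler_eq0 (negbTE (c0 _ ed)) => /eqP.
have phi0 : phi = 0.
  rewrite KA0 (bl0 bB) in eq1.
  apply: rep_ext; aeuse eq1, (edist_neq0 z), r0 => x h1 ed h0; rewrite h0.
  move: h1; rewrite h0 mulmx0 addr0 => /eqP.
  by rewrite scaler_eq0 (negbTE (c0 _ ed)) => /eqP.
rewrite aE phi0; exact: mop0 (mbounded_weight m).
Qed.

(** The cut is relative to (1 + e)^2, so that (1 + e)(D + z) / (e^2 - z^2) is bounded on it also at
    infinity; off the spectrum of D_m a single k gives the whole space. *)
Definition cutset z (k : nat) := [set x | (1 + e x) ^+ 2 <= k.+1%:R * normc (edist z x)].

Lemma cmeas_edist z : cmeasurable (edist z).
Proof.
apply: cmeasD; first by apply: cmeas_real; exact: measurable_energy2.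
exact: cmeas_cst.
Qed.

Lemma measurable_cutset z k : measurable (cutset z k).
Proof.
pose f x := k.+1%:R * normc (edist z x) - (1 + e x) ^+ 2.
have mf : measurable_fun setT f.
  apply: measurable_funB.
    by apply: measurable_funM => //; apply: measurable_normc; exact: cmeas_edist.
  by apply: measurable_funX; apply: measurable_funD => //; exact: measurable_energy.
rewrite (_ : cutset z k = setT `&` f @^-1` `[0, +oo[); first exact: mf.
by rewrite setTI; apply/seteqP; split => x /=; rewrite /cutset /f /= in_itv /= andbT subr_ge0.
Qed.

Lemma normc_gt0 (y : R[i]) : y != 0 -> 0 < normc y.
Proof.
move=> y0; have : 0 <= normc y by case: y {y0} => p q; exact: sqrtr_ge0.
rewrite le_eqVlt => /predU1P[h|//]; case/eqP: y0; apply/complex.ComplexField.Normc.eq0_normc.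
by [].
Qed.

Lemma cutset_exhausts z : exhausts (cutset z).
Proof.
split; first exact: measurable_cutset.
aeuse (edist_neq0 z) => x /normc_gt0 ed.
exists (Num.trunc ((1 + e x) ^+ 2 / normc (edist z x))) => k hk.
rewrite /cutset /= -ler_pdivrMr//; apply: ltW; apply: lt_le_trans (truncnS_gt _) _.
by rewrite ler_nat.
Qed.

Lemma cutset_sub z j k : (j <= k)%N -> cutset z j `<=` cutset z k.
Proof.
move=> jk x; rewrite /cutset /= => h; apply: le_trans h _.
rewrite ler_wpM2r ?ler_nat//; case: (edist z x) => p q; exact: sqrtr_ge0.
Qed.

(** The factor 1 + e is the inverse of w^2, so that [rmx] inverts w^2 (D - z) on the cut set. *)
Definition rcoef z k x : R[i] := (\1_(cutset z k) x * (1 + e x))%:C%C * (edist z x)^-1.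
Definition rmx z k x : 'M[R[i]]_N := rcoef z k x *: (D x + z%:M).

Lemma rcoefE z k x : rcoef z k x * edist z x = (\1_(cutset z k) x * (1 + e x))%:C%C.
Proof.
(* Where e^2 = z^2 the inverse is 0 by default, and such a point is outside the cut set, so both
   sides are 0. *)
rewrite /rcoef; have [e0|ed] := eqVneq (edist z x) 0; last by rewrite divfK.
rewrite e0 invr0 !mulr0 indicE [_ \in _](_ : _ = false) ?mul0r//; apply/negbTE/negP; rewrite inE.
rewrite /cutset /= e0 complex.ComplexField.Normc.normc0 mulr0 leNgt => /negP; apply.
by rewrite exprn_gt0// addrC energy1_gt0.
Qed.

Lemma rcoef_bound z k x : normc (rcoef z k x) * (1 + e x) <= k.+1%:R.
Proof.
have e1 : 0 < 1 + e x by rewrite addrC energy1_gt0.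
have r0 : 0 <= normc (rcoef z k x) by case: (rcoef z k x) => p q; exact: sqrtr_ge0.
have := congr1 (@complex.ComplexField.Normc.normc R) (rcoefE z k x); rewrite complex.ComplexField.Normc.normcM.
rewrite [RHS]/normc /= expr0n /= addr0 sqrtr_sqr indicE.
have [|nV] := boolP (x \in cutset z k); last first.
  move=> _; rewrite /rcoef indicE (negbTE nV) !mul0r complex.ComplexField.Normc.normc0 mul0r.
  exact: ler0n.
rewrite inE /cutset /= mul1r (ger0_norm (ltW e1)) => hV hE.
rewrite -(ler_pM2r e1) -mulrA -expr2; apply: le_trans (ler_wpM2l r0 hV) _.
by rewrite mulrCA hE.
Qed.

Lemma shift_norm z x (u : 'cV[R[i]]_N) :
  l2norm ((D x + z%:M) *m u) ^+ 2 <= 2 * (energy2 m x + normc z ^+ 2) * l2norm u ^+ 2.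
Proof.
rewrite mulmxDl; apply: le_trans (l2norm_sqrD _ _) _.
by rewrite dsym_norm// mul_scalar_mx l2norm_sqrZ -mulrDr -mulrDl mulrA.
Qed.

Lemma mbounded_rmx z k : mbounded (rmx z k).
Proof.
split.
  apply: mmeasZ.
    apply: cmeasM.
      apply: cmeas_real; apply: measurable_funM; first by apply: measurable_indic; exact: measurable_cutset.
      by apply: measurable_funD => //; exact: measurable_energy.
    have ev (y : R[i]) : y^-1 = y^* * ((normc y ^+ 2)^-1)%:C%C.
      have [->|y0] := eqVneq y 0; first by rewrite invr0 rmorph0 mul0r.
      apply: (mulfI y0); rewrite divff// mulrA (_ : y * y^* = (normc y ^+ 2)%:C%C).
        by rewrite -rmorphM divff// expf_neq0// gt_eqF// normc_gt0.
      by apply: complex_ext; rewrite ?(cReM, cImM, cReJ, cImJ) /= ?normc_sqr; ring.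
    under [X in cmeasurable X]eq_fun do rewrite ev.
    apply: cmeasM; first exact: cmeasJ (cmeas_edist z).
    apply: cmeas_real; apply: measurableT_comp measurable_inv _; apply: measurable_funX.
    by apply: measurable_normc; exact: cmeas_edist.
  by apply: mmeasD; [exact: mmeas_dsym|exact: mmeas_cst].
exists (2 * k.+1%:R ^+ 2 * (1 + normc z ^+ 2)) => [|x u].
  by rewrite !mulr_ge0// ?sqr_ge0// addr_ge0// sqr_ge0.
rewrite /rmx -scalemxAl l2norm_sqrZ; apply: le_trans (ler_wpM2l (sqr_ge0 _) (shift_norm z x u)) _.
rewrite mulrA ler_wpM2r ?sqr_ge0//.
have e0 := energy_ge0 m x; have r0 := rcoef_bound z k x.
have n0 : 0 <= normc (rcoef z k x) by case: (rcoef z k x) => p q; exact: sqrtr_ge0.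
have r1 : normc (rcoef z k x) ^+ 2 * (1 + e x) ^+ 2 <= k.+1%:R ^+ 2.
  by rewrite -exprMn; apply: lerXn2r => //; rewrite nnegrE ?mulr_ge0// addr_ge0.
rewrite -energy_sqr; move: (normc z ^+ 2) (sqr_ge0 (normc z)) => q q0.
have r2 : e x ^+ 2 + q <= (1 + e x) ^+ 2 * (1 + q) by rewrite !expr2; nra.
have r3 := ler_wpM2l (sqr_ge0 (normc (rcoef z k x))) r2.
have q1 : 0 <= 1 + q by rewrite addr_ge0.
have r4 := ler_wpM2r q1 r1; move: r3 r4.
move: (normc _ ^+ 2) (k.+1%:R ^+ 2) ((1 + e x) ^+ 2) (e x ^+ 2) => P K Q E; lra.
Qed.

Lemma rmx_inv z k x (u : 'cV[R[i]]_N) : (w x ^+ 2)%:C%C *: ((D x - z%:M) *m (rmx z k x *m u)) =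
  (\1_(cutset z k) x : R)%:C%C *: u.
Proof.
rewrite /rmx -!scalemxAl -scalemxAr mulmxA dsym_shift_mul mul_scalar_mx !scalerA rcoefE.
have e1 : e x + 1 != 0 by rewrite gt_eqF// energy1_gt0.
by rewrite -rmorphM /= weight_sqr mulrCA [1 + _]addrC (mulVf e1) mulr1.
Qed.

Lemma KA_rmx z k c : KA (mop (rmx z k) (KBs c)) = 0.
Proof.
apply: kA; aeuse (rep_mop (KBs c) (mbounded_rmx z k)), (kB z c) => x -> h.
by rewrite /rmx -scalemxAl -scalemxAr h scaler0.
Qed.

(* As K L^-1 K = 0 for L = D - z, the approximate inverse is L^-1 - L^-1 K L^-1, cut off near e^2 = z^2. *)
Definition dvsolve z i j (u : H) : H :=
  mop (rmx z i) u - mop (rmx z j) (KBs (KA (mop (rmx z i) u))).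

Lemma dvsolveE z i j (u : H) : \forall x \ae mu,
  (w x ^+ 2)%:C%C *: ((D x - z%:M) *m rep (dvsolve z i j u) x) + rep (KBs (KA (dvsolve z i j u))) x =
  rep (restr (cutset z i) u) x + rep (restr (~` cutset z j) (KBs (KA (mop (rmx z i) u)))) x.
Proof.
set c := KA (mop (rmx z i) u).
have -> : KA (dvsolve z i j u) = c by rewrite /dvsolve (blB _ _ bA) KA_rmx subr0.
have mi := measurable_cutset z i; have mj := measurable_cutset z j.
aeuse (repB (mop (rmx z i) u) (mop (rmx z j) (KBs c))), (rep_mop u (mbounded_rmx z i)),
  (rep_mop (KBs c) (mbounded_rmx z j)), (rep_restr u mi), (rep_restr (KBs c) (measurableC mj)).
move=> x e1 e2 e3 e4 e5; rewrite e4 e5 {1}/dvsolve -/c e1 e2 e3 mulmxBr scalerBr !rmx_inv in_setC.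
rewrite !indicE -addrA; congr (_ + _); first by case: (x \in _); rewrite ?scale1r ?scale0r.
by case: (x \in _); rewrite /= ?scale1r ?scale0r ?addNr// oppr0 add0r.
Qed.

Lemma dvshiftB z a a' h h' : dvshift z a h -> dvshift z a' h' -> dvshift z (a - a') (h - h').
Proof.
move=> /dvshiftE[phi aE hx] /dvshiftE[phi' aE' hx']; apply: (dvshiftE _ _ _).2.
have bw := bl_mop (mbounded_weight (n := n) (N := N) m).
exists (phi - phi'); first by rewrite aE aE' -(blB _ _ bw).
have e1 : KBs (KA (phi - phi')) = KBs (KA phi) - KBs (KA phi') by rewrite (blB _ _ bA) (blB _ _ bB).
aeuse hx, hx', (repB h h'), (repB phi phi'), (repB (KBs (KA phi)) (KBs (KA phi'))).
move=> x h1 h2 h3 h4 h5; rewrite e1 h3 h4 h5 scalerBr h1 h2 mulmxBr scalerBr.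
by rewrite opprD addrACA.
Qed.

Lemma bl_sub K L : bounded_linear K -> bounded_linear L -> bounded_linear (fun a => K a - L a).
Proof.
move=> hK hL; split=> [a b|z a|]; first by rewrite (blD hK) (blD hL) opprD addrACA.
  by rewrite (blZ hK) (blZ hL) scalerBr.
have [c1 p1 h1] := bl_bound hK; have [c2 p2 h2] := bl_bound hL.
exists (c1 + c2) => [|a]; first exact: addr_ge0.
have hH := @L2class_hilbert R n N; apply: le_trans (hnormD hH _ _) _.
by rewrite (hnormN hH) mulrDl; exact: lerD.
Qed.

Lemma bl_dvsolve z i j : bounded_linear (dvsolve z i j).
Proof.
have b1 := bl_mop (mbounded_rmx z i); have b2 := bl_mop (mbounded_rmx z j).
exact: bl_sub b1 (bl_comp b2 (bl_comp bB (bl_comp bA b1))).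
Qed.

Lemma dvshift_solve z k h : (forall x, cutset z k x) -> dvshift z (J (dvsolve z k k (J h))) h.
Proof.
move=> hk; apply: (dvshiftE _ _ _).2; exists (dvsolve z k k (J h)) => //.
have mk := measurable_cutset z k; set c := KBs (KA (mop (rmx z k) (J h))).
aeuse (dvsolveE z k k (J h)), (rep_restr (J h) mk), (rep_restr c (measurableC mk)), (rep_wop m h).
move=> x -> -> ; rewrite -/c => -> ->; rewrite in_setC (_ : x \in cutset z k) ?addr0//.
by rewrite inE; exact: hk.
Qed.

Lemma dvshift_bounded z k : (forall x, cutset z k x) ->
  exists c : R, forall a h, dvshift z a h -> nrm a <= c * nrm h.
Proof.
move=> hk; have bw := bl_mop (mbounded_weight (n := n) (N := N) m).
have [c _ hc] := bl_bound (bl_comp bw (bl_comp (bl_dvsolve z k k) bw)).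
exists c => a h ah; suff -> : a = J (dvsolve z k k (J h)) by exact: hc.
apply/eqP; rewrite -subr_eq0; apply/eqP; apply: (@dvshift_injective z).
rewrite -(subrr h); exact: dvshiftB ah (dvshift_solve h hk).
Qed.

(** An attained right-hand side enters multiplied by w, so the remainder of the second cut must be w
    times a square-integrable function. It lives near e^2 = z^2, where e is bounded, so it may be
    divided by w; the quotient tends to 0 as j grows. *)
Lemma dvshift_dense z h0 (eps : R) : 0 < eps -> exists a h, dvshift z a h /\ nrm (h0 - h) < eps.
Proof.
move=> eps0; have eps2 : 0 < eps / 2 by rewrite divr_gt0.
have ex := cutset_exhausts z.
have [i /(_ _ (leqnn _)) hi] := restr_cvg h0 ex eps2.
pose c := KBs (KA (mop (rmx z i) (J h0))).
(* Outside the set of index 2 one has 3 (e^2 - Re z^2) < (1 + e)^2. As 3 e^2 outgrows (1 + e)^2,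
   this bounds e, whence the constant 4 + 3 |Re z^2| for 1/w. *)
pose s x := (w x)^-1 * \1_(~` cutset z 2) x.
have m2 := measurable_cutset z 2; have mi := measurable_cutset z i.
have bs : mbounded (fun x => ((s x)%:C%C)%:M : 'M[R[i]]_N).
  apply: (mbounded_real (c := 4 + 3 * `|complex.Re (z ^+ 2)|)).
    apply: measurable_funM; last by apply: measurable_indic; exact: measurableC.
    by apply: measurableT_comp measurable_inv _; exact: measurable_weight.
  move=> x; rewrite /s indicE in_setC; have [|nV] := boolP (x \in cutset z 2).
    by rewrite /= mulr0 normr0 addr_ge0.
  have e0 := energy_ge0 m x; rewrite /= mulr1 /weight invrK ger0_norm ?sqrtr_ge0//.
  have : ~ cutset z 2 x by move=> Vx; move/negP: nV; apply; rewrite inE.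
  rewrite /cutset /= => /negP; rewrite -ltNge => h1.
  have h2 : e x ^+ 2 - complex.Re (z ^+ 2) <= normc (edist z x).
    have -> : e x ^+ 2 - complex.Re (z ^+ 2) = complex.Re (edist z x).
      by rewrite /edist cReD cReN energy_sqr.
    have := normc_sqr (edist z x).
    have : 0 <= normc (edist z x) by case: (edist z x) => p q; exact: sqrtr_ge0.
    move: (normc _) (complex.Re (edist z x)) (complex.Im _) => p q r p0 pE.
    by apply: (le_trans (ler_norm q)); apply: le_of_sqr => //; rewrite real_normK ?num_real// pE lerDl sqr_ge0.
  have h3 := ler_norm (complex.Re (z ^+ 2)).
  have h4 : Num.sqrt (e x + 1) <= e x + 1.
    apply: le_of_sqr; first by rewrite addr_ge0.
    by rewrite sqr_sqrtr ?addr_ge0// expr2; nra.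
  apply: le_trans h4 _; move: h1 h2 h3 e0; rewrite !expr2.
  move: (normc _) (e x) (complex.Re _) `|_| => p q r t h1 h2 h3 e0.
  have := sqr_ge0 (q - 1); rewrite expr2; nra.
pose y := mop (fun x => ((s x)%:C%C)%:M) c.
have [j0 hj0] := restr_cvg y ex eps2.
pose j := maxn j0 2; have hj : nrm (restr (~` cutset z j) y) < eps / 2 by apply: hj0; exact: leq_maxl.
have mj := measurable_cutset z j.
exists (J (dvsolve z i j (J h0))), (restr (cutset z i) h0 + restr (~` cutset z j) y); split; last first.
  have hH := @L2class_hilbert R n N.
  rewrite [X in nrm (X - _)](restr_split h0 mi) opprD addrACA subrr add0r.
  apply: le_lt_trans (hnormD hH _ _) _; rewrite (hnormN hH).
  by rewrite [X in _ < X](splitr eps); exact: ltrD.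
apply: (dvshiftE _ _ _).2; exists (dvsolve z i j (J h0)) => //.
have h1 := repD (restr (cutset z i) h0) (restr (~` cutset z j) y).
have h2 := rep_restr h0 mi; have h3 := rep_restr y (measurableC mj).
have h4 := rep_restr (J h0) mi; have h5 := rep_restr c (measurableC mj).
have h6 := rep_mop c bs; have h7 := rep_wop m h0.
have hA : \forall x \ae mu, (w x)%:C%C *: rep (restr (cutset z i) h0) x = rep (restr (cutset z i) (J h0)) x.
  by aeuse h2, h4, h7 => x -> -> ->; case: ifP => _; rewrite ?scaler0.
have hB : \forall x \ae mu, (w x)%:C%C *: rep (restr (~` cutset z j) y) x = rep (restr (~` cutset z j) c) x.
  aeuse h3, h5, h6 => x -> -> e1; rewrite -/y in e1; rewrite e1.
  have [|nV] := boolP (x \in ~` cutset z j); last by rewrite scaler0.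
  move=> xV; rewrite mul_scalar_mx scalerA -rmorphM /s indicE (_ : x \in ~` cutset z 2).
    by rewrite mulr1 mulfV ?scale1r// gt_eqF// weight_gt0.
  move: xV; rewrite !inE => nV Vx; apply: nV; apply: cutset_sub Vx; exact: leq_maxr.
aeuse (dvsolveE z i j (J h0)), h1, hA, hB => x -> -> e1 e2.
by rewrite scalerDr e1 e2.
Qed.
End SpectralAnalysis.

(** * Real z with |z| >= |m|: the range is not everything *)

Section NotSurjective.
Context {R : realType} {n N : nat}.
Local Notation mu := (@lebesgue_Rn R n).
Local Notation X := (Rn R n).
Local Notation H := (L2class R n N).
Local Notation nrm := (hnorm (@rip R n N)).
Local Opaque hnorm l2norm L2.
Implicit Types (a b c d h phi : H) (z : R[i]) (x : X).
Variables (alpha : 'I_n.+1 -> 'M[R[i]]_N) (m : R).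
Hypothesis halpha : dirac_matrices alpha.
Hypothesis hn : (0 < n)%N.
Local Notation D := (dsym alpha m).
Local Notation J := (@wop R n N m).
Local Notation w := (@weight R n m).
Variables (KA KBs : H -> H) (Y : 'cV[R[i]]_N) (l : R).
Hypothesis Y0 : Y != 0.
Hypothesis kY : forall z a, \forall x \ae mu, cdot Y ((D x + z%:M) *m rep (KBs a) x) = 0.
Local Notation z := (l%:C%C : R[i]).

Let p x : R := energy2 m x - l ^+ 2.
Let pE x : edist m z x = (p x)%:C%C.
Proof. by rewrite /edist /p rmorphB rmorphXn. Qed.

Lemma cdot_sumr I (s : seq I) (f : I -> 'cV[R[i]]_N) u :
  cdot u (\sum_(i <- s) f i) = \sum_(i <- s) cdot u (f i).
Proof. by elim: s => [|i s IH]; rewrite ?big_nil ?cdot0r// !big_cons cdotDr IH. Qed.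

Let y2 := l2norm Y ^+ 2.
Let y2_gt0 : 0 < y2.
Proof.
rewrite lt_def sqr_ge0 andbT sqrf_eq0; apply: contra Y0 => /eqP/l2norm_eq0 ->.
exact: eqxx.
Qed.

Let c (k : 'I_n.+1) : R := complex.Re (cdot Y (alpha k *m Y)).

Let shift_expand x : l2norm ((D x + z%:M) *m Y) ^+ 2 =
  (energy2 m x + l ^+ 2) * y2 + 2 * l * (\sum_(k < n) tnth x k * c (lift ord_max k) + m * c ord_max).
Proof.
have e1 : complex.Re (cdot Y (D x *m Y)) = \sum_(k < n) tnth x k * c (lift ord_max k) + m * c ord_max.
  rewrite /dsym mulmxDl mulmx_suml cdotDr cdot_sumr cReD Re_sum -scalemxAl cdotZr cReM /= mul0r subr0.
  congr (_ + _); apply: eq_bigr => k _.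
  by rewrite -scalemxAl cdotZr cReM /= mul0r subr0.
rewrite mulmxDl mul_scalar_mx l2norm_sqr cdotDl !cdotDr !(cdotZl, cdotZr).
have e2 := dsym_norm m halpha x Y; rewrite l2norm_sqr in e2.
rewrite (cdotC Y (D x *m Y)) !(cReD, cReM, cReJ, cImJ) /= e1 e2 cdotuu /=.
rewrite /y2; ring.
Qed.

Hypothesis surj : forall h, exists a, dvshift alpha m KA KBs z a h.

(** Pairing with Y after D + l removes the perturbation, so surjectivity makes Y^* (D + l) h
    divisible by e^2 - l^2 within the components of L^2 functions. *)
Let surj_pointwise h : exists a, \forall x \ae mu,
  cdot Y ((D x + z%:M) *m rep h x) = (p x)%:C%C * cdot Y (rep a x).
Proof.
have [a /(dvshiftE m halpha)[phi aE hx]] := surj h; exists a.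
have hw := rep_wop m phi; rewrite -aE in hw.
aeuse hx, hw, (kY z (KA phi)) => x h1 h2 h3.
have := congr1 (cdot Y) (shift_cancel halpha h1); rewrite cdotDr !cdotZr h3 addr0 pE h2 cdotZr => e.
have w0 := weight_neq0 m x.
by apply: (mulfI w0); rewrite e rmorphXn expr2; ring.
Qed.

(** The rank-one multiplier sending u to <Y, u> (D + l) Y / (e^2 - l^2) on the cut set. Its pairings
    with h contain the quotient that surjectivity provides. *)
Let M k x : 'M[R[i]]_N := ((w x ^+ 2)%:C%C)%:M *m rmx alpha m z k x *m (Y *m Y^t*).

Let bM k : mbounded (M k).
Proof.
apply: mboundedM; last exact: mbounded_cst.
apply: mboundedM; last exact: mbounded_rmx.
apply: (mbounded_real (c := 1)); first by apply: measurable_funX; exact: measurable_weight.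
move=> x; rewrite ger0_norm ?sqr_ge0//; apply: exprn_ile1; last exact: weight_le1.
exact: ltW (weight_gt0 m x).
Qed.

Let YYE (u : 'cV[R[i]]_N) : Y *m Y^t* *m u = cdot Y u *: Y.
Proof. by rewrite -mulmxA [Y^t* *m u]mx11_scalar mul_mx_scalar. Qed.

Let s k x : R := w x ^+ 2 * (\1_(cutset m z k) x * (1 + energy m x)) / p x.

Let sE k x : (w x ^+ 2)%:C%C * rcoef m z k x = (s k x)%:C%C.
Proof. by rewrite /rcoef pE -fmorphV -!rmorphM /s /= mulrA. Qed.

Let spE k x : x \in cutset m z k -> s k x * p x = 1.
Proof.
move=> xV; have := rcoefE m z k x; rewrite pE.
move=> /(congr1 (fun y => (w x ^+ 2)%:C%C * y)); rewrite mulrA sE -!rmorphM => /complexI ->.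
by rewrite indicE xV mul1r weight_sqr [1 + _]addrC mulVf// gt_eqF// energy1_gt0.
Qed.

Let ME k x u : M k x *m u = ((s k x)%:C%C * cdot Y u) *: ((D x + z%:M) *m Y).
Proof.
rewrite /M -mulmxA YYE -mulmxA mul_scalar_mx /rmx -scalemxAl -scalemxAr !scalerA.
by congr (_ *: _); rewrite -sE; ring.
Qed.

Lemma shift_adj x (u v : 'cV[R[i]]_N) : cdot ((D x + z%:M) *m u) v = cdot u ((D x + z%:M) *m v).
Proof.
rewrite cdotMl; congr (cdot _ (_ *m _)).
have -> : (D x + z%:M)^t* = (D x)^t* + (z%:M)^t*.
  by apply/matrixP => i j; rewrite !mxE rmorphD.
rewrite dsym_adj// scalar_adj; congr (_ + _%:M).
by apply: complex_ext; rewrite ?cReJ ?cImJ//= oppr0.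
Qed.

(** Against a fixed h, the image of a unit vector b pairs like the restriction of Y Y^* b with the
    solution a from [surj_pointwise], with a bound independent of the cut; uniform boundedness then
    bounds all the norms at once. *)
Let bound : exists C : R, forall k a, nrm (mop (M k) a) <= C * nrm a.
Proof.
have hH := @L2class_hilbert R n N.
have [K0 k0 hK0] := nrm_mop (mbounded_cst (n := n) (Y *m Y^t*)).
pose I := {q : nat * H | nrm q.2 <= 1}.
have [C hC] : exists C : R, forall i : I, nrm (mop (M (sval i).1) (sval i).2) <= C.
  apply: (uniform_boundedness hH) => h; have [a ha] := surj_pointwise h.
  exists (K0 * nrm a) => -[[k b] /= hb].
  have mV := measurable_cutset (n := n) m z k.
  rewrite (_ : rip _ h = rip (restr (cutset m z k) (cmx (Y *m Y^t*) b)) a); last first.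
    congr complex.Re; rewrite !ipE; apply: cintegral_ae.
    - by apply: vmeas_cdot; exact: rep_vmeas.
    - by apply: vmeas_cdot; exact: rep_vmeas.
    aeuse ha, (rep_mop b (bM k)), (rep_restr (cmx (Y *m Y^t*) b) mV), (rep_cmx (Y *m Y^t*) b).
    move=> x h1 -> -> -> _; rewrite ME YYE cdotZl shift_adj h1 rmorphM /=.
    rewrite (_ : ((s k x)%:C%C)^* = (s k x)%:C%C); last first.
      by apply: complex_ext; rewrite ?cReJ ?cImJ//= oppr0.
    have [xV|nV] := boolP (x \in cutset m z k).
      by rewrite cdotZl mulrACA -rmorphM spE// mul1r.
    by rewrite cdot0l /s indicE (negbTE nV) !mul0r mulr0 mul0r !mul0r.
  apply: le_trans (cauchy_schwarz hH _ _) _; rewrite ler_wpM2r ?hnorm_ge0//.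
  apply: le_trans (restr_norm _ mV) _; apply: le_trans (hK0 _) _.
  by rewrite -[leRHS]mulr1 ler_wpM2l.
exists C => k a; have [a0|ap] := leP (nrm a) 0.
  have -> : a = 0 by apply: (hnorm_eq0 hH); apply/eqP; rewrite eq_le a0 hnorm_ge0.
  by rewrite mop0// (hnorm0 hH) mulr0.
have an : nrm a != 0 by rewrite gt_eqF.
have h1 : nrm ((nrm a)^-1%:C%C *: a) <= 1.
  by rewrite (hnormZ hH) ger0_norm ?invr_ge0 ?(ltW ap)// mulVf.
have := hC (exist _ (k, (nrm a)^-1%:C%C *: a) h1); rewrite /= mopZ// (hnormZ hH).
by rewrite ger0_norm ?invr_ge0 ?(ltW ap)// mulrC ler_pdivrMr.
Qed.

(** The pointwise bound for M, tested at the vector Y itself. *)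
Let ae_bound : exists C : R, \forall x \ae mu,
  l2norm ((D x + z%:M) *m Y) ^+ 2 * y2 <= C ^+ 2 * p x ^+ 2.
Proof.
have [C hC] := bound; exists C; apply: (restr_ae (cutset_exhausts m hn z)) => k.
aeuse (mop_bound_ae Y (bM k) (hC k)) => x; rewrite ME cdotuu -rmorphM l2norm_sqrZ => h Vx.
have xV : x \in cutset m z k by rewrite inE.
move: h; rewrite normc_sqr /= expr0n /= addr0 -/y2 exprMn => h.
have sp := spE xV; have h2 := ler_wpM2l (sqr_ge0 (p x)) h.
rewrite -(ler_pM2l y2_gt0); move: h2; move: (l2norm _ ^+ 2) => V h2.
rewrite (_ : y2 * (V * y2) = p x ^+ 2 * (s k x ^+ 2 * y2 ^+ 2 * V)); last first.
  by rewrite -[LHS]mul1r -(expr1n R 2) -[in LHS]sp; ring.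
by apply: le_trans h2 _; rewrite [leRHS](_ : _ = p x ^+ 2 * (C ^+ 2 * y2)) //; ring.
Qed.

(** Both sides are polynomials in the momentum, so by continuity the almost everywhere bound holds
    at every point. *)
Let poly_bound : exists C : R, forall t : 'I_n -> R,
  ((\sum_k t k ^+ 2 + m ^+ 2 + l ^+ 2) * y2 + 2 * l * (\sum_k t k * c (lift ord_max k) + m * c ord_max)) * y2
  <= C ^+ 2 * (\sum_k t k ^+ 2 + m ^+ 2 - l ^+ 2) ^+ 2.
Proof.
have [C hC] := ae_bound; exists C => t.
pose S (v : 'rV[R]_n) := \sum_k v 0 k ^+ 2.
pose L (v : 'rV[R]_n) := \sum_k v 0 k * c (lift ord_max k).
have cc (k : 'I_n) : continuous (fun v : 'rV[R]_n => v 0 k) by exact: coord_continuous.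
have csum (f : 'I_n -> 'rV[R]_n -> R) : (forall k, continuous (f k)) ->
    continuous (fun v => \sum_k f k v).
  move=> cf v; suff h (r : seq 'I_n) :
    \sum_(k <- r) f k u @[u --> nbhs v] --> \sum_(k <- r) f k v by exact: h.
  elim: r => [|k r IH].
    by under eq_fun do rewrite big_nil; rewrite big_nil; exact: cvg_cst.
  under eq_fun do rewrite big_cons; rewrite big_cons.
  by apply: cvgD; [exact: cf|exact: IH].
have cS : continuous S by apply: csum => k v; exact: cvgM (cc k v) (cc k v).
have cL : continuous L by apply: csum => k v; apply: cvgM (cc k v) _; exact: cvg_cst.
pose P v := C ^+ 2 * ((S v + m ^+ 2 - l ^+ 2) * (S v + m ^+ 2 - l ^+ 2)) -
  ((S v + m ^+ 2 + l ^+ 2) * y2 + 2 * l * (L v + m * c ord_max)) * y2.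
have cP : continuous P.
  move=> v; have cst (r : R) : (fun _ : 'rV[R]_n => r) u @[u --> nbhs v] --> r by exact: cvg_cst.
  have c1 : S u + m ^+ 2 - l ^+ 2 @[u --> nbhs v] --> S v + m ^+ 2 - l ^+ 2.
    by exact: cvgB (cvgD (cS v) (cst (m ^+ 2))) (cst (l ^+ 2)).
  have c3 : (S u + m ^+ 2 + l ^+ 2) * y2 @[u --> nbhs v] --> (S v + m ^+ 2 + l ^+ 2) * y2.
    by exact: cvgM (cvgD (cvgD (cS v) (cst (m ^+ 2))) (cst (l ^+ 2))) (cst y2).
  have c4 : 2 * l * (L u + m * c ord_max) @[u --> nbhs v] --> 2 * l * (L v + m * c ord_max).
    by exact: cvgM (cst (2 * l)) (cvgD (cL v) (cst (m * c ord_max))).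
  exact: cvgB (cvgM (cst (C ^+ 2)) (cvgM c1 c1)) (cvgM (cvgD c3 c4) (cst y2)).
have P0 : \forall x \ae mu, 0 <= P (row_of x).
  aeuse hC => x; rewrite shift_expand /P subr_ge0 -expr2 /p /energy2.
  have -> : S (row_of x) = \sum_k tnth x k ^+ 2 by apply: eq_bigr => k _; rewrite mxE.
  by have -> : L (row_of x) = \sum_k tnth x k * c (lift ord_max k) by apply: eq_bigr => k _; rewrite mxE.
have := ae_ge0_continuous cP P0 (\row_k t k); rewrite /P subr_ge0 -expr2.
have -> : S (\row_k t k) = \sum_k t k ^+ 2 by apply: eq_bigr => k _; rewrite mxE.
by have -> : L (\row_k t k) = \sum_k t k * c (lift ord_max k) by apply: eq_bigr => k _; rewrite mxE.
Qed.

(* Averaging the bound over t and -t leaves n t^2 |Y|^4 <= C^2 (n t^2 - (l^2 - m^2))^2, which fails at n t^2 = l^2 - m^2, or for small t when l^2 = m^2. *)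
Lemma dvshift_surjective_lt : l ^+ 2 < m ^+ 2.
Proof.
rewrite ltNge; apply/negP => ml.
have [C hC] := poly_bound.
(* The squared norm at momentum 0; this keeps the mass part of the cross term, which survives the
   averaging, from spoiling the lower bound. *)
have base : 0 <= (m ^+ 2 + l ^+ 2) * y2 + 2 * l * (m * c ord_max).
  have := shift_expand [tuple 0 | k < n]; rewrite /energy2.
  rewrite big1 => [|k _]; last by rewrite tnth_mktuple expr0n.
  rewrite big1 => [|k _]; last by rewrite tnth_mktuple mul0r.
  by rewrite !add0r => <-; exact: sqr_ge0.
have n0 : 0 < n%:R :> R by rewrite ltr0n.
have key (tau : R) : 0 <= tau -> tau * y2 ^+ 2 <= C ^+ 2 * (tau + m ^+ 2 - l ^+ 2) ^+ 2.
  move=> tau0; pose t := Num.sqrt (tau / n%:R).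
  have tE : n%:R * t ^+ 2 = tau by rewrite sqr_sqrtr ?divr_ge0 ?ler0n// mulrC divfK// gt_eqF.
  have := hC (fun=> t); have := hC (fun=> - t).
  rewrite sqrrN (_ : \sum_(k < n) t ^+ 2 = tau); last by rewrite sumr_const card_ord -tE mulr_natl.
  rewrite -!mulr_sumr mulNr.
  have := mulr_ge0 base (ltW y2_gt0); rewrite [y2 ^+ 2]expr2.
  move: (\sum_(k < n) c (lift ord_max k)) (c ord_max) y2 (C ^+ 2 * _) => q r y K b2 h1 h2; lra.
have [lm|lm] := eqVneq (l ^+ 2) (m ^+ 2).
  (* For l^2 = m^2 the bound reads tau |Y|^4 <= C^2 tau^2, and this tau satisfies C^2 tau <
     |Y|^4. *)
  have := key (y2 ^+ 2 / (C ^+ 2 + 1)); rewrite lm.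
  have C1 : 0 < C ^+ 2 + 1 by rewrite ltr_wpDl ?sqr_ge0.
  have y4 : 0 < y2 ^+ 2 by rewrite exprn_gt0.
  have tau0 : 0 < y2 ^+ 2 / (C ^+ 2 + 1) by rewrite divr_gt0.
  have tE : y2 ^+ 2 / (C ^+ 2 + 1) * (C ^+ 2 + 1) = y2 ^+ 2 by rewrite divfK// gt_eqF.
  move: tE tau0; move: (y2 ^+ 2 / (C ^+ 2 + 1)) => u tE u0 /(_ (ltW u0)); rewrite addrK => h.
  have h' : y2 ^+ 2 <= C ^+ 2 * u.
    by rewrite -(ler_pM2l u0); apply: le_trans h _; rewrite (expr2 u) mulrCA.
  by move: tE h' u0; rewrite mulrDr mulr1 mulrC; move: (y2 ^+ 2) (C ^+ 2 * u) => q r; lra.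
have := key (l ^+ 2 - m ^+ 2); rewrite subr_ge0 => /(_ ml).
rewrite subrK subrr expr0n /= mulr0 leNgt => /negP; apply.
by apply: mulr_gt0; [rewrite subr_gt0 lt_def lm|exact: exprn_gt0].
Qed.
End NotSurjective.

(** * The spectrum of the perturbed operator and its parts *)

Section SpectrumOfPerturbation.
Context {R : realType} {n N : nat}.
Local Notation mu := (@lebesgue_Rn R n).
Local Notation X := (Rn R n).
Local Notation H := (L2class R n N).
Local Notation nrm := (hnorm (@rip R n N)).
Local Opaque hnorm l2norm L2.
Implicit Types (a b c d h phi : H) (z : R[i]) (x : X).
Variables (alpha : 'I_n.+1 -> 'M[R[i]]_N) (m : R).
Hypothesis halpha : dirac_matrices alpha.
Hypothesis hn : (0 < n)%N.
Hypothesis hm : 0 <= m.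
Local Notation D := (dsym alpha m).

Definition dirac_spectrum (m' : R) := [set z : R[i] |
  complex.Im z = 0 /\ (complex.Re z <= - m' \/ m' <= complex.Re z)].

Lemma normc_ge_Re (y : R[i]) : `|complex.Re y| <= normc y.
Proof.
apply: le_of_sqr; first by case: y => p q; exact: sqrtr_ge0.
by rewrite normc_sqr real_normK ?num_real// lerDl sqr_ge0.
Qed.

Lemma normc_ge_Im (y : R[i]) : `|complex.Im y| <= normc y.
Proof.
apply: le_of_sqr; first by case: y => p q; exact: sqrtr_ge0.
by rewrite normc_sqr real_normK ?num_real// lerDr sqr_ge0.
Qed.

(** A point off the half-line has positive distance d from it, which controls bounded r; for large r
    the distance grows like r. *)
Lemma dist_halfline (y : R[i]) : ~ (complex.Im y = 0 /\ m <= complex.Re y) ->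
  exists2 c : R, 0 < c & forall r, m <= r -> 1 + r <= c * normc (r%:C%C - y).
Proof.
move=> hy.
have [d d0 hd] : exists2 d : R, 0 < d & forall r, m <= r -> d <= normc (r%:C%C - y).
  have [i0|i0] := eqVneq (complex.Im y) 0.
    have ym : complex.Re y < m by rewrite ltNge; apply/negP => h; apply: hy.
    exists (m - complex.Re y) => [|r mr]; first by rewrite subr_gt0.
    apply: le_trans (normc_ge_Re _); rewrite cReD cReN /=.
    by apply: le_trans (ler_norm _); rewrite lerB.
  exists `|complex.Im y| => [|r mr]; first by rewrite normr_gt0.
  by apply: le_trans (normc_ge_Im _); rewrite cImD cImN /= sub0r normrN.
exists (1 + (1 + `|complex.Re y|) / d) => [|r mr].
  by rewrite addr_gt0// divr_gt0// ltr_pwDl.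
have h1 := hd r mr; have h2 : r - complex.Re y <= normc (r%:C%C - y).
  by apply: le_trans (normc_ge_Re _); rewrite cReD cReN /=; exact: ler_norm.
have h3 := ler_norm (complex.Re y).
have h4 : 1 + `|complex.Re y| <= (1 + `|complex.Re y|) / d * normc (r%:C%C - y).
  rewrite -[leLHS]mulr1 -mulrA ler_wpM2l ?addr_ge0// mulrC ler_pdivlMr// mul1r.
  exact: h1.
by move: h2 h3 h4; rewrite mulrDl mul1r; lra.
Qed.

Lemma energy_ge x : m <= energy m x.
Proof.
apply: le_of_sqr; first exact: energy_ge0.
by rewrite energy_sqr /energy2 lerDr sumr_ge0// => k _; exact: sqr_ge0.
Qed.

(** In e^2 - z^2 = (e - z)(e + z) each factor dominates 1 + e, by [dist_halfline] at z and at -z,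
    since e >= m. *)
Lemma cutset_full z : ~ dirac_spectrum m z -> exists k, forall x, cutset m z k x.
Proof.
move=> nz.
have [|c1 c10 h1] := @dist_halfline z; first by move=> [i0 mr]; apply: nz; split=> //; right.
have [|c2 c20 h2] := @dist_halfline (- z).
  move=> []; rewrite cImN cReN => /eqP; rewrite oppr_eq0 => /eqP i0 mr; apply: nz; split=> //; left.
  by rewrite lerNr.
exists (Num.trunc (c1 * c2)) => x; rewrite /cutset /=.
have em := energy_ge x; have e0 := energy_ge0 m x.
have -> : edist m z x = ((energy m x)%:C%C - z) * ((energy m x)%:C%C - - z).
  by rewrite /edist -energy_sqr rmorphXn opprK -subr_sqr.
rewrite complex.ComplexField.Normc.normcM.
have n1 : 0 <= normc ((energy m x)%:C%C - z) by exact: le_trans (normc_ge_Re _).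
have n2 : 0 <= normc ((energy m x)%:C%C - - z) by exact: le_trans (normc_ge_Re _).
have e1 : 0 <= 1 + energy m x by exact: addr_ge0.
apply: (@le_trans _ _ (c1 * c2 * (normc ((energy m x)%:C%C - z) * normc ((energy m x)%:C%C - - z)))).
  by rewrite mulrACA expr2; apply: ler_pM => //; [exact: h1|exact: h2].
by rewrite ler_wpM2r ?mulr_ge0// ltW// truncnS_gt.
Qed.

Variables (KA KBs : H -> H) (A : 'M[R[i]]_N) (Y : 'cV[R[i]]_N).
Hypothesis bA : bounded_linear KA.
Hypothesis bB : bounded_linear KBs.
Hypothesis kA : forall a, (\forall x \ae mu, A *m rep a x = 0) -> KA a = 0.
Hypothesis kB : forall z a, \forall x \ae mu, A *m ((D x + z%:M) *m rep (KBs a) x) = 0.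
Hypothesis Y0 : Y != 0.
Hypothesis kY : forall z a, \forall x \ae mu, cdot Y ((D x + z%:M) *m rep (KBs a) x) = 0.
Local Notation T := (flift (dvrel alpha m KA KBs)).

Let shiftE z : Defs.shift T z = flift (dvshift alpha m KA KBs z).
Proof. by rewrite /Defs.shift lift_scalar lift_add. Qed.

Let inj z : injective_op (Defs.shift T z).
Proof.
rewrite shiftE; apply: lift_injective => a1 a2 b h1 h2.
apply/eqP; rewrite -subr_eq0; apply/eqP; apply: (dvshift_injective halpha hn bB kA kB (z := z)).
by rewrite -(subrr b); exact: (dvshiftB halpha bA bB h1 h2).
Qed.

Let resolvent z : ~ dirac_spectrum m z -> resolvent_set T z.
Proof.
move=> /cutset_full[k hk]; split; first exact: inj.
  rewrite shiftE; apply/lift_surjective => b.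
  by eexists; exact: (dvshift_solve halpha bA kA kB b hk).
rewrite shiftE lift_inv.
have [c hc] := dvshift_bounded halpha hn bA bB kA kB hk.
by apply: (lift_bounded (c := c)) => a b; exact: hc.
Qed.

Let not_surj z : dirac_spectrum m z -> ~ surjective_op (Defs.shift T z).
Proof.
move=> [i0 hr]; rewrite shiftE => /lift_surjective hs.
have zE : z = (complex.Re z)%:C%C by apply: complex_ext.
rewrite zE in hs; have := dvshift_surjective_lt halpha hn Y0 kY hs.
apply/negP; rewrite -leNgt; move: hr; move: (complex.Re z) => l hr.
by move: hm; case: hr => hr m0; nra.
Qed.

Lemma dvrel_spectrum :
  [/\ spectrum T = dirac_spectrum m, continuous_spectrum T = dirac_spectrum m & point_spectrum T = set0].
Proof.
have sp : spectrum T = dirac_spectrum m.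
  apply/seteqP; split=> [z nz|z hz [_ hs _]]; last exact: not_surj hz hs.
  by apply: contrapT => hz; apply: nz; exact: resolvent.
split=> //.
  apply/seteqP; split=> [z []|z hz]; first by rewrite sp.
  split; [by rewrite sp|exact: inj| |exact: not_surj].
  rewrite shiftE; apply: lift_dense => b eps eps0.
  exact: (dvshift_dense halpha hn bA kA kB z b eps0).
apply/seteqP; split=> // z /lift_point_spectrum[a Ta a0]; apply: a0.
apply: (dvshift_injective halpha hn bB kA kB (z := z)).
by exists (z *: a), (- z *: a); split=> //; rewrite scaleNr subrr.
Qed.
End SpectrumOfPerturbation.

(** * Application to the free and the perturbed Dirac operator *)

Section Main.
Context {R : realType} {n N : nat}.
Local Notation mu := (@lebesgue_Rn R n).
Local Notation H := (L2class R n N).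
Local Opaque hnorm l2norm L2.
Variables (alpha : 'I_n.+1 -> 'M[R[i]]_N) (m : R).
Hypothesis halpha : dirac_matrices alpha.
Hypothesis hn : (0 < n)%N.
Hypothesis hm : 0 <= m.
Local Notation D := (dsym alpha m).

(** The case of zero perturbation with matrix 0; any nonzero Y serves, here the vector of ones. *)
Lemma free_dirac_spectrum : (0 < N)%N -> spectrum (free_dirac alpha m) = dirac_spectrum m.
Proof.
move=> N0; rewrite (free_dirac_dvrel m halpha).
have Y0 : (const_mx 1 : 'cV[R[i]]_N) != 0.
  by apply/eqP => /matrixP/(_ (Ordinal N0) 0) /eqP; rewrite !mxE oner_eq0.
have b0 := @bl_zero R n N; have r0 := @rep0 R n N.
have [|||//] := @dvrel_spectrum R n N alpha m halpha hn hm (fun=> 0) (fun=> 0) 0 (const_mx 1) b0 b0 _ _ Y0.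
- by [].
- by move=> z a; aeuse r0 => x _; rewrite mul0mx.
- by move=> z a; aeuse r0 => x ->; rewrite mulmx0 cdot0r.
Qed.

Lemma perturbed_dirac_spectrum (v : Rn R n -> R[i]) (A B : 'M[R[i]]_N) :
  lebesgue_measurable v ->
  dom (op_sqrt (op_abs (free_dirac alpha m))) `<=` dom (pert_A v A) `&` dom (pert_B v B) ->
  A != 0 -> A *m B^t* = 0 -> (forall k : 'I_n, A *m alpha (lift ord_max k) *m B^t* = 0) ->
  m%:C%C *: (A *m alpha ord_max *m B^t*) = 0 ->
  let DV := perturbed_dirac alpha m v A B in
  [/\ spectrum DV = dirac_spectrum m, continuous_spectrum DV = dirac_spectrum m & point_spectrum DV = set0].
Proof.
move=> hv hdom A0 AB hAB hABm.
have [KA [KBs [bA bB kA kB ->]]] := perturbed_lift halpha hv hdom.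
have ADB x : A *m D x *m B^t* = 0.
  rewrite /dsym mulmxDr mulmxDl mulmx_sumr mulmx_suml -scalemxAr -scalemxAl hABm addr0.
  by rewrite big1// => k _; rewrite -scalemxAr -scalemxAl hAB scaler0.
(* D is unbounded, so the annihilation property is applied to the bounded multipliers A w^2 D and A,
   after which w^2 is divided out. *)
have kB' z a : \forall x \ae mu, A *m ((D x + z%:M) *m rep (KBs a) x) = 0.
  have bM1 : mbounded (fun x => A *m wdsym alpha m x).
    by apply: mboundedM; [exact: mbounded_cst|exact: mbounded_wdsym].
  have h1 := kB _ a bM1; have h2 := kB _ a (mbounded_cst A).
  have e1 : mop (fun x => A *m wdsym alpha m x) (KBs a) = 0.
    apply: h1 => x; by rewrite /wdsym mul_scalar_mx -scalemxAr -scalemxAl ADB scaler0.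
  have e2 : mop (fun=> A) (KBs a) = 0 by apply: h2.
  have r1 := rep_mop (KBs a) bM1; rewrite e1 in r1.
  have r2 := rep_mop (KBs a) (mbounded_cst (n := n) A); rewrite e2 in r2.
  aeuse r1, r2, (@rep0 R n N) => x; rewrite /wdsym => h3 h4 h0; rewrite h0 in h3 h4.
  rewrite mulmxDl mulmxDr mul_scalar_mx -[A *m (z *: _)]scalemxAr -h4 scaler0 addr0.
  have w0 : ((weight m x ^+ 2)%:C%C : R[i]) != 0 by rewrite rmorphXn expf_neq0// weight_neq0.
  apply: (scalerI w0); rewrite scaler0 h3 mul_scalar_mx -scalemxAr -scalemxAl.
  by rewrite mulmxA.
(* With Y = A^* y one has Y^* u = y^* A u, so the condition on Y follows from the one on A. *)
have [y Y0] : exists y : 'cV[R[i]]_N, A^t* *m y != 0.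
  apply: contrapT => h; move/eqP: A0; apply; rewrite -[A]ctrmxK.
  have -> : A^t* = 0.
    apply/matrixP => i j; rewrite [RHS]mxE.
    have : A^t* *m delta_mx j 0 = 0 :> 'cV_N.
      by apply/eqP; apply: contrapT => h'; apply: h; exists (delta_mx j 0); exact/negP.
    by rewrite -colE => /matrixP/(_ i 0); rewrite !mxE.
  by apply/matrixP => i j; rewrite !mxE rmorph0.
apply: (dvrel_spectrum halpha hn hm bA bB kA kB' Y0) => z a.
by aeuse (kB' z a) => x hx; rewrite -cdotMr hx cdot0r.
Qed.
End Main.

(* uphalf n = ceil (n / 2). *)
Theorem theorem4 (R : realType) (n : nat) (hn : (1 <= n)%N)
  (alpha : 'I_n.+1 -> 'M[R[i]]_(2 ^ uphalf n)) (halpha : dirac_matrices alpha)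
  (m : R) (hm : 0 <= m)
  (v : Rn R n -> R[i]) (hv : lebesgue_measurable v)
  (A B : 'M[R[i]]_(2 ^ uphalf n))
  (hdom : dom (op_sqrt (op_abs (free_dirac alpha m)))
          `<=` dom (pert_A v A) `&` dom (pert_B v B))
  (hA : opnorm A = 1) (hB : opnorm B = 1) (hBA : B^t* *m A <> 0)
  (hAB : forall k : 'I_n, A *m alpha (lift ord_max k) *m B^t* = 0)
  (hcase :
    [/\ n <> 2%N, n <> 4%N, m = 0, A *m alpha ord_max *m B^t* <> 0
      & A *m B^t* = 0]
    \/
    [/\ n <> 1%N, n <> 2%N, A *m alpha ord_max *m B^t* = 0
      & A *m B^t* = 0]) :
  let D := free_dirac alpha m in
  let DV := perturbed_dirac alpha m v A B in
  [/\ spectrum DV = continuous_spectrum DV,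
      continuous_spectrum DV = spectrum D,
      spectrum D = [set z : R[i] | complex.Im z = 0 /\
                      (complex.Re z <= - m \/ m <= complex.Re z)]
    & point_spectrum DV = set0].
Proof.
move=> D DV.
have A0 : A != 0 by apply/eqP => A0; apply: hBA; rewrite A0 mulmx0.
have N0 : (0 < 2 ^ uphalf n)%N by rewrite expn_gt0.
have AB : A *m B^t* = 0 by case: hcase => -[].
have mAB : m%:C%C *: (A *m alpha ord_max *m B^t*) = 0.
  by case: hcase => [[_ _ -> _ _]|[_ _ -> _]]; rewrite ?scale0r ?scaler0.
have [s c p] := perturbed_dirac_spectrum halpha hn hm hv hdom A0 AB hAB mAB.
by split; rewrite ?s ?c ?p ?free_dirac_spectrum.
Qed.
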